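(* Let $\psi$ be a character of $\Gamma(2)$ with $\psi(-I)=1$ such that there exist $\xi_1\in\mathbf{Q}$ and an algebraic number $\xi_2$ of degree two with $e^{2\pi i\xi_1}=\psi(T^2)$ and $e^{2\pi i\xi_2}=\psi(U^2)$. Let $\rho=\mathrm{Ind}_{\Gamma(2)}^{\Gamma_0(2)}\psi$. Let $k\in\mathbf{Z}$ and let $Z\in M_k(\rho')$ be such that all Fourier coefficients of its component functions $Z_1,Z_2$ are algebraic numbers. Then the sequence of denominators of the Fourier coefficients of $Z_1$ and the sequence of denominators of the Fourier coefficients of $Z_2$ are both unbounded. Moreover, if $M$ is the square-free integer with $\mathbf{Q}(\sqrt{M})=\mathbf{Q}(\xi_2)$, then every sufficiently large prime $p$ such that $M$ is not a quadratic residue mod $p$ divides the denominator of at least one Fourier coefficient of $Z_1$ and of at least one Fourier coefficient of $Z_2$.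
   Context: $\Gamma=\mathrm{SL}_2(\mathbf{Z})$, $\Gamma_0(2)=\{\begin{pmatrix}a&b\\c&d\end{pmatrix}\in\Gamma:2\mid c\}$, $\Gamma(2)$ the principal congruence subgroup of level 2, $T=\begin{pmatrix}1&1\\0&1\end{pmatrix}$, $U=\begin{pmatrix}1&0\\1&1\end{pmatrix}$. $q=e^{2\pi i\tau}$, $q^s:=e^{2\pi is\tau}$, $(F|_k\gamma)(\tau)=(c\tau+d)^{-k}F(\frac{a\tau+b}{c\tau+d})$. For a representation $\sigma$ of $\Gamma_0(2)$ on $\mathbf{C}^2$, $M_k(\sigma)$ is the space of holomorphic $F:\mathfrak{H}\to\mathbf{C}^2$ with $F|_k\gamma=\sigma(\gamma)F$ for $\gamma\in\Gamma_0(2)$, holomorphic at all cusps (for each $\gamma\in\Gamma$, the expansions of the components of $F|_k\gamma$ in powers $e^{2\pi i(n+\mu)\tau/N}$ have no terms with $\mathrm{Re}(n+\mu)<0$). $E_2=1-24\sum\sigma(n)q^n$, $E_4=1+240\sum\sigma_3(n)q^n$, $G(\tau)=-E_2(\tau)+2E_2(2\tau)$, $D_kA=\frac{1}{2\pi i}A'-\frac{k}{12}E_2A$. Construction of $\rho'$ from an irreducible $\rho:\Gamma_0(2)\to\mathrm{GL}_2(\mathbf{C})$ with $\rho(T)$ diagonalizable: let $k_0$ be least with $M_{k_0}(\rho)\ne0$ and $F\ne0$ in $M_{k_0}(\rho)$; $\rho(T)$ has distinct eigenvalues $e^{2\pi im_1},e^{2\pi im_2}$ ($|m_1|\le|m_2|$);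 fix $X$ with $X\rho(T)X^{-1}=\mathrm{diag}(e^{2\pi im_1},e^{2\pi im_2})$; each component of $XF$ is $\lambda_iq^{\nu_i}(1+\sum_{n\ge1}c_{i,n}q^n)$ with $\lambda_i\ne0$; set $E=\mathrm{diag}(\lambda_1^{-1},\lambda_2^{-1})X$, $F'=EF$, $\rho'=E\rho E^{-1}$. Each component of $Z\in M_k(\rho')$ has the form $q^\mu\sum_{n\ge0}c_nq^n$; the $c_n$ are its Fourier coefficients. The denominator of a nonzero algebraic number $\zeta$ is the least positive integer $N$ with $N\zeta$ an algebraic integer. *)

(* Defs.v *)
From HB Require Import structures.
From mathcomp Require Import all_boot all_order all_algebra.
From mathcomp Require Import complex.
From mathcomp Require Import all_classical all_reals all_analysis.
Import Order.TTheory GRing.Theory Num.Theory numFieldNormedType.Exports.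

Set Implicit Arguments.
Unset Strict Implicit.
Unset Printing Implicit Defensive.

Local Open Scope ring_scope.
Local Open Scope classical_set_scope.

(* Declared as a numClosedFieldType so that the topology and the normed module
   structure of MathComp-Analysis are inferred on it. *)
Definition C (R : realType) : numClosedFieldType := R[i]%C.

Definition cexp (R : realType) (z : C R) : C R :=
  (expR (complex.Re z) * cos (complex.Im z)
   +i* (expR (complex.Re z) * sin (complex.Im z)))%C.

(* exp (2 pi i z) *)
Definition e2pi (R : realType) (z : C R) : C R :=
  cexp (2 * (pi : R)%:C%C * 'i * z).

Definition upper_half (R : realType) : set (C R) := [set t | 0 < complex.Im t].

Definition SL2Z : {pred 'M[int]_2} := [pred g | \det g == 1].

Definition Gamma0_2 : {pred 'M[int]_2} :=
  [pred g | (g \in SL2Z) && (2 %| g 1%R 0%R)%Z].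

Definition Gamma2 : {pred 'M[int]_2} :=
  [pred g | (g \in SL2Z) &&
    [forall i, forall j, (g i j == (1%R : 'M[int]_2) i j %[mod 2])%Z]].

Definition Tmx : 'M[int]_2 := \matrix_(i, j) (i <= j)%N%:Z.
Definition Umx : 'M[int]_2 := \matrix_(i, j) (j <= i)%N%:Z.

Definition mobius (R : realType) (g : 'M[int]_2) (t : C R) : C R :=
  ((g 0 0)%:~R * t + (g 0 1)%:~R) / ((g 1 0)%:~R * t + (g 1 1)%:~R).

Definition slash (R : realType) (k : int) (F : C R -> 'cV[C R]_2)
    (g : 'M[int]_2) (t : C R) : 'cV[C R]_2 :=
  ((g 1 0)%:~R * t + (g 1 1)%:~R) ^ (- k) *: F (mobius g t).

(* f t = \sum_n a_n exp (2 pi i (n + mu) t / N) on the upper half plane *)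
Definition qexpansion (R : realType) (N : nat) (f : C R -> C R)
    (mu : C R) (a : nat -> C R) : Prop :=
  forall t, upper_half t ->
    series (fun n => a n * e2pi ((n%:R + mu) / N%:R * t)) @ \oo --> f t.

(* f is a finite sum of expansions in powers exp (2 pi i (n + mu) t / N), all
   of whose terms satisfy Re (n + mu) >= 0.  Several mu are needed: a component
   of a vector-valued form mixes the eigenvalues of the action of the
   stabilizer of the cusp. *)
Definition regular_expansion (R : realType) (f : C R -> C R) : Prop :=
  exists (N r : nat) (g : 'I_r -> C R -> C R) (mu : 'I_r -> C R)
      (a : 'I_r -> nat -> C R),
    [/\ (0 < N)%N,
        forall j, qexpansion N (g j) (mu j) (a j),
        forall j n, a j n != 0 -> 0 <= complex.Re (n%:R + mu j)
      & forall t, upper_half t -> f t = \sum_j g j t].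

(* M_k(sigma).  Functions on the upper half plane are represented by total
   functions on C whose values elsewhere are irrelevant. *)
Definition modular_form (R : realType) (k : int)
    (sigma : 'M[int]_2 -> 'M[C R]_2) (F : C R -> 'cV[C R]_2) : Prop :=
  [/\ forall i t, upper_half t -> derivable (fun s : C R => F s i 0) t 1,
      forall g, g \in Gamma0_2 ->
        forall t, upper_half t -> slash k F g t = sigma g *m F t
    & forall g, g \in SL2Z ->
        forall i, regular_expansion (fun t => slash k F g t i 0)].

Definition nonzero_form (R : realType) (F : C R -> 'cV[C R]_2) : Prop :=
  exists2 t, upper_half t & F t != 0.

Definition character_Gamma2 (R : realType) (psi : 'M[int]_2 -> C R) : Prop :=
  {in Gamma2, forall g, psi g != 0} /\
  {in Gamma2 &, {morph psi : g h / g * h}}.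

(* Matrix of Ind_{Gamma(2)}^{Gamma_0(2)} psi with respect to the left
   transversal 1, T of Gamma(2) in Gamma_0(2): entry (i, j) is
   psi (T^-i g T^j), with psi extended by 0 outside Gamma(2). *)
Definition Ind (R : realType) (psi : 'M[int]_2 -> C R) (g : 'M[int]_2) :
    'M[C R]_2 :=
  \matrix_(i, j)
    let h := Tmx ^- i * g * Tmx ^+ j in if h \in Gamma2 then psi h else 0.

(* rho' is obtained from rho by the normalization of a nonzero form F of least
   weight k0: rho' = E rho E^-1, with E = diag(lambda_1^-1, lambda_2^-1) X,
   where X diagonalizes rho(T) and lambda_i is the leading coefficient of the
   i-th component of X F. *)
Definition normalization (R : realType) (rho rho' : 'M[int]_2 -> 'M[C R]_2) :
    Prop :=
  exists (k0 : int) (F : C R -> 'cV[C R]_2) (m : 'rV[C R]_2) (X : 'M[C R]_2)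
      (lambda nu : 'rV[C R]_2) (c : 'I_2 -> nat -> C R),
    [/\ [/\ modular_form k0 rho F, nonzero_form F
          & forall k G, modular_form k rho G -> nonzero_form G -> k0 <= k],
        [/\ e2pi (m 0 0) != e2pi (m 0 1), `|m 0 0| <= `|m 0 1|, X \in unitmx
          & X *m rho Tmx *m invmx X = diag_mx (map_mx (@e2pi R) m)],
        forall i, [/\ lambda 0 i != 0, c i 0%N = 1
          & qexpansion 1 (fun t => (X *m F t) i 0) (nu 0 i)
              (fun n => lambda 0 i * c i n)]
      & let E := diag_mx (map_mx GRing.inv lambda) *m X in
        forall g, rho' g = E *m rho g *m invmx E].

Definition algebraic_degree2 (R : realType) (x : C R) : Prop :=
  exists p : {poly rat},
    [/\ irreducible_poly p, size p = 3%N
      & root (map_poly (ratr : rat -> C R) p) x].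

(* The subfield Q(x) of C. *)
Definition Qadjoin (R : realType) (x : C R) : set (C R) :=
  [set y | forall S : {pred C R}, divring_closed S -> x \in S -> y \in S].

Definition squarefreez (M : int) : Prop :=
  forall d : int, (d ^+ 2 %| M)%Z -> `|d|%N = 1%N.

Definition algebraic_number (R : realType) (x : C R) : Prop :=
  algebraicOver (ratr : rat -> C R) x.

Definition algebraic_integer (R : realType) (x : C R) : Prop :=
  integralOver (intr : int -> C R) x.

Definition is_denominator (R : realType) (x : C R) (N : nat) : Prop :=
  [/\ (0 < N)%N, algebraic_integer (N%:R * x)
    & forall N' : nat, (0 < N')%N -> algebraic_integer (N'%:R * x) ->
        (N <= N')%N].

Definition unbounded_denominators (R : realType) (c : nat -> C R) : Prop :=
  forall B : nat, exists n N : nat,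
    [/\ c n != 0, is_denominator (c n) N & (B < N)%N].

(* Main.v *)
(* The components of a form for rho' come from a single function f of even weight k = 2 l
   with character psi on Gamma(2).  Let A = lambda / 16, B = 1 - lambda and Th = theta_3 ^ 4;
   their logarithms are eta quotients, so the powers A ^ x B ^ y Th ^ l exist for complex x, y.
   With x = xi1 - m and y = - xi2 - m these powers have the character psi, and a form of
   weight -2 holomorphic at the cusps vanishes; hence f = A ^ x B ^ y Th ^ l Q(B) for some
   polynomial Q, and every component is a constant times A ^ x Th ^ l times a finite sum of
   the D_s B ^ s, whose exponents s are distinct irrational elements of Q(xi2).

   Suppose that the coefficients of such a component are p-integral.  So are those of the
   power A ^ x Th ^ l without its leading factor (for large p, as x is rational), and those of
   the sum of the D_s B ^ s.  The derivation w d/dw maps B ^ s to s B ^ s times a fixed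
   integral series, so Lagrange interpolation shows that a single B ^ s has p-integral
   coefficients.  As B = 1 - 16 w + ..., expanding B ^ s in powers of 1 - B gives that the
   binomial coefficient of s over p is p-integral.  But p! times it is a product of factors
   s - i whose norms are prime to p when M is not a square modulo p.

   For the unboundedness it remains to see that a nonsquare M is a nonresidue modulo
   infinitely many primes.  Otherwise every Galois automorphism of a cyclotomic field
   containing a square root of M, being a product of Frobenius maps at large primes, would
   fix that root. *)
Require Import Defs.
From HB Require Import structures.
From mathcomp Require Import all_boot all_order all_algebra.
From mathcomp Require Import algC cyclotomic algnum.
From mathcomp Require Import complex.
From mathcomp Require Import all_classical all_reals all_analysis.
From mathcomp Require Import ring lra zify.
Import Order.TTheory GRing.Theory Num.Theory numFieldNormedType.Exports.

Set Implicit Arguments.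
Unset Strict Implicit.
Unset Printing Implicit Defensive.

Local Open Scope ring_scope.
Local Open Scope classical_set_scope.

(** * Complex sequences and series *)

(** The powers A ^ x and B ^ y need a branch that is consistent on the whole half plane, so
    everything is built on one logarithm, the series [fL] with coefficients - sigma(n) / n. Its
    behaviour under S is the law of E_2, integrated. The constants of integration are read off at t
    = i or, for exp([c1]) = 16, from the coefficient of w in the relation B + exp([c1]) A = 1,
    itself an instance of the vanishing in weight -2. The exponents x, y and l - x - y describe A ^
    x B ^ y Th ^ l at the three cusps, and S and T permute them. The shift m settles the cusps
    governed by x and y, and a large degree of Q settles the third. As U ^ 2 is conjugate to T ^ -2,
    the exponent of B involves - xi2 and not xi2. A component combines f(t) and f(t + 1).
    Translation by 1 turns B into its inverse, so two families of exponents occur, y + d and l - x -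
    y - d. They are disjoint because a coincidence would make xi2 rational; this keeps the isolated
    term from being cancelled. *)

Ltac cfield := field; repeat (apply/andP; split); try assumption; try (by rewrite pnatr_eq0).

Section Modulus.
Variable R : realType.
Local Notation K := (C R).
Implicit Types (z u : K) (x : R).

(* The modulus as an element of [R]: [`|z|] has type [K]. *)
Definition cm (z : K) : R := Normc.normc z.
Definition rc (x : R) : K := (x%:C)%C.
Definition im (z : K) : R := complex.Im z.
Definition re (z : K) : R := complex.Re z.

Lemma cmE z : cm z = Num.sqrt (re z ^+ 2 + im z ^+ 2).
Proof. by case: z. Qed.

Lemma cm_ge0 z : 0 <= cm z.
Proof. by rewrite cmE sqrtr_ge0. Qed.

Lemma cm2 z : cm z ^+ 2 = re z ^+ 2 + im z ^+ 2.
Proof. by rewrite cmE sqr_sqrtr// addr_ge0// sqr_ge0. Qed.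

Lemma cm0 : cm 0 = 0. Proof. exact: Normc.normc0. Qed.

Lemma cm1 : cm 1 = 1. Proof. exact: Normc.normc1. Qed.

Lemma cmM z u : cm (z * u) = cm z * cm u. Proof. exact: Normc.normcM. Qed.

Lemma cmV z : cm z^-1 = (cm z)^-1. Proof. exact: Normc.normcV. Qed.

Lemma cmD z u : cm (z + u) <= cm z + cm u. Proof. exact: le_normcD. Qed.

Lemma cmN z : cm (- z) = cm z. Proof. by case: z => a b; rewrite /cm /= !sqrrN. Qed.

Lemma cmB z u : cm (z - u) <= cm z + cm u.
Proof. by rewrite (le_trans (cmD _ _))// cmN. Qed.

Lemma cmC z u : cm (z - u) = cm (u - z).
Proof. by rewrite -opprB cmN. Qed.

Lemma cm_eq0 z : (cm z == 0) = (z == 0).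
Proof. by apply/eqP/eqP => [/Normc.eq0_normc ->//|->]; rewrite cm0. Qed.

Lemma cm_gt0 z : (0 < cm z) = (z != 0).
Proof. by rewrite lt_def cm_ge0 andbT cm_eq0. Qed.

Lemma cmX z n : cm (z ^+ n) = cm z ^+ n.
Proof. by elim: n => [|n IH]; rewrite ?expr0 ?cm1// !exprS cmM IH. Qed.

Lemma norm_cm z : `|z| = rc (cm z).
Proof. by rewrite cmE normc_def. Qed.

Lemma rcD (x y : R) : rc (x + y) = rc x + rc y.
Proof. by rewrite /rc; apply/eqP; rewrite eq_complex /= addr0 !eqxx. Qed.
Lemma rcN (x : R) : rc (- x) = - rc x.
Proof. by rewrite /rc; apply/eqP; rewrite eq_complex /= oppr0 !eqxx. Qed.
Lemma rcB (x y : R) : rc (x - y) = rc x - rc y.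
Proof. by rewrite rcD rcN. Qed.
Lemma rcM (x y : R) : rc (x * y) = rc x * rc y.
Proof. by rewrite /rc; apply/eqP; rewrite eq_complex /= !(mul0r,mulr0,subr0,addr0) !eqxx. Qed.
Lemma rc0 : rc 0 = 0. Proof. by []. Qed.
Lemma rc1 : rc 1 = 1. Proof. by []. Qed.
Lemma rcX (x : R) n : rc (x ^+ n) = rc x ^+ n.
Proof. by elim: n => [|n IH]; rewrite ?expr0 // !exprS rcM IH. Qed.
Lemma rc_nat n : rc n%:R = n%:R.
Proof. by elim: n => [|n IH] //; rewrite -!natr1 rcD IH. Qed.
Lemma rcV (x : R) : rc x^-1 = (rc x)^-1.
Proof.
have [->|x0] := eqVneq x 0; first by rewrite invr0 rc0 invr0.
have h : rc x != 0 by apply: contra x0 => /eqP[->].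
by apply: (mulIf h); rewrite mulVf// -rcM mulVf.
Qed.

Lemma cm_rc x : cm (rc x) = `|x|.
Proof. by rewrite cmE /= expr0n addr0 sqrtr_sqr. Qed.

Lemma cm_nat n : cm n%:R = n%:R.
Proof. by rewrite -rc_nat cm_rc ger0_norm. Qed.

Lemma re_cm z : `|re z| <= cm z.
Proof. by rewrite -(@ler_pXn2r _ 2%N) ?nnegrE ?cm_ge0// cm2 real_normK ?num_real// lerDl sqr_ge0. Qed.

Lemma im_cm z : `|im z| <= cm z.
Proof. by rewrite -(@ler_pXn2r _ 2%N) ?nnegrE ?cm_ge0// cm2 real_normK ?num_real// lerDr sqr_ge0. Qed.

Lemma cm_re_im z : cm z <= `|re z| + `|im z|.
Proof.
rewrite -(@ler_pXn2r _ 2%N) ?nnegrE ?cm_ge0 ?addr_ge0// cm2.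
rewrite sqrrD !real_normK ?num_real// [leRHS]addrAC lerDl.
by rewrite mulrn_wge0// mulr_ge0.
Qed.

Lemma reD z u : re (z + u) = re z + re u. Proof. by case: z; case: u. Qed.
Lemma imD z u : im (z + u) = im z + im u. Proof. by case: z; case: u. Qed.
Lemma reN z : re (- z) = - re z. Proof. by case: z. Qed.
Lemma imN z : im (- z) = - im z. Proof. by case: z. Qed.
Lemma reB z u : re (z - u) = re z - re u. Proof. by rewrite reD reN. Qed.
Lemma imB z u : im (z - u) = im z - im u. Proof. by rewrite imD imN. Qed.
Lemma reM z u : re (z * u) = re z * re u - im z * im u. Proof. by case: z; case: u. Qed.
Lemma imM z u : im (z * u) = re z * im u + im z * re u. Proof. by case: z; case: u. Qed.
Lemma re_rc x : re (rc x) = x. Proof. by []. Qed.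
Lemma im_rc x : im (rc x) = 0. Proof. by []. Qed.
Lemma re_nat n : re n%:R = n%:R. Proof. by rewrite -rc_nat. Qed.
Lemma im_nat n : im n%:R = 0. Proof. by rewrite -rc_nat. Qed.
Lemma im_rcM x z : im (rc x * z) = x * im z. Proof. by rewrite imM re_rc im_rc mul0r addr0. Qed.
Lemma re_rcM x z : re (rc x * z) = x * re z. Proof. by rewrite reM re_rc im_rc mul0r subr0. Qed.

Lemma re_divn z n : re (z / n%:R) = re z / n%:R.
Proof. by rewrite -rc_nat -rcV mulrC re_rcM mulrC. Qed.
Lemma im_divn z n : im (z / n%:R) = im z / n%:R.
Proof. by rewrite -rc_nat -rcV mulrC im_rcM mulrC. Qed.

Lemma im_natM n z : im (n%:R * z) = n%:R * im z.
Proof. by rewrite -rc_nat im_rcM. Qed.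

Lemma c_eq z u : re z = re u -> im z = im u -> z = u.
Proof. by case: z; case: u => a b c d /= -> ->. Qed.

Lemma re_i : re ('i : K) = 0. Proof. by rewrite -complexiE. Qed.
Lemma im_i : im ('i : K) = 1. Proof. by rewrite -complexiE. Qed.

Lemma cm_i : cm ('i : K) = 1.
Proof. by rewrite cmE re_i im_i expr0n expr1n add0r sqrtr1. Qed.

Lemma imV z : im z^-1 = - im z / cm z ^+ 2.
Proof. by rewrite cm2; case: z => a b /=; rewrite mulNr. Qed.

Lemma cm_distl z u : `|cm z - cm u| <= cm (z - u).
Proof.
rewrite ler_norml; apply/andP; split.
  rewrite lerNl opprB lerBlDr; have := cmD (u - z) z.
  by rewrite subrK cmC.
by rewrite lerBlDr; have := cmD (z - u) u; rewrite subrK.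
Qed.

Lemma cm_sum (I : Type) (r : seq I) (P : pred I) (F : I -> K) :
  cm (\sum_(i <- r | P i) F i) <= \sum_(i <- r | P i) cm (F i).
Proof.
elim/big_ind2: _ => [|x1 x2 y1 y2 h1 h2|i _]; first by rewrite cm0.
- by rewrite (le_trans (cmD _ _))// lerD.
- by [].
Qed.

Lemma re_sum (I : Type) (r : seq I) (P : pred I) (F : I -> K) :
  re (\sum_(i <- r | P i) F i) = \sum_(i <- r | P i) re (F i).
Proof. by elim/big_ind2: _ => // x1 x2 y1 y2 <- <-; rewrite reD. Qed.

Lemma im_sum (I : Type) (r : seq I) (P : pred I) (F : I -> K) :
  im (\sum_(i <- r | P i) F i) = \sum_(i <- r | P i) im (F i).
Proof. by elim/big_ind2: _ => // x1 x2 y1 y2 <- <-; rewrite imD. Qed.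

Lemma rc_sum (I : Type) (r : seq I) (P : pred I) (F : I -> R) :
  rc (\sum_(i <- r | P i) F i) = \sum_(i <- r | P i) rc (F i).
Proof. by elim/big_ind2: _ => // x1 x2 y1 y2 <- <-; rewrite rcD. Qed.

End Modulus.

Arguments cm : simpl never.
Arguments rc : simpl never.
Arguments re : simpl never.
Arguments im : simpl never.

Section Sums.
Variable R : realType.
Local Notation K := (C R).

(** Convergence is measured by the real number [cm], so that squeezing and epsilon arguments take
    place in the totally ordered field [R]. *)
Definition ctends (u : nat -> K) (l : K) := cm (u n - l) @[n --> \oo] --> (0 : R).

Definition csums (u : nat -> K) (l : K) := ctends (fun n => \sum_(i < n) u i) l.

(** Dominating series are carried around by a bound on their partial sums, without naming the
    limit. *)
Definition rbnd (M : nat -> R) := (forall n, 0 <= M n) /\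
  exists B, forall n, \sum_(i < n) M i <= B.

Definition absum (u : nat -> K) := rbnd (fun n => cm (u n)).

Lemma cvg0D (a b : nat -> R) : a @ \oo --> (0 : R) -> b @ \oo --> (0 : R) ->
  (fun n => a n + b n) @ \oo --> (0 : R).
Proof. by move=> ha hb; rewrite -[X in _ --> X](addr0 0); apply: cvgD. Qed.

Lemma cvg0M (c : R) (a : nat -> R) : a @ \oo --> (0 : R) -> (fun n => c * a n) @ \oo --> (0 : R).
Proof. by move=> ha; rewrite -[X in _ --> X](mulr0 c); apply: cvgM => //; exact: cvg_cst. Qed.

Lemma ctendsP (u : nat -> K) (l : K) : ctends u l <->
  forall e : R, 0 < e -> exists N, forall n, (N <= n)%N -> cm (u n - l) < e.
Proof.
split.
  move/cvgrPdist_lt => h e /h [N _ hN]; exists N => n /hN /=.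
  by rewrite sub0r normrN ger0_norm ?cm_ge0.
move=> h; apply/cvgrPdist_lt => e /h [N hN]; exists N => // n /= /hN.
by rewrite sub0r normrN ger0_norm ?cm_ge0.
Qed.

Lemma cvg_ctends (u : nat -> K) (l : K) : u @ \oo --> l <-> ctends u l.
Proof.
rewrite ctendsP; split.
  move/cvgrPdist_lt => h e e0; have /h [N _ hN] : (0 : K) < rc e by rewrite /rc ltcR.
  exists N => n /hN /=; rewrite norm_cm /rc ltcR cmC //.
move=> h; apply/cvgrPdist_lt => e; rewrite ltcE => /andP[/eqP i0 r0].
have ee : e = rc (re e) by apply: c_eq => //; exact: i0.
have /h [N hN] : 0 < re e by exact: r0.
exists N => // n /= /hN; rewrite norm_cm ee /rc ltcR re_rc cmC //.
Qed.

Lemma ctends_cst (l : K) : ctends (fun=> l) l.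
Proof. by rewrite /ctends subrr cm0; exact: cvg_cst. Qed.

Lemma ctends_le (u : nat -> K) l (v : nat -> R) N :
  (forall n, (N <= n)%N -> cm (u n - l) <= v n) -> v @ \oo --> (0 : R) -> ctends u l.
Proof.
move=> h hv; apply/ctendsP => e e0.
have [N1 _ h1] := (cvgrPdist_lt _ _).1 hv e e0.
exists (maxn N N1) => n; rewrite geq_max => /andP[hN hN1].
apply: le_lt_trans (h _ hN) _; have := h1 _ hN1; rewrite /= sub0r normrN.
exact: le_lt_trans (ler_norm _).
Qed.

Lemma ctends_eq (u v : nat -> K) l N : (forall n, (N <= n)%N -> u n = v n) -> ctends v l -> ctends u l.
Proof. by move=> h hv; apply: (ctends_le (N := N)) hv => n /h ->. Qed.

Lemma ctendsD (u v : nat -> K) l m : ctends u l -> ctends v m -> ctends (fun n => u n + v n) (l + m).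
Proof.
move=> hu hv; have h := cvg0D hu hv.
apply: (ctends_le (N := 0)) h => n _ /=.
by rewrite opprD addrACA cmD.
Qed.

Lemma ctendsMl (c : K) (u : nat -> K) l : ctends u l -> ctends (fun n => c * u n) (c * l).
Proof.
move=> hu; have h := cvg0M (cm c) hu.
apply: (ctends_le (N := 0)) h => n _ /=.
by rewrite -mulrBr cmM.
Qed.

Lemma ctendsMr (c : K) (u : nat -> K) l : ctends u l -> ctends (fun n => u n * c) (l * c).
Proof.
by move=> h; rewrite mulrC; apply: (ctends_eq (N:=0)) (ctendsMl c h) => n _; rewrite mulrC.
Qed.

Lemma ctendsN (u : nat -> K) l : ctends u l -> ctends (fun n => - u n) (- l).
Proof. by move=> h; rewrite -mulN1r; apply: (ctends_eq (N:=0)) (ctendsMl (-1) h) => n _; rewrite mulN1r. Qed.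

Lemma ctendsB (u v : nat -> K) l m : ctends u l -> ctends v m -> ctends (fun n => u n - v n) (l - m).
Proof. by move=> hu hv; apply: ctendsD => //; exact: ctendsN. Qed.

Lemma ctends_bnd (u : nat -> K) l : ctends u l -> exists2 B : R, 0 < B & forall n, cm (u n) <= B.
Proof.
move=> /ctendsP /(_ 1 ltr01) [N hN].
exists (cm l + 1 + \sum_(i < N) cm (u i)).
  by rewrite ltr_wpDr ?sumr_ge0// ?ltr_wpDl ?cm_ge0// => i _; exact: cm_ge0.
move=> n; have [nN|Nn] := ltnP n N.
  rewrite (bigD1 (Ordinal nN)) //= addrCA lerDl ?addr_ge0 ?cm_ge0//.
  by rewrite sumr_ge0// => i _; exact: cm_ge0.
apply: (@le_trans _ _ (cm l + 1)); last by rewrite lerDl sumr_ge0// => i _; exact: cm_ge0.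
have -> : u n = l + (u n - l) by ring.
by rewrite (le_trans (cmD _ _))// lerD2l ltW// hN.
Qed.

Lemma ctendsM (u v : nat -> K) l m : ctends u l -> ctends v m -> ctends (fun n => u n * v n) (l * m).
Proof.
move=> hu hv; have [B B0 hB] := ctends_bnd hu.
have h := cvg0D (cvg0M B hv) (cvg0M (cm m) hu).
apply: (ctends_le (N := 0)) h => n _ /=.
have -> : u n * v n - l * m = u n * (v n - m) + m * (u n - l) by ring.
rewrite (le_trans (cmD _ _))// !cmM lerD2r.
by rewrite ler_wpM2r// cm_ge0.
Qed.

Lemma ctendsX (u : nat -> K) l k : ctends u l -> ctends (fun n => u n ^+ k) (l ^+ k).
Proof.
move=> h; elim: k => [|k IH]; first exact: ctends_cst.
by rewrite exprS; apply: (ctends_eq (N:=0)) (ctendsM h IH) => n _; rewrite exprS.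
Qed.

Lemma ctendsV (u : nat -> K) l : l != 0 -> ctends u l -> ctends (fun n => (u n)^-1) l^-1.
Proof.
move=> l0 hu; have cl0 : 0 < cm l by rewrite cm_gt0.
have /ctendsP /(_ (cm l / 2)) [|N hN] := hu; first by rewrite divr_gt0.
have h := cvg0M (2 / cm l ^+ 2) hu.
apply: (ctends_le (N := N)) h => n /hN hn /=.
have hun : cm l / 2 <= cm (u n).
  have := cm_distl (u n) l; rewrite ler_norml => /andP[h1 _].
  by lra.
have un0 : u n != 0 by rewrite -cm_gt0; apply: lt_le_trans hun; rewrite divr_gt0.
have -> : (u n)^-1 - l^-1 = (l - u n) / (u n * l) by field; rewrite l0 un0.
rewrite !cmM cmV cmM cmC mulrC ler_wpM2r ?cm_ge0//.
have -> : 2 / cm l ^+ 2 = (cm l / 2 * cm l)^-1 by field; rewrite gt_eqF.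
rewrite lef_pV2 ?posrE ?mulr_gt0 ?divr_gt0// ?cm_gt0//.
by rewrite ler_pM2r.
Qed.

Lemma ctends_shift (u : nat -> K) l k : ctends (fun n => u (n + k)%N) l <-> ctends u l.
Proof.
rewrite !ctendsP; split => h e /h [N hN].
  exists (N + k)%N => n hn; have -> : n = (n - k + k)%N by lia.
  by apply: hN; lia.
by exists N => n hn; apply: hN; lia.
Qed.

Lemma ctends_uniq (u : nat -> K) l m : ctends u l -> ctends u m -> l = m.
Proof.
move=> hu hv; have := ctendsB hu hv => /ctendsP h.
apply/eqP; rewrite -subr_eq0 -cm_eq0; apply/eqP/le_anti; rewrite cm_ge0 andbT.
apply/ler_addgt0Pl => e /h [N /(_ N (leqnn _))].
by rewrite subrr sub0r cmN addr0 => /ltW.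
Qed.

Lemma ctends_sub (u : nat -> K) l (f : nat -> nat) : (forall n, (n <= f n)%N) ->
  ctends u l -> ctends (fun n => u (f n)) l.
Proof.
move=> hf /ctendsP h; apply/ctendsP => e /h [N hN]; exists N => n hn.
by apply: hN; apply: leq_trans hn (hf n).
Qed.

Lemma ctends_cm (u : nat -> K) l B : ctends u l -> (forall n, cm (u n) <= B) -> cm l <= B.
Proof.
move=> /ctendsP h hB; apply/ler_addgt0Pl => e /h [N /(_ N (leqnn _)) hN].
have -> : l = u N - (u N - l) by ring.
by rewrite (le_trans (cmB _ _))// addrC lerD// ltW.
Qed.

Lemma csums_uniq u l m : csums u l -> csums u m -> l = m.
Proof. exact: ctends_uniq. Qed.

Lemma csums_ext u v l : (forall n, u n = v n) -> csums u l -> csums v l.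
Proof. by move=> /funext ->. Qed.

Lemma csumsD u v l m : csums u l -> csums v m -> csums (fun n => u n + v n) (l + m).
Proof.
by move=> hu hv; apply: (ctends_eq (N := 0)) (ctendsD hu hv) => n _; rewrite big_split.
Qed.

Lemma csumsMl c u l : csums u l -> csums (fun n => c * u n) (c * l).
Proof.
by move=> hu; apply: (ctends_eq (N := 0)) (ctendsMl c hu) => n _; rewrite mulr_sumr.
Qed.

Lemma csumsMr c u l : csums u l -> csums (fun n => u n * c) (l * c).
Proof.
by move=> hu; apply: (ctends_eq (N := 0)) (ctendsMr c hu) => n _; rewrite mulr_suml.
Qed.

Lemma csumsN u l : csums u l -> csums (fun n => - u n) (- l).
Proof. by move=> hu; apply: (ctends_eq (N := 0)) (ctendsN hu) => n _; rewrite sumrN. Qed.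

Lemma csumsB u v l m : csums u l -> csums v m -> csums (fun n => u n - v n) (l - m).
Proof. by move=> hu hv; apply: csumsD => //; exact: csumsN. Qed.

Lemma csums0 : csums (fun=> 0) 0.
Proof. by apply: (ctends_eq (N := 0)) (ctends_cst 0) => n _; rewrite big1. Qed.

Lemma csumsS u l : csums (fun n => u n.+1) l <-> csums u (u 0%N + l).
Proof.
rewrite /csums -(ctends_shift (fun n => \sum_(i < n) u i) _ 1); split => h.
  apply: (ctends_eq (N := 0)) (ctendsD (ctends_cst (u 0%N)) h) => n _.
  by rewrite addn1 big_ord_recl.
have := ctendsD (ctends_cst (- u 0%N)) h; rewrite addKr => h'.
by apply: (ctends_eq (N := 0)) h' => n _; rewrite addn1 big_ord_recl addKr.
Qed.

Lemma csums_fin (u : nat -> K) N : (forall n, (N <= n)%N -> u n = 0) -> csums u (\sum_(i < N) u i).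
Proof.
move=> h; apply: (ctends_eq (N := N)) (ctends_cst _) => n hn.
rewrite -(subnKC hn) big_split_ord /= [X in _ + X]big1 ?addr0// => i _.
by rewrite h// leq_addr.
Qed.

Lemma rbnd_le M M' : (forall n, 0 <= M n <= M' n) -> rbnd M' -> rbnd M.
Proof.
move=> h [h0 [B hB]]; split; first by move=> n; have /andP[] := h n.
exists B => n; apply: le_trans (hB n); apply: ler_sum => i _.
by have /andP[] := h i.
Qed.

Lemma rbndM c M : 0 <= c -> rbnd M -> rbnd (fun n => c * M n).
Proof.
move=> c0 [h0 [B hB]]; split; first by move=> n; rewrite mulr_ge0.
by exists (c * B) => n; rewrite -mulr_sumr ler_wpM2l.
Qed.

Lemma rbndS M : (forall n, 0 <= M n) -> rbnd (fun n => M n.+1) -> rbnd M.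
Proof.
move=> h0 [_ [B hB]]; split => //; exists (M 0%N + B) => -[|n].
  by rewrite big_ord0 addr_ge0// (le_trans _ (hB 0%N))// big_ord0.
by rewrite big_ord_recl lerD2l.
Qed.

Lemma rbnd_cvg M : rbnd M -> cvgn (fun n => \sum_(i < n) M i).
Proof.
move=> [h0 [B hB]]; apply: nondecreasing_is_cvgn.
  apply/nondecreasing_seqP => n; rewrite big_ord_recr/= lerDl; exact: h0.
by exists B => _ [n _ <-].
Qed.

Lemma rbnd_tail M : rbnd M -> forall e, 0 < e -> exists N, forall n m, (N <= n)%N -> (n <= m)%N ->
  \sum_(i < m) M i - \sum_(i < n) M i < e.
Proof.
move=> hM e e0; have h := rbnd_cvg hM.
set l := limn _ in h.
have [N _ hN] := (cvgrPdist_lt _ _).1 h (e / 2) (divr_gt0 e0 (ltr0n _ 2)).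
exists N => n m hn hm.
have /= := hN n hn; have /= := hN m (leq_trans hn hm).
rewrite !ltr_norml => /andP[h1 h2] /andP[h3 h4]; lra.
Qed.

Lemma absum_cvg u : absum u -> exists l, csums u l.
Proof.
move=> hu.
have hre : rbnd (fun n => `|re (u n)|) by apply: rbnd_le hu => n; rewrite normr_ge0 re_cm.
have him : rbnd (fun n => `|im (u n)|) by apply: rbnd_le hu => n; rewrite normr_ge0 im_cm.
have cvs (f : nat -> R) : rbnd (fun n => `|f n|) -> cvgn (fun n => \sum_(i < n) f i).
  move=> hf; have := rbnd_cvg hf; have E (g : nat -> R) : (fun n => \sum_(i < n) g i) = series g.
    by apply/funext => n; rewrite /series /= big_mkord.
  by rewrite (E f) (E (fun n => `|f n|)) => h; apply: normed_cvg.
move: (cvs _ hre) (cvs _ him); set a := limn _; set b := limn _ => ha hb.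
exists ((a +i* b)%C : K).
have cv0 (f : nat -> R) x : f @ \oo --> x -> (fun n => `|f n - x|) @ \oo --> (0 : R).
  move=> /cvgrPdist_lt hf; apply/cvgrPdist_lt => e /hf [N _ hN]; exists N => // n /hN /=.
  by rewrite sub0r normrN normr_id distrC.
have h := cvg0D (cv0 _ _ ha) (cv0 _ _ hb).
apply: (ctends_le (N := 0)) h => n _ /=.
by rewrite (le_trans (cm_re_im _))// reB imB re_sum im_sum.
Qed.

Lemma csums_le u l M : csums u l -> (forall n, cm (u n) <= M n) -> rbnd M ->
  forall N e, 0 < e -> (forall n, (N <= n)%N -> \sum_(i < n) M i - \sum_(i < N) M i <= e) ->
  cm (l - \sum_(i < N) u i) <= e.
Proof.
move=> hu hM hb N e e0 he.
have h : ctends (fun n => \sum_(i < n + N) u i - \sum_(i < N) u i) (l - \sum_(i < N) u i).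
  by apply: ctendsB; [apply/(ctends_shift (fun n => \sum_(i < n) u i)) | apply: ctends_cst].
apply: (ctends_cm h) => n.
rewrite addnC big_split_ord /= addrAC subrr add0r.
rewrite (le_trans (cm_sum _ _ _))//; apply: le_trans (he (N + n)%N (leq_addr _ _)).
rewrite big_split_ord /= addrAC subrr add0r.
by apply: ler_sum => i _; exact: hM.
Qed.

Lemma csums_ge (x : nat -> R) l : (forall n, 0 <= x n) -> csums (fun n => rc (x n)) l ->
  forall n, \sum_(i < n) x i <= re l.
Proof.
move=> x0 /ctendsP h n; apply/ler_addgt0Pl => e /h [N hN].
have := hN (N + n)%N (leq_addr _ _); rewrite -rc_sum => h1.
have := le_lt_trans (re_cm _) h1; rewrite reB re_rc ltr_norml => /andP[_ h2].
have : \sum_(i < n) x i <= \sum_(i < N + n) x i.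
  by rewrite addnC big_split_ord /= lerDl sumr_ge0.
lra.
Qed.

Lemma csums_cm u l M B : csums u l -> (forall n, cm (u n) <= M n) ->
  (forall n, \sum_(i < n) M i <= B) -> cm l <= B.
Proof.
move=> h hM hB; apply: (ctends_cm h) => n.
by rewrite (le_trans (cm_sum _ _ _))// (le_trans _ (hB n))// ler_sum.
Qed.

(** Dominated convergence for series: one tail of [M] bounds the tails of all rows and of the limit
    row, and the finite sums that remain converge termwise. *)
Lemma tannery (u : nat -> nat -> K) (v : nat -> K) (M : nat -> R) (l : nat -> K) (L : K) :
  rbnd M -> (exists N0, forall N m, (N0 <= N)%N -> cm (u N m) <= M m) ->
  (forall m, ctends (fun N => u N m) (v m)) ->
  (forall N, csums (u N) (l N)) -> csums v L -> ctends l L.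
Proof.
move=> hM [N0 hu] huv hl hL; apply/ctendsP => e e0.
have hv m : cm (v m) <= M m.
  apply: (@ctends_cm (fun N => u (N + N0)%N m)); first exact/(ctends_shift (fun N => u N m)).
  by move=> n; apply: hu; exact: leq_addl.
have e4 : 0 < e / 4 by rewrite divr_gt0.
have [k hk] := rbnd_tail hM e4.
have hfin : ctends (fun N => \sum_(i < k) u N i) (\sum_(i < k) v i).
  elim: k {hk} => [|k IH].
    by apply: (ctends_eq (N := 0)) (ctends_cst _) => n _; rewrite !big_ord0.
  rewrite big_ord_recr /=; apply: (ctends_eq (N := 0)) (ctendsD IH (huv k)) => n _.
  by rewrite big_ord_recr.
have [N1 hN1] := (ctendsP _ _).1 hfin _ e4.
exists (maxn N0 N1) => n; rewrite geq_max => /andP[hn0 hn1].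
have h1 : cm (l n - \sum_(i < k) u n i) <= e / 4.
  apply: (csums_le (hl n) (M := M)) => // [m|m hm]; first exact: hu.
  by rewrite ltW// hk.
have h2 : cm (L - \sum_(i < k) v i) <= e / 4.
  by apply: (csums_le hL (M := M)) => // m hm; rewrite ltW// hk.
have h3 := hN1 n hn1.
have -> : l n - L = (l n - \sum_(i < k) u n i) + (\sum_(i < k) u n i - \sum_(i < k) v i)
   - (L - \sum_(i < k) v i) by ring.
apply: le_lt_trans (cmB _ _) _; apply: le_lt_trans (lerD (cmD _ _) (lexx _)) _.
lra.
Qed.

Lemma absum_le (u : nat -> K) M : (forall n, cm (u n) <= M n) -> rbnd M -> absum u.
Proof. by move=> h; apply: rbnd_le => n; rewrite cm_ge0 h. Qed.

(** Fubini for double series, from [tannery]: the sum of the first N columns is a series over the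
    rows, dominated by [B] independently of N. *)
Lemma csums_exchange (u : nat -> nat -> K) (M : nat -> nat -> R) (B : nat -> R)
    (r c : nat -> K) (L : K) :
  (forall m k, cm (u m k) <= M m k) -> (forall m n, \sum_(k < n) M m k <= B m) -> rbnd B ->
  (forall m, csums (u m) (r m)) -> (forall k, csums (fun m => u m k) (c k)) ->
  csums r L -> csums c L.
Proof.
move=> hu hM hB hr hc hL.
apply: (tannery (u := fun N m => \sum_(k < N) u m k) hB) (hr) _ hL; first exists 0%N => N m _.
  by rewrite (le_trans (cm_sum _ _ _))// (le_trans _ (hM m N))// ler_sum.
move=> N; rewrite /csums; elim: N => [|N IH].
  rewrite big_ord0; apply: (ctends_eq (N := 0)) (ctends_cst 0) => n _.
  by rewrite big1// => i _; rewrite big_ord0.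
rewrite big_ord_recr /=; apply: (ctends_eq (N := 0)) (ctendsD IH (hc N)) => n _.
by rewrite -big_split /=; apply: eq_bigr => i _; rewrite big_ord_recr.
Qed.

Lemma rbnd_geo (x : R) : 0 <= x < 1 -> rbnd (fun n => x ^+ n).
Proof.
move=> /andP[x0 x1]; split; first by move=> n; rewrite exprn_ge0.
exists (1 - x)^-1 => n; have x1' : 0 < 1 - x by lra.
rewrite -[leRHS]mul1r ler_pdivlMr// mulrC.
have -> : (1 - x) * \sum_(i < n) x ^+ i = 1 - x ^+ n.
  by rewrite -opprB mulNr -subrX1 opprB.
by rewrite gerBl exprn_ge0.
Qed.

End Sums.

(** * The complex exponential *)

Section CauchyProduct.
Variable R : realType.
Local Notation K := (C R).

Definition conv (a b : nat -> K) (n : nat) : K := \sum_(i < n.+1) a i * b (n - i)%N.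

Lemma csums_shiftn (b : nat -> K) (B c : K) (i : nat) : csums b B ->
  csums (fun n => if (i <= n)%N then c * b (n - i)%N else 0) (c * B).
Proof.
move=> hb; elim: i => [|i IH].
  by apply: csums_ext (csumsMl c hb) => n; rewrite leq0n subn0.
have := (csumsS (fun n => if (i.+1 <= n)%N then c * b (n - i.+1)%N else 0) (c * B)).1.
by rewrite ltn0 add0r; apply.
Qed.

(** A double series whose row i is [b] shifted by i and scaled by [a i]; its column sums are the
    terms of [conv]. *)
Lemma csums_conv (a b : nat -> K) (A B : K) : absum a -> absum b -> csums a A -> csums b B ->
  csums (conv a b) (A * B).
Proof.
move=> ha hb hA hB; have [h0 [Bb hBb]] := hb.
have Bb0 : 0 <= Bb by apply: le_trans (hBb 0%N); rewrite big_ord0.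
apply: (@csums_exchange R (fun i n => if (i <= n)%N then a i * b (n - i)%N else 0)
  (fun i n => if (i <= n)%N then cm (a i) * cm (b (n - i)%N) else 0) (fun i => Bb * cm (a i))
  (fun i => a i * B)).
- by move=> m k; case: ifP; rewrite ?cmM ?cm0.
- move=> m n; have [nm|mn] := leqP n m.
    rewrite big1 ?mulr_ge0 ?cm_ge0// => i _; rewrite ifF//; apply/negbTE; rewrite -ltnNge.
    exact: leq_trans (ltn_ord i) nm.
  rewrite -(subnKC (ltnW mn)) big_split_ord /= [X in X + _]big1 ?add0r; last first.
    by move=> i _; rewrite ifF//; apply/negbTE; rewrite -ltnNge.
  under eq_bigr do rewrite leq_addr addKn.
  by rewrite -mulr_sumr mulrC ler_wpM2r ?cm_ge0//; exact: hBb.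
- exact: rbndM.
- by move=> i; apply: csums_shiftn.
- move=> n; rewrite /conv.
  have -> : \sum_(i < n.+1) a i * b (n - i)%N = \sum_(i < n.+1) (if (i <= n)%N then a i * b (n - i)%N else 0).
    by apply: eq_bigr => i _; rewrite -ltnS ltn_ord.
  by apply: (@csums_fin R (fun i => if (i <= n)%N then a i * b (n - i)%N else 0)) => i hi; rewrite ifF//; apply/negbTE; rewrite -ltnNge.
- exact: csumsMr.
Qed.

End CauchyProduct.

Section Exponential.
Variable R : realType.
Local Notation K := (C R).
Implicit Types z : K.

Lemma re_cexp z : re (cexp z) = expR (re z) * cos (im z). Proof. by []. Qed.
Lemma im_cexp z : im (cexp z) = expR (re z) * sin (im z). Proof. by []. Qed.

Lemma cexpD z u : cexp (z + u) = cexp z * cexp u.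
Proof.
by apply: c_eq; rewrite ?reM ?imM !(re_cexp, im_cexp, reD, imD) expRD ?cosD ?sinD; ring.
Qed.

Lemma cexp0 : cexp (0 : K) = 1.
Proof. by apply: c_eq; rewrite ?re_cexp ?im_cexp expR0 mul1r ?cos0 ?sin0. Qed.

Lemma cm_cexp z : cm (cexp z) = expR (re z).
Proof.
apply/eqP; rewrite -(@eqrXn2 _ 2) ?cm_ge0 ?expR_ge0// cm2 re_cexp im_cexp !exprMn -mulrDr.
by rewrite cos2Dsin2 mulr1.
Qed.

Lemma cexp_neq0 z : cexp z != 0.
Proof. by rewrite -cm_gt0 cm_cexp expR_gt0. Qed.

Lemma cexpN z : cexp (- z) = (cexp z)^-1.
Proof.
by apply: (mulIf (cexp_neq0 z)); rewrite mulVf ?cexp_neq0// -cexpD addNr cexp0.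
Qed.

Lemma cexpB z u : cexp (z - u) = cexp z / cexp u.
Proof. by rewrite cexpD cexpN. Qed.

Lemma cexpMn z n : cexp (n%:R * z) = cexp z ^+ n.
Proof. by elim: n => [|n IH]; rewrite ?mul0r ?cexp0// -natr1 mulrDl mul1r cexpD IH exprSr. Qed.

Lemma cexp_rc (x : R) : cexp (rc x) = rc (expR x).
Proof. by apply: c_eq; rewrite ?re_cexp ?im_cexp /= ?cos0 ?sin0 ?mulr1 ?mulr0. Qed.

Lemma csums_rc (u : nat -> R) l : series u @ \oo --> l -> csums (fun n => rc (u n)) (rc l).
Proof.
move=> h; apply/ctendsP => e e0; have [N _ hN] := (cvgrPdist_lt _ _).1 h e e0.
exists N => n /hN /=; rewrite -rc_sum -rcB cm_rc distrC /series /=.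
by rewrite big_mkord.
Qed.

Lemma csums_exp_rc (x : R) : csums (fun n => rc x ^+ n / n`!%:R) (cexp (rc x)).
Proof.
rewrite cexp_rc; apply: (@csums_ext R (fun n => rc (x ^+ n / n`!%:R))).
  by move=> n; rewrite rcM rcX rcV rc_nat.
by apply: csums_rc; exact: is_cvg_series_exp_coeff x.
Qed.

Lemma absum_exp z : absum (fun n => z ^+ n / n`!%:R).
Proof.
have := is_cvg_series_exp_coeff (cm z) => h.
apply: (@absum_le _ _ (fun n => cm z ^+ n / n`!%:R)).
  by move=> n; rewrite cmM cmX cmV cm_nat.
split; first by move=> n; rewrite divr_ge0 ?exprn_ge0 ?cm_ge0.
exists (expR (cm z)) => n.
have h0 k : 0 <= exp_coeff (cm z) k by rewrite /exp_coeff /= divr_ge0 ?exprn_ge0 ?cm_ge0.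
have : series (exp_coeff (cm z)) n <= expR (cm z).
  apply: nondecreasing_cvgn_le => //; apply/nondecreasing_seqP => k.
  by rewrite /series /= big_nat_recr//= lerDl.
by rewrite /series /= big_mkord.
Qed.

Lemma csums_exp_i (x : R) : csums (fun n => ('i * rc x : K) ^+ n / n`!%:R) (cexp ('i * rc x)).
Proof.
have [l hl] := absum_cvg (absum_exp ('i * rc x)).
suff -> : cexp ('i * rc x) = l by [].
have hs : csums (fun n => rc (cos_coeff x n) + 'i * rc (sin_coeff x n)) (rc (cos x) + 'i * rc (sin x)).
  apply: csumsD; last apply: csumsMl; apply: csums_rc.
    by rewrite cos.unlock; exact: is_cvg_series_cos_coeff.
  by rewrite sin.unlock; exact: is_cvg_series_sin_coeff.
have i2 : ('i : K) ^+ 2 = -1 by rewrite sqrCi.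
have := csums_uniq (csums_ext _ hs) hl => <-.
  apply: c_eq; rewrite ?re_cexp ?im_cexp ?reD ?imD ?reM ?imM ?re_i ?im_i !(re_rc, im_rc);
  by rewrite !(mul0r, mulr0, mul1r, subr0, addr0, add0r, sub0r, oppr0) expR0 mul1r.
move=> n; rewrite exprMn -rcX -rc_nat -rcV -mulrA -rcM.
rewrite /cos_coeff /sin_coeff /= -[in 'i ^+ n](odd_double_half n) exprD -mul2n exprM i2.
have sgn k : (-1 : K) ^+ k = rc ((-1) ^+ k) by rewrite rcX rcN.
case: (boolP (odd n)) => hn /=.
  rewrite !mul0r rc0 add0r expr1 mul1r sgn -[RHS]mulrA -rcM; congr (_ * rc _).
  have -> : n.-1./2 = n./2 by rewrite -[in n.-1](odd_double_half n) hn /= doubleK.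
  by rewrite mulrA.
rewrite !mul0r rc0 mulr0 addr0 expr0 mul1r mul1r sgn -rcM; congr rc.
by rewrite mulrA.
Qed.

(** The expansion holds on the real and imaginary axes by the real series of exp, cos and sin; the
    Cauchy product and the binomial theorem extend it to their sums. *)
Lemma csums_exp z : csums (fun n => z ^+ n / n`!%:R) (cexp z).
Proof.
have e : z = rc (re z) + 'i * rc (im z).
  by apply: c_eq; rewrite ?reD ?imD ?reM ?imM ?re_i ?im_i !(re_rc, im_rc) /=; ring.
rewrite e cexpD.
apply: csums_ext (csums_conv (absum_exp _) (absum_exp _) (csums_exp_rc _) (csums_exp_i _)).
move=> n; rewrite /conv [_ + 'i * _]addrC exprDn mulr_suml; apply: eq_bigr => -[i /=]; rewrite ltnS => hi _.
have f0 k : k`!%:R != 0 :> K by rewrite pnatr_eq0 -lt0n fact_gt0.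
have hf : 'C(n, i)%:R = n`!%:R / (i`!%:R * (n - i)`!%:R) :> K.
  by rewrite -(bin_fact hi) !natrM mulfK// mulf_neq0.
rewrite -[X in _ = X / _]mulr_natr hf; set a := rc _; set b := 'i * _.
by field; rewrite !f0.
Qed.

End Exponential.

(** * The function exp(2 pi i z): its periods and a lower bound near 0 *)

Section E2pi.
Variable R : realType.
Local Notation K := (C R).
Local Notation pi := (pi : R).
Implicit Types (z t u : K).

Lemma e2piE z : e2pi z = cexp (2 * rc pi * 'i * z). Proof. by []. Qed.

Lemma re_2pi z : re (2 * rc pi * 'i * z) = - (2 * pi * im z).
Proof. by rewrite !(reM, imM) re_i im_i re_nat im_nat re_rc im_rc; ring. Qed.

Lemma im_2pi z : im (2 * rc pi * 'i * z) = 2 * pi * re z.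
Proof. by rewrite !(reM, imM) re_i im_i re_nat im_nat re_rc im_rc; ring. Qed.

Lemma e2piD z u : e2pi (z + u) = e2pi z * e2pi u.
Proof. by rewrite !e2piE mulrDr cexpD. Qed.

Lemma e2pi0 : e2pi (0 : K) = 1. Proof. by rewrite e2piE mulr0 cexp0. Qed.

Lemma e2piN z : e2pi (- z) = (e2pi z)^-1. Proof. by rewrite !e2piE mulrN cexpN. Qed.

Lemma e2piB z u : e2pi (z - u) = e2pi z / e2pi u. Proof. by rewrite e2piD e2piN. Qed.

Lemma e2piMn n z : e2pi (n%:R * z) = e2pi z ^+ n.
Proof. by rewrite !e2piE mulrCA cexpMn. Qed.

Lemma cm_e2pi z : cm (e2pi z) = expR (- (2 * pi * im z)).
Proof. by rewrite e2piE cm_cexp re_2pi. Qed.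

Lemma e2pi_neq0 z : e2pi z != 0. Proof. exact: cexp_neq0. Qed.

Lemma e2pi1 : e2pi (1 : K) = 1.
Proof.
apply: c_eq; rewrite e2piE ?re_cexp ?im_cexp re_2pi im_2pi (im_nat R 1) (re_nat R 1) mulr0 oppr0 expR0 mulr1 mul1r mulr_natl.
  exact: cos2pi.
exact: sin2pi.
Qed.

Lemma e2pi_nat n : e2pi (n%:R : K) = 1.
Proof. by rewrite -[n%:R]mulr1 e2piMn e2pi1 expr1n. Qed.

Lemma e2pi_int (m : int) : e2pi (m%:~R : K) = 1.
Proof.
case: m => n; first by rewrite -pmulrn e2pi_nat.
by rewrite NegzE mulrNz -pmulrn e2piN e2pi_nat invr1.
Qed.

Lemma e2pi_half : e2pi (2^-1 : K) = -1.
Proof.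
have -> : (2^-1 : K) = rc 2^-1 by rewrite rcV rc_nat.
apply: c_eq; rewrite e2piE ?re_cexp ?im_cexp re_2pi im_2pi re_rc im_rc mulr0 oppr0 expR0 mul1r mulrAC mulfV// mul1r ?reN ?imN.
  by rewrite cospi (re_nat R 1).
by rewrite sinpi (im_nat R 1) oppr0.
Qed.

Lemma cos_eq1 (x : R) : 0 <= x < 2 * pi -> cos x = 1 -> x = 0.
Proof.
move=> /andP[x0 x2] h; have pi0 := pi_gt0 R.
have [xpi|xpi] := leP x pi.
  by apply: (@cos_inj R); rewrite ?cos0 ?h// in_itv /= ?x0 ?xpi ?lexx ?(ltW pi0).
have h2 : cos (x - 2 * pi) = 1 by rewrite -(cosD2pi (x - 2 * pi)) mulr_natl subrK.
have : x - 2 * pi = 0; last by lra.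
have : - (x - 2 * pi) = 0; last by move=> ?; lra.
apply: (@cos_inj R); rewrite ?cosN ?cos0 ?h2// in_itv /= ?lexx ?(ltW pi0)//.
by apply/andP; split; lra.
Qed.

Lemma e2pi_eq1 z : e2pi z = 1 -> exists m : int, z = m%:~R.
Proof.
move=> h; have pi0 := pi_gt0 R.
have i0 : im z = 0.
  have := congr1 (@cm R) h; rewrite cm_e2pi cm1 => h'.
  have /eqP := expR_inj (etrans h' (esym (expR0 R))).
  by rewrite oppr_eq0 !mulf_eq0 pnatr_eq0 (gt_eqF pi0) /= => /eqP.
set m := Num.floor (re z).
have hz : z = rc (re z) by apply: c_eq.
set y := re z - m%:~R.
have hy : e2pi (rc y) = 1.
  have rcZ : rc (m%:~R) = m%:~R :> K.
    by case: (m) => n; rewrite ?NegzE ?mulrNz -?pmulrn ?rcN rc_nat.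
  by rewrite rcB -hz e2piB h rcZ e2pi_int divr1.
have y01 : 0 <= y < 1.
  have := lt_succ_floor (re z); rewrite -/m intrD => h1.
  by have := Num.Theory.floor_le (re z); rewrite -/m /y => h2; apply/andP; split; lra.
exists m; rewrite hz; apply: c_eq; rewrite ?re_rc ?im_rc.
  have := congr1 (@re R) hy; rewrite e2piE re_cexp re_2pi im_2pi im_rc re_rc mulr0 oppr0 expR0 mul1r (re_nat R 1).
  move=> /cos_eq1 H; have /H/eqP : 0 <= 2 * pi * y < 2 * pi.
    case/andP: y01 => y0 y1; rewrite mulr_ge0 ?mulr_ge0// ?ltW//=.
    by rewrite gtr_pMr// mulr_gt0.
  rewrite !mulf_eq0 pnatr_eq0 (gt_eqF pi0) /= subr_eq0 => /eqP ->.
  by case: (m) => n; rewrite ?NegzE ?mulrNz -?pmulrn ?reN ?re_nat.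
by case: (m) => n; rewrite ?NegzE ?mulrNz -?pmulrn ?imN ?im_nat ?oppr0.
Qed.

Lemma exp_sum_le (x : R) n : 0 <= x -> \sum_(i < n) x ^+ i / i`!%:R <= expR x.
Proof.
move=> x0; have h := is_cvg_series_exp_coeff x.
have : series (exp_coeff x) n <= expR x.
  apply: nondecreasing_cvgn_le => //; apply/nondecreasing_seqP => k.
  by rewrite /series /= big_nat_recr//= lerDl /exp_coeff /= divr_ge0 ?exprn_ge0.
by rewrite /series /= big_mkord.
Qed.

Lemma cexp_taylor z : cm (cexp z - 1 - z) <= cm z ^+ 2 * expR (cm z).
Proof.
have h := csums_exp z.
have h1 : csums (fun n => z ^+ n.+1 / n.+1`!%:R) (cexp z - 1).
  by apply/(csumsS (fun n => z ^+ n / n`!%:R)); rewrite expr0 fact0 divr1 addrC subrK.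
have h2 : csums (fun n => z ^+ n.+2 / n.+2`!%:R) (cexp z - 1 - z).
  by apply/(csumsS (fun n => z ^+ n.+1 / n.+1`!%:R)); rewrite expr1 divr1 addrC subrK.
apply: (csums_cm h2 (M := fun n => cm z ^+ 2 * (cm z ^+ n / n`!%:R))).
  move=> n; rewrite cmM cmX cmV cm_nat -addn2 exprD mulrAC -[leLHS]mulrA mulrC.
  rewrite -mulrA mulrC [leRHS]mulrA ler_wpM2l ?mulr_ge0 ?exprn_ge0 ?cm_ge0//.
  by rewrite lef_pV2 ?posrE ?ltr0n ?fact_gt0// ler_nat addn2 !factS mulnA leq_pmull// muln_gt0.
move=> n; rewrite -mulr_sumr ler_wpM2l ?exprn_ge0 ?cm_ge0//.
exact: exp_sum_le (cm_ge0 _).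
Qed.

(** From exp(- 1/2) > 1 - 1/2, which gives exp(1/2) < 2. *)
Lemma expR1_lt4 : expR 1 < 4 :> R.
Proof.
have h : expR (1 / 2) <= 2 :> R.
  rewrite -[expR _]invrK -expRN -[leRHS]invrK lef_pV2 ?posrE ?invr_gt0 ?expR_gt0//.
  apply: le_trans (expR_ge1Dx _); lra.
have : (expR (1 / 2) : R) != 2.
  apply/eqP => h2; have := @expR_gt1Dx R (- (1 / 2)) _; rewrite expRN h2 => H.
  have : 1 + - (1 / 2) < 2^-1 :> R by apply: H; rewrite oppr_eq0; apply/eqP; lra.
  by lra.
move=> hn; have {h hn} h : expR (1 / 2) < 2 :> R by rewrite lt_neqAle hn h.
have -> : (1 : R) = 2%:R * (1 / 2) by lra.
rewrite expRM_natl; have h0 := @expR_ge0 R (1 / 2); nra.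
Qed.

Lemma sin_small (x : R) : 0 <= x <= 1 / 8 -> x / 2 <= sin x.
Proof.
move=> /andP[x0 x1].
have := cexp_taylor ('i * rc x).
have cx : cm ('i * rc x : K) = x by rewrite cmM cm_i mul1r cm_rc ger0_norm.
rewrite cx => h.
have := im_cm (cexp ('i * rc x) - 1 - 'i * rc x).
rewrite !imB (im_nat R 1) im_cexp reM imM re_i im_i re_rc im_rc !(mul0r, mulr0, mul1r, subr0, addr0, add0r) expR0 mul1r => h2.
have h3 : expR x <= 4 by apply: le_trans (ltW expR1_lt4); rewrite ler_expR; lra.
have h4 : `|sin x - x| <= x ^+ 2 * expR x by apply: le_trans h2 h.
move: h4; rewrite ler_norml => /andP[h4 _].
have : x ^+ 2 * expR x <= x ^+ 2 * 4 by rewrite ler_wpM2l ?sqr_ge0.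
nra.
Qed.

(** A crude slope suffices. Between 1/8 and 3 pi / 4 the sine is at least 1/16, whereas x < 3 there
    because pi < 4, so that x / 48 < 1/16. *)
Lemma sin_lower (x : R) : 0 <= x <= 3 / 4 * pi -> x / 48 <= sin x.
Proof.
move=> /andP[x0 x1].
have pi4 : pi < 4 by have := pihalf_lt2 R; lra.
have pi2 : 2 <= pi := pi_ge2 R.
have [xs|xs] := leP x (1 / 8).
  have := @sin_small x; rewrite x0 xs => /(_ isT); lra.
have s8 : 1 / 16 <= sin (1 / 8 : R).
  have := @sin_small (1 / 8); rewrite lexx andbT => H.
  have : (0 : R) <= 1 / 8 by lra.
  by move/H; lra.
have mono (y : R) : 1 / 8 <= y <= pi / 2 -> 1 / 16 <= sin y.
  move=> /andP[y1 y2]; apply: le_trans s8 _.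
  have [->//|hn] := eqVneq y (1 / 8).
  apply: ltW; rewrite ltr_sin ?in_itv /=; [|by apply/andP; split; lra|by apply/andP; split; lra].
  by rewrite lt_neqAle eq_sym hn.
suff : 1 / 16 <= sin x by lra.
have [xp|xp] := leP x (pi / 2); first by apply: mono; rewrite xp ltW.
have -> : sin x = sin (pi - x) by rewrite sinB sinpi cospi mul0r sub0r mulN1r opprK.
by apply: mono; apply/andP; split; lra.
Qed.

Lemma cm2_1Be2pi u : cm (1 - e2pi u) ^+ 2 =
  (1 - expR (- (2 * pi * im u))) ^+ 2 + 4 * expR (- (2 * pi * im u)) * sin (pi * re u) ^+ 2.
Proof.
rewrite cm2 reB imB (re_nat R 1) (im_nat R 1) e2piE re_cexp im_cexp re_2pi im_2pi.
set p := expR _.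
have -> : 2 * pi * re u = (pi * re u) *+ 2 by rewrite -mulr_natl; ring.
rewrite cos_mulr2n sin_mulr2n cos2sin2.
have := cos2sin2 (pi * re u).
set c := cos _; set s := sin _; rewrite !mulr2n => hc.
have -> : (0 - p * (c * s + c * s)) ^+ 2 = 4 * p ^+ 2 * (c ^+ 2) * s ^+ 2 by ring.
by rewrite hc; ring.
Qed.

(** In this range 0 is the only zero of 1 - e2pi u. The width 3/4 is 1/2 for the residues modulo N
    plus a margin of 1/4 that absorbs the shift by z in [tors_lower]. *)
Lemma e2pi_lower : exists2 c : R, 0 < c & forall u, `|re u| <= 3 / 4 -> 0 <= im u <= 1 ->
  c * cm u <= cm (1 - e2pi u).
Proof.
have pi0 := pi_gt0 R; have pi4 : pi < 4 by have := pihalf_lt2 R; lra.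
have pi2 : 2 <= pi := pi_ge2 R.
set r0 := expR (- (2 * pi)) : R; have r00 : 0 < r0 by exact: expR_gt0.
exists (Num.min (1 / 16) (r0 / 48)); first by rewrite lt_min !divr_gt0.
move=> u hx /andP[y0 y1].
set d := Num.min _ _.
have d0 : 0 <= d by rewrite le_min !divr_ge0// ltW.
have d1 : d <= 1 / 16 by rewrite ge_min lexx.
have d2 : d <= r0 / 48 by rewrite ge_min lexx orbT.
rewrite -(@ler_pXn2r _ 2%N) ?nnegrE ?cm_ge0 ?mulr_ge0 ?cm_ge0// exprMn cm2 cm2_1Be2pi.
set y := im u; set x := re u.
set r := expR (- (2 * pi * y)).
have r1 : r0 <= r by rewrite ler_expR lerN2 ger_pMr// mulr_gt0.
have hr : r0 <= 1 by rewrite expR_le1; lra.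
have A : (1 / 16 * y) ^+ 2 <= (1 - r) ^+ 2.
  suff : 1 / 16 * y <= 1 - r.
    have : 0 <= 1 / 16 * y by rewrite mulr_ge0.
    by set a := 1 / 16 * y; nra.
  have h : r * (1 + 2 * pi * y) <= 1.
    have h1 := expR_ge1Dx (2 * pi * y).
    have h2 : r * expR (2 * pi * y) = 1 by rewrite /r expRN mulVf// gt_eqF// expR_gt0.
    by rewrite -[leRHS]h2 ler_wpM2l// expR_ge0.
  have rg : 0 < r := expR_gt0 _.
  have : 0 <= pi * y <= 4 by apply/andP; split; nra.
  rewrite -mulrA in h; set a := pi * y in h * => /andP[a0 a1].
  have ya : 2 * y <= a by rewrite /a; nra.
  have [rh|rh] := leP r (1 / 2); first by lra.
  have : a <= 2 * r * a by nra.
  by move=> ha; lra.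
have B : (r0 / 48 * x) ^+ 2 <= 4 * r * sin (pi * x) ^+ 2.
  have hs : (x / 48) ^+ 2 <= sin (pi * x) ^+ 2.
    have h (z : R) : 0 <= z <= 3 / 4 -> (z / 48) ^+ 2 <= sin (pi * z) ^+ 2.
      move=> /andP[z0 z1]; have := @sin_lower (pi * z).
      have -> : 0 <= pi * z <= 3 / 4 * pi by apply/andP; split; nra.
      move=> /(_ isT) h.
      have h1 : z / 48 <= sin (pi * z) by apply: le_trans h; nra.
      have : 0 <= z / 48 by lra.
      by set a := z / 48 in h1 *; nra.
    have [x0|x0] := leP 0 x; first by apply: h; rewrite x0 -(ger0_norm x0).
    have := h (- x); rewrite mulrN sinN !sqrrN mulNr sqrrN => /(_ _); apply.
    by rewrite oppr_ge0 ltW//= -(ltr0_norm x0).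
  have -> : (r0 / 48 * x) ^+ 2 = r0 ^+ 2 * (x / 48) ^+ 2 by ring.
  apply: ler_pM => //; rewrite ?sqr_ge0//; nra.
have sqm (p q z : R) : 0 <= p -> p <= q -> (p * z) ^+ 2 <= (q * z) ^+ 2.
  by move=> p0 pq; rewrite !exprMn ler_wpM2r ?sqr_ge0// ler_pXn2r ?nnegrE// (le_trans p0).
rewrite mulrDr -!exprMn addrC lerD//; first exact: le_trans (sqm _ _ _ d0 d1) A.
exact: le_trans (sqm _ _ _ d0 d2) B.
Qed.

End E2pi.

(** * Partial fractions of the cotangent and of the squared cosecant *)

Section PartialFractions.
Variable R : realType.
Local Notation K := (C R).
Local Notation pi := (pi : R).
Implicit Types (z t u : K).

Lemma rbnd_inv2 : rbnd (fun k => (k.+1%:R ^+ 2)^-1 : R).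
Proof.
apply: rbndS => [k|]; first by rewrite invr_ge0 sqr_ge0.
split; first by move=> n; rewrite invr_ge0 sqr_ge0.
(* The terms 1 / (k + 2) ^ 2 are compared with the telescoping 1 / (k + 1) - 1 / (k + 2). *)
exists 1 => n; apply: (@le_trans _ _ (1 - n.+1%:R^-1)); last by rewrite lerBlDr lerDl invr_ge0.
elim: n => [|n IH]; first by rewrite big_ord0 invr1; lra.
rewrite big_ord_recr /=; apply: le_trans (lerD IH (lexx _)) _.
have h0 : 0 < n.+1%:R :> R by rewrite ltr0n.
rewrite -[n.+2%:R]natr1; set x := n.+1%:R in h0 *.
rewrite -subr_ge0.
have -> : 1 - (x + 1)^-1 - (1 - x^-1 + ((x + 1) ^+ 2)^-1) = (x * (x + 1) ^+ 2)^-1.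
  by field; rewrite !gt_eqF//; lra.
by rewrite invr_ge0 mulr_ge0 ?sqr_ge0 ?ltW.
Qed.

Lemma ctends_natV : ctends (fun n => (n.+1%:R : K)^-1) 0.
Proof.
apply: (ctends_le (N := 0)) (@cvg_harmonic R) => n _.
by rewrite subr0 cmV cm_nat.
Qed.

Lemma ctends_e2pi u : ctends (fun n => n.+1%:R * (e2pi (u / n.+1%:R) - 1)) (2 * rc pi * 'i * u).
Proof.
set v := 2 * rc pi * 'i * u.
have h0 : ((fun n => cm v ^+ 2 * expR (cm v) * n.+1%:R^-1) : nat -> R) @ \oo --> (0 : R).
  by apply: cvg0M; exact: cvg_harmonic.
apply: (ctends_le (N := 0)) h0 => n _.
have n0' : 0 < n.+1%:R :> R by rewrite ltr0n.
have -> : e2pi (u / n.+1%:R) = cexp (v / n.+1%:R) by rewrite e2piE mulrA.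
have -> : n.+1%:R * (cexp (v / n.+1%:R) - 1) - v = n.+1%:R * (cexp (v / n.+1%:R) - 1 - v / n.+1%:R) by field.
rewrite cmM cm_nat; apply: le_trans (ler_wpM2l (ltW n0') (cexp_taylor _)) _.
rewrite cmM cmV cm_nat.
have -> : n.+1%:R * ((cm v / n.+1%:R) ^+ 2 * expR (cm v / n.+1%:R)) = cm v ^+ 2 / n.+1%:R * expR (cm v / n.+1%:R).
  by field; rewrite gt_eqF.
rewrite mulrAC ler_wpM2r ?invr_ge0// ler_wpM2l ?sqr_ge0// ler_expR ler_pdivrMr// ler_peMr ?cm_ge0//.
by rewrite ler1n.
Qed.

Lemma ctends_e2pi1 u : ctends (fun n => e2pi (u / n.+1%:R)) 1.
Proof.
have := ctendsD (ctendsM ctends_natV (ctends_e2pi u)) (ctends_cst 1).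
rewrite mul0r add0r; apply: (ctends_eq (N := 0%N)) => n _.
by field.
Qed.

Lemma sum_root_unity (N j : nat) : (0 < N)%N ->
  \sum_(k < N) e2pi (j%:R / N%:R : K) ^+ k = if (N %| j)%N then N%:R else 0.
Proof.
move=> N0; have nz : (N%:R : K) != 0 by rewrite pnatr_eq0 -lt0n.
case: ifP => [/dvdnP[m ->]|hj].
  rewrite natrM mulfK// e2pi_nat; under eq_bigr do rewrite expr1n.
  by rewrite sumr_const card_ord.
set y := e2pi _.
have yN : y ^+ N = 1 by rewrite /y -e2piMn mulrCA mulfV// mulr1 e2pi_nat.
have y1 : y - 1 != 0.
  rewrite subr_eq0; apply/eqP => /e2pi_eq1[m hm]; move/negbT: hj => /negP; apply.
  have : (j%:R : K) = (m * N%:Z)%:~R by rewrite intrM -hm mulfVK.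
  rewrite pmulrn => /intr_inj hj; apply/dvdnP; exists `|m|%N.
  by lia.
by apply: (mulfI y1); rewrite mulr0 -subrX1 yN subrr.
Qed.

(* The sums of 1 / (1 - y) and y / (1 - y) ^ 2 over the N-th roots y of e2pi z are
   elementary; as N grows they tend termwise to the partial fractions of the
   cotangent and of the squared cosecant. *)
Section Torsion.
Variables (z : K) (n : nat).
Hypothesis hz : e2pi z != 1.
Local Notation N := (n.+1).
Let y k := e2pi ((z + k%:R) / N%:R).

Lemma tors_pow k : y k ^+ N = e2pi z.
Proof.
rewrite /y -e2piMn mulrCA mulfV ?pnatr_eq0// mulr1 e2piD e2pi_nat mulr1 //.
Qed.

Lemma tors_neq1 k : 1 - y k != 0.
Proof.
rewrite subr_eq0; apply: contra hz => /eqP h.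
by rewrite -(tors_pow k) -h expr1n.
Qed.

(** It makes 1 / (1 - y) a polynomial in y; a sum over the roots then sees only the exponents
    divisible by N ([tors_monom]). *)
Lemma tors_inv k : (1 - y k)^-1 = (\sum_(j < N) y k ^+ j) / (1 - e2pi z).
Proof.
have h1 := tors_neq1 k.
have h2 : 1 - e2pi z != 0 by rewrite subr_eq0 eq_sym.
apply: (mulfI h1); rewrite mulfV// mulrA.
have -> : (1 - y k) * \sum_(j < N) y k ^+ j = 1 - e2pi z.
  by rewrite -(tors_pow k) -opprB mulNr -subrX1 opprB.
by rewrite mulfV.
Qed.

Lemma tors_monom j : \sum_(k < N) y k ^+ j = if (N %| j)%N then N%:R * e2pi (z / N%:R) ^+ j else 0.
Proof.
have -> : \sum_(k < N) y k ^+ j = e2pi (z / N%:R) ^+ j * \sum_(k < N) e2pi (j%:R / N%:R : K) ^+ k.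
  rewrite mulr_sumr; apply: eq_bigr => k _; rewrite /y mulrDl e2piD exprMn; congr (_ * _).
  by rewrite -!e2piMn; congr e2pi; ring.
by rewrite sum_root_unity//; case: ifP; rewrite ?mulr0// mulrC.
Qed.

Lemma tors_sum1 : \sum_(k < N) (1 - y k)^-1 = N%:R / (1 - e2pi z).
Proof.
under eq_bigr do rewrite tors_inv.
rewrite -mulr_suml exchange_big /= big_ord_recl tors_monom dvdn0 expr0 mulr1 big1 ?addr0// => j _.
by rewrite tors_monom ifF//; apply/negbTE; rewrite gtnNdvd.
Qed.

Lemma tors_sum2 : \sum_(k < N) y k / (1 - y k) ^+ 2 = N%:R ^+ 2 * e2pi z / (1 - e2pi z) ^+ 2.
Proof.
have -> : \sum_(k < N) y k / (1 - y k) ^+ 2 =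
   (\sum_(k < N) \sum_(i < N) \sum_(j < N) y k ^+ (i + j).+1) / (1 - e2pi z) ^+ 2.
  rewrite mulr_suml; apply: eq_bigr => k _.
  rewrite -exprVn tors_inv exprMn exprVn mulrA; congr (_ / _).
  rewrite expr2 mulr_suml mulr_sumr; apply: eq_bigr => i _.
  by rewrite !mulr_sumr; apply: eq_bigr => j _; rewrite exprS exprD.
congr (_ / _); rewrite exchange_big /=.
have -> : N%:R ^+ 2 * e2pi z = \sum_(i < N) N%:R * e2pi z.
  by rewrite sumr_const card_ord -[RHS]mulr_natl expr2 mulrA.
apply: eq_bigr => i _; rewrite exchange_big /=.
(* The exponent i + j + 1 lies between 1 and 2 N - 1, so it is a multiple of N only for j = N - 1 -
   i. *)
rewrite (bigD1 (rev_ord i)) //= [X in _ + X]big1 ?addr0.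
  have e : (i + (N - i.+1)).+1 = N by rewrite -addSn subnKC.
  rewrite tors_monom e dvdnn -e2piMn mulrCA mulfV ?pnatr_eq0// mulr1 //.
move=> j hj; rewrite tors_monom ifF//; apply/negbTE/negP => /dvdnP[m hm].
have hi := ltn_ord i; have hjn := ltn_ord j.
have m1 : m = 1%N by nia.
by case/eqP: hj; apply: val_inj => /=; lia.
Qed.

End Torsion.

(** The residues modulo 2 n + 1 are grouped as 0 and the pairs m + 1, - (m + 1), the symmetric order
    in which the partial fractions converge. *)
Lemma sum_sym (n : nat) (F : nat -> K) :
  \sum_(k < n.*2.+1) F k = F 0%N + \sum_(m < n) (F m.+1 + F (n.*2 - m)%N).
Proof.
rewrite big_ord_recl big_split /=; congr (_ + _).
rewrite -addnn big_split_ord /=; congr (_ + _).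
rewrite (reindex_inj rev_ord_inj) /=; apply: eq_bigr => i _.
by congr F; rewrite /bump /=; have := ltn_ord i; lia.
Qed.

Lemma e2pi_shift z n m : (m < n.*2.+1)%N ->
  e2pi ((z + (n.*2 - m)%:R) / n.*2.+1%:R) = e2pi ((z - m.+1%:R) / n.*2.+1%:R).
Proof.
move=> hm; have -> : (z + (n.*2 - m)%:R) / n.*2.+1%:R = (z - m.+1%:R) / n.*2.+1%:R + 1.
  by rewrite natrB// -!natr1; field; rewrite natr1.
by rewrite e2piD e2pi1 mulr1.
Qed.

Section Limits.
Variables (z : K) (d : R).
Hypotheses (d0 : 0 < d) (iz : 0 <= im z)
  (hd : forall k : nat, d <= cm (z + k%:R) /\ d <= cm (z - k%:R)).

Let zk (k : nat) : z + k%:R != 0.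
Proof. by rewrite -cm_gt0 (lt_le_trans d0)//; have [] := hd k. Qed.

Let zkB (k : nat) : z - k%:R != 0.
Proof. by rewrite -cm_gt0 (lt_le_trans d0)//; have [] := hd k. Qed.

Lemma sep_e2pi : e2pi z != 1.
Proof.
apply/eqP => /e2pi_eq1[[m|m] hm].
  by have := zkB m; rewrite hm -pmulrn subrr eqxx.
by have := zk m.+1; rewrite hm NegzE mulrNz -pmulrn addNr eqxx.
Qed.

Lemma sep_linear : exists2 c : R, 0 < c &
  forall k : nat, c * k%:R <= cm (z + k%:R) /\ c * k%:R <= cm (z - k%:R).
Proof.
have zd : 0 < cm z + d by rewrite ltr_wpDl ?cm_ge0.
exists (d / (cm z + d)); first by rewrite divr_gt0.
have key (k x : R) : 0 <= k -> d <= x -> k - cm z <= x -> d / (cm z + d) * k <= x.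
  move=> k0 h1 h2; rewrite mulrAC ler_pdivrMr//.
  have z0 := cm_ge0 z; have [kz|kz] := leP k (cm z + d).
    by apply: le_trans (ler_wpM2l (ltW d0) kz) _; rewrite ler_pM2r.
  have : (k - cm z) * (cm z + d) <= x * (cm z + d) by rewrite ler_pM2r.
  nra.
move=> k; split; apply: key => //; try by have [] := hd k.
  have := cmB (z + k%:R) z; rewrite addrAC subrr add0r cm_nat; lra.
have := cmB z (z - k%:R); rewrite opprB addrC subrK cm_nat; lra.
Qed.

Lemma tors_lower : exists2 c : R, 0 < c & exists N0, forall n m : nat, (N0 <= n)%N -> (m <= n)%N ->
  c * m%:R <= n.*2.+1%:R * cm (1 - e2pi ((z + m%:R) / n.*2.+1%:R)) /\
  c * m%:R <= n.*2.+1%:R * cm (1 - e2pi ((z - m%:R) / n.*2.+1%:R)).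
Proof.
have [c1 c10 h1] := e2pi_lower R; have [c2 c20 h2] := sep_linear.
exists (c1 * c2); first exact: mulr_gt0.
have [N0 hN0] : exists N0 : nat, cm z <= N0%:R / 4.
  have := archi_boundP (mulr_ge0 (ler0n R 4) (cm_ge0 z)).
  by exists (Num.bound (4 * cm z)); lra.
exists N0 => n m hn hm; set N := n.*2.+1.
have Np : 0 < N%:R :> R by rewrite ltr0n.
have hN : cm z <= N%:R / 4.
  by apply: le_trans hN0 _; rewrite ler_pM2r ?invr_gt0// ler_nat /N; lia.
have hm2 : 2 * m%:R <= N%:R :> R by rewrite -natrM ler_nat /N; lia.
have key (u : K) : `|re u| <= cm z + m%:R -> im u = im z -> c2 * m%:R <= cm u ->
    c1 * c2 * m%:R <= N%:R * cm (1 - e2pi (u / N%:R)).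
  move=> hu hi hc; apply: (@le_trans _ _ (N%:R * (c1 * cm (u / N%:R)))).
    have -> : N%:R * (c1 * cm (u / N%:R)) = c1 * cm u by rewrite cmM cmV cm_nat; field; rewrite gt_eqF.
    by rewrite -mulrA ler_wpM2l// ltW.
  apply: ler_wpM2l; first exact: ltW.
  apply: h1.
    rewrite re_divn normrM [`|N%:R^-1|]ger0_norm ?invr_ge0// ler_pdivrMr//.
    by apply: le_trans hu _; lra.
  rewrite im_divn hi divr_ge0//= ler_pdivrMr// mul1r.
  have := im_cm z; have := ler_norm (im z); lra.
have [k1 k2] := h2 m; split; apply: key => //.
- rewrite reD re_nat (le_trans (ler_normD _ _))// lerD ?re_cm// ger0_norm//.
- by rewrite imD im_nat addr0.
- rewrite reB re_nat (le_trans (ler_normB _ _))// lerD ?re_cm// ger0_norm//.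
- by rewrite imB im_nat subr0.
Qed.

Lemma ctends_dbl (u : nat -> K) l : ctends u l -> ctends (fun n => u n.*2) l.
Proof. by apply: ctends_sub => n; rewrite -addnn leq_addr. Qed.

Lemma ct_limit u : u != 0 -> ctends (fun n => rc pi * 'i / n.+1%:R *
   ((e2pi (u / n.+1%:R) + 1) / (e2pi (u / n.+1%:R) - 1))) u^-1.
Proof.
move=> u0.
have pi0 : rc pi != 0 by rewrite -cm_gt0 cm_rc normr_gt0 gt_eqF// pi_gt0.
have i0 : ('i : K) != 0 by exact: neq0Ci.
have v0 : 2 * rc pi * 'i * u != 0 by rewrite !mulf_neq0// pnatr_eq0.
have := ctendsMl (rc pi * 'i) (ctendsM (ctendsD (ctends_e2pi1 u) (ctends_cst 1)) (ctendsV v0 (ctends_e2pi u))).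
have -> : rc pi * 'i * ((1 + 1) * (2 * rc pi * 'i * u)^-1) = u^-1.
  by move: pi0; move: (rc pi) => P P0; cfield.
apply: (ctends_eq (N := 0%N)) => n _; set e := e2pi _.
by rewrite invfM; ring.
Qed.

Lemma csc_limit u : u != 0 -> ctends (fun n => - (2 * rc pi) ^+ 2 / n.+1%:R ^+ 2 *
   (e2pi (u / n.+1%:R) / (1 - e2pi (u / n.+1%:R)) ^+ 2)) (u ^+ 2)^-1.
Proof.
move=> u0.
have pi0 : rc pi != 0 by rewrite -cm_gt0 cm_rc normr_gt0 gt_eqF// pi_gt0.
have i0 : ('i : K) != 0 by exact: neq0Ci.
have i2 : ('i : K) ^+ 2 = -1 by rewrite sqrCi.
have v0 : 2 * rc pi * 'i * u != 0 by rewrite !mulf_neq0// pnatr_eq0.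
have := ctendsMl (- (2 * rc pi) ^+ 2) (ctendsM (ctends_e2pi1 u) (ctendsX 2 (ctendsV v0 (ctends_e2pi u)))).
have -> : - (2 * rc pi) ^+ 2 * (1 * (2 * rc pi * 'i * u)^-1 ^+ 2) = (u ^+ 2)^-1.
  rewrite mul1r exprVn !exprMn i2; move: pi0; move: (rc pi) => P P0; cfield.
apply: (ctends_eq (N := 0%N)) => n _; set e := e2pi _.
by rewrite mulf_div -[_ ^+ 2 * (1 - e) ^+ 2]exprMn exprVn -[1 - e]opprB mulrN sqrrN mulrA.
Qed.

(** The right-hand side is pi cot(pi z) - 1 / z. It arises from the torsion sums by [tannery], with
    the terms of index m and - m taken together. *)
Lemma csums_cot : csums (fun m => (z + m.+1%:R)^-1 + (z - m.+1%:R)^-1)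
  (rc pi * 'i * ((e2pi z + 1) / (e2pi z - 1)) - z^-1).
Proof.
have [c c0 [N0 hN0]] := tors_lower; have he := sep_e2pi.
have z0 : z != 0 by have := zk 0; rewrite addr0.
set S := _ - z^-1.
have [B B0 hB] := ctends_bnd (ctends_e2pi (2 * z)).
pose ct u n := rc pi * 'i / n.*2.+1%:R * ((e2pi (u / n.*2.+1%:R) + 1) / (e2pi (u / n.*2.+1%:R) - 1)).
pose U n m := if (m < n)%N then ct (z + m.+1%:R) n + ct (z - m.+1%:R) n else 0.
pose M m := 2 * pi * B / c ^+ 2 * (m.+1%:R ^+ 2)^-1.
have pip := pi_gt0 R.
have hM : rbnd M by apply: rbndM rbnd_inv2; rewrite !mulr_ge0 ?invr_ge0 ?sqr_ge0// ltW.
have hU n m : (N0 <= n)%N -> cm (U n m) <= M m.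
  move=> hn; rewrite /U; case: ifP => hm; last by rewrite cm0 hM.1.
  have [l1 l2] := hN0 n m.+1 hn hm.
  rewrite /ct; set a := e2pi ((z + _) / _) in l1 *; set b := e2pi ((z - _) / _) in l2 *.
  have Np : 0 < n.*2.+1%:R :> R by rewrite ltr0n.
  have cm1p : 0 < c * m.+1%:R by rewrite mulr_gt0// ltr0n.
  have a1 : a - 1 != 0.
    rewrite -cm_gt0 cmC -(pmulr_rgt0 _ Np); exact: lt_le_trans l1.
  have b1 : b - 1 != 0.
    rewrite -cm_gt0 cmC -(pmulr_rgt0 _ Np); exact: lt_le_trans l2.
  have NK : (n.*2.+1%:R : K) != 0 by rewrite pnatr_eq0.
  have hab : a * b = e2pi (2 * z / n.*2.+1%:R) by rewrite -e2piD; congr e2pi; field.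
  (* The product a b = e2pi (2 z / N) does not depend on m, and N (a b - 1) is bounded. Pairing thus
     leaves two denominators of size m, which is summable. *)
  have -> : rc pi * 'i / n.*2.+1%:R * ((a + 1) / (a - 1)) + rc pi * 'i / n.*2.+1%:R * ((b + 1) / (b - 1)) =
    2 * rc pi * 'i * (n.*2.+1%:R * (a * b - 1)) / (n.*2.+1%:R * (1 - a) * (n.*2.+1%:R * (1 - b))).
    have a2 : 1 - a != 0 by rewrite -opprB oppr_eq0.
    have b2 : 1 - b != 0 by rewrite -opprB oppr_eq0.
    by cfield.
  rewrite !cmM cmV !cmM hab cm_i !cm_nat cm_rc (ger0_norm (ltW pip)) mulr1.
  have -> : M m = 2 * pi * B / (c * m.+1%:R * (c * m.+1%:R)).
    rewrite /M; have x0 : m.+1%:R != 0 :> R by rewrite pnatr_eq0.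
    have c0' : c != 0 by rewrite gt_eqF.
    by move: x0; move: (m.+1%:R) => x x0; cfield.
  have hBn := hB n.*2; rewrite cmM cm_nat in hBn.
  apply: ler_pM; rewrite ?invr_ge0 ?mulr_ge0 ?cm_ge0 ?(ltW pip)//.
    by rewrite ler_wpM2l// mulr_ge0 ?(ltW pip).
  rewrite lef_pV2 ?posrE; last 2 first.
    by apply: mulr_gt0; [apply: lt_le_trans l1| apply: lt_le_trans l2].
    by apply: mulr_gt0.
  by apply: ler_pM => //; rewrite ltW.
have hlim m : ctends (fun n => U n m) ((z + m.+1%:R)^-1 + (z - m.+1%:R)^-1).
  apply: (ctends_eq (N := m.+1) (v := fun n => ct (z + m.+1%:R) n + ct (z - m.+1%:R) n)).
    by move=> n hn; rewrite /U hn.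
  by apply: ctendsD; apply: (ctends_dbl (ct_limit _)).
have hrow n : csums (U n) (rc pi * 'i * ((e2pi z + 1) / (e2pi z - 1)) - ct z n).
  have -> : rc pi * 'i * ((e2pi z + 1) / (e2pi z - 1)) - ct z n = \sum_(m < n) U n m.
    have NK : (n.*2.+1%:R : K) != 0 by rewrite pnatr_eq0.
    have he' : e2pi z - 1 != 0 by rewrite subr_eq0.
    have he2 : 1 - e2pi z != 0 by rewrite subr_eq0 eq_sym.
    have ct1 (k : nat) : (e2pi ((z + k%:R) / n.*2.+1%:R) + 1) / (e2pi ((z + k%:R) / n.*2.+1%:R) - 1) =
        1 - 2 * (1 - e2pi ((z + k%:R) / n.*2.+1%:R))^-1.
      have h := tors_neq1 n.*2 he k; have h' := h.
      rewrite -opprB oppr_eq0 in h'.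
      by cfield.
    have hs : \sum_(k < n.*2.+1) ct (z + k%:R) n = rc pi * 'i * ((e2pi z + 1) / (e2pi z - 1)).
      rewrite /ct; under eq_bigr do rewrite ct1.
      rewrite -mulr_sumr big_split /= sumr_const card_ord sumrN -mulr_sumr (tors_sum1 _ he).
      by cfield.
    rewrite -hs (sum_sym n (fun k => ct (z + k%:R) n)) addr0 addrAC subrr add0r.
    apply: eq_bigr => m _; rewrite /U ltn_ord /ct; congr (_ + _).
    by rewrite e2pi_shift//; have := ltn_ord m; lia.
  by apply: csums_fin => m hm; rewrite /U ltnNge hm.
have [L hL] : exists L, csums (fun m => (z + m.+1%:R)^-1 + (z - m.+1%:R)^-1) L.
  apply: absum_cvg; apply: (absum_le (M := M)) => // m.
  apply: (@ctends_cm R (fun n => U (n + N0)%N m)); first exact/(ctends_shift (fun n => U n m)).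
  by move=> n; apply: hU; rewrite leq_addl.
have := tannery hM (ex_intro _ N0 hU) hlim hrow hL.
have h2 : ctends (fun n => rc pi * 'i * ((e2pi z + 1) / (e2pi z - 1)) - ct z n) S.
  by apply: ctendsB; [exact: ctends_cst | apply: (ctends_dbl (ct_limit z0))].
by move/ctends_uniq => /(_ _ h2) <-.
Qed.

(** The right-hand side is pi ^ 2 / sin(pi z) ^ 2 - 1 / z ^ 2. Each term already decays
    quadratically, so no cancellation within the pairs is involved. *)
Lemma csums_csc : csums (fun m => ((z + m.+1%:R) ^+ 2)^-1 + ((z - m.+1%:R) ^+ 2)^-1)
  (- (2 * rc pi) ^+ 2 * (e2pi z / (1 - e2pi z) ^+ 2) - (z ^+ 2)^-1).
Proof.
have [c c0 [N0 hN0]] := tors_lower; have he := sep_e2pi.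
have z0 : z != 0 by have := zk 0; rewrite addr0.
set S := _ - (z ^+ 2)^-1.
have bE u : 0 <= im u -> cm (e2pi u) <= 1.
  by move=> hu; rewrite cm_e2pi expR_le1 oppr_le0 !mulr_ge0// pi_ge0.
pose ct u n := - (2 * rc pi) ^+ 2 / n.*2.+1%:R ^+ 2 * (e2pi (u / n.*2.+1%:R) / (1 - e2pi (u / n.*2.+1%:R)) ^+ 2).
pose U n m := if (m < n)%N then ct (z + m.+1%:R) n + ct (z - m.+1%:R) n else 0.
pose M m := 2 * (2 * pi) ^+ 2 / c ^+ 2 * (m.+1%:R ^+ 2)^-1.
have pip := pi_gt0 R.
have hM : rbnd M by apply: rbndM rbnd_inv2; rewrite !mulr_ge0 ?invr_ge0 ?sqr_ge0// ltW.
have hU n m : (N0 <= n)%N -> cm (U n m) <= M m.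
  move=> hn; rewrite /U; case: ifP => hm; last by rewrite cm0 hM.1.
  have [l1 l2] := hN0 n m.+1 hn hm.
    have cm1p : 0 < c * m.+1%:R by rewrite mulr_gt0// ltr0n.
  have key u : im u = im z -> c * m.+1%:R <= n.*2.+1%:R * cm (1 - e2pi (u / n.*2.+1%:R)) ->
      cm (ct u n) <= (2 * pi) ^+ 2 / (c * m.+1%:R) ^+ 2.
    move=> hi hl; rewrite /ct; set e := e2pi _ in hl *.
    have ce : cm e <= 1.
      by apply: bE; rewrite im_divn hi divr_ge0.
    have -> : - (2 * rc pi) ^+ 2 / n.*2.+1%:R ^+ 2 * (e / (1 - e) ^+ 2) =
       - ((2 * rc pi) ^+ 2 * (e / (n.*2.+1%:R * (1 - e)) ^+ 2)).
      by rewrite mulf_div -[_ ^+ 2 * (1 - e) ^+ 2]exprMn !mulNr mulrA.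
    rewrite cmN cmM cmX !cmM cm_rc (ger0_norm (ltW pip)) cm_nat ler_wpM2l ?sqr_ge0//.
    rewrite cmV cmX cmM cm_nat -[leRHS]mul1r ler_pM ?cm_ge0 ?invr_ge0 ?sqr_ge0//.
    have hp := lt_le_trans cm1p hl.
    by rewrite lef_pV2 ?posrE ?exprn_gt0// ler_pXn2r// ?nnegrE ltW.
  have -> : M m = (2 * pi) ^+ 2 / (c * m.+1%:R) ^+ 2 + (2 * pi) ^+ 2 / (c * m.+1%:R) ^+ 2.
    rewrite /M; have x0 : m.+1%:R != 0 :> R by rewrite pnatr_eq0.
    have c0' : c != 0 by rewrite gt_eqF.
    by move: x0; move: (m.+1%:R) => x x0; cfield.
  apply: le_trans (cmD _ _) _; apply: lerD; apply: key => //.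
    by rewrite imD im_nat addr0.
  by rewrite imB im_nat subr0.
have hlim m : ctends (fun n => U n m) (((z + m.+1%:R) ^+ 2)^-1 + ((z - m.+1%:R) ^+ 2)^-1).
  apply: (ctends_eq (N := m.+1) (v := fun n => ct (z + m.+1%:R) n + ct (z - m.+1%:R) n)).
    by move=> n hn; rewrite /U hn.
  by apply: ctendsD; apply: (ctends_dbl (csc_limit _)).
have hrow n : csums (U n) (- (2 * rc pi) ^+ 2 * (e2pi z / (1 - e2pi z) ^+ 2) - ct z n).
  have -> : - (2 * rc pi) ^+ 2 * (e2pi z / (1 - e2pi z) ^+ 2) - ct z n = \sum_(m < n) U n m.
        have he2 : 1 - e2pi z != 0 by rewrite subr_eq0 eq_sym.
    have hs : \sum_(k < n.*2.+1) ct (z + k%:R) n = - (2 * rc pi) ^+ 2 * (e2pi z / (1 - e2pi z) ^+ 2).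
      rewrite /ct -mulr_sumr (tors_sum2 _ he).
      by cfield.
    rewrite -hs (sum_sym n (fun k => ct (z + k%:R) n)) addr0 addrAC subrr add0r.
    apply: eq_bigr => m _; rewrite /U ltn_ord /ct; congr (_ + _).
    by rewrite e2pi_shift//; have := ltn_ord m; lia.
  by apply: csums_fin => m hm; rewrite /U ltnNge hm.
have [L hL] : exists L, csums (fun m => ((z + m.+1%:R) ^+ 2)^-1 + ((z - m.+1%:R) ^+ 2)^-1) L.
  apply: absum_cvg; apply: (absum_le (M := M)) => // m.
  apply: (@ctends_cm R (fun n => U (n + N0)%N m)); first exact/(ctends_shift (fun n => U n m)).
  by move=> n; apply: hU; rewrite leq_addl.
have := tannery hM (ex_intro _ N0 hU) hlim hrow hL.
have h2 : ctends (fun n => - (2 * rc pi) ^+ 2 * (e2pi z / (1 - e2pi z) ^+ 2) - ct z n) S.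
  by apply: ctendsB; [exact: ctends_cst | apply: (ctends_dbl (csc_limit z0))].
by move/ctends_uniq => /(_ _ h2) <-.
Qed.

End Limits.
End PartialFractions.

(** * The transformation law of the Eisenstein series of weight two *)

Section EisensteinTwo.
Variable R : realType.
Local Notation K := (C R).
Local Notation pi := (pi : R).
Implicit Types (z t u : K).

Lemma sum_even_odd (n : nat) (F : nat -> K) :
  \sum_(k < n.*2) F k = \sum_(m < n) F m.*2 + \sum_(m < n) F m.*2.+1.
Proof.
elim: n => [|n IH]; first by rewrite !big_ord0 addr0.
by rewrite doubleS !big_ord_recr /= IH; ring.
Qed.

(** The squared cosecant at z = 1/2 gives the sum over odd squares, pi ^ 2 / 8; splitting by parity
    gives ze = od + ze / 4. For this real argument the partial fractions assume a distance to the
    integers rather than a positive imaginary part. *)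
Lemma csums_zeta2 : csums (fun m => (m.+1%:R ^+ 2)^-1 : K) (rc (pi ^+ 2 / 6)).
Proof.
have cmi m : cm ((m.+1%:R ^+ 2)^-1 : K) = (m.+1%:R ^+ 2)^-1 by rewrite cmV cmX cm_nat.
have [ze hz] : exists ze, csums (fun m => (m.+1%:R ^+ 2)^-1 : K) ze.
  apply: absum_cvg; apply: absum_le (rbnd_inv2 R) => m; by rewrite cmi.
have [od ho] : exists od, csums (fun m => (m.*2.+1%:R ^+ 2)^-1 : K) od.
  apply: absum_cvg; apply: absum_le (rbnd_inv2 R) => m.
  rewrite cmV cmX cm_nat lef_pV2 ?posrE ?exprn_gt0// ler_pXn2r ?nnegrE// ler_nat; lia.
have h4 : ze = od + ze * (2 ^+ 2)^-1.
  apply: (ctends_uniq (ctends_sub (f := double) _ hz)); first by move=> n; rewrite -addnn leq_addr.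
  apply: (ctends_eq (N := 0)) (ctendsD ho (csumsMr (2 ^+ 2)^-1 hz)) => n _.
  rewrite (sum_even_odd n (fun m => (m.+1%:R ^+ 2)^-1)); congr (_ + _).
  by apply: eq_bigr => i _; rewrite -invfM -exprMn -natrM; congr ((_%:R ^+ 2)^-1); lia.
have half_r : (2^-1 : K) = rc 2^-1 by rewrite rcV rc_nat.
have hsep (k : nat) : (1 / 2 : R) <= cm (2^-1 + k%:R : K) /\ (1 / 2 : R) <= cm (2^-1 - k%:R : K).
  rewrite half_r -rc_nat -rcD -rcB !cm_rc; split.
    by rewrite ger0_norm ?addr_ge0 ?invr_ge0// ; have := ler0n R k; lra.
  case: k => [|k]; first by rewrite subr0 ger0_norm ?invr_ge0//; lra.
  have k0 := ler0n R k; have e : k.+1%:R = k%:R + 1 :> R by rewrite natr1.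
  by rewrite e distrC ger0_norm; lra.
have := csums_csc (z := 2^-1) (d := 1 / 2) _ _ hsep.
have -> : 0 < 1 / 2 :> R by lra.
have -> : 0 <= im (2^-1 : K) by rewrite half_r im_rc.
move=> /(_ isT isT) h.
have h8 : csums (fun m => ((2^-1 + m.+1%:R) ^+ 2)^-1 + ((2^-1 - m.+1%:R : K) ^+ 2)^-1) (4 * (od - 1) + 4 * od).
  have ho1 : csums (fun m => (m.+1.*2.+1%:R ^+ 2)^-1 : K) (od - 1).
    by apply/(csumsS (fun m => (m.*2.+1%:R ^+ 2)^-1 : K)); rewrite expr1n invr1 addrC subrK.
  apply: csums_ext (csumsD (csumsMl 4 ho1) (csumsMl 4 ho)) => m.
  have e1 : (2^-1 + m.+1%:R : K) = m.+1.*2.+1%:R / 2.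
    have -> : m.+1.*2.+1 = (2 * m + 3)%N by lia.
    by rewrite natrD natrM -[m.+1%:R]natr1; field.
  have e2 : (2^-1 - m.+1%:R : K) = - (m.*2.+1%:R / 2).
    have -> : m.*2.+1 = (2 * m + 1)%N by lia.
    by rewrite natrD natrM -[m.+1%:R]natr1; field.
  have n1 : (m.+1.*2.+1%:R : K) != 0 by rewrite pnatr_eq0.
  have n2 : (m.*2.+1%:R : K) != 0 by rewrite pnatr_eq0.
  rewrite e1 e2 sqrrN; move: n1 n2; move: (m.+1.*2.+1%:R) (m.*2.+1%:R) => x y x0 y0.
  by cfield.
have := csums_uniq h8 h; rewrite e2pi_half => ho8.
have o8 : od * 8 = rc (pi ^+ 2).
  have -> : od * 8 = 4 * (od - 1) + 4 * od + 4 by ring.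
  rewrite ho8 rcX; move: (rc pi) => P; by field.
suff -> : rc (pi ^+ 2 / 6) = ze by [].
have e : ze * 3 = od * 4.
  have -> : ze * 3 = (ze - ze * (2 ^+ 2)^-1) * 4 by field.
  by rewrite {1}h4 addrK.
rewrite rcM rcV -o8 rc_nat.
have -> : od * 8 / 6 = (od * 4) / 3 by field.
by rewrite -e; field.
Qed.

(** This is pi ^ 2 / sin(pi z) ^ 2, the sum of (z + k) ^ -2 over all integers k. *)
Definition csc2 (z : K) : K := - (2 * rc pi) ^+ 2 * (e2pi z / (1 - e2pi z) ^+ 2).

Lemma im_sep z (k : nat) : 0 < im z -> im z <= cm (z + k%:R) /\ im z <= cm (z - k%:R).
Proof.
move=> h; split; [have := im_cm (z + k%:R)|have := im_cm (z - k%:R)].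
  by rewrite imD im_nat addr0 ger0_norm// ltW.
by rewrite imB im_nat subr0 ger0_norm// ltW.
Qed.

Lemma csums_csc_up z : 0 < im z ->
  csums (fun m => ((z + m.+1%:R) ^+ 2)^-1 + ((z - m.+1%:R) ^+ 2)^-1) (csc2 z - (z ^+ 2)^-1).
Proof. by move=> h; apply: (csums_csc (d := im z)) => // [|k]; [exact: ltW|exact: im_sep]. Qed.

Lemma csums_cot_up z : 0 < im z ->
  csums (fun m => (z + m.+1%:R)^-1 + (z - m.+1%:R)^-1)
    (rc pi * 'i * ((e2pi z + 1) / (e2pi z - 1)) - z^-1).
Proof. by move=> h; apply: (csums_cot (d := im z)) => // [|k]; [exact: ltW|exact: im_sep]. Qed.

Lemma up_neq0 z : 0 < im z -> z != 0.
Proof. by move=> h; apply: contraTneq h => ->; rewrite (im_nat R 0) ltxx. Qed.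

Lemma im_negV z : 0 < im z -> 0 < im (- z^-1).
Proof. by move=> h; rewrite imN imV mulNr opprK divr_gt0// exprn_gt0// cm_gt0 up_neq0. Qed.

Lemma sep_real z : 0 < im z -> exists2 c : R, 0 < c & forall r : R, c * `|r| <= cm (z + rc r).
Proof.
move=> hz; have z0 := cm_ge0 z; have zd : 0 < cm z + im z by rewrite ltr_wpDl.
exists (im z / (cm z + im z)); first by rewrite divr_gt0.
move=> r; set x := cm (z + rc r); set k := `|r|.
have h1 : im z <= x.
  by have := im_cm (z + rc r); rewrite imD im_rc addr0 ger0_norm// ltW.
have h2 : k - cm z <= x.
  by have := cmB (z + rc r) z; rewrite addrAC subrr add0r cm_rc -/k -/x; lra.
rewrite mulrAC ler_pdivrMr//.
have [kz|kz] := leP k (cm z + im z).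
  by apply: le_trans (ler_wpM2l (ltW hz) kz) _; rewrite ler_pM2r.
have : (k - cm z) * (cm z + im z) <= x * (cm z + im z) by rewrite ler_pM2r.
nra.
Qed.

(* Eisenstein summation: over the points m t + k (m > 0, k an integer), the terms
   al - be are absolutely summable, so that rows and columns give the same sum.
   The be telescope in k; the rows of be sum to 0, while its columns
   leave the anomaly pi i / t. *)
Section Lattice.
Variable t : K.
Hypothesis ht : 0 < im t.

Let x (m : nat) : K := m.+1%:R * t.
Let al (z : K) : K := (z ^+ 2)^-1.
Let be (z : K) : K := (z - 2^-1)^-1 - (z + 2^-1)^-1.
Let A m k : K := if k is k'.+1 then al (x m + k%:R) + al (x m - k%:R) else al (x m).
Let Bt m k : K := if k is k'.+1 then be (x m + k%:R) + be (x m - k%:R) else be (x m).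

Let imx m : 0 < im (x m).
Proof. by rewrite im_natM mulr_gt0. Qed.

Let xr m (r : R) : x m + rc r != 0.
Proof. by apply: up_neq0; rewrite imD im_rc addr0 imx. Qed.

Let half_rc : (2^-1 : K) = rc 2^-1.
Proof. by rewrite rcV rc_nat. Qed.

(** The difference is - 1/4 divided by z ^ 2 (z ^ 2 - 1/4). The factor z ^ 2 is bounded below by a
    multiple of (k + 1) ^ 2, the other one, through imaginary parts, by a multiple of (m + 1) ^
    2. *)
Lemma lattice_term : exists2 C0 : R, 0 < C0 & forall m (k : nat) (s : R), `|s| = k%:R ->
  cm (al (x m + rc s) - be (x m + rc s)) <= C0 * ((m.+1%:R ^+ 2)^-1 * (k.+1%:R ^+ 2)^-1).
Proof.
have [c c0 hc] := sep_real ht.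
set y := im t; set c1 := Num.min c y / 2.
have mc : Num.min c y <= c by rewrite ge_min lexx.
have my : Num.min c y <= y by rewrite ge_min lexx orbT.
have c10 : 0 < c1 by rewrite divr_gt0// lt_min c0.
exists (4^-1 / (c1 ^+ 2 * y ^+ 2)); first by rewrite divr_gt0// mulr_gt0// exprn_gt0.
move=> m k s hs.
have M1 : 1 <= m.+1%:R :> R by rewrite ler1n.
have M0 : 0 < m.+1%:R :> R by rewrite ltr0n.
have low1 (r : R) : m.+1%:R * y <= cm (x m + rc r).
  have := im_cm (x m + rc r); rewrite imD im_rc addr0 ger0_norm ?(ltW (imx m))//.
  by rewrite im_natM.
have low2 (r : R) : c * `|r| <= cm (x m + rc r).
  have -> : x m + rc r = rc m.+1%:R * (t + rc (r / m.+1%:R)).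
    rewrite mulrDr -rcM rc_nat; congr (_ + rc _).
    by rewrite mulrCA mulfV ?mulr1// gt_eqF.
  rewrite cmM cm_rc (ger0_norm (ltW M0)).
  apply: le_trans (ler_wpM2l (ltW M0) (hc _)).
  by rewrite normrM normfV normr_nat mulrCA [m.+1%:R * _]mulrCA mulfV ?mulr1// gt_eqF.
have low : c1 * k.+1%:R <= cm (x m + rc s).
  have l1 := low1 s; have l2 := low2 s; rewrite hs in l2; rewrite -natr1 /c1.
  have k0 := ler0n R k.
  have : y <= m.+1%:R * y by rewrite ler_peMl// ltW.
  have : Num.min c y * k%:R <= c * k%:R by rewrite ler_wpM2r.
  lra.
have e : al (x m + rc s) - be (x m + rc s) =
  - (4^-1 / ((x m + rc s) ^+ 2 * ((x m + rc (s - 2^-1)) * (x m + rc (s + 2^-1))))).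
  have h0 := xr m s; have h1 := xr m (s - 2^-1); have h2 := xr m (s + 2^-1).
  rewrite /al /be rcB rcD -half_rc !addrA in h1 h2 *.
  have hd : (2^-1 : K) * 2 = 1 by field.
  have -> : (4^-1 : K) = 2^-1 ^+ 2 by field.
  move: h0 h1 h2 hd; move: (x m + rc s) (2^-1 : K) => X d h0 h1 h2 hd.
  have e1 : (X - d)^-1 - (X + d)^-1 = (d * 2) / ((X - d) * (X + d)) by cfield.
  by rewrite e1 hd; cfield.
have c4 : cm (4^-1 : K) = 4^-1 by rewrite cmV cm_nat.
rewrite e cmN cmM c4 cmV cmM cmX (cmM (x m + rc (s - 2^-1))).
have -> : 4^-1 / (c1 ^+ 2 * y ^+ 2) * ((m.+1%:R ^+ 2)^-1 * (k.+1%:R ^+ 2)^-1) =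
   4^-1 / ((c1 * k.+1%:R) ^+ 2 * ((m.+1%:R * y) * (m.+1%:R * y))).
  rewrite -[LHS]mulrA; congr (_ * _); rewrite -!invfM; congr (_^-1); ring.
have q1 : 0 < c1 * k.+1%:R by rewrite mulr_gt0.
have q2 : 0 < m.+1%:R * y by rewrite mulr_gt0.
have l1 := low1 (s - 2^-1); have l2 := low1 (s + 2^-1).
move: low l1 l2 q1 q2; move: (c1 * k.+1%:R) (m.+1%:R * y) (cm (x m + rc s)) => L N X.
move: (cm (x m + rc (s - 2^-1))) (cm (x m + rc (s + 2^-1))) => P Q hL l1 l2 L0 N0.
have X0 := lt_le_trans L0 hL; have P0 := lt_le_trans N0 l1; have Q0 := lt_le_trans N0 l2.
rewrite ler_wpM2l ?invr_ge0// lef_pV2 ?posrE ?mulr_gt0 ?exprn_gt0//.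
apply: ler_pM; [exact: sqr_ge0 | by rewrite mulr_ge0 ?(ltW N0) | |].
  by rewrite ler_pXn2r ?nnegrE ?(ltW L0) ?(ltW X0).
by apply: ler_pM => //; rewrite ltW.
Qed.

Lemma lattice_bound : exists2 C0 : R, 0 < C0 & forall m k,
  cm (A m k - Bt m k) <= C0 * ((m.+1%:R ^+ 2)^-1 * (k.+1%:R ^+ 2)^-1).
Proof.
have [C0 C00 h] := lattice_term.
exists (2 * C0); first by rewrite mulr_gt0.
move=> m [|k] /=.
  have := h m 0%N 0; rewrite normr0 rc0 addr0 => /(_ erefl); set X := _ * (_ * _) => hX.
  have := cm_ge0 (al (x m) - be (x m)); set Y := cm _ in hX *; rewrite -mulrA -/X; lra.
rewrite opprD addrACA.
have := h m k.+1 k.+1%:R (normr_nat _ _); have := h m k.+1 (- k.+1%:R) (etrans (normrN _) (normr_nat _ _)).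
rewrite rcN rc_nat; set X := C0 * _ => h1 h2.
by apply: le_trans (cmD _ _) _; rewrite -mulrA -/X; lra.
Qed.

Lemma row_A m : csums (A m) (csc2 (x m)).
Proof.
have -> : csc2 (x m) = A m 0%N + (csc2 (x m) - al (x m)) by rewrite /= addrC subrK.
apply/csumsS; exact: csums_csc_up (imx m).
Qed.

Lemma telescope_be (X : K) K0 : \sum_(k < K0.+1) (if (k : nat) is k'.+1 then be (X + k%:R) + be (X - k%:R) else be X)
  = (X - (K0%:R + 2^-1))^-1 - (X + (K0%:R + 2^-1))^-1.
Proof.
elim: K0 => [|K0 IH]; first by rewrite big_ord_recr big_ord0 /= /be !add0r.
rewrite big_ord_recr /= IH /be.
have -> : X + K0.+1%:R - 2^-1 = X + (K0%:R + 2^-1) by rewrite -natr1; field.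
have -> : X - K0.+1%:R + 2^-1 = X - (K0%:R + 2^-1) by rewrite -natr1; field.
have -> : X + K0.+1%:R + 2^-1 = X + (K0.+1%:R + 2^-1) by ring.
have -> : X - K0.+1%:R - 2^-1 = X - (K0.+1%:R + 2^-1) by ring.
by ring.
Qed.

Lemma ctends_inv_nat (X : K) (s : bool) : 0 < im X ->
  ctends (fun k : nat => (X + (-1) ^+ s * (k%:R + 2^-1))^-1) 0.
Proof.
move=> hX; have [c c0 hc] := sep_real hX.
have h0 := cvg0M c^-1 (@cvg_harmonic R).
have h1 := cvg0M 2 h0.
apply: (ctends_le (N := 0)) h1 => k _.
have hr : (-1) ^+ s * (k%:R + 2^-1 : K) = rc ((-1) ^+ s * (k%:R + 2^-1)).
  by rewrite rcM rcX rcN rcD rc_nat -half_rc.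
rewrite subr0 hr cmV /=.
have := hc ((-1) ^+ s * (k%:R + 2^-1)); rewrite normrM normrX normrN normr1 expr1n mul1r ger0_norm ?addr_ge0 ?invr_ge0//.
move=> h2.
have k0 := ler0n R k.
have hp : 0 < c * (k%:R + 2^-1) by rewrite mulr_gt0// ltr_wpDl.
have -> : 2 * (c^-1 / k.+1%:R) = (c * (k.+1%:R / 2))^-1.
  rewrite -natr1; field; rewrite gt_eqF//=; apply/negP => /eqP; lra.
rewrite lef_pV2 ?posrE; last 2 first.
- exact: lt_le_trans hp h2.
- by rewrite mulr_gt0// divr_gt0.
apply: le_trans h2; rewrite ler_pM2l// -natr1; lra.
Qed.

Lemma row_B m : csums (Bt m) 0.
Proof.
apply/(ctends_shift (fun n => \sum_(i < n) Bt m i) _ 1).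
have := ctendsB (ctends_inv_nat true (imx m)) (ctends_inv_nat false (imx m)); rewrite subr0.
apply: (ctends_eq (N := 0)) => n _; rewrite addn1 telescope_be expr0 expr1 mul1r.
by rewrite mulN1r.
Qed.

Let zk (k : nat) : K := k%:R * (- t^-1).
Let hk (k : nat) : K := (k%:R + 2^-1) * (- t^-1).

Let imz k : 0 < im (zk k.+1).
Proof. by rewrite im_natM mulr_gt0// im_negV. Qed.

Let imh k : 0 < im (hk k).
Proof.
by rewrite /hk half_rc -rc_nat -rcD im_rcM mulr_gt0 ?im_negV// ltr_wpDl// invr_gt0.
Qed.

Let t0 : t != 0 := up_neq0 ht.

(** Factoring t out of m t + k and m t - k turns the sum over m into the expansion of [csc2] at - k
    / t; the column k = 0 is a value of zeta. *)
Definition colA (k : nat) : K :=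
  if k is k'.+1 then (t ^+ 2)^-1 * (csc2 (zk k) - (zk k ^+ 2)^-1) else (t ^+ 2)^-1 * rc (pi ^+ 2 / 6).

Lemma col_A k : csums (fun m => A m k) (colA k).
Proof.
case: k => [|k] /=.
  apply: csums_ext (csumsMl _ csums_zeta2) => m.
  by rewrite /al /x exprMn [RHS]invfM mulrC.
apply: csums_ext (csumsMl _ (csums_csc_up (imz k))) => m.
rewrite /al /x /zk.
have n1 : k.+1%:R * - t^-1 + m.+1%:R != 0.
  by apply: up_neq0; rewrite imD im_nat addr0 imz.
have n2 : k.+1%:R * - t^-1 - m.+1%:R != 0.
  by apply: up_neq0; rewrite imB im_nat subr0 imz.
have e1 : m.+1%:R * t - k.+1%:R = t * (k.+1%:R * - t^-1 + m.+1%:R) by cfield.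
have e2 : m.+1%:R * t + k.+1%:R = - (t * (k.+1%:R * - t^-1 - m.+1%:R)) by cfield.
by rewrite e1 e2 sqrrN !exprMn !invfM mulrDr addrC.
Qed.

(** The sum of the columns 0 to k of [be]: by [telescope_be] only the ends at distance k + 1/2
    survive, and their sum over m is a cotangent at - (k + 1/2) / t. *)
Definition gB (k : nat) : K := t^-1 * (rc pi * 'i * ((e2pi (hk k) + 1) / (e2pi (hk k) - 1)) - (hk k)^-1).

Lemma col_g k : csums (fun m => (x m - (k%:R + 2^-1))^-1 - (x m + (k%:R + 2^-1))^-1) (gB k).
Proof.
apply: csums_ext (csumsMl _ (csums_cot_up (imh k))) => m.
rewrite /x /hk; set h := _ + 2^-1.
have n1 : h * - t^-1 + m.+1%:R != 0.
  by apply: up_neq0; rewrite imD im_nat addr0 imh.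
have n2 : h * - t^-1 - m.+1%:R != 0.
  by apply: up_neq0; rewrite imB im_nat subr0 imh.
have e1 : m.+1%:R * t - h = t * (h * - t^-1 + m.+1%:R) by cfield.
have e2 : m.+1%:R * t + h = - (t * (h * - t^-1 - m.+1%:R)) by cfield.
by rewrite e1 e2 invrN opprK !invfM mulrDr.
Qed.

Definition colB (k : nat) : K := if k is k'.+1 then gB k - gB k' else gB 0.

Lemma col_B k : csums (fun m => Bt m k) (colB k).
Proof.
have e m : Bt m k = \sum_(j < k.+1) Bt m j - \sum_(j < k) Bt m j.
  by rewrite big_ord_recr /= addrAC subrr add0r.
case: k e => [|k] e.
  apply: csums_ext (col_g 0) => m; rewrite -telescope_be e big_ord0 subr0 //.
apply: csums_ext (csumsB (col_g k.+1) (col_g k)) => m.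
by rewrite -!telescope_be -e.
Qed.

(** The imaginary part of [hk k] grows without bound, so e2pi tends to 0 and pi times the cotangent
    to - pi i. This limit is the anomaly. *)
Lemma gB_lim : ctends gB (- (rc pi * 'i / t)).
Proof.
have imd := im_negV ht; set d := im (- t^-1) in imd.
have q0 : ctends (fun k => e2pi (hk k)) 0.
  have hr : `|expR (- (2 * pi * d))| < 1.
    by rewrite ger0_norm ?expR_ge0// expR_lt1 oppr_lt0 !mulr_gt0// pi_gt0.
  apply: (ctends_le (N := 0)) (cvg_expr hr) => k _.
  rewrite subr0 cm_e2pi -expRM_natl ler_expR /hk half_rc -rc_nat -rcD im_rcM -/d.
  rewrite mulrN lerN2 mulrCA ler_wpM2l ?mulr_ge0 ?pi_ge0//.
  by rewrite ler_wpM2r ?(ltW imd)// lerDl invr_ge0.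
have i0 : ctends (fun k => (hk k)^-1) 0.
  have := ctendsMl (- t) (ctends_sub (f := fun n => n.*2) _ (@ctends_natV R)).
  rewrite mulr0 => h; have {}h := ctendsMl 2 (h _); rewrite mulr0 in h.
  apply: (ctends_eq (N := 0)) (h _) => [k _|n]; last by rewrite -addnn leq_addr.
  have -> : hk k = k.*2.+1%:R * (- (2 * t)^-1).
    have -> : k.*2.+1%:R = k%:R * 2 + 1 :> K by rewrite -natr1 -muln2 natrM.
    by rewrite /hk; cfield.
  by rewrite invfM invrN invrK; ring.
have n1 : 0 - 1 != 0 :> K by rewrite sub0r oppr_eq0 oner_eq0.
have := ctendsMl t^-1 (ctendsB (ctendsMl (rc pi * 'i) (ctendsM (ctendsD q0 (ctends_cst 1)) (ctendsV n1 (ctendsB q0 (ctends_cst 1))))) i0).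
by have -> : t^-1 * (rc pi * 'i * ((0 + 1) * (0 - 1)^-1) - 0) = - (rc pi * 'i / t) by field.
Qed.

(** Here S1 + pi ^ 2 / 6 is pi ^ 2 / 6 times E_2(t): the identity is E_2(- 1 / t) = t ^ 2 E_2(t) + 6
    t / (pi i). *)
Lemma E2_law S1 S2 : csums (fun m => csc2 (m.+1%:R * t)) S1 ->
  csums (fun m => csc2 (m.+1%:R * (- t^-1))) S2 ->
  S1 + rc (pi ^+ 2 / 6) = (t ^+ 2)^-1 * (S2 + rc (pi ^+ 2 / 6)) + rc pi * 'i / t.
Proof.
move=> h1 h2.
have [C0 C00 hC] := lattice_bound.
have [Bz _ hBz] : exists2 B : R, True & forall n, \sum_(k < n) (k.+1%:R ^+ 2)^-1 <= B.
  by have [_ [B hB]] := rbnd_inv2 R; exists B.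
have Bz0 : 0 <= Bz by apply: le_trans (hBz 0%N); rewrite big_ord0.
have hB : rbnd (fun m => C0 * Bz * (m.+1%:R ^+ 2)^-1 : R).
  by apply: rbndM (rbnd_inv2 R); rewrite mulr_ge0// ltW.
have rowD m : csums (fun k => A m k - Bt m k) (csc2 (x m)).
  by rewrite -[csc2 _]subr0; apply: csumsB; [exact: row_A|exact: row_B].
have colD k : csums (fun m => A m k - Bt m k) (colA k - colB k).
  by apply: csumsB; [exact: col_A|exact: col_B].
have hrow m n : \sum_(k < n) C0 * ((m.+1%:R ^+ 2)^-1 * (k.+1%:R ^+ 2)^-1) <= C0 * Bz * (m.+1%:R ^+ 2)^-1.
  rewrite -!mulr_sumr -mulrA ler_wpM2l ?(ltW C00)// mulrC ler_wpM2r ?invr_ge0 ?sqr_ge0//.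
have hcol := csums_exchange hC hrow hB rowD colD h1.
have hcA : csums colA ((t ^+ 2)^-1 * rc (pi ^+ 2 / 6) + ((t ^+ 2)^-1 * S2 - rc (pi ^+ 2 / 6))).
  apply/csumsS; apply: csums_ext (csumsB (csumsMl (t ^+ 2)^-1 h2) csums_zeta2) => k.
  rewrite /colA /zk; have kk : (k.+1%:R : K) != 0 by rewrite pnatr_eq0.
  by move: kk; move: (k.+1%:R) => y y0; cfield.
have hcB : csums colB (- (rc pi * 'i / t)).
  apply/(ctends_shift (fun n => \sum_(i < n) colB i) _ 1).
  apply: (ctends_eq (N := 0)) gB_lim => n _; rewrite addn1.
  elim: n => [|n IH]; first by rewrite big_ord1.
  by rewrite big_ord_recr /= IH addrC subrK.
have := csums_uniq hcol (csumsB hcA hcB); rewrite opprK => ->.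
by ring.
Qed.

End Lattice.
End EisensteinTwo.

(** * Formal power series and series in exp(pi i tau) *)

Section FormalSeries.
Variable R : realType.
Local Notation K := (C R).

Record fps := Fps { cf : nat -> K }.

Lemma fps_ext (a b : fps) : (forall n, cf a n = cf b n) -> a = b.
Proof. by case: a => a; case: b => b /= /funext ->. Qed.

HB.instance Definition _ := gen_eqMixin fps.
HB.instance Definition _ := gen_choiceMixin fps.

Definition fadd (a b : fps) := Fps (fun n => cf a n + cf b n).
Definition fopp (a : fps) := Fps (fun n => - cf a n).
Definition fmul (a b : fps) := Fps (conv (cf a) (cf b)).
Definition fone := Fps (fun n => (n == 0%N)%:R).

Let faddA : associative fadd.
Proof. by move=> a b c; apply: fps_ext => n /=; rewrite addrA. Qed.
Let faddC : commutative fadd.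
Proof. by move=> a b; apply: fps_ext => n /=; rewrite addrC. Qed.
Let fadd0 : left_id (Fps (fun=> 0)) fadd.
Proof. by move=> a; apply: fps_ext => n /=; rewrite add0r. Qed.
Let faddN : left_inverse (Fps (fun=> 0)) fopp fadd.
Proof. by move=> a; apply: fps_ext => n /=; rewrite addNr. Qed.

HB.instance Definition _ := GRing.isZmodule.Build fps faddA faddC fadd0 faddN.

(** Truncations carry commutativity and associativity over from polynomials. *)
Definition ftr (N : nat) (a : fps) : {poly K} := \poly_(i < N) cf a i.

Lemma cf_ftr N a n : (n < N)%N -> (ftr N a)`_n = cf a n.
Proof. by move=> h; rewrite coef_poly h. Qed.

Lemma cf_mul_ftr N a b n : (n < N)%N -> cf (fmul a b) n = (ftr N a * ftr N b)`_n.
Proof.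
move=> h; rewrite coefM /= /conv; apply: eq_bigr => i _.
have hi := ltn_ord i; rewrite !cf_ftr//; first by rewrite (leq_trans _ h) // ltnS leq_subr.
by rewrite (leq_trans hi).
Qed.

Let fmulC : commutative fmul.
Proof. by move=> a b; apply: fps_ext => n; rewrite !(@cf_mul_ftr n.+1)// mulrC. Qed.

Let fmulA : associative fmul.
Proof.
have key a b c n : cf (fmul (fmul a b) c) n = (ftr n.+1 a * ftr n.+1 b * ftr n.+1 c)`_n.
  rewrite coefM /= /conv; apply: eq_bigr => i _; have hi := ltn_ord i.
  by rewrite -(@cf_mul_ftr n.+1)// cf_ftr// ltnS leq_subr.
move=> a b c; apply: fps_ext => n.
by rewrite fmulC !key mulrC mulrA.
Qed.

Let fmul1 : left_id fone fmul.
Proof.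
move=> a; apply: fps_ext => n; rewrite /= /conv big_ord_recl /= subn0 mul1r big1 ?addr0// => i _.
by rewrite mul0r.
Qed.

Let fmulDl : left_distributive fmul fadd.
Proof.
move=> a b c; apply: fps_ext => n /=; rewrite /conv -big_split /=.
by apply: eq_bigr => i _; rewrite mulrDl.
Qed.

Let fone_neq0 : fone != 0.
Proof.
by apply/eqP => /(congr1 (fun a => cf a 0)) /= /eqP; rewrite oner_eq0.
Qed.

HB.instance Definition _ := GRing.Zmodule_isComNzRing.Build fps fmulA fmulC fmul1 fmulDl fone_neq0.

Lemma cfD a b n : cf (a + b) n = cf a n + cf b n. Proof. by []. Qed.
Lemma cfN a n : cf (- a) n = - cf a n. Proof. by []. Qed.
Lemma cfB a b n : cf (a - b) n = cf a n - cf b n. Proof. by []. Qed.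
Lemma cf0 n : cf 0 n = 0. Proof. by []. Qed.
Lemma cf1 n : cf 1 n = (n == 0%N)%:R. Proof. by []. Qed.
Lemma cfM a b n : cf (a * b) n = \sum_(i < n.+1) cf a i * cf b (n - i)%N. Proof. by []. Qed.

Lemma cf_sum (I : Type) (r : seq I) (P : pred I) (F : I -> fps) n :
  cf (\sum_(i <- r | P i) F i) n = \sum_(i <- r | P i) cf (F i) n.
Proof. by elim/big_rec2: _ => // i y x _ <-. Qed.

Lemma cfMn a n m : cf (a *+ m) n = cf a n *+ m.
Proof. by elim: m => // m IH; rewrite !mulrS cfD IH. Qed.

Definition fC (c : K) : fps := Fps (fun n => c *+ (n == 0%N)).
Definition fX : fps := Fps (fun n => (n == 1%N)%:R).

Lemma cf_fC c a n : cf (fC c * a) n = c * cf a n.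
Proof.
rewrite cfM big_ord_recl /= subn0 mulr1n big1 ?addr0// => i _.
by rewrite mulr0n mul0r.
Qed.

Lemma cfM0 a b : cf (a * b) 0 = cf a 0 * cf b 0.
Proof. by rewrite cfM big_ord1. Qed.

Lemma cf_fX a n : cf (fX * a) n = if n is n'.+1 then cf a n' else 0.
Proof.
case: n => [|n]; first by rewrite cfM0 mul0r.
rewrite cfM big_ord_recl /= mul0r add0r big_ord_recl /= mul1r subn1 big1 ?addr0// => i _.
by rewrite mul0r.
Qed.

Lemma cf_fXn k a n : cf (fX ^+ k * a) n = if (k <= n)%N then cf a (n - k) else 0.
Proof.
elim: k n => [|k IH] n; first by rewrite expr0 mul1r subn0.
by rewrite exprS -mulrA cf_fX; case: n => // n; rewrite IH ltnS subSS.
Qed.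

Definition fD (a : fps) : fps := Fps (fun n => n%:R * cf a n).

Lemma fDD a b : fD (a + b) = fD a + fD b.
Proof. by apply: fps_ext => n /=; rewrite mulrDr. Qed.

Lemma fDM a b : fD (a * b) = fD a * b + a * fD b.
Proof.
apply: fps_ext => n; rewrite cfD !cfM /= /conv mulr_sumr -big_split /=.
apply: eq_bigr => i _; rewrite -mulrA [cf a i * (_ * _)]mulrCA -mulrDl.
by rewrite -natrD subnKC// -ltnS.
Qed.

Lemma fD1 : fD 1 = 0.
Proof. by apply: fps_ext => -[|n] /=; rewrite ?mul0r ?mulr0. Qed.

Lemma fDX a k : fD (a ^+ k.+1) = a ^+ k * fD a *+ k.+1.
Proof.
elim: k => [|k IH]; first by rewrite expr1 expr0 mul1r.
rewrite exprS fDM IH -[in RHS]mulr_natr -[in LHS]mulr_natr exprS.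
rewrite -[k.+2]addn1 natrD; ring.
Qed.

(** As g has no constant term, a first order linear equation determines each coefficient from the
    lower ones. Identities between formal exponentials are proved this way. *)
Lemma fD_uniq g a b : cf g 0 = 0 -> fD a = g * a -> fD b = g * b -> cf a 0 = cf b 0 -> a = b.
Proof.
move=> g0 ha hb h0; apply: fps_ext => n.
elim/ltn_ind: n => -[//|n] IH.
have n0 : (n.+1%:R : K) != 0 by rewrite pnatr_eq0.
apply: (mulfI n0).
have := congr1 (fun s => cf s n.+1) ha; have := congr1 (fun s => cf s n.+1) hb.
rewrite /= /conv => -> ->; rewrite big_ord_recl [in RHS]big_ord_recl /= g0 !mul0r !add0r.
apply: eq_bigr => i _; congr (_ * _); rewrite IH//.
by rewrite /bump /=; have := ltn_ord i; lia.
Qed.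

Lemma cfX_lt a k n : cf a 0 = 0 -> (n < k)%N -> cf (a ^+ k) n = 0.
Proof.
move=> a0; elim: k n => // k IH n hn; rewrite exprS cfM.
apply: big1 => -[[|i] /= hi] _; first by rewrite a0 mul0r.
by rewrite IH ?mulr0//; lia.
Qed.

(** If a has no constant term, a ^ k starts at order k, so the coefficient of order n involves only
    k <= n. This is the only case in which the definition is meaningful. *)
Definition fexp (a : fps) : fps := Fps (fun n => \sum_(k < n.+1) cf (a ^+ k) n / k`!%:R).

Lemma cf_fexp a n N : cf a 0 = 0 -> (n < N)%N -> cf (fexp a) n = \sum_(k < N) cf (a ^+ k) n / k`!%:R.
Proof.
move=> a0 hN; rewrite /= -(subnKC hN) big_split_ord /= [X in _ = _ + X]big1 ?addr0// => i _.
by rewrite cfX_lt ?mul0r// leq_addr.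
Qed.

Lemma cf_fexp0 a : cf (fexp a) 0 = 1.
Proof. by rewrite /= big_ord1 expr0 fact0 divr1. Qed.

Lemma fD_fexp a : cf a 0 = 0 -> fD (fexp a) = fD a * fexp a.
Proof.
move=> a0; apply: fps_ext => n; rewrite mulrC cfM.
have -> : cf (fD (fexp a)) n = \sum_(k < n.+1) cf (a ^+ k * fD a) n / k`!%:R.
  have -> : cf (fD (fexp a)) n = n%:R * \sum_(k < n.+2) cf (a ^+ k) n / k`!%:R.
    by rewrite -(@cf_fexp a n n.+2 a0 (leqnSn _)).
  rewrite big_ord_recl expr0 cf1 fact0 divr1 mulrDr.
  have -> : n%:R * (n == 0%N)%:R = 0 :> K by case: (n) => [|?]; rewrite ?mul0r ?mulr0.
  rewrite add0r mulr_sumr; apply: eq_bigr => k _.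
  have k0 : (k.+1%:R : K) != 0 by rewrite pnatr_eq0.
  have kf0 : (k`!%:R : K) != 0 by rewrite pnatr_eq0 -lt0n fact_gt0.
  rewrite lift0 mulrA.
  have -> : n%:R * cf (a ^+ k.+1) n = cf (a ^+ k * fD a) n * k.+1%:R.
    by rewrite mulr_natr -cfMn -fDX.
  rewrite factS natrM; move: k0 kf0; move: (k.+1%:R) => x x0 y0.
  by cfield.
under eq_bigr do rewrite cfM mulr_suml.
rewrite exchange_big /=; apply: eq_bigr => i _.
rewrite -[\sum_(k < i.+1) _]/(cf (fexp a) i) (@cf_fexp a i n.+1)// mulr_suml; apply: eq_bigr => k _.
by rewrite mulrAC.
Qed.

End FormalSeries.

Arguments fX {R}.

(** * Functions on the upper half plane given by power series in w = exp(pi i t) *)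

Section PowerSeries.
Variable R : realType.
Local Notation K := (C R).
Local Notation pi := (pi : R).
Implicit Types (a b : fps R) (F G : K -> K) (t : K).

(* The local parameter exp(pi i t) of Gamma(2) at the cusp infinity. *)
Definition wv t : K := e2pi (t / 2).

Lemma cm_wv t : cm (wv t) = expR (- (pi * im t)).
Proof. by rewrite /wv cm_e2pi im_divn; congr expR; field. Qed.

Lemma wv_neq0 t : wv t != 0. Proof. exact: e2pi_neq0. Qed.

Lemma wvM n t : wv (n%:R * t) = wv t ^+ n.
Proof. by rewrite /wv -e2piMn mulrA. Qed.

Lemma wv1 t : wv (t + 1) = - wv t.
Proof. by rewrite /wv mulrDl e2piD mul1r e2pi_half mulrN1. Qed.

Definition PS a F := forall t, 0 < im t -> csums (fun n => cf a n * wv t ^+ n) (F t).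

(** The modulus of w on the line im t = y. *)
Definition rad (y : R) : R := expR (- (pi * y)).

Lemma rad_gt0 y : 0 < rad y. Proof. exact: expR_gt0. Qed.

Lemma rad_lt1 y : 0 < y -> rad y < 1.
Proof. by move=> h; rewrite expR_lt1 oppr_lt0 mulr_gt0// pi_gt0. Qed.

Lemma le_rad y z : y <= z -> rad z <= rad y.
Proof. by move=> h; rewrite ler_expR lerN2 ler_pM2l// pi_gt0. Qed.

Lemma radD y z : rad (y + z) = rad y * rad z.
Proof. by rewrite /rad mulrDr opprD expRD. Qed.

Definition cvf a := forall y : R, 0 < y -> rbnd (fun n => cm (cf a n) * rad y ^+ n).

(** Abel's lemma: terms bounded at height y / 2 decay geometrically at height y. *)
Lemma cvf_bnd a : (forall y : R, 0 < y -> exists B : R, forall n, cm (cf a n) * rad y ^+ n <= B) -> cvf a.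
Proof.
move=> h y y0; have y2 : 0 < y / 2 by rewrite divr_gt0.
have [B hB] := h _ y2.
have B0 : 0 <= B by apply: le_trans (hB 0%N); rewrite mulr_ge0 ?cm_ge0// exprn_ge0// ltW// rad_gt0.
have hg : 0 <= rad (y / 2) < 1 by rewrite ltW ?rad_gt0// rad_lt1.
apply: rbnd_le (rbndM B0 (rbnd_geo hg)) => n.
rewrite mulr_ge0 ?cm_ge0 ?exprn_ge0 ?(ltW (rad_gt0 _))//=.
have -> : rad y = rad (y / 2) * rad (y / 2) by rewrite -radD; congr rad; field.
by rewrite exprMn mulrA ler_wpM2r// exprn_ge0// ltW// rad_gt0.
Qed.

Lemma PS_cvf a F : PS a F -> cvf a.
Proof.
move=> h; apply: cvf_bnd => y y0.
pose t : K := 'i * rc y.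
have it : im t = y by rewrite /t mulrC im_rcM im_i mulr1.
have := h t; rewrite it => /(_ y0) ht.
have h0 : ctends (fun n => cf a n * wv t ^+ n) 0.
  have h1 := (ctends_shift (fun n => \sum_(i < n) (cf a i * wv t ^+ i)) (F t) 1).2 ht.
  have := ctendsB h1 ht; rewrite subrr; apply: (ctends_eq (N := 0)) => n _.
  by rewrite addn1 big_ord_recr /= addrAC subrr add0r.
have [B B0 hB] := ctends_bnd h0; exists B => n.
by have := hB n; rewrite cmM cmX cm_wv it.
Qed.

Lemma cvf_dom a t y n : y <= im t -> cm (cf a n * wv t ^+ n) <= cm (cf a n) * rad y ^+ n.
Proof.
move=> h; by rewrite cmM cmX cm_wv -/(rad _) ler_wpM2l ?cm_ge0// lerXn2r ?nnegrE ?(ltW (rad_gt0 _))// le_rad.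
Qed.

Lemma cvf_absum a t : cvf a -> 0 < im t -> absum (fun n => cf a n * wv t ^+ n).
Proof. by move=> h ht; apply: absum_le (h _ ht) => n; exact: cvf_dom. Qed.

Lemma cvf_PS a : cvf a -> exists F, PS a F.
Proof.
move=> h.
have : forall t, exists l, 0 < im t -> csums (fun n => cf a n * wv t ^+ n) l.
  move=> t; have [ht|_] := boolP (0 < im t); last by exists 0.
  by have [l hl] := absum_cvg (cvf_absum h ht); exists l.
by move=> /choice[F hF]; exists F => t; exact: hF.
Qed.

Lemma PS_eq a F G : (forall t, 0 < im t -> F t = G t) -> PS a F -> PS a G.
Proof. by move=> h hF t ht; rewrite -h//; exact: hF. Qed.

Lemma PS_D a b F G : PS a F -> PS b G -> PS (a + b) (fun t => F t + G t).
Proof.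
by move=> hF hG t ht; apply: csums_ext (csumsD (hF t ht) (hG t ht)) => n; rewrite cfD mulrDl.
Qed.

Lemma PS_N a F : PS a F -> PS (- a) (fun t => - F t).
Proof.
by move=> hF t ht; apply: csums_ext (csumsN (hF t ht)) => n; rewrite cfN mulNr.
Qed.

Lemma PS_B a b F G : PS a F -> PS b G -> PS (a - b) (fun t => F t - G t).
Proof. by move=> hF hG; apply: PS_D => //; exact: PS_N. Qed.

Lemma PS_Z c a F : PS a F -> PS (fC c * a) (fun t => c * F t).
Proof.
by move=> hF t ht; apply: csums_ext (csumsMl c (hF t ht)) => n; rewrite cf_fC mulrA.
Qed.

Lemma PS_C c : PS (fC c) (fun=> c).
Proof.
move=> t ht; have := @csums_fin R (fun n => cf (fC c) n * wv t ^+ n) 1.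
rewrite big_ord1 /= mulr1n expr0 mulr1; apply => -[//|n] _.
by rewrite mulr0n mul0r.
Qed.

Lemma PS_1 : PS 1 (fun=> 1).
Proof.
by have -> : 1 = fC 1 :> fps R; [apply: fps_ext => -[|n]|exact: PS_C].
Qed.

Lemma PS_0 : PS 0 (fun=> 0).
Proof. by move=> t ht; apply: csums_ext (@csums0 R) => n; rewrite cf0 mul0r. Qed.

Lemma PS_M a b F G : PS a F -> PS b G -> PS (a * b) (fun t => F t * G t).
Proof.
move=> hF hG t ht.
have := csums_conv (cvf_absum (PS_cvf hF) ht) (cvf_absum (PS_cvf hG) ht) (hF t ht) (hG t ht).
apply: csums_ext => n; rewrite cfM /conv mulr_suml; apply: eq_bigr => i _.
have hi : (i <= n)%N by rewrite -ltnS.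
have -> : wv t ^+ n = wv t ^+ i * wv t ^+ (n - i) by rewrite -exprD subnKC.
by ring.
Qed.

Lemma PS_Xn a F k : PS a F -> PS (a ^+ k) (fun t => F t ^+ k).
Proof.
move=> h; elim: k => [|k IH]; first by apply: PS_eq PS_1 => t _; rewrite expr0.
by rewrite exprS; apply: PS_eq (PS_M h IH) => t _; rewrite exprS.
Qed.

Lemma PS_X : PS fX wv.
Proof.
move=> t ht; have := @csums_fin R (fun n => cf fX n * wv t ^+ n) 2.
rewrite !big_ord_recl big_ord0 /= mul0r mul1r add0r addr0 expr1; apply => -[//|[//|n]] _.
by rewrite /= mul0r.
Qed.

Lemma PS_sum (I : Type) (r : seq I) (a : I -> fps R) (F : I -> K -> K) :
  (forall i, PS (a i) (F i)) -> PS (\sum_(i <- r) a i) (fun t => \sum_(i <- r) F i t).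
Proof.
move=> h; elim: r => [|i r IH].
  by rewrite big_nil; apply: PS_eq PS_0 => t _; rewrite big_nil.
by rewrite big_cons; apply: PS_eq (PS_D (h i) IH) => t _; rewrite big_cons.
Qed.

Lemma PS_bounded a F y : PS a F -> 0 < y -> exists2 B : R, 0 < B & forall t, y <= im t -> cm (F t) <= B.
Proof.
move=> hF y0; have [_ [B hB]] := PS_cvf hF y0.
have B0 : 0 <= B by apply: le_trans (hB 0%N); rewrite big_ord0.
exists (B + 1); first by rewrite ltr_wpDl.
move=> t ht; have ht0 : 0 < im t := lt_le_trans y0 ht.
apply: le_trans (_ : B <= _); last by rewrite lerDl.
by apply: (csums_cm (M := fun n => cm (cf a n) * rad y ^+ n) (hF t ht0)) hB => n; exact: cvf_dom.
Qed.

Definition iy (k : nat) : K := 'i * k.+1%:R.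

Lemma im_iy k : im (iy k) = k.+1%:R.
Proof. by rewrite /iy mulrC im_natM im_i mulr1. Qed.

Lemma PS_at_infinity a F : PS a F -> ctends (fun k => F (iy k)) (cf a 0).
Proof.
move=> hF; have ik k : 0 < im (iy k) by rewrite im_iy.
have hg : 0 <= rad 1 < 1 by rewrite ltW ?rad_gt0// rad_lt1.
have wk k : wv (iy k) = wv 'i ^+ k.+1 by rewrite -wvM /iy mulrC.
have cw : cm (wv 'i) = rad 1 by rewrite cm_wv im_i.
apply: (tannery (u := fun k n => cf a n * wv (iy k) ^+ n)
  (v := fun n => if n is n'.+1 then 0 else cf a 0) (PS_cvf hF ltr01)).
- exists 0%N => k n _; apply: cvf_dom; by rewrite im_iy ler1n.
- case=> [|n].
    by apply: (ctends_eq (N := 0)) (ctends_cst _) => k _; rewrite expr0 mulr1.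
  rewrite -(mulr0 (cf a n.+1)); apply: ctendsMl.
  have hg1 : `|rad 1| < 1 by case/andP: hg => h0 h1; rewrite ger0_norm.
  apply: (ctends_le (N := 0)) (cvg_expr hg1) => k _.
  rewrite subr0 cmX wk cmX cw exprS -exprM -exprD.
  by rewrite ler_wiXn2l//; [case/andP: hg|case/andP: hg => _ /ltW|lia].
- by move=> k; apply: hF.
- have := @csums_fin R (fun n => if n is n'.+1 then 0 else cf a 0) 1.
  by rewrite big_ord1; apply; case.
Qed.

Definition fsh (a : fps R) : fps R := Fps (fun n => cf a n.+1).

Lemma fshK a : cf a 0 = 0 -> fX * fsh a = a.
Proof. by move=> a0; apply: fps_ext => -[|n]; rewrite cf_fX. Qed.

Lemma PS_sh a F : PS a F -> cf a 0 = 0 -> PS (fsh a) (fun t => F t / wv t).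
Proof.
move=> hF a0 t ht.
have := (csumsS (fun n => cf a n * wv t ^+ n) (F t)).2.
rewrite a0 mul0r add0r => /(_ (hF t ht)) h.
apply: csums_ext (csumsMr (wv t)^-1 h) => n.
by rewrite /= exprSr mulrA mulfK// wv_neq0.
Qed.

(** The constant term is the limit at i infinity; dividing by w with [fsh] then brings the next
    coefficient into that place. *)
Lemma PS_eq0 a : PS a (fun=> 0) -> a = 0.
Proof.
move=> h; apply: fps_ext => n; rewrite cf0; elim: n a h => [|n IH] a h.
  exact: ctends_uniq (PS_at_infinity h) (ctends_cst 0).
have a0 : cf a 0 = 0 by exact: ctends_uniq (PS_at_infinity h) (ctends_cst 0).
have := IH (fsh a); apply; apply: PS_eq (PS_sh h a0) => t _.
by rewrite mul0r.
Qed.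

Lemma PS_uniq a b F : PS a F -> PS b F -> a = b.
Proof.
move=> ha hb; apply/eqP; rewrite -subr_eq0; apply/eqP/PS_eq0.
by apply: PS_eq (PS_B ha hb) => t _; rewrite subrr.
Qed.

Definition fT a : fps R := Fps (fun n => (-1) ^+ n * cf a n).

Lemma PS_T a F : PS a F -> PS (fT a) (fun t => F (t + 1)).
Proof.
move=> h t ht; have := h (t + 1); rewrite imD (im_nat R 1) addr0 => /(_ ht).
by apply: csums_ext => n; rewrite /= wv1 [(- wv t) ^+ n]exprNn mulrA [cf a n * _]mulrC.
Qed.

Lemma csums_sparse (u : nat -> K) l d : (0 < d)%N -> csums u l ->
  csums (fun n => if (d %| n)%N then u (n %/ d)%N else 0) l.
Proof.
move=> d0 h; have part N : \sum_(i < N * d) (if (d %| i)%N then u (i %/ d)%N else 0) = \sum_(i < N) u i.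
  elim: N => [|N IH]; first by rewrite !big_ord0.
  rewrite mulSn addnC big_split_ord /= IH big_ord_recr /=; congr (_ + _).
  case: d d0 {IH h} => // d _; rewrite big_ord_recl /= addn0 dvdn_mull// mulnK// big1 ?addr0// => i _.
  by rewrite /bump /= add1n ifF//; apply/negbTE; rewrite dvdn_addr ?dvdn_mull// gtnNdvd// ltnS ltn_ord.
apply/ctendsP => e e0; have [N hN] := (ctendsP _ _).1 h e e0.
exists (N.+1 * d)%N => n hn.
have hnd : (N.+1 <= n %/ d)%N by rewrite leq_divRL.
have [r0|r0] := posnP (n %% d)%N.
  have -> : n = (n %/ d * d)%N by rewrite {1}(divn_eq n d) r0 addn0.
  by rewrite part; apply: hN; rewrite ltnW.
have -> : n = (n %/ d * d + n %% d)%N by exact: divn_eq.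
rewrite big_split_ord /= part.
case E : (n %% d)%N r0 => [//|r] _; rewrite big_ord_recl /= addn0 dvdn_mull// mulnK//.
rewrite [X in _ + (_ + X)]big1 ?addr0; last first.
  move=> i _; rewrite ifF//; apply/negbTE; rewrite dvdn_addr ?dvdn_mull// /bump /= add1n gtnNdvd//.
  have := ltn_ord i; have := ltn_pmod n d0; rewrite E; lia.
have -> : \sum_(i < n %/ d) u i + u (n %/ d)%N = \sum_(i < (n %/ d).+1) u i by rewrite big_ord_recr.
by apply: hN; rewrite ltnW// ltnW.
Qed.

Definition fdil (d : nat) a : fps R := Fps (fun n => if (d %| n)%N then cf a (n %/ d)%N else 0).

Lemma PS_dil a F d : (0 < d)%N -> PS a F -> PS (fdil d a) (fun t => F (d%:R * t)).
Proof.
move=> d0 h t ht; have := h (d%:R * t); rewrite im_natM mulr_gt0 ?ltr0n// => /(_ isT).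
move/(csums_sparse d0); apply: csums_ext => n /=.
case: ifP => hd; last by rewrite mul0r.
by rewrite wvM -exprM mulnC divnK.
Qed.

Lemma cvf_fD a : cvf a -> cvf (fD a).
Proof.
move=> h; apply: cvf_bnd => y y0; have y2 : 0 < y / 2 by rewrite divr_gt0.
have [h0 [B hB]] := h _ y2.
exists (B * (pi * (y / 2))^-1) => n.
have -> : cm (cf (fD a) n) * rad y ^+ n = (cm (cf a n) * rad (y / 2) ^+ n) * (n%:R * rad (y / 2) ^+ n).
  have -> : rad y = rad (y / 2) * rad (y / 2) by rewrite -radD; congr rad; field.
  by rewrite /= cmM cm_nat exprMn; ring.
have hn : cm (cf a n) * rad (y / 2) ^+ n <= B.
  apply: le_trans (hB n.+1); rewrite big_ord_recr /= lerDr sumr_ge0// => i _; exact: h0.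
have p0 : 0 < pi * (y / 2) by rewrite mulr_gt0// pi_gt0.
apply: ler_pM => //; first by rewrite mulr_ge0// exprn_ge0// ltW// rad_gt0.
rewrite -[leRHS]mul1r ler_pdivlMr// /rad -expRM_natl mulrN expRN mulrAC ler_pdivrMr ?expR_gt0// mul1r.
by apply: le_trans (expR_ge1Dx _); rewrite mulrC; lra.
Qed.

(** The method of majorants: [fa] has the coefficients |a_n|, its powers bound those of a, and at t'
    = i im t, where w is real and positive, its value bounds the sum over the k-th power by A ^ k.
    The double series is thus dominated by exp A. *)
Lemma PS_fexp a F : PS a F -> cf a 0 = 0 -> PS (fexp a) (fun t => cexp (F t)).
Proof.
move=> hF a0 t ht.
pose u k n := cf (a ^+ k) n * wv t ^+ n / k`!%:R.
pose fa := @Fps R (fun n => rc (cm (cf a n))).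
have hfa : cvf fa.
  move=> y y0; apply: rbnd_le (PS_cvf hF y0) => n.
  rewrite (_ : cm (cf fa n) = cm (cf a n)); last exact: etrans (cm_rc _) (ger0_norm (cm_ge0 _)).
  by rewrite lexx mulr_ge0 ?cm_ge0// exprn_ge0// ltW// rad_gt0.
have [G hG] := cvf_PS hfa.
have hx k : exists x : nat -> R, forall n, cf (fa ^+ k) n = rc (x n) /\ cm (cf (a ^+ k) n) <= x n.
  elim: k => [|k [x hx]].
    by exists (fun n => (n == 0%N)%:R) => n; rewrite expr0 cf1 cm_nat rc_nat.
  exists (fun n => \sum_(i < n.+1) cm (cf a i) * x (n - i)%N) => n; split.
    by rewrite exprS cfM rc_sum; apply: eq_bigr => i _; rewrite (hx _).1 rcM.
  rewrite exprS cfM; apply: le_trans (cm_sum _ _ _) _; apply: ler_sum => i _.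
  by rewrite cmM ler_wpM2l ?cm_ge0//; have [] := hx (n - i)%N.
pose t' : K := 'i * rc (im t).
have it : im t' = im t by rewrite /t' mulrC im_rcM im_i mulr1.
have wt' : wv t' = rc (rad (im t)).
  rewrite /wv e2piE /t' -cexp_rc; congr cexp.
  have i2 : ('i : K) ^+ 2 = -1 by rewrite sqrCi.
  have -> : 2 * rc pi * 'i * ('i * rc (im t) / 2) = 'i ^+ 2 * (rc pi * rc (im t)) by field.
  by rewrite i2 mulN1r rcN rcM.
set A := cm (G t').
have hk k n : \sum_(i < n) cm (cf (a ^+ k) i * wv t ^+ i) <= A ^+ k.
  have [x hxk] := hx k.
  have h1 : csums (fun n => rc (x n * rad (im t) ^+ n)) (G t' ^+ k).
    have := PS_Xn k hG (t := t'); rewrite it => /(_ ht); apply: csums_ext => m.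
    by rewrite (hxk m).1 wt' rcM rcX.
  have x0 m : 0 <= x m by apply: le_trans (cm_ge0 _) (hxk m).2.
  apply: (@le_trans _ _ (\sum_(i < n) x i * rad (im t) ^+ i)).
    apply: ler_sum => i _; rewrite cmM cmX cm_wv -/(rad _) ler_wpM2r ?exprn_ge0 ?(ltW (rad_gt0 _))//.
    by have [] := hxk i.
  apply: (@le_trans _ _ (re (G t' ^+ k))).
    apply: (@csums_ge R (fun i => x i * rad (im t) ^+ i) _ _ h1) => m; rewrite mulr_ge0// exprn_ge0//; exact: ltW (rad_gt0 _).
  by apply: le_trans (ler_norm _) _; apply: le_trans (re_cm _) _; rewrite cmX.
have A0 : 0 <= A := cm_ge0 _.
apply: (@csums_exchange R u (fun k n => cm (u k n)) (fun k => A ^+ k / k`!%:R) (fun k => F t ^+ k / k`!%:R)).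
- by [].
- move=> k n; have -> : \sum_(i < n) cm (u k i) = (\sum_(i < n) cm (cf (a ^+ k) i * wv t ^+ i)) / k`!%:R.
    by rewrite mulr_suml; apply: eq_bigr => i _; rewrite /u cmM cmV cm_nat.
  by rewrite ler_wpM2r// invr_ge0.
- split; first by move=> k; rewrite divr_ge0 ?exprn_ge0.
  by exists (expR A) => n; apply: exp_sum_le.
- by move=> k; apply: csumsMr; apply: PS_Xn.
- move=> n; rewrite /= mulr_suml.
  have -> : \sum_(i < n.+1) cf (a ^+ i) n / i`!%:R * wv t ^+ n = \sum_(i < n.+1) u i n.
    by apply: eq_bigr => i _; rewrite /u mulrAC.
  by apply: (@csums_fin R (fun i => u i n)) => k hk'; rewrite /u cfX_lt// !mul0r.
- exact: csums_exp.
Qed.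

End PowerSeries.

(** * The logarithm of the eta product *)

Section DivisorSum.

Definition sigma (n : nat) : nat := \sum_(d < n.+1 | (d %| n)%N) d.

Lemma sigma0 : sigma 0 = 0%N.
Proof. by rewrite /sigma big_mkcond big_ord1. Qed.

Lemma sigmaE n N : (0 < n)%N -> (n < N)%N -> sigma n = (\sum_(d < N) (if (d %| n)%N then d : nat else 0))%N.
Proof.
move=> n0 nN; rewrite -big_mkcond /= /sigma.
rewrite (big_ord_widen_cond N (fun d => (d %| n)%N) (fun d => d))//.
apply: eq_bigl => d; rewrite andb_idr// => hd.
by rewrite ltnS dvdn_leq.
Qed.

Lemma sum_even_odd_nat (n : nat) (F : nat -> nat) :
  (\sum_(k < n.*2) F k = \sum_(m < n) F m.*2 + \sum_(m < n) F m.*2.+1)%N.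
Proof.
elim: n => [|n IH]; first by rewrite !big_ord0.
by rewrite doubleS !big_ord_recr /= IH -addnA addnACA.
Qed.

(** The Hecke relation at 2. It expresses the substitution of - w for w in the series of sigma(n) /
    n through dilations, see [fT_fL]. *)
Lemma sigma_double m : (0 < m)%N ->
  (sigma m.*2 + (if (2 %| m)%N then 2 * sigma (m %/ 2) else 0) = 3 * sigma m)%N.
Proof.
move=> m0; pose N := m.*2.+1.
have m2 : (0 < m.*2)%N by rewrite double_gt0.
have mN : (m < N.*2)%N by rewrite /N; lia.
have m2N : (m.*2 < N.*2)%N by rewrite /N; lia.
rewrite (sigmaE m2 m2N) (sum_even_odd_nat N (fun k => if (k %| m.*2)%N then k else 0%N)).
have dd x y : (x.*2 %| y.*2)%N = (x %| y)%N by rewrite -!muln2 dvdn_pmul2r.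
have dv x y : (x.*2.+1 %| y.*2)%N = (x.*2.+1 %| y)%N.
  by rewrite -(muln2 y) Gauss_dvdl// coprimen2 /= odd_double.
have e1 : (\sum_(e < N) (if (e.*2 %| m.*2)%N then e.*2 else 0) = 2 * sigma m)%N.
  rewrite (@sigmaE m N)// ?/N; last by lia.
  rewrite big_distrr /=; apply: eq_bigr => e _.
  by rewrite dd; case: ifP => _; lia.
have e2 : (\sum_(e < N) (if (e.*2.+1 %| m.*2)%N then e.*2.+1 else 0) =
           \sum_(e < N) (if (e.*2.+1 %| m)%N then e.*2.+1 else 0))%N.
  by apply: eq_bigr => e _; rewrite dv.
have e3 : (\sum_(e < N) (if (e.*2 %| m)%N then e.*2 else 0) = if (2 %| m)%N then 2 * sigma (m %/ 2) else 0)%N.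
  case: ifP => hm; last first.
    apply: big1 => e _; case: ifP => // he.
    by move: hm; rewrite (dvdn_trans _ he)// -muln2 dvdn_mull.
  have hk : (0 < m %/ 2)%N by rewrite divn_gt0// dvdn_leq.
  rewrite (@sigmaE (m %/ 2) N)//; last by rewrite /N; have := leq_div m 2; lia.
  rewrite big_distrr /=; apply: eq_bigr => e _.
  have dm x : (x.*2 %| m)%N = (x %| m %/ 2)%N by rewrite -[in LHS](divnK hm) muln2 dd.
  rewrite dm; case: ifP => _; lia.
have e4 : sigma m = (\sum_(e < N) (if (e.*2 %| m)%N then e.*2 else 0) +
     \sum_(e < N) (if (e.*2.+1 %| m)%N then e.*2.+1 else 0))%N.
  by rewrite (sigmaE m0 mN) (sum_even_odd_nat N (fun k => if (k %| m)%N then k else 0%N)).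
rewrite e1 e2; rewrite e3 in e4; lia.
Qed.

Lemma sigma_inv n : sigma n = (\sum_(m < n | (m.+1 %| n)%N) n %/ m.+1)%N.
Proof.
case: n => [|n]; first by rewrite sigma0 big_ord0.
have -> : sigma n.+1 = (\sum_(m < n.+1 | (m.+1 %| n.+1)%N) m.+1)%N.
  by rewrite /sigma big_mkcond big_ord_recl dvd0n /= add0n [RHS]big_mkcond.
pose h (m : 'I_n.+1) : 'I_n.+1 := inord (n.+1 %/ m.+1).-1.
have hv (m : 'I_n.+1) : (m.+1 %| n.+1)%N -> (h m).+1 = (n.+1 %/ m.+1)%N.
  move=> hm; have hp : (0 < n.+1 %/ m.+1)%N by rewrite divn_gt0// dvdn_leq.
  rewrite /h inordK ?prednK// leq_div//.
rewrite (reindex_onto h h) /=; last first.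
  move=> m hm; apply: val_inj; apply: succn_inj; rewrite /= hv; last by rewrite hv// dvdn_div.
  by rewrite hv// divnA// mulKn.
apply: eq_big => [m|m /andP[hm /eqP hh]].
  apply/andP/idP => [[hm /eqP hh]|hm].
    by have := hv _ hm; rewrite hh => ->; apply: dvdn_div.
  rewrite hv// dvdn_div//; split=> //; apply/eqP; apply: val_inj; apply: succn_inj; rewrite /= hv.
    by rewrite hv// divnA// mulKn.
  by rewrite hv// dvdn_div.
by have := hv _ hm; rewrite hh => e; rewrite hv// e dvdn_div.
Qed.

Lemma sigma_le n : (sigma n <= n.+1 * n)%N.
Proof.
rewrite /sigma big_mkcond /=; apply: (@leq_trans (\sum_(d < n.+1) n)%N).
  by apply: leq_sum => d _; case: ifP => // _; rewrite -ltnS.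
by rewrite sum_nat_const card_ord.
Qed.

End DivisorSum.

(** * The Lambert series of E_2 and the logarithm of the eta product *)

Section LogEta.
Variable R : realType.
Local Notation K := (C R).
Local Notation pi := (pi : R).
Implicit Types (a b : fps R) (F G : K -> K) (t : K).

(** Gives a name to the sum of a series known only by its coefficients; where the series diverges
    the value is 0. *)
Definition ev a t : K := xget 0 [set l | csums (fun n => cf a n * wv t ^+ n) l].

Lemma PS_ev a : cvf a -> PS a (ev a).
Proof.
move=> h t ht; have [l hl] := absum_cvg (cvf_absum h ht).
by rewrite /ev; case: xgetP => [y _ //|/(_ l)].
Qed.

Lemma PS_fun a F G t : PS a F -> PS a G -> 0 < im t -> F t = G t.
Proof. by move=> hF hG ht; exact: csums_uniq (hF t ht) (hG t ht). Qed.

Lemma cvf_le a b : (forall n, cm (cf a n) <= cm (cf b n)) -> cvf b -> cvf a.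
Proof.
move=> h hb y y0; apply: rbnd_le (hb y y0) => n.
have r0 : 0 <= rad y ^+ n by rewrite exprn_ge0// ltW// rad_gt0.
by rewrite mulr_ge0 ?cm_ge0//= ler_wpM2r.
Qed.

Definition ones : fps R := Fps (fun=> 1).

Lemma cvf_ones : cvf ones.
Proof.
apply: cvf_bnd => y y0; exists 1 => n; rewrite /= cm1 mul1r exprn_ile1 ?ltW ?rad_gt0//.
exact: rad_lt1.
Qed.

Definition nums : fps R := Fps (fun n => n%:R).

Lemma cvf_nums : cvf nums.
Proof. by apply: cvf_le (cvf_fD cvf_ones) => n; rewrite /= mulr1. Qed.

Lemma PS_ones : PS ones (fun t => (1 - wv t)^-1).
Proof.
move=> t ht; have hw : cm (wv t) < 1 by rewrite cm_wv rad_lt1.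
have w1 : 1 - wv t != 0.
  by rewrite subr_eq0; apply: contraTneq hw => <-; rewrite cm1 ltxx.
have hr : `|cm (wv t)| < 1 by rewrite ger0_norm ?cm_ge0.
have h0 := cvg0M (cm (1 - wv t))^-1 (cvg_expr hr).
apply: (ctends_le (N := 0)) h0 => n _.
under eq_bigr do rewrite mul1r.
have -> : \sum_(i < n) wv t ^+ i = (1 - wv t ^+ n) / (1 - wv t).
  by apply: (canRL (mulfK w1)); rewrite mulrC -opprB mulNr -subrX1 opprB.
by rewrite mulrBl mul1r addrAC subrr add0r cmN cmM cmX cmV mulrC.
Qed.

Lemma PS_nums : PS nums (fun t => wv t / (1 - wv t) ^+ 2).
Proof.
have -> : nums = fX * (ones * ones).
  apply: fps_ext => -[|n]; rewrite cf_fX// cfM /=.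
  by under eq_bigr do rewrite mulr1; rewrite sumr_const card_ord.
apply: PS_eq (PS_M (@PS_X R) (PS_M PS_ones PS_ones)) => t _.
by rewrite -exprVn expr2.
Qed.

Definition fsig : fps R := Fps (fun n => (sigma n)%:R).

Lemma cvf_fsig : cvf fsig.
Proof.
apply: (cvf_le (b := fD nums + nums)).
  move=> n; rewrite /= -natrM -natrD !cm_nat ler_nat.
  by apply: leq_trans (sigma_le n) _; lia.
have h1 := PS_ev (cvf_fD cvf_nums); have h2 := PS_ev cvf_nums.
exact: PS_cvf (PS_D h1 h2).
Qed.

(** Each q ^ m / (1 - q ^ m) ^ 2 is expanded in powers of q and the terms are collected by exponent,
    which produces sigma. The argument 2 t appears because [fsig] is a series in w, and w(2 t) =
    q. *)
Lemma lambert t : 0 < im t ->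
  csums (fun m => csc2 (m.+1%:R * t)) (- (2 * rc pi) ^+ 2 * ev fsig (2 * t)).
Proof.
move=> ht; have h2t : 0 < im (2 * t) by rewrite im_natM mulr_gt0.
set y := im (2 * t) in h2t.
set Q := wv (2 * t).
have cQ : cm Q = rad y by rewrite /Q cm_wv.
pose u m n : K := if (m.+1 %| n)%N then (n %/ m.+1)%:R * Q ^+ n else 0.
have rowS m : csums (u m) (e2pi (m.+1%:R * t) / (1 - e2pi (m.+1%:R * t)) ^+ 2).
  have him : 0 < im (m.+1%:R * (2 * t)) by rewrite im_natM mulr_gt0.
  have := csums_sparse (ltn0Sn m) (PS_nums him).
  have -> : wv (m.+1%:R * (2 * t)) = e2pi (m.+1%:R * t) by rewrite /wv; congr e2pi; field.
  apply: csums_ext => n; rewrite /u; case: ifP => // hn.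
  rewrite /=; congr (_ * _); rewrite -e2piMn /Q -wvM /wv; congr e2pi.
  have -> : n%:R = (n %/ m.+1)%:R * m.+1%:R :> K by rewrite -natrM divnK.
  by rewrite mulrA; field.
have [hn0 [B hB]] := cvf_nums h2t.
have B0 : 0 <= B by apply: le_trans (hB 0%N); rewrite big_ord0.
pose M m n : R := if (m.+1 %| n)%N then (n %/ m.+1)%:R * rad y ^+ n else 0.
have r01 : 0 <= rad y < 1 by rewrite ltW ?rad_gt0 ?rad_lt1.
have M0 m n : 0 <= M m n.
  by rewrite /M; case: ifP => // _; rewrite mulr_ge0// exprn_ge0//; case/andP: r01.
have hM m n : \sum_(k < n) M m k <= B * rad y ^+ m.
  (* Row m lives on the multiples of m + 1; indexed by the quotient j, its terms are bounded through
     (m + 1) j >= m + j for j > 0. *)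
  pose v j : R := j%:R * rad y ^+ (m.+1 * j).
  have hv j : v j <= rad y ^+ m * (cm (cf nums j) * rad y ^+ j).
    case: j => [|j]; first by rewrite /v /= !mul0r cm0 mul0r mulr0.
    rewrite /v /= cm_nat mulrCA ler_wpM2l// -exprD ler_wiXn2l ?(andP r01).1//.
      by case/andP: r01 => _ /ltW.
    by nia.
  have v0 j : 0 <= v j by rewrite mulr_ge0// exprn_ge0//; case/andP: r01.
  have [l hl] : exists l, csums (fun j => rc (v j)) l.
    apply: absum_cvg; apply: (absum_le (M := fun j => rad y ^+ m * (cm (cf nums j) * rad y ^+ j))).
      by move=> j; rewrite cm_rc ger0_norm.
    by apply: rbndM (cvf_nums h2t); rewrite exprn_ge0//; case/andP: r01.
  have hsp : csums (fun k => rc (M m k)) l.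
    apply: csums_ext (csums_sparse (ltn0Sn m) hl) => k; rewrite /M; case: ifP => // hk.
    by rewrite /v mulnC divnK.
  apply: le_trans (csums_ge (M0 m) hsp n) _.
  apply: le_trans (ler_norm _) _; apply: le_trans (re_cm _) _.
  apply: (csums_cm (M := fun j => rad y ^+ m * (cm (cf nums j) * rad y ^+ j)) hl) => [j|k]; first by rewrite cm_rc ger0_norm//; exact: hv.
  by rewrite -mulr_sumr mulrC ler_wpM2r// exprn_ge0//; case/andP: r01.
have hcol n : csums (fun m => u m n) (cf fsig n * Q ^+ n).
  have -> : cf fsig n * Q ^+ n = \sum_(m < n) u m n.
    rewrite /= sigma_inv natr_sum mulr_suml big_mkcond /=; apply: eq_bigr => m _.
    by rewrite /u; case: ifP; rewrite ?mul0r.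
  apply: (@csums_fin R (fun m => u m n)) => m hm; rewrite /u; case: n hm => [|n] hm.
    by rewrite dvdn0 div0n mul0r.
  by rewrite gtnNdvd// ltnS.
have hrows : csums (fun m => e2pi (m.+1%:R * t) / (1 - e2pi (m.+1%:R * t)) ^+ 2) (ev fsig (2 * t)).
  have [L hL] : exists L, csums (fun m => e2pi (m.+1%:R * t) / (1 - e2pi (m.+1%:R * t)) ^+ 2) L.
    apply: absum_cvg; apply: (absum_le (M := fun m => B * rad y ^+ m)); last exact: rbndM (rbnd_geo r01).
    move=> m; apply: (csums_cm (M := M m) (rowS m)) => [n|n]; last exact: hM.
    by rewrite /u /M; case: ifP => _; rewrite ?cm0// cmM cm_nat cmX cQ.
  have := csums_exchange (M := M) (B := fun m => B * rad y ^+ m) _ hM (rbndM B0 (rbnd_geo r01)) rowS hcol hL.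
  have -> : ev fsig (2 * t) = L; last by [].
  have hc : csums (fun n => cf fsig n * Q ^+ n) L.
    apply: (csums_exchange (M := M) (B := fun m => B * rad y ^+ m) _ hM (rbndM B0 (rbnd_geo r01)) rowS hcol hL).
    by move=> m n; rewrite /u /M; case: ifP => _; rewrite ?cm0// cmM cm_nat cmX cQ.
  exact: csums_uniq (PS_ev cvf_fsig h2t) hc.
exact: csumsMl.
Qed.

Definition fL : fps R := Fps (fun n => - ((sigma n)%:R / n%:R)).

Lemma fD_fL : fD fL = - fsig.
Proof.
apply: fps_ext => -[|n]; rewrite cfN /=; first by rewrite sigma0 mul0r oppr0.
by rewrite mulrN mulrCA mulfV ?mulr1// pnatr_eq0.
Qed.

Lemma cf_fL0 : cf fL 0 = 0.
Proof. by rewrite /= sigma0 mul0r oppr0. Qed.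

Lemma cvf_fL : cvf fL.
Proof.
apply: cvf_le cvf_fsig => -[|n]; first by rewrite /= sigma0 mul0r oppr0.
by rewrite /= cmN cmM cmV !cm_nat ler_piMr// invf_le1 ?ltr0n// ler1n.
Qed.

(* The logarithm of the product of the 1 - w ^ n, where w = exp(pi i t). *)
Definition Lf : K -> K := ev fL.

Lemma PS_Lf : PS fL Lf. Proof. exact: PS_ev cvf_fL. Qed.

Lemma PS_Lf_dil d : (0 < d)%N -> PS (fdil d fL) (fun t => Lf (d%:R * t)).
Proof. by move=> d0; apply: PS_dil d0 PS_Lf. Qed.

(** In product form: the product of the 1 - w ^ n, taken at - w, is the cube of its value at w ^ 2
    divided by its values at w and at w ^ 4. *)
Lemma fT_fL : fT fL = fC 3 * fdil 2 fL - fL - fdil 4 fL.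
Proof.
apply: fps_ext => n; rewrite !cfB cf_fC.
have [hn|hn] := boolP (odd n).
  rewrite /= !ifF; last 2 first.
  - by apply/negbTE; apply/negP => /(dvdn_trans (isT : (2 %| 4)%N)); rewrite dvdn2 hn.
  - by rewrite dvdn2 hn.
  by rewrite -signr_odd hn expr1 mulr0 sub0r subr0 mulN1r.
have [m ->] : exists m, n = m.*2 by exists n./2; rewrite -[LHS](odd_double_half n) (negbTE hn).
have [->|m0] := posnP m; first by rewrite /= sigma0 !(mul0r, oppr0, mulr0, subr0).
have hs := sigma_double m0.
have d2 : (2 %| m.*2)%N by rewrite -muln2 dvdn_mull.
have d4 : (4 %| m.*2)%N = (2 %| m)%N by rewrite -muln2 (_ : 4 = 2 * 2)%N// dvdn_pmul2r.
have mK : (m%:R : K) != 0 by rewrite pnatr_eq0 -lt0n.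
have q2 : (m.*2 %/ 2 = m)%N by rewrite -muln2 mulnK.
have q4 : (m.*2 %/ 4 = m %/ 2)%N by rewrite -muln2 (_ : 4 = 2 * 2)%N// divnMr.
rewrite /= d2 d4 q2 q4 -signr_odd odd_double expr0 mul1r.
have e2 : m.*2%:R = 2 * m%:R :> K by rewrite -natrM mul2n.
have hsK := congr1 (fun x : nat => x%:R : K) hs.
rewrite /= natrD natrM in hsK; rewrite e2.
case: ifP hsK => hm hsK.
  have k0 : (0 < m %/ 2)%N by rewrite divn_gt0// dvdn_leq.
  have kK : ((m %/ 2)%:R : K) != 0 by rewrite pnatr_eq0 -lt0n.
  have mk : m%:R = 2 * (m %/ 2)%:R :> K by rewrite -natrM mulnC divnK.
  rewrite natrM in hsK.
  have -> : (sigma m.*2)%:R = 3 * (sigma m)%:R - 2 * (sigma (m %/ 2))%:R :> K by rewrite -hsK addrK.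
  rewrite mk; move: kK; move: ((m %/ 2)%:R : K) ((sigma (m %/ 2))%:R : K) ((sigma m)%:R : K) => x y z x0.
  by cfield.
have -> : (sigma m.*2)%:R = 3 * (sigma m)%:R :> K by rewrite -hsK addr0.
move: mK; move: (m%:R : K) ((sigma m)%:R : K) => x z x0.
by cfield.
Qed.

Lemma Lf_T t : 0 < im t -> Lf (t + 1) = 3 * Lf (2 * t) - Lf t - Lf (4 * t).
Proof.
move=> ht; have h1 := PS_T PS_Lf; rewrite fT_fL in h1.
exact: PS_fun h1 (PS_B (PS_B (PS_Z 3 (PS_Lf_dil (isT : (0 < 2)%N))) PS_Lf) (PS_Lf_dil (isT : (0 < 4)%N))) ht.
Qed.

Lemma PS_even_T a F t : PS (fdil 2 a) F -> 0 < im t -> F (t + 1) = F t.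
Proof.
move=> hF ht; have h := PS_T hF.
have e : fT (fdil 2 a) = fdil 2 a.
  apply: fps_ext => n /=; case: ifP => hn; last by rewrite mulr0.
  by rewrite -signr_odd (_ : odd n = false) ?mul1r//; move: hn; rewrite dvdn2 => /negbTE.
by rewrite e in h; exact: PS_fun h hF ht.
Qed.

Lemma Lf2_T t : 0 < im t -> Lf (2 * (t + 1)) = Lf (2 * t).
Proof. by move=> ht; apply: (PS_even_T (PS_Lf_dil (isT : (0 < 2)%N))) ht. Qed.

Lemma Lf4_T t : 0 < im t -> Lf (4 * (t + 1)) = Lf (4 * t).
Proof.
move=> ht; have e : fdil 4 fL = fdil 2 (fdil 2 fL).
  apply: fps_ext => n /=; have [h|h] := boolP (2 %| n)%N.
    have [m ->] : exists m, n = (m * 2)%N by exists (n %/ 2)%N; rewrite divnK.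
    by rewrite (_ : 4 = 2 * 2)%N// dvdn_pmul2r// divnMr// mulnK.
  by rewrite ifF//; apply/negbTE; apply: contra h; apply: dvdn_trans.
have h := PS_Lf_dil (isT : (0 < 4)%N); rewrite e in h.
exact: (PS_even_T h) ht.
Qed.

End LogEta.

(** * Logarithms of modular units and their transformation laws *)

Section ComplexDerivative.
Variable R : realType.
Local Notation K := (C R).
Local Notation pi := (pi : R).
Implicit Types (a b : fps R) (F G : K -> K) (s t d : K).

(* The quadratic error term makes the product and chain rules elementary. *)
Definition hd F t d := exists e B : R, [/\ 0 < e, 0 <= B &
  forall h : K, cm h <= e -> cm (F (t + h) - F t - d * h) <= B * cm h ^+ 2].

Lemma hd_ext F G t d : (forall s, F s = G s) -> hd F t d -> hd G t d.
Proof. by move=> /funext ->. Qed.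

Lemma hd_D F G t d d' : hd F t d -> hd G t d' -> hd (fun s => F s + G s) t (d + d').
Proof.
move=> [e [B [e0 B0 h]]] [e' [B' [e0' B0' h']]].
exists (Num.min e e'), (B + B'); split; rewrite ?addr_ge0// ?lt_min ?e0//.
move=> k; rewrite le_min => /andP[k1 k2].
have -> : F (t + k) + G (t + k) - (F t + G t) - (d + d') * k =
  (F (t + k) - F t - d * k) + (G (t + k) - G t - d' * k) by ring.
by rewrite mulrDl (le_trans (cmD _ _))// lerD// ?h// h'.
Qed.

Lemma hd_Z c F t d : hd F t d -> hd (fun s => c * F s) t (c * d).
Proof.
move=> [e [B [e0 B0 h]]]; exists e, (cm c * B); split; rewrite ?mulr_ge0 ?cm_ge0// => k hk.
have -> : c * F (t + k) - c * F t - c * d * k = c * (F (t + k) - F t - d * k) by ring.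
by rewrite cmM -mulrA ler_wpM2l ?cm_ge0// h.
Qed.

Lemma hd_B F G t d d' : hd F t d -> hd G t d' -> hd (fun s => F s - G s) t (d - d').
Proof.
move=> h h'; have := hd_D h (hd_Z (-1) h'); rewrite mulN1r.
by apply: hd_ext => s; rewrite mulN1r.
Qed.

Lemma hd_id t : hd id t 1.
Proof.
exists 1, 0; split => // k _; have -> : id (t + k) - id t - 1 * k = 0 by rewrite /=; ring.
by rewrite cm0 mul0r.
Qed.

Lemma hd_lin c t : hd (fun s => c * s) t c.
Proof. by have := hd_Z c (hd_id t); rewrite mulr1. Qed.

Lemma hd_lip F t d : hd F t d -> exists e A : R, [/\ 0 < e, 0 < A &
  forall h : K, cm h <= e -> cm (F (t + h) - F t) <= A * cm h].
Proof.
move=> [e [B [e0 B0 h]]]; exists e, (B * e + cm d + 1); split => //.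
  by rewrite ltr_wpDl// addr_ge0 ?cm_ge0// mulr_ge0// ltW.
move=> k hk; have -> : F (t + k) - F t = (F (t + k) - F t - d * k) + d * k by ring.
rewrite (le_trans (cmD _ _))// cmM.
apply: le_trans (lerD (h _ hk) (lexx _)) _.
have k0 := cm_ge0 k; have d0 := cm_ge0 d.
have : cm k ^+ 2 <= e * cm k by rewrite expr2 ler_wpM2r.
nra.
Qed.

Lemma hd_comp F p t d d' : hd F (p t) d -> hd p t d' -> hd (fun s => F (p s)) t (d * d').
Proof.
move=> [e [B [e0 B0 h]]] hp; have [e1 [A [e10 A0 hA]]] := hd_lip hp.
move: hp => [e2 [B2 [e20 B20 h2]]].
exists (Num.min (e / A) (Num.min e1 e2)), (B * A ^+ 2 + cm d * B2); split.
- by rewrite !lt_min divr_gt0// e10.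
- by rewrite addr_ge0// mulr_ge0 ?sqr_ge0 ?cm_ge0.
move=> k; rewrite !le_min => /and3P[k1 k2 k3].
set u := p (t + k) - p t.
have hu : cm u <= A * cm k by exact: hA.
have hue : cm u <= e by apply: le_trans hu _; rewrite mulrC -ler_pdivlMr.
have -> : F (p (t + k)) - F (p t) - d * d' * k = (F (p t + u) - F (p t) - d * u) + d * (u - d' * k).
  by rewrite /u (addrC (p t)) subrK; ring.
rewrite (le_trans (cmD _ _))// mulrDl lerD//.
  apply: le_trans (h _ hue) _; rewrite -mulrA ler_wpM2l// -exprMn.
  by rewrite ler_pXn2r ?nnegrE ?cm_ge0 ?mulr_ge0 ?cm_ge0 ?(ltW A0).
by rewrite cmM -mulrA ler_wpM2l ?cm_ge0// h2.
Qed.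

Lemma hd_M F G t d d' : hd F t d -> hd G t d' -> hd (fun s => F s * G s) t (d * G t + F t * d').
Proof.
move=> hF hG; have [e1 [A [e10 A0 hA]]] := hd_lip hF; have [e2 [A' [e20 A0' hA']]] := hd_lip hG.
move: hF hG => [e3 [B [e30 B0 h]]] [e4 [B' [e40 B0' h']]].
exists (Num.min (Num.min e1 e2) (Num.min e3 e4)), (B * cm (G t) + cm (F t) * B' + A * A'); split.
- by rewrite !lt_min e10 e20 e30.
- by rewrite !addr_ge0 ?mulr_ge0 ?cm_ge0 ?(ltW A0) ?(ltW A0').
move=> k; rewrite !le_min => /andP[/andP[k1 k2] /andP[k3 k4]].
have -> : F (t + k) * G (t + k) - F t * G t - (d * G t + F t * d') * k =
  (F (t + k) - F t - d * k) * G t + F t * (G (t + k) - G t - d' * k) + (F (t + k) - F t) * (G (t + k) - G t) by ring.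
apply: le_trans (cmD _ _) _; rewrite [leRHS]mulrDl lerD//.
  apply: le_trans (cmD _ _) _; rewrite !cmM [leRHS]mulrDl lerD//.
    by rewrite mulrAC ler_wpM2r ?cm_ge0// h.
  by rewrite -mulrA ler_wpM2l ?cm_ge0// h'.
rewrite cmM; have -> : A * A' * cm k ^+ 2 = (A * cm k) * (A' * cm k) by ring.
by apply: ler_pM; rewrite ?cm_ge0// ?hA// hA'.
Qed.

Lemma hd_cexp z : hd (@cexp R) z (cexp z).
Proof.
exists 1, (expR (re z) * expR 1); split; rewrite ?mulr_ge0 ?expR_ge0// => k hk.
rewrite cexpD; have -> : cexp z * cexp k - cexp z - cexp z * k = cexp z * (cexp k - 1 - k) by ring.
rewrite cmM cm_cexp -mulrA ler_wpM2l ?expR_ge0//.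
by apply: le_trans (cexp_taylor _) _; rewrite mulrC ler_wpM2r ?sqr_ge0// ler_expR.
Qed.

Lemma hd_sq t : hd (fun s => s ^+ 2) t (2 * t).
Proof.
exists 1, 1; split => // k _; have -> : (t + k) ^+ 2 - t ^+ 2 - 2 * t * k = k ^+ 2 by ring.
by rewrite cmX mul1r.
Qed.

Lemma hd_negV t : t != 0 -> hd (fun s => - s^-1) t (t ^+ 2)^-1.
Proof.
move=> t0; have c0 : 0 < cm t by rewrite cm_gt0.
exists (cm t / 2), (2 / cm t ^+ 3); split; [by rewrite divr_gt0|by rewrite divr_ge0 ?exprn_ge0 ?cm_ge0|move=> k hk].
have hl : cm t / 2 <= cm (t + k).
  by have := cmB (t + k) k; rewrite addrK; lra.
have tk : t + k != 0 by rewrite -cm_gt0; apply: lt_le_trans hl; rewrite divr_gt0.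
have -> : - (t + k)^-1 - - t^-1 - (t ^+ 2)^-1 * k = - (k ^+ 2 / (t ^+ 2 * (t + k))) by cfield.
rewrite cmN cmM cmV cmM !cmX mulrC ler_wpM2r ?exprn_ge0 ?cm_ge0//.
have -> : 2 / cm t ^+ 3 = (cm t ^+ 2 * (cm t / 2))^-1 by field; rewrite gt_eqF.
have h2 : 0 < cm t / 2 by rewrite divr_gt0.
rewrite lef_pV2 ?posrE ?mulr_gt0 ?exprn_gt0 ?(lt_le_trans h2 hl)//.
by rewrite ler_pM2l// exprn_gt0.
Qed.

(** Termwise differentiation. The Taylor remainder of the n-th term costs a factor n ^ 2 exp(pi e
    n); descending from height im t to half of it pays for the exponential, and [fD (fD a)] still
    converges there. *)
Lemma hd_PS a F G t : PS a F -> PS (fD a) G -> 0 < im t -> hd F t (rc pi * 'i * G t).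
Proof.
move=> hF hG ht; set e := im t / 2; have e0 : 0 < e by rewrite divr_gt0.
have [_ [B hB]] := cvf_fD (PS_cvf hG) e0.
have B0 : 0 <= B by apply: le_trans (hB 0%N); rewrite big_ord0.
exists e, (pi ^+ 2 * B); split => //; first by rewrite mulr_ge0 ?sqr_ge0.
move=> k hk.
have itk : 0 < im (t + k).
  rewrite imD; have := im_cm k; rewrite ler_norml => /andP[h1 _].
  have : im t = e + e by rewrite /e; field.
  lra.
have h1 := csumsB (csumsB (hF _ itk) (hF _ ht)) (csumsMl (rc pi * 'i * k) (hG _ ht)).
have -> : F (t + k) - F t - rc pi * 'i * G t * k = F (t + k) - F t - rc pi * 'i * k * G t by ring.
apply: (csums_cm (M := fun n => pi ^+ 2 * cm k ^+ 2 * (cm (cf (fD (fD a)) n) * rad e ^+ n)) h1); last first.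
  by move=> n; rewrite -mulr_sumr mulrAC ler_wpM2r ?exprn_ge0 ?cm_ge0// ler_wpM2l ?sqr_ge0.
move=> n; set v : K := rc pi * 'i * k.
have wvD : wv (t + k) = wv t * cexp v.
  rewrite /wv mulrDl e2piD e2piE [e2pi (k / 2)]e2piE; congr (_ * cexp _); rewrite /v; by field.
have -> : cf a n * wv (t + k) ^+ n - cf a n * wv t ^+ n - v * (cf (fD a) n * wv t ^+ n) =
  cf a n * wv t ^+ n * (cexp (n%:R * v) - 1 - n%:R * v).
  by rewrite wvD exprMn cexpMn /=; ring.
have cv : cm v = pi * cm k by rewrite /v !cmM cm_i mulr1 cm_rc ger0_norm ?pi_ge0.
rewrite cmM; apply: le_trans (ler_wpM2l (cm_ge0 _) (cexp_taylor _)) _.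
have cnv : cm (n%:R * v) = n%:R * (pi * cm k) by rewrite cmM cm_nat cv.
rewrite cnv cmM cmX cm_wv -/(rad _).
have -> : cm (cf (fD (fD a)) n) = n%:R * (n%:R * cm (cf a n)) by rewrite /= !cmM !cm_nat.
have hr : expR (n%:R * (pi * cm k)) <= expR (pi * e) ^+ n.
  by rewrite -expRM_natl ler_expR ler_wpM2l// ler_wpM2l// pi_ge0.
have hre : rad (im t) * expR (pi * e) = rad e.
  by rewrite /rad -expRD; congr expR; rewrite /e; field.
apply: (@le_trans _ _ (cm (cf a n) * rad (im t) ^+ n * ((n%:R * (pi * cm k)) ^+ 2 * expR (pi * e) ^+ n))).
  rewrite ler_wpM2l ?mulr_ge0 ?cm_ge0 ?exprn_ge0 ?(ltW (rad_gt0 _))//.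
  by rewrite ler_wpM2l// sqr_ge0.
by rewrite -hre !exprMn le_eqVlt; apply/orP; left; apply/eqP; ring.
Qed.

(* Extends segments to the whole line, where the constancy criterion is available. *)
Definition clamp (x : R) : R := Num.max 0 (Num.min 1 x).

Lemma clamp_mono (u v : R) : u <= v -> 0 <= clamp v - clamp u <= v - u.
Proof.
move=> uv; rewrite /clamp !maxEle !minEle.
have [h1|h1] := leP 1 v; have [h2|h2] := leP 1 u; rewrite ?ler01.
- by rewrite subrr lexx subr_ge0.
- by case: (leP 0 u) => h3; apply/andP; split; lra.
- by exfalso; lra.
- by case: (leP 0 u) => h3; case: (leP 0 v) => h4; apply/andP; split; lra.
Qed.

Lemma clamp_lip (x k : R) : `|clamp (x + k) - clamp x| <= `|k|.
Proof.
have [k0|k0] := leP 0 k.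
  have := @clamp_mono x (x + k); rewrite lerDl k0 addrAC subrr add0r => /(_ isT) /andP[h1 h2].
  by rewrite !ger0_norm.
have := @clamp_mono (x + k) x; rewrite gerDl (ltW k0) => /(_ isT) /andP[h1 h2].
by rewrite distrC ger0_norm// ltr0_norm//; lra.
Qed.

Lemma clamp01 x : 0 <= clamp x <= 1.
Proof. by rewrite /clamp le_max lexx ge_max ler01 ge_min lexx. Qed.

Lemma is_derive0 (g : R -> R) x (e B : R) : 0 < e -> (forall k, `|k| <= e -> `|g (x + k) - g x| <= B * k ^+ 2) ->
  is_derive x (1 : R) g 0.
Proof.
move=> e0 h.
have h0 : (fun k : R => k^-1 *: ((g \o shift x) (k *: (1 : R)) - g x)) @ 0^' --> (0 : R).
  apply/cvgrPdist_le => d d0; near=> k.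
  have k0 : k != 0 by near: k; exact: nbhs_dnbhs_neq.
  rewrite /= sub0r normrN normrM normfV ler_pdivrMl ?normr_gt0// [k *: _]mulr1 (addrC k).
  have ke : `|k| <= e by near: k; exact: dnbhs0_le.
  apply: le_trans (h _ ke) _.
  have hB : `|k| <= d / (`|B| + 1).
    by near: k; apply: dnbhs0_le; rewrite divr_gt0// ltr_wpDl.
  have hB' : `|k| * (`|B| + 1) <= d by rewrite -ler_pdivlMr// ltr_wpDl.
  have k2 : k ^+ 2 = `|k| * `|k| by rewrite -normrM -expr2 ger0_norm ?sqr_ge0.
  have kk : 0 <= `|k| := normr_ge0 _.
  have BB : B <= `|B| := ler_norm _.
  rewrite k2 mulrCA ler_wpM2l//.
  have : B * `|k| <= `|B| * `|k| by rewrite ler_wpM2r.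
  lra.
apply: DeriveDef; first by apply/cvg_ex; exists 0.
by rewrite /derive; apply/cvg_lim.
Unshelve. all: by end_near.
Qed.

Lemma seg_im s t x : 0 < im s -> 0 < im t -> 0 <= x <= 1 -> 0 < im (s + rc x * (t - s)).
Proof.
move=> hs ht /andP[x0 x1]; rewrite imD im_rcM imB.
have [h|h] := leP (im s) (im t).
  by rewrite ltr_pwDl// mulr_ge0// subr_ge0.
have : x * (im s - im t) <= 1 * (im s - im t) by rewrite ler_wpM2r// subr_ge0 ltW.
lra.
Qed.

Lemma hd0_re F s t : (forall u, 0 < im u -> hd F u 0) -> 0 < im s -> 0 < im t -> re (F s) = re (F t).
Proof.
move=> hF hs ht; pose p x := s + rc (clamp x) * (t - s).
have hg (x : R) : is_derive x (1 : R) (fun x => re (F (p x))) 0.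
  have [e [B [e0 B0 h]]] := hF (p x) (seg_im hs ht (clamp01 x)).
  have c1 : 0 < cm (t - s) + 1 by rewrite ltr_wpDl// cm_ge0.
  apply: (@is_derive0 _ _ (e / (cm (t - s) + 1)) (B * (cm (t - s) + 1) ^+ 2)); first by rewrite divr_gt0.
  move=> k; rewrite ler_pdivlMr// => hk.
  set u := p (x + k) - p x.
  have hu : cm u <= `|k| * (cm (t - s) + 1).
    have -> : u = rc (clamp (x + k) - clamp x) * (t - s) by rewrite /u /p rcB; ring.
    rewrite cmM cm_rc; apply: ler_pM; rewrite ?cm_ge0 ?clamp_lip//; lra.
  have := h u (le_trans hu hk); rewrite mul0r subr0.
  have -> : p x + u = p (x + k) by rewrite /u addrC subrK.
  rewrite -reB => h1; apply: le_trans (re_cm _) _; apply: le_trans h1 _.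
  rewrite -mulrA ler_wpM2l//.
  have -> : (cm (t - s) + 1) ^+ 2 * k ^+ 2 = (`|k| * (cm (t - s) + 1)) ^+ 2.
    by rewrite exprMn mulrC real_normK ?num_real.
  by rewrite ler_pXn2r ?nnegrE ?cm_ge0// mulr_ge0// ltW.
have := is_derive_0_is_cst 0 1 hg.
have -> : p 0 = s.
  by rewrite /p (_ : clamp 0 = 0) ?rc0 ?mul0r ?addr0// /clamp (min_idPr _)// maxxx.
suff -> : p 1 = t by [].
rewrite /p (_ : clamp 1 = 1) ?rc1 ?mul1r 1?addrC ?subrK//.
by rewrite /clamp minxx; apply/max_idPr.
Qed.

Lemma hd0_cst F s t : (forall u, 0 < im u -> hd F u 0) -> 0 < im s -> 0 < im t -> F s = F t.
Proof.
move=> hF hs ht.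
have h1 := hd0_re hF hs ht.
have h2 : re ('i * F s) = re ('i * F t).
  apply: (@hd0_re (fun u => 'i * F u)) hs ht => u hu; by have := hd_Z 'i (hF u hu); rewrite mulr0.
apply: c_eq => //; move: h2; rewrite !reM re_i im_i !mul0r !mul1r !sub0r; exact: oppr_inj.
Qed.

(* The logarithm of the Dedekind eta function. *)
Definition leta t : K := rc pi * 'i / 12 * t + Lf (2 * t).

Lemma hd_Lf (d : nat) t : (0 < d)%N -> 0 < im t ->
  hd (fun s => Lf (d%:R * s)) t (- (rc pi * 'i * d%:R * ev (fsig R) (d%:R * t))).
Proof.
move=> d0 ht; have hdt : 0 < im (d%:R * t) by rewrite im_natM mulr_gt0// ltr0n.
have hG : PS (fD (fL R)) (fun t => - ev (fsig R) t).
  by rewrite fD_fL; apply: PS_N; apply: PS_ev; exact: cvf_fsig.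
have := hd_comp (hd_PS (@PS_Lf R) hG hdt) (hd_lin d%:R t).
by rewrite mulrN mulNr; congr hd; ring.
Qed.

Lemma hd_leta t : 0 < im t -> hd leta t (rc pi * 'i / 12 - 2 * rc pi * 'i * ev (fsig R) (2 * t)).
Proof.
move=> ht; have := hd_D (hd_lin (rc pi * 'i / 12) t) (hd_Lf (isT : (0 < 2)%N) ht).
by congr hd; ring.
Qed.

(** Up to a constant this is half a logarithm of t. No branch is chosen: only the derivative is
    computed, and the combinations used below are either constant or exponentiated. *)
Definition leta_cocycle t : K := leta (- t^-1) - leta t.

(** The derivative of [leta] is (pi i / 12) E_2, so what remains is the anomaly of [E2_law]
    multiplied by a constant. *)
Lemma hd_cocycle t : 0 < im t -> hd leta_cocycle t (2 * t)^-1.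
Proof.
move=> ht; have t0 := up_neq0 ht; have ht' := im_negV ht.
have := hd_B (hd_comp (p := fun s => - s^-1) (hd_leta ht') (hd_negV t0)) (hd_leta ht).
have E := E2_law ht (lambert ht) (lambert ht').
suff -> : (rc pi * 'i / 12 - 2 * rc pi * 'i * ev (fsig R) (2 * (- t^-1))) / t ^+ 2 -
  (rc pi * 'i / 12 - 2 * rc pi * 'i * ev (fsig R) (2 * t)) = (2 * t)^-1 by [].
have P0 : rc pi != 0 :> K by rewrite -cm_gt0 cm_rc normr_gt0 gt_eqF// pi_gt0.
have i2 : 'i ^+ 2 = -1 :> K := sqrCi _.
move: E P0; rewrite rcM rcV rc_nat rcX; move: (ev _ _) (ev _ _) (rc pi) => y x P E P0.
have h2 : (2 * P) * ((P * 'i / 12 - 2 * P * 'i * y) / t ^+ 2 - (P * 'i / 12 - 2 * P * 'i * x)) =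
  'i * ((t ^+ 2)^-1 * (- (2 * P) ^+ 2 * y + P ^+ 2 / 6) - (- (2 * P) ^+ 2 * x + P ^+ 2 / 6)).
  by cfield.
apply: (mulfI (_ : 2 * P != 0)); first by rewrite mulf_neq0.
rewrite h2 E opprD addrA subrr sub0r -mulNr.
have -> : 'i * (- (P * 'i) / t) = - 'i ^+ 2 * P / t by ring.
by rewrite i2 opprK; cfield.
Qed.

(* With lambda = theta_2 ^ 4 / theta_3 ^ 4, these are the logarithms, as eta quotients, of
   1 - lambda (lB), lambda / 16 (lA) and theta_3 ^ 4 (lTh). *)
Definition lB t : K := 16 * Lf t + 8 * Lf (4 * t) - 24 * Lf (2 * t).
Definition lA1 t : K := 8 * Lf t + 16 * Lf (4 * t) - 24 * Lf (2 * t).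
Definition lA t : K := rc pi * 'i * t + lA1 t.
Definition lTh t : K := 20 * Lf (2 * t) - 8 * Lf t - 8 * Lf (4 * t).

Lemma leta_half t : leta (t / 2) = rc pi * 'i / 24 * t + Lf t.
Proof.
have -> : leta (t / 2) = rc pi * 'i / 12 * (t / 2) + Lf (2 * (t / 2)) by [].
have -> : 2 * (t / 2) = t by field.
by move: (Lf t) => x; field.
Qed.

Lemma leta_double t : leta (2 * t) = rc pi * 'i / 6 * t + Lf (4 * t).
Proof.
have -> : leta (2 * t) = rc pi * 'i / 12 * (2 * t) + Lf (2 * (2 * t)) by [].
have -> : 2 * (2 * t) = 4 * t by ring.
by move: (Lf (4 * t)) => x; field.
Qed.

Lemma lB_leta t : lB t = 16 * leta (t / 2) + 8 * leta (2 * t) - 24 * leta t.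
Proof. by rewrite leta_half leta_double /leta /lB; move: (rc pi) (Lf t) (Lf (2 * t)) (Lf (4 * t)) => P x y z; field. Qed.

Lemma lA_leta t : lA t = 8 * leta (t / 2) + 16 * leta (2 * t) - 24 * leta t.
Proof. by rewrite leta_half leta_double /leta /lA /lA1; move: (rc pi) (Lf t) (Lf (2 * t)) (Lf (4 * t)) => P x y z; field. Qed.

Lemma lTh_leta t : lTh t = 20 * leta t - 8 * leta (t / 2) - 8 * leta (2 * t).
Proof. by rewrite leta_half leta_double /leta /lTh; move: (rc pi) (Lf t) (Lf (2 * t)) (Lf (4 * t)) => P x y z; field. Qed.

Lemma leta_S t : leta (- t^-1) = leta t + leta_cocycle t.
Proof. by rewrite /leta_cocycle addrC subrK. Qed.

Lemma leta_S2 t : leta (2 * - t^-1) = leta (t / 2) + leta_cocycle (t / 2).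
Proof. by rewrite -leta_S invf_div mulrN. Qed.

Lemma leta_Sh t : leta (- t^-1 / 2) = leta (2 * t) + leta_cocycle (2 * t).
Proof. by rewrite -leta_S invfM mulNr [_^-1 * _]mulrC. Qed.

(** The constant of integration in [lB_S], taken at t = i. Its exponential is found in [cexp_c1]. *)
Definition c1 : K := 16 * leta_cocycle (2 * 'i) + 8 * leta_cocycle ('i / 2) - 24 * leta_cocycle 'i.

Lemma im_half_gt0 t : 0 < im t -> 0 < im (t / 2).
Proof. by move=> ht; rewrite im_divn divr_gt0. Qed.

Lemma im_double_gt0 t : 0 < im t -> 0 < im (2 * t).
Proof. by move=> ht; rewrite im_natM mulr_gt0. Qed.

Lemma hd_cocycle2 t : 0 < im t -> hd (fun s => leta_cocycle (2 * s)) t (2 * t)^-1.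
Proof.
move=> ht; have t0 := up_neq0 ht.
have := hd_comp (p := fun s => 2 * s) (hd_cocycle (im_double_gt0 ht)) (hd_lin 2 t).
by congr hd; cfield.
Qed.

Lemma hd_cocycleh t : 0 < im t -> hd (fun s => leta_cocycle (s / 2)) t (2 * t)^-1.
Proof.
move=> ht; have t0 := up_neq0 ht.
have := hd_comp (p := fun s => 2^-1 * s) (hd_cocycle _) (hd_lin 2^-1 t).
rewrite mulrC => /(_ (im_half_gt0 ht)).
have -> : (2 * (t / 2))^-1 * 2^-1 = (2 * t)^-1 by cfield.
by apply: hd_ext => s; rewrite mulrC.
Qed.

(** S exchanges the points t / 2 and 2 t up to cocycles, hence A and B. The coefficients 16, 8 and -
    24 sum to 0, so the derivatives of the cocycles cancel and a constant is left. *)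
Lemma lB_S t : 0 < im t -> lB (- t^-1) = lA t + c1.
Proof.
move=> ht; pose F s := 16 * leta_cocycle (2 * s) + 8 * leta_cocycle (s / 2) - 24 * leta_cocycle s.
have -> : c1 = F t.
  apply: (@hd0_cst F) => // s hs; have s0 := up_neq0 hs.
  have := hd_B (hd_D (hd_Z 16 (hd_cocycle2 hs)) (hd_Z 8 (hd_cocycleh hs))) (hd_Z 24 (hd_cocycle hs)).
  by congr hd; cfield.
rewrite lB_leta leta_S leta_S2 leta_Sh lA_leta /F.
move: (leta t) (leta (t / 2)) (leta (2 * t)) (leta_cocycle t) (leta_cocycle (t / 2)) (leta_cocycle (2 * t)) => *; ring.
Qed.

Lemma opp_invK t : - (- t^-1)^-1 = t.
Proof. by rewrite invrN opprK invrK. Qed.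

Lemma lA_S t : 0 < im t -> lA (- t^-1) = lB t - c1.
Proof. by move=> ht; have := lB_S (im_negV ht); rewrite opp_invK => ->; rewrite addrK. Qed.

(** Here the coefficients 20, - 8 and - 8 sum to 4, so F has derivative 2 / t and t ^ 2 exp(- F) is
    constant. At the fixed point i of S the function F vanishes, which gives the constant - 1. *)
Lemma cexp_lTh_S t : 0 < im t -> cexp (lTh (- t^-1)) = - t ^+ 2 * cexp (lTh t).
Proof.
move=> ht; pose F s := 20 * leta_cocycle s - 8 * leta_cocycle (s / 2) - 8 * leta_cocycle (2 * s).
have FE s : lTh (- s^-1) = lTh s + F s.
  rewrite !lTh_leta leta_S leta_S2 leta_Sh /F.
  by move: (leta s) (leta (s / 2)) (leta (2 * s)) (leta_cocycle s) (leta_cocycle (s / 2)) (leta_cocycle (2 * s)) => *; ring.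
pose H s := s ^+ 2 * cexp (- F s).
have hF s : 0 < im s -> hd F s (2 / s).
  move=> hs; have s0 := up_neq0 hs.
  have := hd_B (hd_B (hd_Z 20 (hd_cocycle hs)) (hd_Z 8 (hd_cocycleh hs))) (hd_Z 8 (hd_cocycle2 hs)).
  by congr hd; cfield.
have Hi : H 'i = H t.
  apply: hd0_cst => // s hs; have s0 := up_neq0 hs.
  have hN : hd (fun s => - F s) s (- (2 / s)).
    have := hd_Z (-1) (hF s hs); rewrite mulN1r; apply: hd_ext => u; exact: mulN1r.
  have := hd_M (hd_sq s) (hd_comp (p := fun s => - F s) (hd_cexp _) hN).
  by congr hd; move: (cexp _) => e; cfield.
have F0 : F 'i = 0.
  have := FE 'i; have -> : - 'i^-1 = 'i :> K by rewrite invCi opprK.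
  by move=> h; apply: (addrI (lTh 'i)); rewrite addr0.
have t2 : t ^+ 2 = - cexp (F t).
  move: Hi; rewrite /H F0 oppr0 cexp0 mulr1 sqrCi => /esym h.
  apply: (mulIf (cexp_neq0 (- F t))).
  by rewrite h mulNr -cexpD subrr cexp0.
by rewrite FE cexpD t2 opprK mulrC.
Qed.

Lemma lB_T t : 0 < im t -> lB (t + 1) = - lB t.
Proof. by move=> ht; rewrite /lB Lf_T// Lf2_T// Lf4_T//; move: (Lf t) (Lf (2 * t)) (Lf (4 * t)) => *; ring. Qed.

Lemma lA_T t : 0 < im t -> lA (t + 1) = lA t - lB t + rc pi * 'i.
Proof. by move=> ht; rewrite /lA /lA1 /lB Lf_T// Lf2_T// Lf4_T//; move: (Lf t) (Lf (2 * t)) (Lf (4 * t)) => *; ring. Qed.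

Lemma lTh_T t : 0 < im t -> lTh (t + 1) = lTh t + lB t.
Proof. by move=> ht; rewrite /lTh /lB Lf_T// Lf2_T// Lf4_T//; move: (Lf t) (Lf (2 * t)) (Lf (4 * t)) => *; ring. Qed.

(** The power A ^ x B ^ y Th ^ l on the branch fixed by the logarithms. [Psi_T] exchanges y with l -
    x - y and [Psi_S] exchanges x with y, so these three numbers play the part of the orders at the
    three cusps. *)
Definition Psi (x y : K) (l : int) t := cexp (x * lA t + y * lB t + l%:~R * lTh t).

Lemma Psi_neq0 x y l t : Psi x y l t != 0.
Proof. exact: cexp_neq0. Qed.

Lemma PsiD x y l x' y' l' t : Psi x y l t * Psi x' y' l' t = Psi (x + x') (y + y') (l + l') t.
Proof.
rewrite /Psi -cexpD rmorphD; congr cexp.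
by move: (lA t) (lB t) (lTh t) => *; ring.
Qed.

Lemma Psi_T x y l t : 0 < im t ->
  Psi x y l (t + 1) = cexp (x * (rc pi * 'i)) * Psi x (l%:~R - x - y) l t.
Proof.
move=> ht; rewrite /Psi lA_T// lB_T// lTh_T// -cexpD; congr cexp.
by move: (lA t) (lB t) (lTh t) (rc pi) => *; ring.
Qed.

Lemma cexp_intM (l : int) (z : K) : cexp (l%:~R * z) = cexp z ^ l.
Proof.
case: l => n; first by rewrite -pmulrn cexpMn.
by rewrite NegzE rmorphN /= mulNr cexpN -pmulrn cexpMn -exprnN.
Qed.

Lemma PsiE x y l t : Psi x y l t = cexp (x * lA t) * cexp (y * lB t) * cexp (lTh t) ^ l.
Proof. by rewrite /Psi; move: (lA t) (lB t) (lTh t) => *; rewrite !cexpD cexp_intM. Qed.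

Lemma Psi_000 t : Psi 0 0 0 t = 1.
Proof. by rewrite PsiE; move: (lA t) (lB t) => *; rewrite !mul0r !cexp0 !mul1r expr0z. Qed.

Lemma Psi_S x y l t : 0 < im t ->
  Psi x y l (- t^-1) = cexp ((y - x) * c1) * (- t ^+ 2) ^ l * Psi y x l t.
Proof.
move=> ht; have E u : lA u = lB t - c1 -> lB u = lA t + c1 -> cexp (lTh u) = - t ^+ 2 * cexp (lTh t) ->
    Psi x y l u = cexp (x * (lB t - c1)) * cexp (y * (lA t + c1)) * (- t ^+ 2 * cexp (lTh t)) ^ l.
  by rewrite PsiE => h1 h2 h3; congr (cexp (_ * _) * cexp (_ * _) * _ ^ l).
rewrite (E _ (lA_S ht) (lB_S ht) (cexp_lTh_S ht)) PsiE => {E}.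
move: (lA t) (lB t) c1 (cexp (lTh t)) => p q c h; rewrite expfzMl.
have -> : cexp (x * (q - c)) * cexp (y * (p + c)) = cexp ((y - x) * c) * (cexp (y * p) * cexp (x * q)).
  by rewrite -!cexpD; congr cexp; ring.
by rewrite !mulrA; congr (_ * _); rewrite mulrAC; congr (_ * _); rewrite mulrAC.
Qed.

End ComplexDerivative.

(** * A vanishing theorem in weight -2 *)

Section Principle.
Variable R : realType.
Local Notation K := (C R).
Local Notation pi := (pi : R).
Implicit Types (a b : fps R) (F G : K -> K) (s t d : K).

Lemma im_int (n : int) : im (n%:~R : K) = 0.
Proof. by case: n => n; rewrite ?NegzE ?rmorphN ?imN /= im_nat ?oppr0. Qed.

Lemma re_int (n : int) : re (n%:~R : K) = n%:~R.
Proof. by case: n => n; rewrite ?NegzE ?rmorphN ?reN /= re_nat. Qed.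

Lemma im_addZ t (n : int) : im (t + n%:~R) = im t.
Proof. by rewrite imD im_int addr0. Qed.

Lemma im_add1 t : im (t + 1) = im t.
Proof. exact: (im_addZ t 1). Qed.

Lemma im_sub1 t : im (t - 1) = im t.
Proof. exact: (im_addZ t (-1)). Qed.

Lemma sum_unity (N : nat) (z : K) : z ^+ N = 1 -> z != 1 -> \sum_(j < N) z ^+ j = 0.
Proof.
move=> h1 h; have := subrX1 z N; rewrite h1 subrr => /esym/eqP.
by rewrite mulf_eq0 subr_eq0 (negbTE h) => /eqP.
Qed.

Lemma mod_small_neq (a b N : nat) (m : int) : (a < N)%N -> (b < N)%N -> a <> b ->
  (a : int) - (b : int) = m * (N : int) -> False.
Proof. by case: m => [[|m]|m]; nia. Qed.

(* The contour integral is replaced by averages over N equally spaced points. *)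
Lemma cauchy_estimate a F (y M : R) : PS a F -> 0 < y -> (forall t, im t = y -> cm (F t) <= M) ->
  forall n, cm (cf a n) * rad y ^+ n <= M.
Proof.
move=> hF y0 hM n; apply/ler_addgt0Pr => e e0.
have [N0 hN] := rbnd_tail (PS_cvf hF y0) e0.
(* N exceeds n so that the average over N points isolates the n-th coefficient of the partial sum P,
   and exceeds N0 so that P is within e of F. *)
pose N := (maxn N0 n.+1).
have NN : (N0 <= N)%N by exact: leq_maxl.
have nN : (n < N)%N by exact: leq_maxr.
have N0' : (N%:R : K) != 0 by rewrite pnatr_eq0 -lt0n (leq_trans _ nN).
pose P t := \sum_(i < N) cf a i * wv t ^+ i.
have hP t : im t = y -> cm (P t) <= M + e.
  move=> it; have ht : 0 < im t by rewrite it.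
  have -> : P t = F t - (F t - P t) by ring.
  apply: le_trans (cmB _ _) _; rewrite lerD ?hM//.
  have h := ctendsB ((ctends_shift _ _ N).2 (hF t ht)) (ctends_cst (P t)).
  apply: (ctends_cm h) => m; rewrite addnC.
  rewrite big_split_ord /= /P addrAC subrr add0r; apply: le_trans (cm_sum _ _ _) _.
  have := hN N (N + m)%N NN (leq_addr _ _); rewrite big_split_ord /= addrAC subrr add0r => /ltW.
  by apply: le_trans; apply: ler_sum => i _; apply: cvf_dom; rewrite it.
pose t0 : K := 'i * rc y.
have it0 : im t0 = y by rewrite /t0 mulrC im_rcM im_i mulr1.
pose tj (j : nat) : K := t0 + 2 * (j%:R / N%:R).
have itj j : im (tj j) = y.
  by rewrite /tj imD it0 im_natM im_divn im_nat mul0r mulr0 addr0.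
have wtj j : wv (tj j) = wv t0 * e2pi (j%:R / N%:R).
  by rewrite /wv -e2piD; congr e2pi; rewrite /tj; cfield.
pose z j : K := e2pi (- (n%:R * (j%:R / N%:R))).
have zP (j : nat) : P (tj j) * z j = \sum_(i < N) cf a i * wv t0 ^+ i * e2pi ((i%:R - n%:R) / N%:R) ^+ j.
  rewrite mulr_suml; apply: eq_bigr => i _; rewrite wtj.
  have -> : e2pi ((i%:R - n%:R) / N%:R) ^+ j = e2pi (j%:R / N%:R) ^+ i * z j.
    by rewrite -!e2piMn /z -e2piD; congr e2pi; cfield.
  by move: (wv t0) (e2pi _) (z j) => p q r; rewrite exprMn; ring.
have hsum : \sum_(j < N) P (tj j) * z j = N%:R * (cf a n * wv t0 ^+ n).
  under eq_bigr do rewrite zP.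
  rewrite exchange_big /= (bigD1 (Ordinal nN)) //= [X in _ + X]big1 ?addr0.
    rewrite subrr mul0r e2pi0; under eq_bigr do rewrite expr1n mulr1.
    by rewrite sumr_const card_ord mulr_natl.
  move=> i hi; rewrite -mulr_sumr sum_unity ?mulr0//.
    rewrite -e2piMn mulrC divfK//.
    by rewrite e2piB !e2pi_nat divr1.
  apply/eqP => /e2pi_eq1 [m hm].
  have hm' : (i%:R - n%:R : K) = m%:~R * N%:R by rewrite -hm divfK.
  have : (i : int) - (n : int) = m * (N : int).
    apply: (@intr_inj K); rewrite rmorphB rmorphM /=; exact: hm'.
  have h1 := ltn_ord i; have : (i : nat) <> n by move=> h2; case/eqP: hi; apply: val_inj.
  exact: mod_small_neq h1 nN.
have : N%:R * (cm (cf a n) * rad y ^+ n) <= N%:R * (M + e).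
  have -> : N%:R * (cm (cf a n) * rad y ^+ n) = cm (N%:R * (cf a n * wv t0 ^+ n)).
    by rewrite !cmM cmX cm_wv cm_nat it0.
  rewrite -hsum; apply: le_trans (cm_sum _ _ _) _.
  rewrite -[in leRHS](card_ord N) mulr_natl -sumr_const; apply: ler_sum => j _.
  by rewrite cmM cm_e2pi imN im_natM im_divn im_nat mul0r mulr0 oppr0 mulr0 oppr0 expR0 mulr1 hP.
by rewrite ler_pM2l// ltr0n (leq_trans _ nN).
Qed.

(* the action of weight -2 of S = [0, -1; 1, 0] *)
Definition slS F t : K := t ^+ 2 * F (- t^-1).
Definition shT F t : K := F (t + 1).

Definition strip_bounded F := exists B : R, forall t, `|re t| <= 2^-1 -> 2^-1 <= im t -> cm (F t) <= B.

(** One function for each of the six cosets of Gamma(2) in SL_2(Z). *)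
Definition slash_orbit F : seq (K -> K) := [:: F; shT F; slS F; shT (slS F); slS (shT F); slS (shT (slS F))].

(* Summing |G| / im over the orbit of F under SL_2(Z), which is finite modulo Gamma(2),
   gives a function invariant under SL_2(Z). *)
Definition wt (F : K -> K) t : R := \sum_(G <- slash_orbit F) cm (G t) / im t.

Lemma wtE F t : wt F t = (cm (F t) + cm (shT F t) + cm (slS F t) + cm (shT (slS F) t) +
   cm (slS (shT F) t) + cm (slS (shT (slS F)) t)) / im t.
Proof. by rewrite /wt !big_cons big_nil addr0 !mulrDl !addrA. Qed.

Lemma slSK F t : 0 < im t -> slS (slS F) t = F t.
Proof.
by move=> /up_neq0 t0; rewrite /slS opp_invK; move: (F t) => x; cfield.
Qed.

Lemma cm_slS F t : 0 < im t -> cm (F (- t^-1)) / im (- t^-1) = cm (slS F t) / im t.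
Proof.
move=> ht; have t0 : 0 < cm t by rewrite cm_gt0 up_neq0.
rewrite imN imV mulNr opprK cmM cmX; move: (cm (F _)) => x.
by field; rewrite !gt_eqF.
Qed.

Section Invariance.
Variable F : K -> K.
Hypothesis F2 : forall t, 0 < im t -> F (t + 2) = F t.
Hypothesis S2 : forall t, 0 < im t -> slS F (t + 2) = slS F t.

(** The relation T S T = S T ^ -1 S of PSL_2(Z), where T ^ -1 may be replaced by T because [slS F]
    has period 2. *)
Lemma slS_shT_T t : 0 < im t -> slS (shT F) (t + 1) = slS (shT (slS F)) t.
Proof.
move=> ht; have t0 := up_neq0 ht.
have ht1 : 0 < im (t + 1) by rewrite im_add1.
have t1 := up_neq0 ht1.
have h1 : 0 < im (- t^-1 - 1) by rewrite im_sub1 im_negV.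
have := S2 h1; rewrite {2}/slS.
have -> : - t^-1 - 1 + 2 = - t^-1 + 1 by ring.
rewrite /shT /slS /= => ->.
have -> : - (- t^-1 - 1)^-1 = - (t + 1)^-1 + 1.
  have -> : - t^-1 - 1 = - ((t + 1) / t) by cfield.
  by rewrite invrN opprK invf_div; cfield.
by move: (F _) => x; cfield.
Qed.

Lemma slS_shT_slS_T t : 0 < im t -> slS (shT (slS F)) (t + 1) = slS (shT F) t.
Proof.
move=> ht; have t0 := up_neq0 ht.
have ht1 : 0 < im (t + 1) by rewrite im_add1.
have t1 := up_neq0 ht1.
have h1 : 0 < im (- t^-1 - 1) by rewrite im_sub1 im_negV.
have e0 : - (t + 1)^-1 + 1 = t / (t + 1) by cfield.
have e1 : - (- (t + 1)^-1 + 1)^-1 = - t^-1 - 1 by rewrite e0; field; rewrite t0 t1.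
rewrite /shT /slS e1 e0 -(F2 h1).
have -> : - t^-1 - 1 + 2 = - t^-1 + 1 by ring.
by move: (F _) => x; cfield.
Qed.

Lemma wt_T t : 0 < im t -> wt F (t + 1) = wt F t.
Proof.
move=> ht; rewrite !wtE slS_shT_T// slS_shT_slS_T// im_add1 /shT.
have -> : t + 1 + 1 = t + 2 by ring.
by rewrite F2// S2//; ring.
Qed.

Lemma wt_S t : 0 < im t -> wt F (- t^-1) = wt F t.
Proof.
move=> ht; rewrite !wtE !mulrDl !cm_slS// !slSK//.
move: (cm (slS F t) / im t) (cm (slS (shT F) t) / im t) (cm (F t) / im t) (cm (slS (shT (slS F)) t) / im t)
  (cm (shT F t) / im t) (cm (shT (slS F) t) / im t) => *; ring.
Qed.

Lemma wt_Zn t (n : nat) : 0 < im t -> wt F (t + n%:R) = wt F t.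
Proof.
move=> ht; elim: n => [|n IH]; first by rewrite addr0.
by rewrite -natr1 addrA wt_T// imD im_nat addr0.
Qed.

Lemma wt_Z t (n : int) : 0 < im t -> wt F (t + n%:~R) = wt F t.
Proof.
move=> ht; case: n => n; first exact: wt_Zn.
rewrite NegzE rmorphN /=.
have h : 0 < im (t - n.+1%:R) by rewrite imB im_nat subr0.
by rewrite -[in RHS](subrK n.+1%:R t) wt_Zn.
Qed.

(** A crude reduction theory: once |re t| <= 1/2, a point of height below 1/2 has |t| ^ 2 <= 1/2, so
    S at least doubles its height. Finitely many steps lead into the region where the bound is
    assumed. *)
Lemma wt_bounded (B : R) :
  (forall t, `|re t| <= 2^-1 -> 2^-1 <= im t -> wt F t <= B) -> forall t, 0 < im t -> wt F t <= B.
Proof.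
move=> hB; have shift t : 0 < im t -> exists n : int, `|re (t + n%:~R)| <= 2^-1.
  move=> _; exists (- Num.floor (re t + 2^-1)).
  have /andP[h1 h2] := floor_itv (re t + 2^-1).
  by rewrite reD re_int ler_norml rmorphN /=; move: h1 h2; rewrite intrD; lra.
have key k t : 2^-1 / 2 ^+ k <= im t -> wt F t <= B.
  elim: k t => [|k IH] t hk.
    have ht : 0 < im t by apply: lt_le_trans hk; rewrite expr0 divr1 invr_gt0.
    have [n hn] := shift t ht; rewrite -(wt_Z n ht); apply: hB => //.
    by move: hk; rewrite expr0 divr1 im_addZ.
  have ht : 0 < im t by apply: lt_le_trans hk; rewrite divr_gt0.
  have [n hn] := shift t ht; rewrite -(wt_Z n ht).
  have hn' := im_addZ t n.
  move: (t + n%:~R) hn hn' => u hu hu'; rewrite -hu' in hk ht.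
  have [h|h] := leP 2^-1 (im u); first exact: hB.
  rewrite -wt_S//; apply: IH.
  rewrite imN imV mulNr opprK cm2.
  have r2 : re u ^+ 2 <= 2^-1 ^+ 2.
    by rewrite -real_normK ?num_real// ler_pXn2r ?nnegrE.
  have h2 : 2 * im u <= im u / (re u ^+ 2 + im u ^+ 2).
    rewrite ler_pdivlMr; last by rewrite ltr_wpDl ?sqr_ge0// exprn_gt0.
    nra.
  apply: le_trans h2; move: hk; rewrite exprS invfM mulrCA; lra.
move=> t ht; apply: (key (Num.bound (im t)^-1)).
have h1 : (im t)^-1 < (Num.bound (im t)^-1)%:R by apply: archi_boundP; rewrite invr_ge0 ltW.
move: (Num.bound _) h1 => k h1.
have h2 : (im t)^-1 < 2 ^+ k.
  by apply: lt_le_trans h1 _; rewrite -natrX ler_nat ltnW// ltn_expl.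
have h3 : (2 ^+ k)^-1 < im t by rewrite invf_plt ?posrE ?exprn_gt0.
lra.
Qed.

End Invariance.

Lemma PS_2 a F t : PS a F -> 0 < im t -> F (t + 2) = F t.
Proof.
move=> hF ht; have ht2 : 0 < im (t + 2) by rewrite (im_addZ t 2).
have := hF _ ht2; have -> : wv (t + 2) = wv t; last by move=> h; exact: csums_uniq h (hF t ht).
have -> : t + 2 = t + 1 + 1 by ring.
by rewrite !wv1 opprK.
Qed.

(* Invariance under SL_2(Z) makes [wt F] bounded everywhere, so that F is O(im t) as t
   approaches the real line; the Cauchy estimates then kill every coefficient. *)
Theorem weight_m2_eq0 a F : PS a F -> (forall t, 0 < im t -> slS F (t + 2) = slS F t) ->
  (forall i, (i < 6)%N -> strip_bounded (nth F (slash_orbit F) i)) -> forall t, 0 < im t -> F t = 0.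
Proof.
move=> hF S2 hb.
have F2 t : 0 < im t -> F (t + 2) = F t by exact: PS_2 hF.
have [B hB] : exists B, forall t, `|re t| <= 2^-1 -> 2^-1 <= im t -> wt F t <= B.
  have [B0 h0] := hb 0%N isT; have [B1 h1] := hb 1%N isT; have [B2 h2] := hb 2%N isT.
  have [B3 h3] := hb 3%N isT; have [B4 h4] := hb 4%N isT; have [B5 h5] := hb 5%N isT.
  exists ((B0 + B1 + B2 + B3 + B4 + B5) * 2) => t hr hi.
  have ht : 0 < im t by apply: lt_le_trans hi; rewrite invr_gt0.
  rewrite wtE ler_pdivrMr//.
  have hs := lerD (lerD (lerD (lerD (lerD (h0 t hr hi) (h1 t hr hi)) (h2 t hr hi)) (h3 t hr hi)) (h4 t hr hi)) (h5 t hr hi).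
  apply: le_trans hs _.
  have Bs : 0 <= B0 + B1 + B2 + B3 + B4 + B5.
    by rewrite !addr_ge0// (le_trans (cm_ge0 _) (h0 t hr hi), le_trans (cm_ge0 _) (h1 t hr hi), le_trans (cm_ge0 _) (h2 t hr hi),
      le_trans (cm_ge0 _) (h3 t hr hi), le_trans (cm_ge0 _) (h4 t hr hi), le_trans (cm_ge0 _) (h5 t hr hi)).
  rewrite -mulrA ler_peMr//; lra.
have hw := wt_bounded F2 S2 hB.
have hFB t : 0 < im t -> cm (F t) <= B * im t.
  move=> ht; apply: le_trans (_ : wt F t * im t <= _); last by rewrite ler_wpM2r ?hw// ltW.
  rewrite wtE divfK ?gt_eqF// -!addrA lerDl !addr_ge0 ?cm_ge0//.
have i1 : 0 < im ('i : K) by rewrite im_i.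
have B0 : 0 <= B by have := hFB 'i i1; rewrite im_i mulr1; apply: le_trans; exact: cm_ge0.
suff a0 : a = 0 by move=> t ht; rewrite a0 in hF; exact: (PS_fun hF (@PS_0 R) ht).
apply: fps_ext => n; rewrite cf0; apply/eqP; rewrite -cm_eq0 eq_le cm_ge0 andbT leNgt; apply/negP => c0.
set c := cm (cf a n) in c0; pose r := rad (1 : R) ^+ n.
have r0 : 0 < r by rewrite exprn_gt0// rad_gt0.
(* The estimate at any height y <= 1 implies c r <= B y; this y is too small for that. *)
pose y := Num.min 1 (c * r / (2 * (B + 1))).
have B1 : 0 < 2 * (B + 1) by lra.
have cr : 0 < c * r by rewrite mulr_gt0.
have y0 : 0 < y by rewrite lt_min ltr01 divr_gt0.
have h : c * rad y ^+ n <= B * y.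
  by apply: (cauchy_estimate hF y0) => t it; rewrite -it hFB// it.
have h1 : c * r <= c * rad y ^+ n.
  by rewrite ler_pM2l// /r lerXn2r ?nnegrE ?(ltW (rad_gt0 _))// le_rad// ge_min lexx.
have h2 : y * (2 * (B + 1)) <= c * r by rewrite -ler_pdivlMr// ge_min lexx orbT.
nra.
Qed.

End Principle.

(** * Forms of level two as combinations of modular units *)

Section Structure.
Variable R : realType.
Local Notation K := (C R).
Local Notation pi := (pi : R).
Implicit Types (a b : fps R) (F G : K -> K) (s t d : K).

Definition fA1 : fps R := fC 8 * fL R + fC 16 * fdil 4 (fL R) - fC 24 * fdil 2 (fL R).
Definition fB : fps R := fC 16 * fL R + fC 8 * fdil 4 (fL R) - fC 24 * fdil 2 (fL R).
Definition fTh : fps R := fC 20 * fdil 2 (fL R) - fC 8 * fL R - fC 8 * fdil 4 (fL R).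

Lemma PS_lA1 : PS fA1 (@lA1 R).
Proof.
have h1 := @PS_Lf R; have h2 := @PS_Lf_dil R 2 isT; have h4 := @PS_Lf_dil R 4 isT.
exact: PS_B (PS_D (PS_Z 8 h1) (PS_Z 16 h4)) (PS_Z 24 h2).
Qed.

Lemma PS_lB : PS fB (@lB R).
Proof.
have h1 := @PS_Lf R; have h2 := @PS_Lf_dil R 2 isT; have h4 := @PS_Lf_dil R 4 isT.
exact: PS_B (PS_D (PS_Z 16 h1) (PS_Z 8 h4)) (PS_Z 24 h2).
Qed.

Lemma PS_lTh : PS fTh (@lTh R).
Proof.
have h1 := @PS_Lf R; have h2 := @PS_Lf_dil R 2 isT; have h4 := @PS_Lf_dil R 4 isT.
exact: PS_B (PS_B (PS_Z 20 h2) (PS_Z 8 h1)) (PS_Z 8 h4).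
Qed.

Lemma cf_fdil0 (d : nat) a : (0 < d)%N -> cf a 0 = 0 -> cf (fdil d a) 0 = 0.
Proof. by move=> d0; rewrite /= dvdn0 div0n. Qed.

Lemma cf_fA10 : cf fA1 0 = 0.
Proof. by rewrite cfB cfD !cf_fC !cf_fdil0 ?cf_fL0// !mulr0 addr0 subrr. Qed.
Lemma cf_fB0 : cf fB 0 = 0.
Proof. by rewrite cfB cfD !cf_fC !cf_fdil0 ?cf_fL0// !mulr0 addr0 subrr. Qed.
Lemma cf_fTh0 : cf fTh 0 = 0.
Proof. by rewrite !cfB !cf_fC !cf_fdil0 ?cf_fL0// !mulr0 !subrr. Qed.

Definition fPsi (x y : K) (l : int) : fps R := fexp (fC x * fA1 + fC y * fB + fC l%:~R * fTh).
(** [Psi] without the factor exp(pi i x t), so that a power series in w remains even when x is not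
    an integer. *)
Definition Psi0 (x y : K) (l : int) t : K := cexp (x * lA1 t + y * lB t + l%:~R * lTh t).

Lemma cf_logPsi0 (x y : K) (l : int) : cf (fC x * fA1 + fC y * fB + fC l%:~R * fTh) 0 = 0.
Proof. by rewrite !cfD !cf_fC cf_fA10 cf_fB0 cf_fTh0 !mulr0 !addr0. Qed.

Lemma PS_logPsi (x y : K) (l : int) :
  PS (fC x * fA1 + fC y * fB + fC l%:~R * fTh) (fun t => x * lA1 t + y * lB t + l%:~R * lTh t).
Proof. exact: PS_D (PS_D (PS_Z x PS_lA1) (PS_Z y PS_lB)) (PS_Z l%:~R PS_lTh). Qed.

Lemma PS_Psi0 x y l : PS (fPsi x y l) (Psi0 x y l).
Proof. exact: PS_fexp (PS_logPsi x y l) (cf_logPsi0 x y l). Qed.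

Lemma wv_cexp t : cexp (rc pi * 'i * t) = wv t.
Proof. by rewrite /wv e2piE; congr cexp; move: (rc pi) => P; field. Qed.

Lemma Psi_Psi0 x y l t : Psi x y l t = cexp (x * (rc pi * 'i * t)) * Psi0 x y l t.
Proof.
rewrite /Psi /Psi0 -cexpD; congr cexp; rewrite /lA.
by move: (lA1 t) (lB t) (lTh t) (rc pi) => *; ring.
Qed.

Lemma strip_bounded_PS a F : PS a F -> strip_bounded F.
Proof.
move=> h; have [B _ hB] := PS_bounded h (y := 2^-1) ltac:(by rewrite invr_gt0).
by exists B => t _; exact: hB.
Qed.

Lemma strip_boundedM F G : strip_bounded F -> strip_bounded G -> strip_bounded (fun t => F t * G t).
Proof.
move=> [B hB] [B' hB']; exists (B * B') => t h1 h2; rewrite cmM.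
by apply: ler_pM; rewrite ?cm_ge0// ?hB// hB'.
Qed.

Lemma strip_boundedD F G : strip_bounded F -> strip_bounded G -> strip_bounded (fun t => F t + G t).
Proof.
move=> [B hB] [B' hB']; exists (B + B') => t h1 h2.
by apply: le_trans (cmD _ _) _; rewrite lerD// ?hB// hB'.
Qed.

Lemma strip_bounded_cst (c : K) : strip_bounded (fun=> c).
Proof. by exists (cm c). Qed.

Lemma strip_boundedZ (c : K) F : strip_bounded F -> strip_bounded (fun t => c * F t).
Proof. exact: strip_boundedM (strip_bounded_cst c). Qed.

Lemma strip_bounded_sum (I : Type) (r : seq I) (F : I -> K -> K) : (forall i, strip_bounded (F i)) ->
  strip_bounded (fun t => \sum_(i <- r) F i t).
Proof.
move=> h; elim: r => [|i r IH].
  by exists 0 => t _ _; rewrite big_nil cm0.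
have [B hB] := strip_boundedD (h i) IH; exists B => t h1 h2; rewrite big_cons; exact: hB.
Qed.

Lemma strip_bounded_ext F G : (forall t, 0 < im t -> F t = G t) -> strip_bounded F -> strip_bounded G.
Proof.
move=> h [B hB]; exists B => t h1 h2; rewrite -h ?hB//.
by apply: lt_le_trans h2; rewrite invr_gt0.
Qed.

(** The leading factor has modulus exp(- pi (re x im t + im x re t)). For nonreal x it is unbounded
    on horizontal lines, hence bounds are only asked on a vertical strip. *)
Lemma strip_bounded_Psi (x y : K) l : 0 <= re x -> strip_bounded (Psi x y l).
Proof.
move=> hx; apply: (@strip_bounded_ext (fun t => cexp (x * (rc pi * 'i * t)) * Psi0 x y l t)).
  by move=> t _; rewrite -Psi_Psi0.
apply: strip_boundedM (strip_bounded_PS (PS_Psi0 x y l)).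
exists (expR (pi * `|im x|)) => t h1 h2; rewrite cm_cexp ler_expR.
have -> : re (x * (rc pi * 'i * t)) = - pi * (re x * im t + im x * re t).
  have -> : x * (rc pi * 'i * t) = rc pi * (x * ('i * t)) by move: (rc pi) => P; ring.
  by rewrite re_rcM 2!reM imM re_i im_i; ring.
have t0 : 0 <= im t by apply: le_trans h2; rewrite invr_ge0.
rewrite mulNr -mulrN ler_pM2l ?pi_gt0// opprD.
have h3 : `|im x * re t| <= `|im x|.
  by rewrite normrM ler_piMr// (le_trans h1)// invf_le1// ler1n.
have h4 := mulr_ge0 hx t0.
by move: h3; rewrite ler_norml => /andP[h3 _]; lra.
Qed.

(* the action of weight 2 l of S *)
Definition slk (l : int) F t : K := (t ^+ 2) ^ (- l) * F (- t^-1).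

(** A form of weight 2 l times a [Psi] of weight - 2 l - 2 lands in weight - 2; the powers of t
    recombine accordingly. *)
Lemma slS_MPsi F (x y : K) l t : 0 < im t ->
  slS (fun t => F t * Psi x y (- l - 1) t) t = (-1) ^ (- l - 1) * cexp ((y - x) * c1 R) * (slk l F t * Psi y x (- l - 1) t).
Proof.
move=> ht; have t0 := up_neq0 ht; rewrite /slS /slk Psi_S//.
move: (F _) (cexp _) (Psi _ _ _ _) => f e P.
have t2 : t ^+ 2 != 0 by rewrite expf_neq0.
have -> : (- t ^+ 2) ^ (- l - 1) = (-1) ^ (- l - 1) * ((t ^+ 2) ^ (- l) / t ^+ 2).
  by rewrite -[- t ^+ 2]mulN1r expfzMl; congr (_ * _); rewrite expfzDr// exprN1.
by move: (_ ^ (- l - 1)) (_ ^ (- l)) => u v; cfield.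
Qed.

Lemma shT_MPsi F (x y : K) l t : 0 < im t ->
  shT (fun t => F t * Psi x y (- l - 1) t) t = cexp (x * (rc pi * 'i)) * (shT F t * Psi x ((- l - 1)%:~R - x - y) (- l - 1) t).
Proof.
by move=> ht; rewrite /shT Psi_T//; move: (F _) (cexp _) (Psi _ _ _ _) => *; ring.
Qed.

Lemma eq_slS F G t : (forall t, 0 < im t -> F t = G t) -> 0 < im t -> slS F t = slS G t.
Proof. by move=> h ht; rewrite /slS h// im_negV. Qed.

Lemma eq_shT F G t : (forall t, 0 < im t -> F t = G t) -> 0 < im t -> shT F t = shT G t.
Proof. by move=> h ht; rewrite /shT h// im_add1. Qed.

Lemma slSZ (c : K) F t : slS (fun t => c * F t) t = c * slS F t.
Proof. by rewrite /slS mulrCA. Qed.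

Lemma shTZ (c : K) F t : shT (fun t => c * F t) t = c * shT F t.
Proof. by []. Qed.

(** The four members of the orbit that involve S. The other two, F and [shT F], are bounded as soon
    as F is a power series in w. *)
Definition slk_bounded l F := [/\ strip_bounded (slk l F), strip_bounded (shT (slk l F)),
  strip_bounded (slk l (shT F)) & strip_bounded (slk l (shT (slk l F)))].

Definition slS_bounded G := [/\ strip_bounded (slS G), strip_bounded (shT (slS G)),
  strip_bounded (slS (shT G)) & strip_bounded (slS (shT (slS G)))].

(** After S and T the exponent of A in the [Psi] factor is y or - l - 1 - x - y; these two must have
    nonnegative real part. *)
Lemma slS_bounded_MPsi F (x y : K) l : slk_bounded l F -> 0 <= re y -> 0 <= re ((- l - 1)%:~R - x - y) ->
  slS_bounded (fun t => F t * Psi x y (- l - 1) t).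
Proof.
move=> [h1 h2 h3 h4] hy hz; set z := (- l - 1)%:~R - x - y in hz.
have hz' : (- l - 1)%:~R - y - x = z by rewrite addrAC.
pose cS (u v : K) : K := (-1) ^ (- l - 1) * cexp ((v - u) * c1 R).
pose cT (u : K) : K := cexp (u * (rc pi * 'i)).
have EST t : 0 < im t -> shT (slS (fun t => F t * Psi x y (- l - 1) t)) t =
    cS x y * (cT y * (shT (slk l F) t * Psi y z (- l - 1) t)).
  move=> ht; rewrite (@eq_shT _ (fun t => cS x y * (slk l F t * Psi y x (- l - 1) t)) t _ ht).
    by rewrite shTZ shT_MPsi// hz'.
  by move=> u hu; exact: slS_MPsi.
split.
- apply: (@strip_bounded_ext (fun t => cS x y * (slk l F t * Psi y x (- l - 1) t))).
    by move=> t ht; rewrite slS_MPsi.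
  exact: strip_boundedZ (strip_boundedM h1 (strip_bounded_Psi _ _ hy)).
- apply: (@strip_bounded_ext (fun t => cS x y * (cT y * (shT (slk l F) t * Psi y z (- l - 1) t)))).
    by move=> t ht; rewrite EST.
  exact: strip_boundedZ (strip_boundedZ _ (strip_boundedM h2 (strip_bounded_Psi _ _ hy))).
- apply: (@strip_bounded_ext (fun t => cT x * (cS x z * (slk l (shT F) t * Psi z x (- l - 1) t)))).
    move=> t ht; rewrite (@eq_slS (shT _) (fun t => cT x * (shT F t * Psi x z (- l - 1) t)) t _ ht).
      by rewrite slSZ slS_MPsi.
    by move=> u hu; exact: shT_MPsi.
  exact: strip_boundedZ (strip_boundedZ _ (strip_boundedM h3 (strip_bounded_Psi _ _ hz))).
- apply: (@strip_bounded_ext (fun t => cS x y * (cT y * (cS y z * (slk l (shT (slk l F)) t * Psi z y (- l - 1) t))))).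
    move=> t ht; rewrite (@eq_slS (shT _) _ t EST ht).
    by rewrite !slSZ slS_MPsi.
  exact: strip_boundedZ (strip_boundedZ _ (strip_boundedZ _ (strip_boundedM h4 (strip_bounded_Psi _ _ hz)))).
Qed.

Lemma slS_boundedD F G : slS_bounded F -> slS_bounded G -> slS_bounded (fun t => F t + G t).
Proof.
move=> [h1 h2 h3 h4] [g1 g2 g3 g4].
have E H H' t : slS (fun t => H t + H' t) t = slS H t + slS H' t by rewrite /slS mulrDr.
have E2 : slS (fun t => F t + G t) = fun t => slS F t + slS G t by apply/funext => t; exact: E.
split.
- by rewrite E2; exact: strip_boundedD.
- by rewrite E2; exact: strip_boundedD h2 g2.
- apply: strip_bounded_ext (strip_boundedD h3 g3) => t _; rewrite -E //.
- rewrite E2; apply: strip_bounded_ext (strip_boundedD h4 g4) => t _; rewrite -E //.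
Qed.

Lemma slS_boundedZ (c : K) F : slS_bounded F -> slS_bounded (fun t => c * F t).
Proof.
move=> [h1 h2 h3 h4].
have E2 H : slS (fun t => c * H t) = fun t => c * slS H t by apply/funext => t; exact: slSZ.
have E3 H : shT (fun t => c * H t) = fun t => c * shT H t by [].
by split; rewrite ?(E3, E2); exact: strip_boundedZ.
Qed.

Lemma slS_bounded_sum (I : Type) (r : seq I) (F : I -> K -> K) : (forall i, slS_bounded (F i)) ->
  slS_bounded (fun t => \sum_(i <- r) F i t).
Proof.
move=> h; elim: r => [|i r IH].
  have -> : (fun t => \sum_(i <- [::]) F i t) = fun t => 0 * (0 : K) by apply/funext => t; rewrite big_nil mul0r.
  apply: slS_boundedZ; split; exists 0 => t _ _; rewrite /shT /slS ?mulr0 cm0 //.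
have -> : (fun t => \sum_(j <- i :: r) F j t) = fun t => F i t + \sum_(j <- r) F j t.
  by apply/funext => t; rewrite big_cons.
exact: slS_boundedD.
Qed.

Lemma strip_bounded_shT a F : PS a F -> strip_bounded (shT F).
Proof. by move=> h; exact: strip_bounded_PS (PS_T h). Qed.

Lemma weight_m2_bounded_eq0 a G : PS a G -> (forall t, 0 < im t -> slS G (t + 2) = slS G t) -> slS_bounded G ->
  forall t, 0 < im t -> G t = 0.
Proof.
move=> hG S2 [h1 h2 h3 h4]; apply: (weight_m2_eq0 hG S2).
case=> [|[|[|[|[|[|//]]]]]] _ //=; first exact: strip_bounded_PS hG.
exact: strip_bounded_shT hG.
Qed.

Lemma slS_Psi (x y : K) t : 0 < im t -> slS (Psi x y (-1)) t = - (cexp ((y - x) * c1 R) * Psi y x (-1) t).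
Proof.
move=> ht; have t0 := up_neq0 ht; rewrite /slS Psi_S// exprN1.
by move: (cexp _) (Psi _ _ _ _) => *; cfield.
Qed.

(* (B - 1 + exp(c1) A) / (A B Th), a form of weight -2 for the group generated by
   S and T ^ 2; it vanishes, which is the relation A + B = 1 up to normalization. *)
Definition relAB (t : K) : K := 1 * Psi (-1) 0 (-1) t + -1 * Psi (-1) (-1) (-1) t + cexp (c1 R) * Psi 0 (-1) (-1) t.

Lemma Psi_m1 (y : K) l t : Psi (-1) y l t = Psi0 (-1) y l t / wv t.
Proof. by rewrite Psi_Psi0 mulN1r cexpN wv_cexp mulrC. Qed.

Lemma Psi_0 (y : K) l t : Psi 0 y l t = Psi0 0 y l t.
Proof. by rewrite Psi_Psi0 mul0r cexp0 mul1r. Qed.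

Lemma PS_expB : PS (fexp fB) (fun t => cexp (lB t)).
Proof. exact: PS_fexp PS_lB cf_fB0. Qed.

(** The pole from dividing by A is cancelled at infinity: B - 1 has no constant term, and [fsh]
    divides it by w. *)
Lemma PS_AB : PS (fsh (fexp fB - 1) * fPsi (-1) (-1) (-1) + fC (cexp (c1 R)) * fPsi 0 (-1) (-1)) relAB.
Proof.
have h0 : cf (fexp fB - 1) 0 = 0 by rewrite cfB cf_fexp0 subrr.
have h1 := PS_sh (PS_B PS_expB (@PS_1 R)) h0.
apply: PS_eq (PS_D (PS_M h1 (PS_Psi0 _ _ _)) (PS_Z _ (PS_Psi0 _ _ _))) => t ht.
rewrite /relAB !Psi_m1 Psi_0 mul1r mulN1r.
have -> : Psi0 (-1) 0 (-1) t = cexp (lB t) * Psi0 (-1) (-1) (-1) t.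
  rewrite /Psi0 -cexpD; congr cexp.
  by move: (lA1 t) (lB t) (lTh t) => *; ring.
by move: (cexp _) (Psi0 _ _ _ _) (wv t)^-1 (cexp _ * _) => *; ring.
Qed.

Lemma slS_lin (a b c : K) F G H t :
  slS (fun t => a * F t + b * G t + c * H t) t = a * slS F t + b * slS G t + c * slS H t.
Proof. by rewrite /slS; move: (F _) (G _) (H _) => *; ring. Qed.

Lemma slS_Psi_eq (x y d : K) t : y - x = d -> 0 < im t -> slS (Psi x y (-1)) t = - (cexp (d * c1 R) * Psi y x (-1) t).
Proof. by move=> <-; exact: slS_Psi. Qed.

Lemma Psi_T_eq (x y z e : K) l t : l%:~R - x - y = z -> cexp (x * (rc pi * 'i)) = e -> 0 < im t ->
  Psi x y l (t + 1) = e * Psi x z l t.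
Proof. by move=> <- <-; exact: Psi_T. Qed.

Lemma slS_AB t : 0 < im t -> slS relAB t = - relAB t.
Proof.
move=> ht; have e0 := cexp_neq0 (c1 R).
have h1 : slS (Psi (-1) 0 (-1)) t = - (cexp (c1 R) * Psi 0 (-1) (-1) t).
  by rewrite -[c1 R]mul1r; apply: slS_Psi_eq ht; ring.
have h2 : slS (Psi (-1) (-1) (-1)) t = - (1 * Psi (-1) (-1) (-1) t).
  by rewrite -(@cexp0 R) -(mul0r (c1 R)); apply: slS_Psi_eq ht; ring.
have h3 : slS (Psi 0 (-1) (-1)) t = - ((cexp (c1 R))^-1 * Psi (-1) 0 (-1) t).
  have -> : (cexp (c1 R))^-1 = cexp (-1 * c1 R) by rewrite mulN1r cexpN.
  by apply: slS_Psi_eq ht; ring.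
rewrite slS_lin h1 h2 h3 /relAB.
move: e0; move: (cexp _) (Psi (-1) 0 (-1) t) (Psi (-1) (-1) (-1) t) (Psi 0 (-1) (-1) t) => e p q r e0; cfield.
Qed.

(** The behaviour at the third cusp: only the exponents 0 and 1 of A occur, so there is no pole. *)
Lemma slS_shT_AB t : 0 < im t -> slS (shT relAB) t =
  cexp (c1 R) * (Psi 0 (-1) (-1) t - cexp (c1 R) * Psi 1 (-1) (-1) t - Psi 0 0 (-1) t).
Proof.
move=> ht.
have hpi : cexp (rc pi * 'i) = -1 :> K.
  rewrite -[rc pi * 'i]mulr1 wv_cexp; have := wv1 (0 : K); rewrite add0r => ->.
  by rewrite /wv mul0r e2pi0.
have hpi' : cexp (-1 * (rc pi * 'i)) = -1 :> K by rewrite mulN1r cexpN hpi invrN1.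
pose g u : K := -1 * Psi (-1) 0 (-1) u + 1 * Psi (-1) 1 (-1) u + cexp (c1 R) * Psi 0 0 (-1) u.
have hg u : 0 < im u -> shT relAB u = g u.
  move=> hu.
  have T1 : Psi (-1) 0 (-1) (u + 1) = -1 * Psi (-1) 0 (-1) u.
    by apply: Psi_T_eq hpi' hu; ring.
  have T2 : Psi (-1) (-1) (-1) (u + 1) = -1 * Psi (-1) 1 (-1) u.
    by apply: Psi_T_eq hpi' hu; ring.
  have T3 : Psi 0 (-1) (-1) (u + 1) = Psi 0 0 (-1) u.
    by rewrite -[RHS]mul1r; apply: Psi_T_eq hu; [ring|rewrite mul0r cexp0].
  rewrite /shT /relAB T1 T2 T3 /g.
  by move: (Psi (-1) 0 (-1) u) (Psi (-1) 1 (-1) u) (cexp _ * _) => *; ring.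
rewrite (eq_slS hg ht) slS_lin.
have h1 : slS (Psi (-1) 0 (-1)) t = - (cexp (c1 R) * Psi 0 (-1) (-1) t).
  by rewrite -[c1 R]mul1r; apply: slS_Psi_eq ht; ring.
have h2 : slS (Psi (-1) 1 (-1)) t = - (cexp (c1 R) * cexp (c1 R) * Psi 1 (-1) (-1) t).
  by rewrite -cexpD -[c1 R + c1 R]/(c1 R *+ 2) -mulr_natl; apply: slS_Psi_eq ht; ring.
have h3 : slS (Psi 0 0 (-1)) t = - (1 * Psi 0 0 (-1) t).
  by rewrite -(@cexp0 R) -(mul0r (c1 R)); apply: slS_Psi_eq ht; ring.
rewrite h1 h2 h3.
by move: (cexp _) (Psi 0 (-1) (-1) t) (Psi 1 (-1) (-1) t) (Psi 0 0 (-1) t) => *; ring.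
Qed.

Lemma AB_eq0 t : 0 < im t -> relAB t = 0.
Proof.
have b1 : strip_bounded (slS (shT relAB)).
  apply: strip_bounded_ext (fun t ht => esym (slS_shT_AB ht)) _.
  have h (x y : K) : 0 <= re x -> strip_bounded (fun t => Psi x y (-1) t) by exact: strip_bounded_Psi.
  have r0 : 0 <= re (0 : K) by rewrite -(rc0 R).
  have r1 : 0 <= re (1 : K) by rewrite -(rc1 R) re_rc.
  have hN F : strip_bounded F -> strip_bounded (fun t => - F t).
    by move=> hF; apply: strip_bounded_ext (strip_boundedZ (-1) hF) => u _; rewrite mulN1r.
  apply: strip_boundedZ; apply: strip_boundedD (hN _ (h _ _ r0)).
  exact: strip_boundedD (h _ _ r0) (hN _ (strip_boundedZ _ (h _ _ r1))).
have E G u : 0 < im u -> (forall v, 0 < im v -> G v = - relAB v) -> slS (shT G) u = - slS (shT relAB) u.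
  move=> hu hG; rewrite (@eq_slS _ (fun v => -1 * shT relAB v) u _ hu); first by rewrite slSZ mulN1r.
  by move=> v hv; rewrite /shT hG ?im_add1// mulN1r.
apply: (weight_m2_bounded_eq0 PS_AB).
  move=> u hu; have hu2 : 0 < im (u + 2) by rewrite (im_addZ u 2).
  have e : relAB (u + 2) = relAB u := PS_2 PS_AB hu.
  exact: (etrans (slS_AB hu2) (etrans (congr1 -%R e) (esym (slS_AB hu)))).
split; [| |exact: b1|].
- apply: strip_bounded_ext (strip_boundedZ (-1) (strip_bounded_PS PS_AB)) => u hu.
  by rewrite slS_AB// mulN1r.
- apply: strip_bounded_ext (strip_boundedZ (-1) (strip_bounded_shT PS_AB)) => u hu.
  by rewrite (eq_shT slS_AB hu) mulN1r.
- apply: strip_bounded_ext (strip_boundedZ (-1) b1) => u hu.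
  by rewrite (E _ _ hu slS_AB) mulN1r.
Qed.

Lemma exp_relation_c1 t : 0 < im t -> cexp (lB t) + cexp (c1 R) * cexp (lA t) = 1.
Proof.
move=> ht; have h := AB_eq0 ht; rewrite /relAB in h.
have h1 : Psi (-1) 0 (-1) t * Psi 1 1 1 t = cexp (lB t).
  by rewrite /Psi -cexpD; congr cexp; move: (lA t) (lB t) (lTh t) => *; ring.
have h2 : Psi (-1) (-1) (-1) t * Psi 1 1 1 t = 1.
  by rewrite /Psi -cexpD -(@cexp0 R); congr cexp; move: (lA t) (lB t) (lTh t) => *; ring.
have h3 : Psi 0 (-1) (-1) t * Psi 1 1 1 t = cexp (lA t).
  by rewrite /Psi -cexpD; congr cexp; move: (lA t) (lB t) (lTh t) => *; ring.
have -> : cexp (lB t) + cexp (c1 R) * cexp (lA t) =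
  (1 * Psi (-1) 0 (-1) t + -1 * Psi (-1) (-1) (-1) t + cexp (c1 R) * Psi 0 (-1) (-1) t) * Psi 1 1 1 t +
  Psi (-1) (-1) (-1) t * Psi 1 1 1 t.
  by rewrite -h1 -h3; move: (Psi 1 1 1 t) (cexp (c1 R)) (Psi (-1) 0 (-1) t) (Psi (-1) (-1) (-1) t) (Psi 0 (-1) (-1) t) => *; ring.
by rewrite h mul0r add0r h2.
Qed.

Lemma cf_fexp1 a : cf a 0 = 0 -> cf (fexp a) 1 = cf a 1.
Proof. by move=> a0; rewrite /= !big_ord_recl big_ord0 expr0 cf1 /= mul0r expr1 divr1 add0r addr0. Qed.

Lemma cf_fB1 : cf fB 1 = - 16.
Proof.
rewrite cfB cfD !cf_fC /= divr1 (_ : sigma 1 = 1%N) ?mulr0 ?addr0 ?subr0 ?mulrN1//.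
by rewrite /sigma big_mkcond /= !big_ord_recl big_ord0.
Qed.

Lemma PS_A0 : PS (fX * fexp fA1) (fun t => cexp (lA t)).
Proof.
apply: PS_eq (PS_M (@PS_X R) (PS_fexp PS_lA1 cf_fA10)) => t _.
by rewrite -wv_cexp -cexpD.
Qed.

(** The coefficient of w in the relation: - 16 from B, against exp([c1]) from the multiple of A,
    whose expansion begins with w. *)
Lemma cexp_c1 : cexp (c1 R) = 16.
Proof.
have h : fexp fB + fC (cexp (c1 R)) * (fX * fexp fA1) = 1.
  apply: (@PS_uniq R _ _ (fun=> 1)); last exact: PS_1.
  by apply: PS_eq (PS_D PS_expB (PS_Z _ PS_A0)) => t ht; exact: exp_relation_c1.
have := congr1 (fun a => cf a 1) h.
rewrite cfD cf_fC cf_fX cf_fexp0 mulr1 cf_fexp1 ?cf_fB0// cf_fB1 cf1 /=.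
by move/eqP; rewrite addrC subr_eq0 => /eqP.
Qed.

Lemma exp_relation t : 0 < im t -> 16 * cexp (lA t) = 1 - cexp (lB t).
Proof.
move=> ht; have h := exp_relation_c1 ht; rewrite cexp_c1 in h.
by apply: (addrI (cexp (lB t))); rewrite h addrC subrK.
Qed.

(** As E has constant term 1, w E is again a local parameter at infinity. Each new coefficient is
    the constant term of the current remainder, which can then be divided by w once more. *)
Lemma expansion_A0 a F e E J : PS a F -> PS e E -> cf e 0 = 1 ->
  exists c : nat -> K, exists b, PS b (fun t => (F t - \sum_(j < J) c j * (wv t * E t) ^+ j) / wv t ^+ J).
Proof.
move=> hF hE e0; elim: J => [|J [c [b hb]]].
  exists (fun=> 0), a; apply: PS_eq hF => t _; by rewrite big_ord0 subr0 expr0 divr1.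
pose c' j := if j == J then cf b 0 else c j.
exists c', (fsh (b - fC (cf b 0) * e ^+ J)).
have h0 : cf (b - fC (cf b 0) * e ^+ J) 0 = 0.
  rewrite cfB cf_fC; suff -> : cf (e ^+ J) 0 = 1 by rewrite mulr1 subrr.
  by elim: (J) => // k IH; rewrite exprS cfM0 IH e0 mulr1.
apply: PS_eq (PS_sh (PS_B hb (PS_Z _ (PS_Xn J hE))) h0) => t _.
rewrite big_ord_recr /= /c' eqxx.
have -> : \sum_(i < J) (if (i : nat) == J then cf b 0 else c i) * (wv t * E t) ^+ i = \sum_(i < J) c i * (wv t * E t) ^+ i.
  by apply: eq_bigr => i _; rewrite ltn_eqF.
have w0 : wv t ^+ J != 0 by rewrite expf_neq0// wv_neq0.
have w1 := wv_neq0 t; rewrite exprMn exprS.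
by move: w0 w1; move: (wv t ^+ J) (wv t) (E t ^+ J) (\sum_(i < J) _) => *; cfield.
Qed.

Lemma Psi_2 (x y : K) l t : 0 < im t -> Psi x y l (t + 2) = cexp (2 * (rc pi * 'i) * x) * Psi x y l t.
Proof.
move=> ht; have ht1 : 0 < im (t + 1) by rewrite im_add1.
have e : l%:~R - x - (l%:~R - x - y) = y by ring.
have h1 := Psi_T_eq (erefl (l%:~R - x - y)) (erefl _) ht1; have h2 := Psi_T_eq e (erefl _) ht.
have -> : t + 2 = t + 1 + 1 by ring.
have -> : cexp (2 * (rc pi * 'i) * x) = cexp (x * (rc pi * 'i)) * cexp (x * (rc pi * 'i)).
  by rewrite -cexpD; congr cexp; move: (rc pi * 'i) => z; ring.
by rewrite -mulrA; exact: etrans h1 (congr1 _ h2).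
Qed.

(** The function 1, seen as a form of weight 0, lets the lemmas on products F * [Psi] apply to [Psi]
    alone. *)
Definition cst1 : K -> K := fun=> 1.

Lemma slk0_cst1 t : 0 < im t -> slk 0 cst1 t = 1.
Proof. by move=> _; rewrite /slk oppr0 expr0z mul1r. Qed.

Lemma slk_bounded_cst1 : slk_bounded 0 cst1.
Proof.
have h := strip_bounded_cst 1.
have e F t : slk 0 F t = F (- t^-1) by rewrite /slk oppr0 expr0z mul1r.
split; apply: strip_bounded_ext h => t ht.
- by rewrite slk0_cst1.
- by rewrite /shT slk0_cst1 ?im_add1.
- by rewrite /slk oppr0 expr0z mul1r.
- by rewrite e /shT slk0_cst1// im_add1 im_negV.
Qed.

Lemma slS_period F (x y : K) l t : (forall t, 0 < im t -> slk l F (t + 2) = cexp (- (2 * (rc pi * 'i) * y)) * slk l F t) ->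
  0 < im t -> slS (fun t => F t * Psi x y (- l - 1) t) (t + 2) = slS (fun t => F t * Psi x y (- l - 1) t) t.
Proof.
move=> h ht; have ht2 : 0 < im (t + 2) by rewrite (im_addZ t 2).
have E u (hu : 0 < im u) := slS_MPsi F x y l hu.
suff key : slk l F (t + 2) * Psi y x (- l - 1) (t + 2) = slk l F t * Psi y x (- l - 1) t.
  exact: (etrans (E _ ht2) (etrans (congr1 _ key) (esym (E _ ht)))).
have e := @cexpN R (2 * (rc pi * 'i) * y).
have e0 := cexp_neq0 (2 * (rc pi * 'i) * y).
have h1 := Psi_2 y x (- l - 1) ht; have h2 := h t ht; rewrite e in h2.
apply: (etrans (congr2 *%R h2 h1)).
by move: e0; move: (cexp _) (slk _ _ _) (Psi _ _ _ _) => *; cfield.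
Qed.

(* f / Psi x0 y0 l is a power series in w, hence agrees with a polynomial in A = exp lA
   up to any given order J; after division by a suitable Psi the remainder has
   weight -2 and no pole at any cusp. *)
Lemma expansion_Psi f l (x0 y0 : K) b : PS b (fun t => f t * Psi (- x0) (- y0) (- l) t) ->
  (forall t, 0 < im t -> slk l f (t + 2) = cexp (2 * (rc pi * 'i) * y0) * slk l f t) ->
  slk_bounded l f -> re y0 <= 0 ->
  exists J (c : nat -> K), forall t, 0 < im t -> f t = \sum_(j < J) c j * Psi (x0 + j%:R) y0 l t.
Proof.
move=> hb h2 hf hy.
(* The order J of the expansion is taken so large that the exponent at the third cusp has
   nonnegative real part. *)
have [J hJ] : exists J : nat, 0 <= re ((- l - 1)%:~R - (- x0 - J%:R) - - y0).
  pose r := re ((- l - 1)%:~R + x0 + y0 : K).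
  exists (Num.bound (- r)); rewrite !opprD !opprK.
  have -> : (- l - 1)%:~R + (x0 + (Num.bound (- r))%:R) + y0 = (- l - 1)%:~R + x0 + y0 + (Num.bound (- r))%:R by ring.
  rewrite reD re_nat -/r; have h0 : - r < (Num.bound (- r))%:R.
    have [h|h] := leP 0 (- r); first exact: archi_boundP.
    exact: lt_le_trans h (ler0n _ _).
  lra.
have [c [b' hb']] := expansion_A0 J hb (PS_fexp PS_lA1 cf_fA10) (cf_fexp0 _).
exists J, c.
(* The remainder is multiplied by A ^ - J Th ^ -1. It has order at least J in w, so no pole appears
   at infinity, and the weight becomes - 2. For the terms [Gj] the exponent at the third cusp is J -
   j - 1, nonnegative as j < J. *)
pose G0 t := f t * Psi (- x0 - J%:R) (- y0) (- l - 1) t.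
pose Gj (j : nat) t := cst1 t * Psi (j%:R - J%:R) 0 (- 0 - 1) t.
pose G t := G0 t + \sum_(j < J) - c j * Gj j t.
have EA t (j : nat) : (wv t * cexp (lA1 t)) ^+ j = Psi j%:R 0 0 t.
  rewrite -wv_cexp -cexpD -cexpMn /Psi /lA; congr cexp.
  by move: (lA1 t) (lB t) (lTh t) (rc pi) => *; ring.
have EG t : (f t * Psi (- x0) (- y0) (- l) t - \sum_(j < J) c j * (wv t * cexp (lA1 t)) ^+ j) * Psi (- J%:R) 0 (-1) t = G t.
  rewrite mulrBl mulr_suml -sumrN /G /G0; congr (_ + _).
    by rewrite -mulrA PsiD addr0.
  apply: eq_bigr => j _; rewrite EA /Gj /cst1 -mulrA PsiD addr0 add0r mul1r mulNr.
  by congr (- (_ * Psi _ _ _ _)).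
have hG : PS (b' * fPsi (- J%:R) 0 (-1)) G.
  apply: PS_eq (PS_M hb' (PS_Psi0 _ _ _)) => t _.
  have eJ : cexp (- J%:R * (rc pi * 'i * t)) = (wv t ^+ J)^-1.
    by rewrite mulNr cexpN cexpMn wv_cexp.
  rewrite -EG (Psi_Psi0 (- J%:R)) eJ.
  by move: (wv t ^+ J)^-1 (Psi0 _ _ _ _) (_ - _) => *; ring.
have re0 : 0 <= re (0 : K) by rewrite -(rc0 R).
have bG : slS_bounded G.
  apply: slS_boundedD; first by apply: slS_bounded_MPsi hf _ hJ; rewrite reN oppr_ge0.
  apply: slS_bounded_sum => j; apply: slS_boundedZ; apply: slS_bounded_MPsi slk_bounded_cst1 re0 _.
  have -> : (- 0 - 1)%:~R - (j%:R - J%:R) - 0 = J%:R - j.+1%:R :> K by rewrite -[j.+1]addn1 natrD; ring.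
  by rewrite reB !re_nat subr_ge0 ler_nat.
have pG t : 0 < im t -> slS G (t + 2) = slS G t.
  move=> ht; have ES u : slS G u = slS G0 u + \sum_(j < J) - c j * slS (Gj j) u.
    rewrite /slS /G mulrDr mulr_sumr; congr (_ + _); apply: eq_bigr => j _; exact: mulrCA.
  have e1 : slS G0 (t + 2) = slS G0 t.
    by apply: slS_period ht => u hu; rewrite mulrN opprK; exact: h2.
  have e2 (j : nat) : slS (Gj j) (t + 2) = slS (Gj j) t.
    apply: slS_period ht => u hu.
    by rewrite mulr0 oppr0 cexp0 mul1r !slk0_cst1// (im_addZ u 2).
  have e3 : \sum_(j < J) - c j * slS (Gj j) (t + 2) = \sum_(j < J) - c j * slS (Gj j) t.
    by apply: eq_bigr => j _; exact: congr1 (e2 j).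
  exact: (etrans (ES (t + 2)) (etrans (congr2 +%R e1 e3) (esym (ES t)))).
move=> t ht; have G00 := weight_m2_bounded_eq0 hG pG bG ht; rewrite -EG in G00.
have /eqP := G00; rewrite mulf_eq0 (negbTE (Psi_neq0 _ _ _ _)) orbF subr_eq0 => /eqP h.
have := congr1 ( *%R^~ (Psi x0 y0 l t)) h; rewrite -mulrA PsiD !addNr Psi_000 mulr1 => ->.
by rewrite mulr_suml; apply: eq_bigr => j _; rewrite EA -mulrA PsiD !add0r addrC.
Qed.

End Structure.

(** * Fourier expansions of the components *)

Section Expansions.
Variable R : realType.
Local Notation K := (C R).
Local Notation pi := (pi : R).
Implicit Types (a b : fps R) (F G : K -> K) (s t d : K).

Lemma qexpansion_csums N F (mu : K) (c : nat -> K) t : qexpansion N F mu c -> 0 < im t ->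
  csums (fun n => c n * e2pi ((n%:R + mu) / N%:R * t)) (F t).
Proof.
move=> h ht; have /cvg_ctends := h t ht; apply: (ctends_eq (N := 0)) => n _.
by rewrite /series /= big_mkord.
Qed.

Lemma cm_qterm (N n : nat) (mu t : K) : (0 < N)%N ->
  cm (e2pi ((n%:R + mu) / N%:R * t)) = expR (- (2 * pi / N%:R * ((n%:R + re mu) * im t + im mu * re t))).
Proof.
move=> N0; have NR : (N%:R : R) != 0 by rewrite pnatr_eq0 -lt0n.
have -> : (n%:R + mu) / N%:R * t = (n%:R + mu) * t / N%:R by rewrite mulrAC.
rewrite cm_e2pi im_divn imM reD imD re_nat im_nat add0r; congr expR.
by field.
Qed.

(** Convergence at the single point i / 4 bounds the terms there. From height 1/2 on they are
    smaller by a geometric factor, since the exponents occurring have nonnegative real part; the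
    contribution of im mu is bounded on the strip. *)
Lemma qexpansion_bounded N F (mu : K) (c : nat -> K) : (0 < N)%N -> qexpansion N F mu c ->
  (forall n, c n != 0 -> 0 <= re (n%:R + mu)) -> strip_bounded F.
Proof.
move=> N0 hF hc; have NR : (0 : R) < N%:R by rewrite ltr0n.
have NR0 : (N%:R : R) != 0 by rewrite gt_eqF.
pose t0 : K := 'i * rc 4^-1.
have it0 : im t0 = 4^-1 by rewrite /t0 mulrC im_rcM im_i mulr1.
have rt0 : re t0 = 0 by rewrite /t0 mulrC re_rcM re_i mulr0.
have ht0 : 0 < im t0 by rewrite it0 invr_gt0.
have [B B0 hB] : exists2 B, 0 < B & forall n, cm (c n * e2pi ((n%:R + mu) / N%:R * t0)) <= B.
  have h := qexpansion_csums hF ht0; apply: (@ctends_bnd R _ 0).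
  have := ctendsB ((ctends_shift _ _ 1).2 h) h; rewrite subrr; apply: (ctends_eq (N := 0)) => n _.
  by rewrite addn1 big_ord_recr /= addrAC subrr add0r.
pose r := expR (- (pi / (2 * N%:R))).
pose A := B * (expR (- (pi / (2 * N%:R) * re mu)) * expR (pi / N%:R * `|im mu|)).
have A0 : 0 <= A by rewrite !mulr_ge0 ?expR_ge0// ltW.
have r01 : 0 <= r < 1.
  by rewrite expR_ge0 expR_lt1 oppr_lt0 divr_gt0 ?pi_gt0// mulr_gt0.
have [_ [M hM]] := rbndM A0 (rbnd_geo r01).
exists M => t hr hi; have ht : 0 < im t by apply: lt_le_trans hi; rewrite invr_gt0.
apply: (csums_cm (M := fun n => A * r ^+ n) (qexpansion_csums hF ht)) hM => n.
have [->|cn0] := eqVneq (c n) 0.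
  by rewrite mul0r cm0 mulr_ge0// exprn_ge0//; case/andP: r01.
have := hB n; rewrite !cmM !cm_qterm// it0 rt0 mulr0 addr0.
have := hc n cn0; rewrite reD re_nat; set x := n%:R + re mu => x0 hBn.
have c0 : 0 <= cm (c n) := cm_ge0 _.
have -> : A * r ^+ n = B * (expR (- (2 * pi / N%:R * (x / 4))) * expR (pi / N%:R * `|im mu|)).
  rewrite /A /r -expRM_natl -!mulrA; congr (_ * _); rewrite -!expRD; congr expR; rewrite /x; field.
  by [].
apply: le_trans (_ : cm (c n) * expR (- (2 * pi / N%:R * (x * 4^-1))) *
    (expR (- (2 * pi / N%:R * (x / 4))) * expR (pi / N%:R * `|im mu|)) <= _); last first.
  by rewrite ler_wpM2r// mulr_ge0 ?expR_ge0.
rewrite -[leRHS]mulrA ler_wpM2l// -!expRD ler_expR.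
have P0 : 0 <= pi / N%:R by rewrite divr_ge0 ?pi_ge0.
have h1 : x / 2 <= x * im t by rewrite ler_wpM2l.
have h2 : - (`|im mu| / 2) <= im mu * re t.
  have h3 : `|im mu * re t| <= `|im mu| * 2^-1 by rewrite normrM ler_wpM2l.
  by have := le_trans h3 (lexx _); rewrite ler_norml => /andP[h4 _]; lra.
have -> : - (2 * pi / N%:R * (x * im t + im mu * re t)) = pi / N%:R * (- 2 * (x * im t + im mu * re t)) by field.
have -> : - (2 * pi / N%:R * (x * 4^-1)) + (- (2 * pi / N%:R * (x / 4)) + pi / N%:R * `|im mu|) =
  pi / N%:R * (- x + `|im mu|) by field.
by rewrite ler_wpM2l//; lra.
Qed.

Lemma regular_bounded F : regular_expansion F -> strip_bounded F.
Proof.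
move=> [N [r [g [mu [a [N0 hg ha hF]]]]]].
apply: (@strip_bounded_ext R (fun t => \sum_j g j t)); first by move=> t ht; rewrite -hF.
apply: strip_bounded_sum => j; exact: qexpansion_bounded N0 (hg j) (ha j).
Qed.

(** Where F does not vanish identically, its behaviour under T forces e2pi mu = z, so 2 mu - x is an
    integer. Dividing by exp(pi i (x - M) t) with M large leaves nonnegative integral powers of
    w. *)
Lemma qexpansion_PS F (mu z : K) (c : nat -> K) (x : K) : qexpansion 1 F mu c ->
  (forall t, 0 < im t -> F (t + 1) = z * F t) -> z ^+ 2 = e2pi x ->
  exists M0 : nat, forall M, (M0 <= M)%N -> exists b,
    PS b (fun t => F t * cexp (- (x - M%:R) * (rc pi * 'i * t))) /\
    forall n, cf b n = 0 \/ exists m, cf b n = c m.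
Proof.
move=> hF hz z2.
(* A function that vanishes identically says nothing about mu; it is represented by the zero
   series. *)
have [h0|/existsNP[t1 /not_implyP[ht1 /eqP Ft1]]] := pselect (forall t, 0 < im t -> F t = 0).
  exists 0%N => M _; exists 0; split; last by left.
  by apply: PS_eq (@PS_0 R) => t ht; rewrite h0// mul0r.
have ez : e2pi mu = z.
  have ht2 : 0 < im (t1 + 1) by rewrite im_add1.
  have h1 := qexpansion_csums hF ht2; rewrite hz// in h1.
  have h2 := csumsMl (e2pi mu) (qexpansion_csums hF ht1).
  apply: (mulIf Ft1); apply/esym/(csums_uniq h1); apply: csums_ext h2 => n.
  rewrite !divr1 mulrDr mulr1 e2piD e2piD e2pi_nat mul1r; by rewrite mulrC -mulrA.
have [n hn] : exists n : int, 2 * mu - x = n%:~R.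
  apply: e2pi_eq1; rewrite e2piB -z2 -ez -e2piMn divff// e2pi_neq0.
  by [].
exists `|n|%N => M hM.
have [N hN] : exists N : nat, n + M%:Z = N%:Z by exists (absz (n + M%:Z)); lia.
have hmu : 2 * mu - x + M%:R = N%:R.
  by rewrite hn -(intrD K n M) hN.
exists (fX ^+ N * fdil 2 (Fps c)); split; last first.
  move=> k; rewrite cf_fXn; case: ifP => _; last by left.
  by rewrite /=; case: ifP => _; [right; eexists|left].
have hdil : PS (fdil 2 (Fps c)) (fun t => F t * cexp (- (x - M%:R) * (rc pi * 'i * t)) / wv t ^+ N).
  move=> t ht; have h1 := csumsMr (cexp (- (x - M%:R) * (rc pi * 'i * t)) / wv t ^+ N) (qexpansion_csums hF ht).
  rewrite mulrA in h1; apply: csums_ext (csums_sparse (isT : (0 < 2)%N) h1) => k /=.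
  case: ifP => hk; last by rewrite mul0r.
  rewrite divr1 -mulrA; congr (_ * _).
  have w0 : wv t ^+ N != 0 by rewrite expf_neq0// wv_neq0.
  rewrite mulrA; apply: (mulIf w0); rewrite divfK// -exprD -wvM -wv_cexp e2piE -cexpD.
  have -> : k = (2 * (k %/ 2))%N by rewrite mulnC divnK.
  congr cexp; rewrite mulKn// natrD natrM -hmu; move: (rc pi) ((k %/ 2)%:R) => P m; ring.
apply: PS_eq (PS_M (PS_Xn N (@PS_X R)) hdil) => t _.
by rewrite mulrC divfK// expf_neq0// wv_neq0.
Qed.

End Expansions.

(** * Matrices of level two and the induced representation *)

Definition mk2 (T : Type) (a b c d : T) : 'M[T]_2 :=
  \matrix_(i, j) if i == 0 then (if j == 0 then a else b) else (if j == 0 then c else d).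

Lemma ord2 (i : 'I_2) : i = 0 \/ i = 1.
Proof. by case: i => -[|[|//]] h; [left|right]; apply: val_inj. Qed.

Lemma mx2_ext (T : Type) (A B : 'M[T]_2) : A 0 0 = B 0 0 -> A 0 1 = B 0 1 -> A 1 0 = B 1 0 -> A 1 1 = B 1 1 -> A = B.
Proof.
move=> h1 h2 h3 h4; apply/matrixP => i j.
by have [->|->] := ord2 i; have [->|->] := ord2 j.
Qed.

Section Level2.
Implicit Types (a b c d : int).

Lemma mk2E (T : Type) (a b c d : T) : ((mk2 a b c d 0 0 = a) * (mk2 a b c d 0 1 = b) * (mk2 a b c d 1 0 = c) * (mk2 a b c d 1 1 = d))%type.
Proof. by rewrite !mxE. Qed.

Lemma mk2M a b c d a' b' c' d' : mk2 a b c d * mk2 a' b' c' d' =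
  mk2 (a * a' + b * c') (a * b' + b * d') (c * a' + d * c') (c * b' + d * d').
Proof. by apply: mx2_ext; rewrite !mxE !big_ord_recl big_ord0 addr0 !mxE. Qed.

Lemma det_mk2 a b c d : \det (mk2 a b c d) = a * d - b * c.
Proof.
rewrite (expand_det_row _ 0) !big_ord_recl big_ord0 addr0 /cofactor !det_mx11 !mxE /=.
by rewrite expr0 expr1 mul1r mulN1r mulrN.
Qed.

Lemma TmxE : Tmx = mk2 1 1 0 1. Proof. by apply: mx2_ext; rewrite !mxE. Qed.
Lemma UmxE : Umx = mk2 1 0 1 1. Proof. by apply: mx2_ext; rewrite !mxE. Qed.
Lemma mx1E : 1 = mk2 1 0 0 1 :> 'M[int]_2. Proof. by apply: mx2_ext; rewrite !mxE. Qed.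

Lemma mem_Gamma2 a b c d : (mk2 a b c d \in Gamma2) =
  [&& a * d - b * c == 1, (a == 1 %[mod 2])%Z, (b == 0 %[mod 2])%Z, (c == 0 %[mod 2])%Z & (d == 1 %[mod 2])%Z].
Proof.
rewrite !inE det_mk2; congr (_ && _); apply/forallP/idP => [h|/and4P[h1 h2 h3 h4] i].
  have /forallP h0 := h 0; have /forallP h1 := h 1.
  by have := h0 0; have := h0 1; have := h1 0; have := h1 1; rewrite !mk2E !mxE => -> -> -> ->.
by apply/forallP => j; have [->|->] := ord2 i; have [->|->] := ord2 j; rewrite mk2E !mxE.
Qed.

Lemma Tinv : Tmx^-1 = mk2 1 (-1) 0 1.
Proof.
have h : Tmx * mk2 1 (-1) 0 1 = 1 by rewrite TmxE mk2M mx1E.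
have h' : mk2 1 (-1) 0 1 * Tmx = 1 by rewrite TmxE mk2M mx1E.
have u : Tmx \is a GRing.unit by apply/unitrP; exists (mk2 1 (-1) 0 1).
by apply: (mulrI u); rewrite h mulrV.
Qed.

End Level2.

Section Induced.
Variable R : realType.
Local Notation K := (C R).
Variable psi : 'M[int]_2 -> K.
Hypothesis hpsi : character_Gamma2 psi.

Let ext h := if h \in Gamma2 then psi h else 0.

Lemma IndE g : ((Ind psi g 0 0 = ext g) * (Ind psi g 0 1 = ext (g * Tmx)) *
  (Ind psi g 1 0 = ext (Tmx^-1 * g)) * (Ind psi g 1 1 = ext (Tmx^-1 * g * Tmx)))%type.
Proof. by rewrite !mxE /= !expr0 !expr1 !invr1 !mul1r !mulr1. Qed.

Lemma psi1 : psi 1 = 1.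
Proof.
case: hpsi => h0 hM; have h1 : 1 \in Gamma2 by rewrite mx1E mem_Gamma2.
by have := hM 1 1 h1 h1; rewrite mulr1 => h; apply: (mulfI (h0 1 h1)); rewrite -h mulr1.
Qed.

Lemma Ind_T : Ind psi Tmx = mk2 0 (psi (Tmx ^+ 2)) 1 0.
Proof.
have u : Tmx \is a GRing.unit.
  apply/unitrP; exists (mk2 1 (-1) 0 1); by rewrite TmxE !mk2M mx1E.
apply: mx2_ext; rewrite IndE mk2E /ext -?expr2 ?mulVr ?mul1r//.
- by rewrite TmxE mem_Gamma2.
- by rewrite expr2 TmxE mk2M mem_Gamma2.
- by rewrite mx1E mem_Gamma2 -mx1E psi1.
- by rewrite TmxE mem_Gamma2.
Qed.

Lemma Ind_U2 : Ind psi (Umx ^+ 2) 0 0 = psi (Umx ^+ 2) /\ Ind psi (Umx ^+ 2) 0 1 = 0.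
Proof.
rewrite !IndE /ext expr2 UmxE TmxE !mk2M !mem_Gamma2; split=> //.
Qed.

Lemma Ind_N1 : psi (-1) = 1 -> Ind psi (-1) = 1.
Proof.
move=> h.
have eN : -1 = mk2 (-1) 0 0 (-1) :> 'M[int]_2 by apply: mx2_ext; rewrite !mxE.
have hN : -1 \in Gamma2 by rewrite eN mem_Gamma2.
have eT : Tmx^-1 * -1 * Tmx = -1 by rewrite mulrN1 mulNr mulVr// TmxE; apply/unitrP; exists (mk2 1 (-1) 0 1); rewrite !mk2M mx1E.
apply: mx2_ext; rewrite IndE /ext ?eT ?hN ?h !mxE//.
- by rewrite mulN1r TmxE (_ : - mk2 1 1 0 1 = mk2 (-1) (-1) 0 (-1)) ?mem_Gamma2//; apply: mx2_ext; rewrite !mxE.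
- by rewrite mulrN1 Tinv (_ : - mk2 1 (-1) 0 1 = mk2 (-1) 1 0 (-1)) ?mem_Gamma2//; apply: mx2_ext; rewrite !mxE.
Qed.

(** The rows of X, hence of E, are left eigenvectors of the matrix of T, whose rows are (0, psi(T ^
    2)) and (1, 0). The two equations express this; as the row is nonzero, its first entry is
    nonzero. *)
Lemma normalization_shape rho' : normalization (Ind psi) rho' -> exists (E : 'M[K]_2) (z : 'I_2 -> K),
  [/\ E \in unitmx, forall g, rho' g = E *m Ind psi g *m invmx E,
      forall i, E i 1 = z i * E i 0, forall i, E i 0 * psi (Tmx ^+ 2) = z i * E i 1 & forall i, E i 0 != 0].
Proof.
move=> [k0 [F [m [X [lambda [nu [c [_ [_ _ uX hX] hl hrho]]]]]]]].
set E := diag_mx _ *m X in hrho.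
have EE i j : E i j = (lambda 0 i)^-1 * X i j by rewrite /E mul_diag_mx !mxE.
have hX2 : X *m Ind psi Tmx = diag_mx (map_mx (@e2pi R) m) *m X by rewrite -hX mulmxKV.
have h0 i : X i 1 = e2pi (m 0 i) * X i 0.
  have := congr1 (fun A : 'M[K]_(2, 2) => A i 0) hX2; rewrite Ind_T mul_diag_mx !mxE !big_ord_recl big_ord0 addr0 !mxE /= => <-.
  by rewrite mulr0 add0r mulr1; congr (X _ _); apply: val_inj.
have h1 i : X i 0 * psi (Tmx ^+ 2) = e2pi (m 0 i) * X i 1.
  have := congr1 (fun A : 'M[K]_(2, 2) => A i 1) hX2; rewrite Ind_T mul_diag_mx !mxE !big_ord_recl big_ord0 addr0 !mxE /= => <-.
  by rewrite mulr0 addr0.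
exists E, (fun i => e2pi (m 0 i)); split=> //.
- rewrite unitmx_mul uX andbT unitmxE det_diag unitfE; apply/prodf_neq0 => i _.
  by rewrite mxE invr_eq0; have [] := hl i.
- by move=> i; rewrite !EE h0 mulrCA.
- by move=> i; rewrite !EE -mulrA h1 mulrCA.
move=> i; rewrite EE mulf_neq0 ?invr_eq0//; first by have [] := hl i.
apply/eqP => Xi0; have := congr1 (fun A : 'M[K]_(2, 2) => A i i) (mulmxV uX).
rewrite !mxE !big_ord_recl big_ord0 addr0 eqxx (_ : lift ord0 ord0 = 1); last exact: val_inj.
by rewrite h0 Xi0 mulr0 !mul0r addr0 => /eqP; rewrite eq_sym oner_eq0.
Qed.

End Induced.

Lemma mulmx2E (K : pzRingType) (A : 'M[K]_2) (v : 'cV[K]_2) i : (A *m v) i 0 = A i 0 * v 0 0 + A i 1 * v 1 0.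
Proof. by rewrite mxE !big_ord_recl big_ord0 addr0; congr (_ + A _ _ * v _ _); apply: val_inj. Qed.

(** * The components of a form in terms of one function on Gamma(2) *)

Section Forms.
Variable R : realType.
Local Notation K := (C R).
Local Notation pi := (pi : R).
Variables (psi : 'M[int]_2 -> K) (rho' : 'M[int]_2 -> 'M[K]_2) (k : int) (Z : K -> 'cV[K]_2).
Variables (E : 'M[K]_2) (z : 'I_2 -> K).
Hypotheses (hpsi : character_Gamma2 psi) (uE : E \in unitmx).
Hypothesis hrho : forall g, rho' g = E *m Ind psi g *m invmx E.
Hypothesis hz0 : forall i, E i 1 = z i * E i 0.
Hypothesis hz1 : forall i, E i 0 * psi (Tmx ^+ 2) = z i * E i 1.
Hypothesis hE : forall i, E i 0 != 0.
Hypothesis hZ : modular_form k rho' Z.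

Let G t := invmx E *m Z t.
(** The first coordinate in the basis where the representation is [Ind psi], that is, the function f
    with character psi from which all components of Z are recovered. *)
Definition gcomp t : K := G t 0 0.
Local Notation f := gcomp.

Lemma slash_G g t : slash k G g t = invmx E *m slash k Z g t.
Proof. by rewrite /slash /G scalemxAr. Qed.

Lemma slash_Gamma0 g t : g \in Gamma0_2 -> 0 < im t -> slash k G g t = Ind psi g *m G t.
Proof.
move=> hg ht; case: hZ => _ h _.
by rewrite slash_G (h g hg t ht) hrho -!mulmxA mulKmx.
Qed.

Lemma Z_G i t : Z t i 0 = E i 0 * (f t + z i * G t 1 0).
Proof.
have -> : Z t = E *m G t by rewrite /G mulmxA mulmxV// mul1mx.
by rewrite mulmx2E hz0 /f mulrDr mulrA [z i * _]mulrC.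
Qed.

Lemma T_Gamma0 : Tmx \in Gamma0_2.
Proof. by rewrite TmxE !inE det_mk2 mk2E. Qed.

Lemma slash_T t : slash k G Tmx t = G (t + 1).
Proof.
rewrite /slash /mobius TmxE !mk2E mul0r add0r mul1r divr1.
by rewrite exp1rz scale1r.
Qed.

Lemma G_T t : 0 < im t -> G (t + 1) 1 0 = f t /\ f (t + 1) = psi (Tmx ^+ 2) * G t 1 0.
Proof.
move=> ht; have h := slash_Gamma0 T_Gamma0 ht; rewrite slash_T (Ind_T hpsi) in h.
by split; rewrite /f h mulmx2E !mk2E ?mul0r ?add0r ?mul1r ?addr0.
Qed.

Lemma Z_T i t : 0 < im t -> Z (t + 1) i 0 = z i * Z t i 0.
Proof.
move=> ht; have [h1 h2] := G_T ht; rewrite !Z_G h1 h2.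
rewrite mulrDr [E i 0 * (psi _ * _)]mulrA hz1 hz0.
by move: (f t) (G t 1 0) => p q; ring.
Qed.

Lemma z2 i : z i ^+ 2 = psi (Tmx ^+ 2).
Proof. by apply: (mulfI (hE i)); rewrite hz1 hz0; ring. Qed.

Lemma Z_f i t : 0 < im t -> z i != 0 -> Z t i 0 = E i 0 * (f t + (z i)^-1 * f (t + 1)).
Proof.
move=> ht z0; have [_ ->] := G_T ht; rewrite Z_G -(z2 i); move: (f t) (G t 1 0) => p q.
by cfield.
Qed.

Lemma f_U2 t : 0 < im t -> (2 * t + 1) ^ (- k) * f (t / (2 * t + 1)) = psi (Umx ^+ 2) * f t.
Proof.
have hU : Umx ^+ 2 = mk2 1 0 2 1 by rewrite expr2 UmxE mk2M.
move=> ht; have hg : Umx ^+ 2 \in Gamma0_2 by rewrite hU !inE det_mk2 mk2E.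
have := congr1 (fun A : 'M[K]_(2, 1) => A 0 0) (slash_Gamma0 hg ht).
have [h1 h2] := Ind_U2 psi.
rewrite [RHS]mulmx2E h1 h2 mul0r addr0 => <-.
by rewrite /slash /mobius hU !mk2E mxE mul1r addr0.
Qed.

Lemma f_strip (a b c d : int) : a * d - b * c = 1 ->
  strip_bounded (fun t => (c%:~R * t + d%:~R) ^ (- k) * f ((a%:~R * t + b%:~R) / (c%:~R * t + d%:~R))).
Proof.
move=> hd; have hg : mk2 a b c d \in SL2Z by rewrite inE det_mk2 hd.
case: hZ => _ _ /(_ _ hg) hr.
have e t : (c%:~R * t + d%:~R) ^ (- k) * f ((a%:~R * t + b%:~R) / (c%:~R * t + d%:~R)) =
   invmx E 0 0 * slash k Z (mk2 a b c d) t 0 0 + invmx E 0 1 * slash k Z (mk2 a b c d) t 1 0.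
  have := slash_G (mk2 a b c d) t; move/(congr1 (fun A : 'M[K]_(2, 1) => A 0 0)).
  by rewrite [RHS]mulmx2E => <-; rewrite /slash /mobius !mk2E mxE.
apply: (strip_bounded_ext (fun t _ => esym (e t))).
exact: strip_boundedD (strip_boundedZ _ (regular_bounded (hr 0))) (strip_boundedZ _ (regular_bounded (hr 1))).
Qed.

Lemma sqr_exprz (u : K) (l : int) : (u ^+ 2) ^ (- l) = u ^ (- (2 * l)).
Proof. by rewrite exprnP exprz_exp mulrN. Qed.

(** The matrix - 1 acts trivially through [Ind psi] and multiplies forms of weight k by (- 1) ^
    k. *)
Lemma weight_even : psi (-1) = 1 -> nonzero_form Z -> exists l : int, k = 2 * l.
Proof.
move=> hN [t ht Zt].
have eN : -1 = mk2 (-1) 0 0 (-1) :> 'M[int]_2 by apply: mx2_ext; rewrite !mxE.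
have hg : -1 \in Gamma0_2 by rewrite eN !inE det_mk2 mk2E.
case: hZ => _ /(_ _ hg t ht) h _; rewrite hrho (Ind_N1 hN) mulmx1 mulmxV// mul1mx in h.
have e : (-1) ^ (- k) = 1 :> K.
  move: h; rewrite /slash /mobius eN !mk2E !(mulr0z, mul0r, addr0, add0r, mulrNz, mulr1z) mulN1r invrN1 mulrN1 opprK.
  move/eqP; rewrite -subr_eq0 -[X in _ - X]scale1r -scalerBl scaler_eq0 (negbTE Zt) orbF subr_eq0.
  by move/eqP.
exists (k %/ 2)%Z; have := divz_eq k 2; have := modz_ge0 k (isT : 2 != 0 :> int); have := ltz_mod k (isT : 2 != 0 :> int).
move: (k %/ 2)%Z (k %% 2)%Z => q r h1 h2 hk.
have [r0|r1] : r = 0 \/ r = 1 by lia.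
  by rewrite hk r0 addr0 mulrC.
have : (-1) ^ (- k) = -1 :> K.
  have -> : - k = 2 * - q - 1 by rewrite hk r1; ring.
  rewrite expfzDr ?oppr_eq0 ?oner_eq0// exprN1 mulrN -sqr_exprz sqrrN expr1n exp1rz mul1r invrN1 //.
by move=> e'; have := e; rewrite e' => /eqP; rewrite eqNr oner_eq0.
Qed.

Lemma f_neq0 : nonzero_form Z -> ~ (forall t, 0 < im t -> f t = 0).
Proof.
move=> [t ht /eqP Zt] h; apply: Zt; apply/matrixP => i j; rewrite ord1 Z_G [RHS]mxE.
have ht1 : 0 < im (t - 1) by rewrite im_sub1.
have [e _] := G_T ht1; rewrite subrK h// in e.
by rewrite h// e mulr0 addr0 mulr0.
Qed.

Lemma f_Z t : f t = invmx E 0 0 * Z t 0 0 + invmx E 0 1 * Z t 1 0.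
Proof. exact: mulmx2E. Qed.

(** Each of the four functions is f slashed by the matrix handed to [h], so holomorphy of Z at the
    cusps bounds it. *)
Lemma f_slk_bounded (l : int) : k = 2 * l -> slk_bounded l f.
Proof.
move=> hk.
have h (a b c d : int) F : a * d - b * c = 1 ->
    (forall t, 0 < im t -> (c%:~R * t + d%:~R) ^ (- k) * f ((a%:~R * t + b%:~R) / (c%:~R * t + d%:~R)) = F t) -> strip_bounded F.
  by move=> h1 h2; apply: strip_bounded_ext h2 (f_strip h1).
split.
- apply: (h 0 (-1) 1 0); [by []|move=> t ht]; have t0 := up_neq0 ht.
  rewrite /slk sqr_exprz hk !(mulr0z, mul0r, addr0, add0r, mulrNz, mulr1z, mul1r).
  by congr (_ * f _); rewrite mulN1r.
- apply: (h 0 (-1) 1 1); [by []|move=> t ht].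
  rewrite /shT /slk sqr_exprz hk !(mulr0z, mul0r, addr0, add0r, mulrNz, mulr1z, mul1r).
  by congr (_ * f _); rewrite mulN1r.
- apply: (h 1 (-1) 1 0); [by []|move=> t ht]; have t0 := up_neq0 ht.
  rewrite /shT /slk sqr_exprz hk !(mulr0z, mul0r, addr0, add0r, mulrNz, mulr1z, mul1r).
  by congr (_ * f _); cfield.
- apply: (h (-1) 0 1 (-1)); [by []|move=> t ht]; have t0 := up_neq0 ht.
  have t1 : t - 1 != 0 by rewrite up_neq0// im_sub1.
  have e : - t^-1 + 1 = (t - 1) / t by cfield.
  rewrite /shT /slk e mulrA -expfzMl -exprMn sqr_exprz hk !(mulr0z, mul0r, addr0, add0r, mulrNz, mulr1z, mul1r).
  have e1 : t * ((t - 1) / t) = t - 1 by cfield.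
  have e2 : - ((t - 1) / t)^-1 = -1 * t / (t - 1) by cfield.
  by rewrite e1 e2.
Qed.

(** S conjugates U ^ 2 to T ^ -2, whence the inverse of psi(U ^ 2) and the minus sign of xi2 in the
    exponent of B. *)
Lemma f_slk_period (l : int) t : k = 2 * l -> 0 < im t ->
  slk l f (t + 2) = (psi (Umx ^+ 2))^-1 * slk l f t.
Proof.
move=> hk ht; have ht2 : 0 < im (t + 2) by rewrite (im_addZ t 2).
have t0 := up_neq0 ht; have t2 := up_neq0 ht2.
have := f_U2 (im_negV ht2); rewrite /slk !sqr_exprz -hk.
have e1 : 2 * - (t + 2)^-1 + 1 = t / (t + 2) by cfield.
have e2 : - (t + 2)^-1 / (t / (t + 2)) = - t^-1 by cfield.
rewrite e1 e2 expfzMl => h.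
have p0 : psi (Umx ^+ 2) != 0.
  by case: hpsi => h0 _; apply: h0; rewrite expr2 UmxE mk2M mem_Gamma2.
have eB : (t + 2)^-1 ^ (- k) = ((t + 2) ^ (- k))^-1 by rewrite exprz_inv invr_expz.
rewrite eB in h.
have B0 : (t + 2) ^ (- k) != 0 by rewrite expfz_neq0.
move: B0 p0 h; move: (t ^ (- k)) (_ ^ (- k)) (f _) (f _) (psi _) => A B p q r B0 p0 h.
have -> : p = A / B * q / r by rewrite h mulrAC divff// mul1r.
by cfield.
Qed.

Variables (xi1 : rat) (xi2 : K) (mu : 'I_2 -> K) (c : 'I_2 -> nat -> K).

(** The component is [E i 0] times f(t) + f(t + 1) / z i. The first sum comes from f(t). The second
    comes from f(t + 1), where B becomes its inverse and y0 becomes l - x0 - y0, so that d enters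
    with the opposite sign. Division by exp(pi i x0 t) makes the whole a power series in w. *)
Lemma component_expansion : psi (-1) = 1 -> e2pi (ratr xi1) = psi (Tmx ^+ 2) -> e2pi xi2 = psi (Umx ^+ 2) ->
  nonzero_form Z -> (forall i, qexpansion 1 (fun t => Z t i 0) (mu i) (c i)) ->
  exists (l : int) (M : nat) (Q : {poly K}), Q != 0 /\ forall i, exists s e : K, [/\ s != 0, e != 0 &
    forall n, let x0 := ratr xi1 - M%:R in let y0 := - xi2 - M%:R in
      let b := cf (fPsi x0 0 l * (\sum_(d < size Q) fC (e * Q`_d) * fexp (fC (y0 + d%:R) * fB R) +
         \sum_(d < size Q) fC (e * s * Q`_d) * fexp (fC (l%:~R - x0 - y0 - d%:R) * fB R))) n in
      b = 0 \/ exists m, b = c i m].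
Proof.
move=> hN h1 h2 hnz hq.
have [l hk] := weight_even hN hnz.
have z2' i : z i ^+ 2 = e2pi (ratr xi1) by rewrite z2.
have [M0 hM0] := qexpansion_PS (hq 0) (Z_T 0) (z2' 0).
have [M1 hM1] := qexpansion_PS (hq 1) (Z_T 1) (z2' 1).
(* Large enough for the expansions of both components and for re y0 <= 0, as [expansion_Psi]
   requires. *)
pose M := (M0 + M1 + Num.bound (- re xi2))%N.
have hM i : exists b, PS b (fun t => Z t i 0 * cexp (- (ratr xi1 - M%:R) * (rc pi * 'i * t))) /\
    forall n, cf b n = 0 \/ exists m, cf b n = c i m.
  have [->|->] := ord2 i; [apply: hM0|apply: hM1]; rewrite /M; lia.
have hy : re (- xi2 - M%:R) <= 0.
  rewrite reB reN re_nat /M !natrD; have h : - re xi2 < (Num.bound (- re xi2))%:R.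
    by have [h|h] := leP 0 (- re xi2); [exact: archi_boundP|exact: lt_le_trans h (ler0n _ _)].
  have m0 : 0 <= M0%:R :> R by []; have m1 : 0 <= M1%:R :> R by [].
  lra.
move: (M) hM hy => {}M hM hy.
set x0 : K := ratr xi1 - M%:R in hM; set y0 := - xi2 - M%:R in hy.
have [b0 [hb0 _]] := hM 0; have [b1 [hb1 _]] := hM 1.
have hb : PS ((fC (invmx E 0 0) * b0 + fC (invmx E 0 1) * b1) * fPsi (- x0) (- y0) (- l))
    (fun t => f t * Psi (- x0) (- y0) (- l) t).
  apply: PS_eq (PS_M (PS_D (PS_Z _ hb0) (PS_Z _ hb1)) (PS_Psi0 _ _ _)) => t _.
  rewrite Psi_Psi0 f_Z; move: (cexp _) (Psi0 _ _ _ _) (Z t 0 0) (Z t 1 0) => *; ring.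
have e2 : (psi (Umx ^+ 2))^-1 = cexp (2 * (rc pi * 'i) * y0).
  have -> : cexp (2 * (rc pi * 'i) * y0) = e2pi y0.
    by rewrite e2piE; congr cexp; move: (rc pi) => P; ring.
  by rewrite /y0 e2piB e2piN h2 e2pi_nat divr1.
have hS t (ht : 0 < im t) : slk l f (t + 2) = cexp (2 * (rc pi * 'i) * y0) * slk l f t.
  by rewrite -e2; exact: f_slk_period hk ht.
have [J [a ha]] := expansion_Psi hb hS (f_slk_bounded hk) hy.
(* The polynomial in A is rewritten in B by means of A = (1 - B) / 16. *)
pose Q : {poly K} := \sum_(j < J) (a j / 16 ^+ j) *: (1 - 'X) ^+ j.
have hf t : 0 < im t -> f t = Psi x0 y0 l t * Q.[cexp (lB t)].
  move=> ht; rewrite ha// /Q horner_sum mulr_sumr; apply: eq_bigr => j _.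
  rewrite hornerZ horner_exp hornerD hornerN hornerX hornerC -(exp_relation ht).
  have -> : Psi (x0 + j%:R) y0 l t = Psi x0 y0 l t * cexp (lA t) ^+ j.
    rewrite /Psi -cexpMn -cexpD; congr cexp; move: (lA t) (lB t) (lTh t) => *; ring.
  have n16 : (16 ^+ j : K) != 0 by rewrite expf_neq0// pnatr_eq0.
  by rewrite exprMn; move: n16; move: (16 ^+ j) (Psi _ _ _ _) (cexp _ ^+ j) (a j) => *; cfield.
have Q0 : Q != 0.
  apply/eqP => Q0; apply: (f_neq0 hnz) => t ht; by rewrite hf// Q0 horner0 mulr0.
pose et := cexp (x0 * (rc pi * 'i)).
have hf1 t : 0 < im t -> f (t + 1) = et * Psi x0 (l%:~R - x0 - y0) l t * Q.[(cexp (lB t))^-1].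
  move=> ht; rewrite hf ?im_add1// lB_T// cexpN; congr (_ * _); exact: Psi_T_eq ht.
exists l, M, Q; split=> // i; have [b [hbi hbn]] := hM i.
have z0 : z i != 0.
  by apply/eqP => z0; have /eqP := z2' i; rewrite z0 expr0n /= eq_sym (negbTE (e2pi_neq0 _)).
exists ((z i)^-1 * et), (E i 0); split; [by rewrite mulf_neq0 ?invr_eq0// cexp_neq0| by []|].
move=> n x0' y0'; rewrite -/x0 -/y0 in x0' y0' *.
suff -> : fPsi x0' 0 l * (\sum_(d < size Q) fC (E i 0 * Q`_d) * fexp (fC (y0' + d%:R) * fB R) +
         \sum_(d < size Q) fC (E i 0 * ((z i)^-1 * et) * Q`_d) * fexp (fC (l%:~R - x0' - y0' - d%:R) * fB R)) = b by exact: hbn.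
rewrite {}/x0' {}/y0'.
apply: (PS_uniq _ hbi).
have hfe (y : K) : PS (fexp (fC y * fB R)) (fun t => cexp (y * lB t)).
  by apply: PS_fexp (PS_Z _ (@PS_lB R)) _; rewrite cf_fC cf_fB0 mulr0.
apply: PS_eq (PS_M (PS_Psi0 _ _ _) (PS_D (PS_sum _ (fun d => PS_Z _ (hfe _))) (PS_sum _ (fun d => PS_Z _ (hfe _))))) => t ht /=.
rewrite Z_f// hf// hf1// !horner_coef {hf hf1 hfe}.
have -> : \sum_(d < size Q) E i 0 * Q`_d * cexp ((y0 + d%:R) * lB t) =
  E i 0 * (cexp (y0 * lB t) * \sum_(d < size Q) Q`_d * cexp (lB t) ^+ d).
  rewrite !mulr_sumr; apply: eq_bigr => d _; rewrite mulrDl cexpD cexpMn.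
  by move: (cexp _) (cexp _ ^+ _) => *; ring.
have -> : \sum_(d < size Q) E i 0 * ((z i)^-1 * et) * Q`_d * cexp ((l%:~R - x0 - y0 - d%:R) * lB t) =
   E i 0 * ((z i)^-1 * et) * (cexp ((l%:~R - x0 - y0) * lB t) * \sum_(d < size Q) Q`_d * (cexp (lB t))^-1 ^+ d).
  rewrite !mulr_sumr; apply: eq_bigr => d _; rewrite mulrBl cexpB cexpMn exprVn.
  by move: (cexp _) (cexp _ ^+ _)^-1 (z i)^-1 (et) => *; ring.
have P1 y : Psi x0 y l t * cexp (- x0 * (rc pi * 'i * t)) = Psi0 x0 0 l t * cexp (y * lB t).
  rewrite Psi_Psi0 /Psi0 -!cexpD; congr cexp; move: (lA1 t) (lB t) (lTh t) (rc pi) => *; ring.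
have alg (e0 z' e' p q e r u v S1 S2 : K) : p * e = r * u -> q * e = r * v ->
    r * (e0 * (u * S1) + e0 * (z' * e') * (v * S2)) = e0 * (p * S1 + z' * (e' * q * S2)) * e.
  move=> g1 g2; transitivity (e0 * ((p * e) * S1 + z' * (e' * (q * e) * S2))); last by ring.
  by rewrite g1 g2; ring.
exact: alg (P1 _) (P1 _).
Qed.

End Forms.

(** * Integrality at a prime *)

Section Integrality.
Variable R : realType.
Local Notation K := (C R).

(** If N clears the denominators of a monic q of degree n with root x, then N x is a root of N ^ n
    q(X / N), which is monic with integral coefficients. *)
Lemma algebraic_multiple (x : K) : algebraic_number x -> exists2 N : nat, (0 < N)%N & algebraic_integer (N%:R * x).
Proof.
move=> /integral_algebraic [q qm qx].
pose n := (size q).-1.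
have sq : size q = n.+1 by rewrite /n prednK// size_poly_gt0 monic_neq0.
pose N := (\prod_(i < n.+1) `|denq q`_i|)%N.
have N0 : (0 < N)%N by rewrite prodn_gt0// => i; rewrite absz_gt0 denq_neq0.
exists N => //.
have Nq (i : nat) : (i < n.+1)%N -> exists m : int, N%:R * q`_i = m%:~R.
  move=> hi; have -> : N = ((\prod_(j < n.+1 | j != Ordinal hi) `|denq q`_j|) * `|denq q`_i|)%N.
    by rewrite /N (bigD1 (Ordinal hi))//= mulnC.
  set N' := (\prod_(j < _ | _) _)%N.
  exists (N'%:Z * numq q`_i); rewrite natrM -mulrA intrM; congr (_ * _).
  have d0 : (denq q`_i)%:~R != 0 :> rat by rewrite intr_eq0 denq_neq0.
  have -> : `|denq q`_i|%:R = (denq q`_i)%:~R :> rat by rewrite -[in RHS](gez0_abs (denq_ge0 _)).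
  by rewrite -[X in _ * X]divq_num_den mulrC divfK.
pose r : {poly K} := \poly_(i < n.+1) (N%:R ^+ (n - i) * ratr q`_i).
have rm : r \is monic.
  rewrite monicE lead_coefE size_poly_eq; rewrite /= ?coef_poly ?ltnSn subnn expr0 mul1r.
    by move: qm; rewrite monicE lead_coefE sq /= => /eqP ->; rewrite rmorph1.
  by move: qm; rewrite monicE lead_coefE sq /= => /eqP ->; rewrite rmorph1 oner_neq0.
apply: (integral_root_monic rm).
  have /rootP hx := qx; apply/rootP.
  rewrite horner_poly; rewrite (@horner_coef_wide _ n.+1) in hx; last first.
    by rewrite size_map_poly sq.
  transitivity (N%:R ^+ n * \sum_(i < n.+1) (map_poly ratr q)`_i * x ^+ i); last by rewrite hx mulr0.
  rewrite mulr_sumr; apply: eq_bigr => i _.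
  rewrite coef_map /= exprMn; have -> : (N%:R : K) ^+ n = N%:R ^+ (n - i) * N%:R ^+ i by rewrite -exprD subnK// -ltnS.
  by move: (_ ^+ _) (_ ^+ _) (_ ^+ _) (ratr _) => *; ring.
apply/integral_poly => i; rewrite coef_poly; case: ltnP => hi; last exact: mxpoly.integral0.
have [->|ni] := eqVneq i n.
  rewrite subnn expr0 mul1r; move: qm; rewrite monicE lead_coefE sq /= => /eqP ->; rewrite rmorph1; exact: integral1.
have hi' : (i < n)%N by rewrite ltn_neqAle ni -ltnS.
have [m hm] := Nq i hi.
have -> : N%:R ^+ (n - i) * ratr q`_i = (N%:Z ^+ (n - i.+1) * m)%:~R :> K.
  rewrite -(subnSK hi') exprSr -mulrA rmorphM rmorphXn /= -pmulrn; congr (_ * _).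
  by have := congr1 (ratr : rat -> K) hm; rewrite rmorphM /= ratr_nat ratr_int.
exact: integral_id.
Qed.

Lemma denominator_exists (x : K) : algebraic_number x -> exists N, is_denominator x N.
Proof.
move=> /algebraic_multiple [N0 N00 hN0].
have ex : exists N, `[< (0 < N)%N /\ algebraic_integer (N%:R * x) >] by exists N0; apply/asboolP.
case: (ex_minnP ex) => N /asboolP[N1 N2] hmin; exists N; split=> // N' h1 h2.
by apply: hmin; apply/asboolP.
Qed.

Lemma natr_algint (n : nat) : algebraic_integer (n%:R : K).
Proof. exact: integral_nat. Qed.

Lemma int_algint (n : int) : algebraic_integer (n%:~R : K).
Proof. exact: integral_id. Qed.

Lemma algint_prod (I : finType) (F : I -> K) : (forall i, algebraic_integer (F i)) -> algebraic_integer (\prod_i F i).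
Proof.
move=> h; elim/big_ind: _ => //; first exact: integral1.
by move=> x y; exact: integral_mul.
Qed.

Lemma algint_sqrt (d : K) (M : int) : d ^+ 2 = M%:~R -> algebraic_integer d.
Proof.
move=> hd; exists ('X^2 - M%:P).
  by rewrite monicE lead_coefDl ?lead_coefXn// size_polyXn size_polyN size_polyC; case: (M != 0).
by apply/rootP; rewrite rmorphB /= map_polyXn map_polyC !hornerE hd subrr.
Qed.

Lemma algint_algebraic (x : K) : algebraic_integer x -> algebraic_number x.
Proof.
move=> [q qm qx]; exists (map_poly intr q); first by rewrite map_poly_eq0_id0 ?monic_neq0// (monicP qm) oner_neq0.
rewrite -map_poly_comp; suff -> : map_poly ((ratr : rat -> K) \o intr) q = map_poly intr q by [].
by apply: eq_map_poly => i /=; rewrite ratr_int.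
Qed.

(** With u = N a, clearing denominators in a monic integral equation for u / p shows that p divides
    a power of u; as p is prime to N, it divides a. *)
Lemma algint_dvdz (p : nat) (a : int) (N : nat) : prime p -> ~~ (p %| N)%N ->
  algebraic_integer (N%:R * (a%:~R / p%:R) : K) -> (p%:Z %| a)%Z.
Proof.
move=> pp pN [q qm qx].
have p0 : (p%:R : K) != 0 by rewrite pnatr_eq0 -lt0n prime_gt0.
set u := N%:Z * a.
have ux : N%:R * (a%:~R / p%:R) = u%:~R / p%:R :> K by rewrite /u rmorphM /= mulrA -pmulrn.
have uE : u = N%:Z * a by [].
clearbody u.
pose n := (size q).-1.
have sq : size q = n.+1 by rewrite /n prednK// size_poly_gt0 monic_neq0.
have qn : q`_n = 1 by move: qm; rewrite monicE lead_coefE sq => /eqP.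
have E : \sum_(i < n.+1) q`_i * u ^+ i * p%:Z ^+ (n - i) = 0.
  apply: (@intr_inj K); rewrite rmorph0 rmorph_sum /=.
  have /rootP := qx; rewrite (@horner_coef_wide _ n.+1) ?size_map_poly_id0 ?sq ?(monicP qm) ?oner_neq0// => h.
  transitivity ((p%:R : K) ^+ n * \sum_(i < n.+1) (map_poly intr q)`_i * (N%:R * (a%:~R / p%:R)) ^+ i); last by rewrite h mulr0.
  rewrite mulr_sumr; apply: eq_bigr => i _.
  rewrite coef_map /= ux !rmorphM /= !rmorphXn /= expr_div_n -pmulrn.
  have hi : (i <= n)%N by rewrite -ltnS.
  have -> : (p%:R : K) ^+ n = p%:R ^+ (n - i) * p%:R ^+ i by rewrite -exprD subnK.
  have pi0 : (p%:R : K) ^+ i != 0 by rewrite expf_neq0.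
  by move: pi0; move: (_ ^+ i) (_ ^+ i) (_ ^+ (n - i)) => x y z x0; cfield.
have hu : (p%:Z %| u ^+ n)%Z.
  move: E; rewrite big_ord_recr /= qn mul1r subnn expr0 mulr1 => /eqP; rewrite addr_eq0 => /eqP E.
  rewrite -[u ^+ n]opprK -E rpredN; apply: rpred_sum => i _; apply: dvdz_mull.
  by rewrite -(subnSK (ltn_ord i)) exprS dvdz_mulr.
have : (p %| `|u|)%N by move: hu; rewrite dvdzE abszX /= Euclid_dvdX// => /andP[].
by rewrite uE abszM Euclid_dvdM//= (negbTE pN) /= dvdzE.
Qed.

(** Membership in the ring of algebraic integers localized at the rational integers prime to p. *)
Definition pint (p : nat) (x : K) := exists2 N : nat, ~~ (p %| N)%N & algebraic_integer (N%:R * x).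

Section Prime.
Variable p : nat.
Hypothesis pp : prime p.

Lemma pint_algint x : algebraic_integer x -> pint p x.
Proof. by move=> h; exists 1%N; rewrite ?mul1r// dvdn1 neq_ltn prime_gt1// orbT. Qed.

Lemma pintM x y : pint p x -> pint p y -> pint p (x * y).
Proof.
move=> [N h1 h2] [N' h1' h2']; exists (N * N')%N; first by rewrite Euclid_dvdM// negb_or h1.
by rewrite natrM mulrACA; exact: integral_mul.
Qed.

Lemma pintD x y : pint p x -> pint p y -> pint p (x + y).
Proof.
move=> [N h1 h2] [N' h1' h2']; exists (N * N')%N; first by rewrite Euclid_dvdM// negb_or h1.
rewrite mulrDr; apply: integral_add.
  rewrite mulnC natrM -mulrA; exact: integral_mul (natr_algint _) h2.
rewrite natrM -mulrA; exact: integral_mul (natr_algint _) h2'.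
Qed.

Lemma pint_int (n : int) : pint p n%:~R.
Proof. exact: pint_algint (int_algint _). Qed.

Lemma pint_nat (n : nat) : pint p n%:R.
Proof. exact: pint_algint (natr_algint _). Qed.

Lemma pintN x : pint p x -> pint p (- x).
Proof. by move=> h; rewrite -mulN1r; apply: pintM h; exact: (pint_int (-1)). Qed.

Lemma pintB x y : pint p x -> pint p y -> pint p (x - y).
Proof. by move=> h1 h2; apply: pintD h1 (pintN h2). Qed.

Lemma pint_sum (I : Type) (r : seq I) (P : pred I) (F : I -> K) : (forall i, P i -> pint p (F i)) ->
  pint p (\sum_(i <- r | P i) F i).
Proof.
by move=> h; elim/big_ind: _ => //; [exact: (pint_nat 0)|move=> x y; exact: pintD].
Qed.

Lemma pint_natV (n : nat) : ~~ (p %| n)%N -> pint p (n%:R)^-1.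
Proof.
move=> h; exists n => //; rewrite divff; first exact: integral1.
by rewrite pnatr_eq0; apply: contra h => /eqP ->; rewrite dvdn0.
Qed.

Lemma pint_div (n : nat) x : ~~ (p %| n)%N -> pint p (n%:R * x) -> pint p x.
Proof.
move=> h hx; have n0 : (n%:R : K) != 0 by rewrite pnatr_eq0; apply: contra h => /eqP ->; rewrite dvdn0.
by rewrite -[x](mulKf n0); apply: pintM hx; exact: pint_natV.
Qed.

Lemma pint_dvdz (a : int) : pint p (a%:~R / p%:R) -> (p%:Z %| a)%Z.
Proof. by move=> [N pN hN]; exact: algint_dvdz hN. Qed.

End Prime.

Lemma algebraic_pint (x : K) : algebraic_number x -> exists P0, forall p, prime p -> (P0 < p)%N -> pint p x.
Proof.
move=> /algebraic_multiple [N N0 hN]; exists N => p pp hp; exists N => //.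
by rewrite gtnNdvd.
Qed.

Lemma pint_algebraic p (x : K) : prime p -> pint p x -> algebraic_number x.
Proof.
move=> pp [N pN hN]; have N0 : (N%:R : K) != 0 by rewrite pnatr_eq0; apply: contra pN => /eqP ->; rewrite dvdn0.
rewrite -[x](mulKf N0); apply: algebraic_mul (algint_algebraic hN); apply: algebraic_inv.
exact: algint_algebraic (natr_algint _).
Qed.

(** Were the least denominator prime to p, it would itself witness [pint p x]. *)
Lemma bad_denominator p (x : K) : prime p -> algebraic_number x -> ~ pint p x ->
  exists N, [/\ x != 0, is_denominator x N & (p %| N)%N].
Proof.
move=> pp hx hp; have [N hN] := denominator_exists hx; exists N; split=> //.
  by apply/eqP => x0; apply: hp; rewrite x0; exact: (pint_nat pp 0).
apply: contra_notT hp => pN; exists N => //; by case: hN.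
Qed.

End Integrality.

(** * Integrality of formal exponentials *)

Section FormalIntegrality.
Variable R : realType.
Local Notation K := (C R).
Implicit Types (a b g x : fps R).

(** The truncated form of [fD_uniq]: it compares the exponential of [fL] with finite products that
    have the same logarithmic derivative up to order N only. *)
Lemma fD_uniq_upto N g h a b : cf g 0 = 0 -> cf h 0 = 0 -> (forall n, (n <= N)%N -> cf g n = cf h n) ->
  fD a = g * a -> fD b = h * b -> cf a 0 = cf b 0 -> forall n, (n <= N)%N -> cf a n = cf b n.
Proof.
move=> g0 h0' gh ha hb h0; elim/ltn_ind => -[//|n] IH hn.
have n0 : (n.+1%:R : K) != 0 by rewrite pnatr_eq0.
apply: (mulfI n0).
have := congr1 (fun s => cf s n.+1) ha; have := congr1 (fun s => cf s n.+1) hb.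
rewrite !cfM /= => -> ->; rewrite big_ord_recl [in RHS]big_ord_recl /= g0 h0' !mul0r !add0r.
apply: eq_bigr => i _; have hi := ltn_ord i; congr (_ * _).
  by apply: gh; rewrite /bump /=; lia.
by rewrite IH//; rewrite /bump /=; lia.
Qed.

Lemma fexpD a b : cf a 0 = 0 -> cf b 0 = 0 -> fexp (a + b) = fexp a * fexp b.
Proof.
move=> a0 b0; have ab0 : cf (a + b) 0 = 0 by rewrite cfD a0 b0 addr0.
have fab0 : cf (fD (a + b)) 0 = 0 by rewrite /= mul0r.
apply: (fD_uniq fab0 (fD_fexp ab0)); last by rewrite cfM0 !cf_fexp0 mulr1.
by rewrite fDM fDD !fD_fexp//; ring.
Qed.

Lemma fexp0 : fexp (0 : fps R) = 1.
Proof.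
apply: (@fD_uniq _ 0) => //; last by rewrite cf_fexp0.
  by rewrite fD_fexp// (_ : fD 0 = 0)//; apply: fps_ext => n /=; rewrite mulr0.
by rewrite fD1 mul0r.
Qed.

Lemma fexpMn a n : cf a 0 = 0 -> fexp (a *+ n) = fexp a ^+ n.
Proof.
move=> a0; elim: n => [|n IH]; first by rewrite mulr0n fexp0.
by rewrite mulrS exprS fexpD ?IH// cfMn a0 mul0rn.
Qed.

Lemma fexpN a : cf a 0 = 0 -> fexp a * fexp (- a) = 1.
Proof. by move=> a0; rewrite -fexpD ?subrr ?fexp0// cfN a0 oppr0. Qed.

Lemma fC1 : fC 1 = 1 :> fps R. Proof. by apply: fps_ext => -[|n]. Qed.
Lemma fCD (c d : K) : fC (c + d) = fC c + fC d.
Proof. by apply: fps_ext => n; rewrite cfD /= mulrnDl. Qed.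
Lemma fCM (c d : K) : fC (c * d) = fC c * fC d.
Proof. by apply: fps_ext => n; rewrite cf_fC /= mulrnAr. Qed.
Lemma fCN (c : K) : fC (- c) = - fC c.
Proof. by apply: fps_ext => n; rewrite cfN /= mulNrn. Qed.
Lemma fC_nat n : fC n%:R = n%:R :> fps R.
Proof. by elim: n => [|n IH]; [apply: fps_ext => -[|n]|rewrite -!natr1 fCD IH fC1]. Qed.

Lemma fD_fdil (d : nat) a : (0 < d)%N -> fD (fdil d a) = fC d%:R * fdil d (fD a).
Proof.
move=> d0; apply: fps_ext => n; rewrite cf_fC /=; case: ifP => h; last by rewrite !mulr0.
by rewrite mulrA -natrM mulnC divnK.
Qed.

Lemma fexp_fdil (d : nat) a F : (0 < d)%N -> PS a F -> cf a 0 = 0 -> fexp (fdil d a) = fdil d (fexp a).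
Proof.
move=> d0 h a0; have h1 : cf (fdil d a) 0 = 0 by rewrite cf_fdil0.
exact: PS_uniq (PS_fexp (PS_dil d0 h) h1) (PS_dil d0 (PS_fexp h a0)).
Qed.

Section Prime.
Variable p : nat.
Hypothesis pp : prime p.

Definition fpint a := forall n, pint p (cf a n).

Lemma fpintM a b : fpint a -> fpint b -> fpint (a * b).
Proof. by move=> ha hb n; rewrite cfM; apply: pint_sum => // i _; exact: pintM. Qed.

Lemma fpintD a b : fpint a -> fpint b -> fpint (a + b).
Proof. by move=> ha hb n; rewrite cfD; exact: pintD. Qed.

Lemma fpintB a b : fpint a -> fpint b -> fpint (a - b).
Proof. by move=> ha hb n; rewrite cfB; exact: pintB. Qed.

Lemma fpint1 : fpint 1.
Proof. by move=> n; rewrite cf1; exact: pint_nat. Qed.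

Lemma fpintX a n : fpint a -> fpint (a ^+ n).
Proof. by move=> ha; elim: n => [|n IH]; [exact: fpint1|rewrite exprS; exact: fpintM]. Qed.

Lemma fpintC c a : pint p c -> fpint a -> fpint (fC c * a).
Proof. by move=> hc ha n; rewrite cf_fC; exact: pintM. Qed.

Lemma fpint_fD a : fpint a -> fpint (fD a).
Proof. by move=> ha n; apply: pintM => //; exact: pint_nat. Qed.

Lemma fpint_fdil d a : fpint a -> fpint (fdil d a).
Proof. by move=> ha n /=; case: ifP => _ //; exact: (pint_nat _ pp 0). Qed.

Lemma fpint_div (m : nat) g a : ~~ (p %| m)%N -> cf g 0 = m%:R -> fpint g -> fpint (g * a) -> fpint a.
Proof.
move=> hm g0 hg hga; elim/ltn_ind => n IH; apply: (pint_div pp hm).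
have := hga n; rewrite cfM big_ord_recl subn0 g0 /= => h.
rewrite -[_ * _](addrK (\sum_(i < n) cf g (bump 0 i) * cf a (n - bump 0 i))).
apply: pintB => //; apply: pint_sum => // i _; apply: pintM => //; apply: IH.
by rewrite /bump /=; have := ltn_ord i; lia.
Qed.

(** The n-th coefficient of a ^ v is v times that of a plus a polynomial in lower coefficients, and
    v is invertible at p. *)
Lemma fpint_root (v : nat) a : ~~ (p %| v)%N -> cf a 0 = 1 -> fpint (a ^+ v) -> fpint a.
Proof.
move=> hv a0 hav; elim/ltn_ind => -[|n] IH; first by rewrite a0; exact: (pint_nat _ pp 1).
have a00 k : cf (a ^+ k) 0 = 1.
  by elim: k => // k IHk; rewrite exprS cfM0 IHk a0 mulr1.
have low k m : (m < n.+1)%N -> pint p (cf (a ^+ k) m).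
  elim: k m => [|k IHk] m hm; first by rewrite cf1; exact: pint_nat.
  rewrite exprS cfM; apply: pint_sum => // i _; have hi := ltn_ord i.
  by apply: pintM => //; [apply: IH|apply: IHk]; lia.
have key k : pint p (cf (a ^+ k) n.+1 - k%:R * cf a n.+1).
  elim: k => [|k IHk]; first by rewrite mul0r subr0 cf1; exact: pint_nat.
  rewrite exprS cfM big_ord_recl big_ord_recr /= subn0 a0 mul1r /bump /= !add1n subnn a00 mulr1.
  set S := \sum_(i < n) _.
  have -> : cf (a ^+ k) n.+1 + (S + cf a n.+1) - k.+1%:R * cf a n.+1 = (cf (a ^+ k) n.+1 - k%:R * cf a n.+1) + S.
    by rewrite -natr1; ring.
  apply: pintD => //; apply: pint_sum => // i _; have hi := ltn_ord i.
  by apply: pintM => //; [apply: IH|apply: low]; rewrite /bump /=; lia.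
apply: (pint_div pp hv).
by have := pintB pp (hav n.+1) (key v); rewrite opprB addrC subrK.
Qed.

Definition fone_sub (k : nat) : fps R := 1 - fX ^+ k.
(** The logarithmic derivative of 1 - X ^ k for X d/dX, namely minus the sum of k X ^ (k j) over j >
    0. *)
Definition flog (k : nat) : fps R := Fps (fun n => if (0 < n)%N && (k %| n)%N then - k%:R else 0).

Lemma cf_fXk k n : cf (fX ^+ k : fps R) n = (n == k)%:R.
Proof.
rewrite -[fX ^+ k]mulr1 cf_fXn cf1 subn_eq0; case: leqP => h.
  by rewrite eqn_leq h andbT.
by rewrite ltn_eqF.
Qed.

Lemma flogE k : (0 < k)%N -> fD (fone_sub k) = flog k * fone_sub k.
Proof.
move=> k0; apply: fps_ext => n; have -> : cf (fD (fone_sub k)) n = n%:R * ((n == 0%N)%:R - (n == k)%:R) by rewrite -(cf_fXk k).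
rewrite /fone_sub [flog k * _]mulrBr mulr1 cfB [flog k * _]mulrC cf_fXn /=.
have [->|n0] := posnP n; first by rewrite mul0r leqNgt k0 subr0.
have [->|nk] := eqVneq n k.
  by rewrite leqnn subnn /= dvdnn !subr0 sub0r mulrN mulr1.
rewrite subrr mulr0; case: (leqP k n) => h; last first.
  by rewrite subr0 ifF// gtnNdvd.
have hk : (0 < n - k)%N by rewrite subn_gt0 ltn_neqAle eq_sym nk.
by rewrite hk /= dvdn_subl// subrr.
Qed.

Lemma cf_fone_sub0 k : (0 < k)%N -> cf (fone_sub k) 0 = 1.
Proof. by move=> k0; rewrite /fone_sub cfB cf1 cf_fXk eq_sym (gtn_eqF k0) subr0. Qed.

Lemma fprod_log N : fD (\prod_(k < N) fone_sub k.+1) = (\sum_(k < N) flog k.+1) * \prod_(k < N) fone_sub k.+1.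
Proof.
elim: N => [|N IH]; first by rewrite !big_ord0 mul0r fD1.
by rewrite !big_ord_recr /= fDM IH flogE//; ring.
Qed.

(* fexp fL is the infinite product of the 1 - X ^ k. *)
Lemma fpint_fexp_fL : fpint (fexp (fL R)).
Proof.
move=> n; have e : cf (fexp (fL R)) n = cf (\prod_(k < n) fone_sub k.+1) n.
  apply: (@fD_uniq_upto n (fD (fL R)) (\sum_(k < n) flog k.+1)) => //.
  - by rewrite /= mul0r.
  - by rewrite cf_sum big1.
  - case=> [|m] hm; first by rewrite cf_sum big1 //= mul0r.
    rewrite fD_fL cfN cf_sum /= (@sigmaE m.+1 n.+1)// natr_sum big_ord_recl /= add0r -sumrN.
    apply: eq_bigr => k _; rewrite /bump add1n; by case: ifP => _; rewrite ?oppr0.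
  - exact: fD_fexp (cf_fL0 R).
  - exact: fprod_log.
  - rewrite cf_fexp0; elim/big_ind: _ => //; last by move=> k _; rewrite cf_fone_sub0.
    by move=> x y h1 h2; rewrite cfM0 -h1 -h2 mulr1.
rewrite e; suff : fpint (\prod_(k < n) fone_sub k.+1) by [].
elim/big_ind: _; [exact: fpint1|exact: fpintM|move=> k _].
apply: fpintB; first exact: fpint1.
by move=> m; rewrite cf_fXk; exact: pint_nat.
Qed.

(** Raised to the power denq x, the series becomes an integral power of [fexp fL], so only primes
    dividing the denominator of x could spoil integrality. *)
Lemma fpint_fexp_rat (x : rat) : ~~ (p %| `|denq x|)%N -> fpint (fexp (fC (ratr x) * fL R)).
Proof.
move=> hx; set v := `|denq x|%N in hx; set y := fexp _.
have L0 := cf_fL0 R; have xL0 : cf (fC (ratr x) * fL R) 0 = 0 by rewrite cf_fC L0 mulr0.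
apply: (fpint_root hx); first exact: cf_fexp0.
rewrite /y -fexpMn//.
have -> : fC (ratr x) * fL R *+ v = fC ((numq x)%:~R) * fL R.
  rewrite -mulr_natl -fC_nat mulrA -fCM; congr (fC _ * _).
  rewrite -[in LHS](divq_num_den x) fmorph_div /= !ratr_int mulrC.
  have -> : v%:R = (denq x)%:~R :> K by rewrite -[in RHS](gez0_abs (denq_ge0 x)) -pmulrn.
  by rewrite divfK// intr_eq0 denq_neq0.
case: (numq x) => n.
  by rewrite -pmulrn fC_nat mulr_natl fexpMn//; apply: fpintX; exact: fpint_fexp_fL.
have h := fpint_fexp_fL.
have hN : fpint (fexp (- fL R)).
  apply: (@fpint_div 1 (fexp (fL R))) => //; rewrite ?cf_fexp0 ?fexpN//; last exact: fpint1.
  by rewrite dvdn1 neq_ltn prime_gt1// orbT.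
rewrite NegzE rmorphN /= -pmulrn fCN fC_nat mulNr mulr_natl -mulNrn fexpMn ?cfN ?L0 ?oppr0//.
exact: fpintX.
Qed.

Lemma fpint_fexp_dil (d : nat) (x : rat) : (0 < d)%N -> ~~ (p %| `|denq x|)%N -> fpint (fexp (fC (ratr x) * fdil d (fL R))).
Proof.
move=> d0 hx; have -> : fC (ratr x) * fdil d (fL R) = fdil d (fC (ratr x) * fL R).
  apply: fps_ext => n; transitivity (if (d %| n)%N then ratr x * cf (fL R) (n %/ d) else 0); last by rewrite -cf_fC.
  by rewrite cf_fC /=; case: ifP => _; rewrite ?mulr0.
rewrite (fexp_fdil d0 (PS_Z (ratr x) (@PS_Lf R))) ?cf_fC ?cf_fL0 ?mulr0//.
exact/fpint_fdil/fpint_fexp_rat.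
Qed.

Lemma fDC c a : fD (fC c * a) = fC c * fD a.
Proof. by apply: fps_ext => n; rewrite cf_fC -[LHS]/(n%:R * cf (fC c * a) n) cf_fC mulrCA. Qed.

Lemma fpint_fD_fB : fpint (fD (fB R)).
Proof.
have hs : fpint (fsig R) by move=> n; exact: pint_nat.
have hd (d : nat) : (0 < d)%N -> fpint (fD (fdil d (fL R))).
  move=> d0; rewrite fD_fdil//; apply: fpintC; first exact: pint_nat.
  apply: fpint_fdil => n; rewrite fD_fL cfN; exact: pintN.
have h1 : fpint (fD (fL R)) by move=> n; rewrite fD_fL cfN; exact: pintN.
have hC (m : nat) a : fpint (fD a) -> fpint (fD (fC m%:R * a)).
  by move=> h; rewrite fDC; apply: fpintC => //; exact: pint_nat.
have -> : fD (fB R) = fD (fC 16 * fL R) + fD (fC 8 * fdil 4 (fL R)) - fD (fC 24 * fdil 2 (fL R)).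
  by apply: fps_ext => n; rewrite !cfB !cfD /= -mulrDr -mulrBr.
apply: fpintB; last exact: hC _ _ (hd 2%N isT).
by apply: fpintD; [exact: hC|exact: hC _ _ (hd 4%N isT)].
Qed.

Let exp_fpint a := cf a 0 = 0 /\ fpint (fexp a).

Let exp_fpintD a b : exp_fpint a -> exp_fpint b -> exp_fpint (a + b).
Proof.
move=> [a0 ha] [b0 hb]; split; first by rewrite cfD a0 b0 addr0.
by rewrite fexpD//; exact: fpintM.
Qed.

Let term (n d : nat) (x : rat) := fC (ratr x) * fdil d (fL R) *+ n.

Let cf_term (n d : nat) (x : rat) : (0 < d)%N -> cf (term n d x) 0 = 0.
Proof. by move=> d0; rewrite cfMn cf_fC cf_fdil0 ?cf_fL0// mulr0 mul0rn. Qed.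

Let exp_fpint_term (n d : nat) (x : rat) : (0 < d)%N -> ~~ (p %| `|denq x|)%N -> exp_fpint (term n d x).
Proof.
move=> d0 hx; split; first exact: cf_term.
rewrite /term fexpMn; last by rewrite cf_fC cf_fdil0 ?cf_fL0// mulr0.
exact/fpintX/fpint_fexp_dil.
Qed.

Let fdil1 a : fdil 1 a = a.
Proof. by apply: fps_ext => n /=; rewrite dvd1n divn1. Qed.

Let p1 : ~~ (p %| 1)%N. Proof. by rewrite dvdn1 neq_ltn prime_gt1// orbT. Qed.

Lemma fpint_fexp_fB : fpint (fexp (fB R)).
Proof.
have -> : fB R = term 16 1 1 + term 8 4 1 + term 24 2 (-1).
  have r1 : ratr (1 : rat) = 1 :> K by exact: rmorph1.
  have rN : ratr (-1 : rat) = -1 :> K by rewrite rmorphN /= r1.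
  rewrite /term fdil1 rN r1 fCN fC1 /fB !fC_nat.
  by move: (fL R) (fdil 4 _) (fdil 2 _) => *; ring.
exact: (exp_fpintD (exp_fpintD (@exp_fpint_term 16 1 1 isT p1) (@exp_fpint_term 8 4 1 isT p1)) (@exp_fpint_term 24 2 (-1) isT p1)).2.
Qed.

Lemma fpint_fPsi (x : rat) (l : int) : ~~ (p %| `|denq x|)%N -> fpint (fPsi (ratr x) 0 l).
Proof.
move=> hx; have hl : ~~ (p %| `|denq l%:~R|)%N by rewrite denq_int.
rewrite /fPsi.
have -> : fC (ratr x) * fA1 R + fC 0 * fB R + fC l%:~R * fTh R =
    term 8 1 x + term 16 4 x + term 24 2 (- x) + term 20 2 l%:~R + term 8 1 (- l%:~R) + term 8 4 (- l%:~R).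
  rewrite /term fdil1 !rmorphN /= !ratr_int !fCN (fC_nat 0) /fA1 /fTh !fC_nat.
  by move: (fC (ratr x)) (fC l%:~R) (fL R) (fdil 4 _) (fdil 2 _) => *; ring.
have hx' : ~~ (p %| `|denq (- x)|)%N by rewrite denqN.
have hl' : ~~ (p %| `|denq (- l%:~R)|)%N by rewrite denqN.
exact: (exp_fpintD (exp_fpintD (exp_fpintD (exp_fpintD (exp_fpintD
  (@exp_fpint_term 8 1 _ isT hx) (@exp_fpint_term 16 4 _ isT hx)) (@exp_fpint_term 24 2 _ isT hx'))
  (@exp_fpint_term 20 2 _ isT hl)) (@exp_fpint_term 8 1 _ isT hl')) (@exp_fpint_term 8 4 _ isT hl')).2.
Qed.

Definition fexpB (s : K) := fexp (fC s * fB R).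

Lemma cf_sfB s : cf (fC s * fB R) 0 = 0.
Proof. by rewrite cf_fC cf_fB0 mulr0. Qed.

Lemma fD_fexpB s : fD (fexpB s) = fD (fB R) * (fC s * fexpB s).
Proof.
rewrite fD_fexp ?cf_sfB//; have -> : fD (fC s * fB R) = fC s * fD (fB R).
  by apply: fps_ext => n; rewrite cf_fC -[LHS]/(n%:R * cf (fC s * fB R) n) cf_fC mulrCA.
by rewrite -/(fexpB s); ring.
Qed.

Lemma fD_sum (I : Type) (r : seq I) (F : I -> fps R) : fD (\sum_(i <- r) F i) = \sum_(i <- r) fD (F i).
Proof.
elim: r => [|i r IH]; last by rewrite !big_cons fDD IH.
by rewrite !big_nil; apply: fps_ext => n /=; rewrite mulr0.
Qed.

(* fD (fB R) = - 16 X + ... has integral coefficients, so dividing by it costs only powers of 2. *)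
Lemma fpint_fD_fexpB (I : Type) (r : seq I) (D e : I -> K) : p != 2%N ->
  fpint (\sum_(i <- r) fC (D i) * fexpB (e i)) -> fpint (\sum_(i <- r) fC (D i * e i) * fexpB (e i)).
Proof.
move=> p2 h; have h1 := fpint_fD h.
have e1 : fD (\sum_(i <- r) fC (D i) * fexpB (e i)) = fD (fB R) * \sum_(i <- r) fC (D i * e i) * fexpB (e i).
  rewrite fD_sum mulr_sumr; apply: eq_bigr => i _; rewrite fDC fD_fexpB fCM; ring.
rewrite e1 in h1; pose g := fsh (- fD (fB R)).
have g0 : cf (- fD (fB R)) 0 = 0 by rewrite cfN /= mul0r oppr0.
have hg : - fD (fB R) = fX * g by rewrite /g fshK.
apply: (@fpint_div 16 g).
- by rewrite (_ : 16 = 2 ^ 4)%N// Euclid_dvdX// dvdn_prime2// (negbTE p2).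
- by rewrite /g -[LHS]/(cf (- fD (fB R)) 1) cfN -[cf (fD _) 1]/(1 * cf (fB R) 1) cf_fB1 mul1r opprK.
- by move=> n; rewrite /g -[cf _ n]/(cf (- fD (fB R)) n.+1) cfN; apply: pintN => //; exact: fpint_fD_fB.
- move=> n; have := h1 n.+1; rewrite -[fD (fB R)]opprK hg mulNr -mulrA cfN cf_fX => h2.
  by have := pintN pp h2; rewrite opprK.
Qed.

(** The map of [fpint_fD_fexpB] multiplies B ^ e by e. Subtracting x times the identity, for each x
    in c in turn, preserves integrality and multiplies the coefficient of B ^ e by e - x. *)
Lemma fpint_eigen (I : Type) (r : seq I) (D e : I -> K) (c : seq K) : p != 2%N ->
  (forall x : K, x \in c -> pint p x) ->
  fpint (\sum_(i <- r) fC (D i) * fexpB (e i)) ->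
  fpint (\sum_(i <- r) fC (D i * \prod_(x <- c) (e i - x)) * fexpB (e i)).
Proof.
move=> p2 hc h; elim: c hc => [|x c IH] hc.
  by under eq_bigr do rewrite big_nil mulr1.
have {}IH := IH (fun y hy => hc y (mem_behead (s := x :: c) hy)).
have hx : pint p x by apply: hc; rewrite mem_head.
have := fpintB (fpint_fD_fexpB p2 IH) (fpintC hx IH).
suff -> : \sum_(i <- r) fC (D i * \prod_(y <- x :: c) (e i - y)) * fexpB (e i) =
  \sum_(i <- r) fC (D i * \prod_(y <- c) (e i - y) * e i) * fexpB (e i) -
  fC x * \sum_(i <- r) fC (D i * \prod_(y <- c) (e i - y)) * fexpB (e i) by [].
rewrite mulr_sumr -sumrB; apply: eq_bigr => i _.
rewrite big_cons [fC x * _]mulrA -fCM -mulrBl -fCN -fCD; congr (fC _ * _); ring.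
Qed.

(* The map [fpint_fD_fexpB] is diagonal on the B ^ e: a Lagrange polynomial in it isolates one term. *)
Lemma fpint_isolate (I : finType) (D e : I -> K) (j : I) : p != 2%N -> (forall i, pint p (e i)) ->
  fpint (\sum_i fC (D i) * fexpB (e i)) -> fpint (fC (D j * \prod_(i | i != j) (e j - e i)) * fexpB (e j)).
Proof.
move=> p2 he h; pose c := [seq e i | i <- enum I & i != j].
have hc (x : K) : x \in c -> pint p x by move=> /mapP[i _ ->].
have := fpint_eigen p2 hc h; rewrite (bigD1 j)//= [X in _ + X]big1 ?addr0; last first.
  move=> i ij; rewrite big_map big_filter big_enum_cond (bigD1 i)//= subrr mul0r mulr0.
  by rewrite (fC_nat 0) mul0r.
by rewrite big_map big_filter big_enum_cond.
Qed.

End Prime.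

(** * Composition of series and the binomial expansion of B ^ s *)

Definition fcomp (b : nat -> K) x : fps R := Fps (fun n => \sum_(k < n.+1) b k * cf (x ^+ k) n).

Lemma cf_fcomp (b : nat -> K) x n N : cf x 0 = 0 -> (n < N)%N -> cf (fcomp b x) n = \sum_(k < N) b k * cf (x ^+ k) n.
Proof.
move=> x0 hN; rewrite /= -(subnKC hN) big_split_ord /= [X in _ = _ + X]big1 ?addr0// => i _.
by rewrite cfX_lt ?mulr0// leq_addr.
Qed.

Lemma fcompM (b : nat -> K) x y : cf x 0 = 0 ->
  forall n, cf (fcomp b x * y) n = \sum_(k < n.+1) b k * cf (x ^+ k * y) n.
Proof.
move=> x0 n; rewrite cfM; under [RHS]eq_bigr do rewrite cfM mulr_sumr.
rewrite exchange_big; apply: eq_bigr => i _; rewrite (@cf_fcomp b x i n.+1)// mulr_suml.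
by apply: eq_bigr => k _; rewrite mulrA.
Qed.

Lemma fD_fcomp (b : nat -> K) x : cf x 0 = 0 -> fD (fcomp b x) = fcomp (fun k => k.+1%:R * b k.+1) x * fD x.
Proof.
move=> x0; apply: fps_ext => n; rewrite fcompM// -[LHS]/(n%:R * cf (fcomp b x) n) (@cf_fcomp b x n n.+2)//.
rewrite big_ord_recl expr0 cf1 mulrDr.
have -> : n%:R * (b 0%N * (n == 0%N)%:R) = 0 by case: (n) => [|?]; rewrite ?mul0r ?mulr0.
rewrite add0r mulr_sumr; apply: eq_bigr => k _; rewrite lift0 mulrCA.
have -> : n%:R * cf (x ^+ k.+1) n = cf (x ^+ k * fD x) n * k.+1%:R by rewrite mulr_natr -cfMn -fDX.
by rewrite [_ * k.+1%:R]mulrC mulrCA mulrA.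
Qed.

Lemma fcomp_mulx (b : nat -> K) x : cf x 0 = 0 ->
  fcomp b x * x = fcomp (fun k => if k is k'.+1 then b k' else 0) x.
Proof.
move=> x0; apply: fps_ext => n; rewrite fcompM// (@cf_fcomp _ x n n.+2)// [RHS]big_ord_recl mul0r add0r.
by apply: eq_bigr => k _; rewrite lift0 exprSr.
Qed.

(** This is (- 1) ^ n times the binomial coefficient of s over n, the coefficient of x ^ n in (1 -
    x) ^ s. *)
Fixpoint bs (s : K) (n : nat) : K := if n is n'.+1 then bs s n' * (n'%:R - s) / n%:R else 1.

Lemma bsS s n : n.+1%:R * bs s n.+1 = bs s n * (n%:R - s).
Proof. by rewrite /= mulrC divfK// pnatr_eq0. Qed.

Lemma bs_fact s n : n`!%:R * bs s n = \prod_(i < n) (i%:R - s).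
Proof.
elim: n => [|n IH]; first by rewrite big_ord0 mulr1.
by rewrite big_ord_recr -IH factS natrM mulrAC bsS /=; ring.
Qed.

(** The modular function lambda = 1 - B, named after its leading coefficient. *)
Definition x16 : fps R := 1 - fexp (fB R).

Lemma cf_x160 : cf x16 0 = 0. Proof. by rewrite cfB cf_fexp0 cf1 subrr. Qed.
Lemma cf_x161 : cf x16 1 = 16. Proof. by rewrite cfB cf1 cf_fexp1 ?cf_fB0// cf_fB1 sub0r opprK. Qed.

Lemma cf_Xn_n x n : cf x 0 = 0 -> cf (x ^+ n) n = cf x 1 ^+ n.
Proof.
move=> x0; rewrite -(fshK x0) exprMn cf_fXn leqnn subnn cf_fX /=.
by elim: n => [|n IH]; rewrite ?expr0 ?cf1// exprS cfM0 IH exprS.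
Qed.

(* the binomial series of (1 - x)^s *)
Lemma fexpB_binomial s : fexpB s = fcomp (bs s) x16.
Proof.
have x0 := cf_x160; apply/esym; apply: (@fD_uniq _ (fD (fB R) * fC s)).
- by rewrite cfM0 /= !mul0r.
- rewrite fD_fcomp//; set F' := fcomp _ _.
  have h : F' - F' * x16 = - (fC s * fcomp (bs s) x16).
    rewrite /F' fcomp_mulx//; apply: fps_ext => n; rewrite cfB cfN cf_fC /= mulr_sumr -sumrB -sumrN.
    have e (k : nat) (z : K) : k.+1%:R * bs s k.+1 * z -
        (if k is k'.+1 then k'.+1%:R * bs s k'.+1 else 0) * z = - (s * (bs s k * z)).
      rewrite bsS; case: k => [|k]; first by rewrite mul0r subr0 /=; ring.
      by move: (bs s k.+1) => y; ring.
    by apply: eq_bigr => k _; exact: e.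
  have -> : fD x16 = - (fD (fB R) * (1 - x16)).
    have -> : 1 - x16 = fexp (fB R) by rewrite /x16 opprB addrC subrK.
    rewrite -fD_fexp ?cf_fB0//.
    by rewrite /x16 fDD fD1 add0r; apply: fps_ext => n; rewrite cfN /= mulrN.
  rewrite mulrN mulrCA [F' * _]mulrBr mulr1 h; ring.
- by rewrite fD_fexpB; ring.
- by rewrite cf_fexp0 /= big_ord1 expr0 mulr1.
Qed.

(** The system is triangular: the n-th coefficient of B ^ s is 16 ^ n [bs s n] plus a combination of
    the earlier [bs s k] with coefficients integral at p, and 16 is invertible at p. *)
Lemma fpint_binomial p s : prime p -> p != 2%N -> fpint p (fexpB s) -> forall n, pint p (bs s n).
Proof.
move=> pp p2 hs; elim/ltn_ind => n IH.
have hx : fpint p x16 by apply: fpintB => //; [exact: fpint1|exact: fpint_fexp_fB].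
apply: (@pint_div R p pp (16 ^ n)).
  by rewrite (_ : 16 = 2 ^ 4)%N// -expnM Euclid_dvdX// dvdn_prime2// (negbTE p2).
have := hs n; rewrite fexpB_binomial /= big_ord_recr /= cf_Xn_n ?cf_x160// cf_x161 natrX mulrC => h.
rewrite -[_ * _](addKr (\sum_(k < n) bs s k * cf (x16 ^+ k) n)) addrC.
apply: pintB => //; apply: pint_sum => // k _; apply: pintM => //; first exact: IH.
exact: fpintX.
Qed.

Lemma prime_dvdz_prod p (I : finType) (F : I -> int) : prime p -> (p%:Z %| \prod_i F i)%Z -> exists i, (p%:Z %| F i)%Z.
Proof.
move=> pp; apply: contraPP => /forallNP h; apply/negP; elim/big_ind: _ => //.
- by rewrite dvdzE /= dvdn1 neq_ltn prime_gt1// orbT.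
- by move=> x y hx hy; rewrite dvdzE abszM Euclid_dvdM// negb_or -!dvdzE hx hy.
- by move=> i _; apply/negP/h.
Qed.

(** Otherwise a / v would be a square root of M modulo p. *)
Lemma nonresidue_norm p (M a v : int) : prime p -> ~ (exists x : int, (x ^+ 2 = M %[mod p])%Z) ->
  ~~ (p%:Z %| v)%Z -> ~~ (p%:Z %| a ^+ 2 - v ^+ 2 * M)%Z.
Proof.
move=> pp hM hv; apply/negP => h; apply: hM.
have cop : coprimez p%:Z v by rewrite coprimezE prime_coprime.
have /coprimezP[[w1 w] /= hw] := cop.
exists (a * w); apply/eqP; rewrite eqz_mod_dvd.
have e : w * v = 1 - w1 * p%:Z by rewrite -hw addrC addKr.
have -> : (a * w) ^+ 2 - M = w ^+ 2 * (a ^+ 2 - v ^+ 2 * M) + M * ((w * v) ^+ 2 - 1) by ring.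
rewrite e rpredD//; first exact: dvdz_mull.
have -> : M * ((1 - w1 * p%:Z) ^+ 2 - 1) = M * (w1 * (w1 * p%:Z - 2)) * p%:Z by ring.
exact: dvdz_mull.
Qed.

(* p! q ^ p bs s p is a product of p factors q i - u - v d; multiplied by its conjugate it
   becomes a product of norms, all prime to p when M is not a square modulo p. *)
Lemma binomial_not_pint p (M u v : int) (q : nat) (d : K) : prime p -> d ^+ 2 = M%:~R -> (0 < q)%N ->
  ~ (exists x : int, (x ^+ 2 = M %[mod p])%Z) -> ~~ (p%:Z %| v)%Z ->
  ~ pint p (bs ((u%:~R + v%:~R * d) / q%:R) p).
Proof.
move=> pp hd q0 hM hv; set s := _ / _ => hb.
pose n (i : 'I_p) : int := (q%:Z * i%:Z - u) ^+ 2 - v ^+ 2 * M.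
have q0' : (q%:R : K) != 0 by rewrite pnatr_eq0 -lt0n.
have p0 : (p%:R : K) != 0 by rewrite pnatr_eq0 -lt0n prime_gt0.
pose cj := \prod_(i < p) (q%:R * i%:R - u%:~R + v%:~R * d).
have hcj : algebraic_integer cj.
  apply: algint_prod => i; apply: integral_add; last exact: integral_mul (int_algint _ _) (algint_sqrt hd).
  by apply: integral_sub; [rewrite -natrM; exact: natr_algint|exact: int_algint].
have E : (\prod_i n i)%:~R / p%:R = ((p.-1)`! * q ^ p)%:R * bs s p * cj.
  have e1 : p%:R * (((p.-1)`! * q ^ p)%:R * bs s p * cj) = q%:R ^+ p * (\prod_(i < p) (i%:R - s)) * cj.
    rewrite -bs_fact; have -> : p`! = (p * (p.-1)`!)%N by rewrite -{1 2}(prednK (prime_gt0 pp)) factS.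
    by rewrite !natrM natrX; ring.
  apply: (mulfI p0); rewrite e1 mulrCA divff// mulr1 rmorph_prod /=.
  have -> : (q%:R : K) ^+ p = \prod_(i < p) q%:R by rewrite prodr_const card_ord.
  rewrite /cj -!big_split /=; apply: eq_bigr => i _; rewrite /n rmorphB !rmorphXn rmorphM /= rmorphXn /= rmorphB rmorphM /= -!pmulrn.
  by rewrite -hd /s; field.
have hp : pint p ((\prod_i n i)%:~R / p%:R : K).
  by rewrite E; apply: pintM => //; [apply: pintM => //; exact: pint_nat|exact: pint_algint].
have [i hi] := prime_dvdz_prod pp (pint_dvdz pp hp).
by have := nonresidue_norm (q%:Z * i%:Z - u) pp hM hv; rewrite hi.
Qed.

Theorem not_fpint (I : finType) (D e : I -> K) (j : I) (x : rat) (l M : int) (d : K) : d ^+ 2 = M%:~R ->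
  (forall i, exists u v : int, exists q : nat, [/\ (0 < q)%N, v != 0 & e i = (u%:~R + v%:~R * d) / q%:R]) ->
  injective e -> D j != 0 ->
  exists P0, forall p, prime p -> (P0 < p)%N -> ~ (exists x : int, (x ^+ 2 = M %[mod p])%Z) ->
    ~ fpint p (fPsi (ratr x) 0 l * \sum_i fC (D i) * fexpB (e i)).
Proof.
move=> hd /choice[u /choice[v /choice[q huv]]] inj Dj.
pose c := D j * \prod_(i | i != j) (e j - e i).
have c0 : c != 0.
  rewrite mulf_neq0//; apply/prodf_neq0 => i ij; rewrite subr_eq0.
  by apply: contra ij => /eqP/inj ->.
(* The coefficient c may be transcendental; it is then p-integral for no p and the implication is
   vacuous. Its p-integrality comes from the constant term of the isolated series. *)
have [P1 hP1] : exists P1, forall p, prime p -> (P1 < p)%N -> pint p c -> pint p c^-1.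
  have [hc|hc] := pselect (algebraic_number c).
    have [P1 h1] := algebraic_pint (algebraic_inv hc).
    by exists P1 => p pp hp _; exact: h1.
  by exists 0%N => p pp _ /(pint_algebraic pp).
(* Beyond this bound p divides none of the numbers that have to be invertible at p. *)
exists (P1 + `|denq x| + \sum_i q i + `|v j| + 2)%N => p pp hp hM h.
have pgt n : (0 < n)%N -> (n <= P1 + `|denq x| + \sum_i q i + `|v j| + 2)%N -> ~~ (p %| n)%N.
  by move=> n0 hn; rewrite gtnNdvd// (leq_ltn_trans hn).
have p2 : p != 2%N by rewrite neq_ltn (leq_ltn_trans _ hp) ?orbT//; lia.
have hx : ~~ (p %| `|denq x|)%N by apply: pgt; [rewrite absz_gt0 denq_neq0|lia].
have hq i : ~~ (p %| q i)%N.
  have [q0 _ _] := huv i; apply: pgt => //.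
  by rewrite (bigD1 i)//=; lia.
have he i : pint p (e i).
  have [q0 _ ->] := huv i; apply: pintM => //; last exact: pint_natV.
  by apply: pint_algint => //; apply: integral_add; [exact: int_algint|exact: integral_mul (int_algint _ _) (algint_sqrt hd)].
have h1 : fpint p (\sum_i fC (D i) * fexpB (e i)).
  apply: (@fpint_div p pp 1 (fPsi (ratr x) 0 l)) => //; [by apply: pgt => //; lia|exact: cf_fexp0|exact: fpint_fPsi].
have h2 := fpint_isolate pp j p2 he h1; rewrite -/c in h2.
have hc : pint p c by have := h2 0%N; rewrite cf_fC cf_fexp0 mulr1.
have hc' : pint p c^-1 by apply: hP1 => //; lia.
have h3 : fpint p (fexpB (e j)).
  by move=> n; have := pintM pp hc' (h2 n); rewrite cf_fC mulKf.
have := fpint_binomial pp p2 h3 p; have [q0 v0 ->] := huv j; apply: (binomial_not_pint pp hd q0 hM).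
by rewrite dvdzE; apply: pgt; [rewrite absz_gt0|lia].
Qed.

End FormalIntegrality.

(** * Nonresidues *)

Section Nonresidues.

Lemma freshman (R : comNzRingType) (p : nat) (a b : R) : prime p ->
  exists r, (a + b) ^+ p = a ^+ p + b ^+ p + p%:R * r.
Proof.
case: p => // p pp.
exists (\sum_(i < p) a ^+ (p - i) * b ^+ i.+1 *+ ('C(p.+1, i.+1) %/ p.+1)).
rewrite exprDn big_ord_recl subn0 expr0 mulr1 bin0 mulr1n -addrA; congr (_ + _).
rewrite big_ord_recr /= /bump /= add1n subnn expr0 mul1r binn mulr1n addrC; congr (_ + _).
rewrite mulr_sumr; apply: eq_bigr => i _; rewrite add1n subSS mulr_natl -mulrnA.
by congr (_ *+ _); rewrite divnK// prime_dvd_bin//= ltnS.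
Qed.

Lemma fermat_int (p : nat) (c : int) : prime p -> odd p -> exists m : int, c ^+ p = c + p%:Z * m.
Proof.
move=> pp op; have nat_case (n : nat) : exists m : int, n%:Z ^+ p = n%:Z + p%:Z * m.
  have /eqP := fermat_little n pp; rewrite eqn_mod_dvd; last first.
    by case: n => // n; rewrite -[X in (X <= _)%N]expn1 leq_pexp2l// prime_gt0.
  move=> hd; exists ((n ^ p - n) %/ p)%N.
  rewrite -rmorphXn /= -PoszM mulnC divnK// -PoszD subnKC ?natrXE//.
  by case: (n) => // k; rewrite -[X in (X <= _)%N]expn1 leq_pexp2l// prime_gt0.
case: c => n; first exact: nat_case.
have [m hm] := nat_case n.+1; exists (- m); rewrite NegzE exprNn -signr_odd op expr1 hm; ring.
Qed.

Lemma frobenius_int (p : nat) (g : {poly int}) : prime p -> odd p -> exists h : {poly int}, g ^+ p = g \Po 'X^p + p%:R * h.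
Proof.
move=> pp op; elim/poly_ind: g => [|g c [h IH]].
  by exists 0; rewrite comp_poly0 mulr0 addr0 expr0n gtn_eqF// prime_gt0.
have [r ->] := freshman (g * 'X) c%:P pp; have [m hm] := fermat_int c pp op.
exists (h * 'X^p + m%:P + r).
rewrite exprMn IH comp_polyD comp_polyM comp_polyX comp_polyC -rmorphXn /= hm rmorphD rmorphM /=.
have -> : (p%:Z)%:P = p%:R :> {poly int} by rewrite -[RHS](rmorph_nat polyC) natz.
ring.
Qed.

Definition evz (g : {poly int}) (z : algC) : algC := (map_poly intr g).[z].

Lemma evz_aut (u : {rmorphism algC -> algC}) g z : u (evz g z) = evz g (u z).
Proof.
rewrite /evz -horner_map /= -map_poly_comp; congr (_.[_]).
by apply: eq_map_poly => x /=; rewrite rmorph_int.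
Qed.

Lemma evz_Aint g z : z \in Aint -> evz g z \in Aint.
Proof.
move=> hz; rewrite /evz horner_coef; apply: rpred_sum => i _; apply: rpredM; last exact: rpredX.
by rewrite coef_map /=; apply: Aint_int; exact: intr_int.
Qed.

(* Frobenius at p fixes a square root of M in a cyclotomic ring when M is a square modulo p. *)
Lemma residue_fixed (M : int) (p : nat) (g : {poly int}) (z : algC) : prime p -> (4 * `|M| + 2 < p)%N -> M != 0 ->
  z \in Aint -> evz g z ^+ 2 = M%:~R -> evz g (z ^+ p) ^+ 2 = M%:~R ->
  (exists x : int, (x ^+ 2 = M %[mod p])%Z) -> evz g (z ^+ p) = evz g z.
Proof.
move=> pp hp M0 hz h1 h2 [x /eqP]; rewrite eqz_mod_dvd => hx.
have op : odd p by have [p2|//] := even_prime pp; move: hp; rewrite p2; lia.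
have [h hh] := frobenius_int g pp op.
have eX : evz g z ^+ p = evz g (z ^+ p) + p%:R * evz h z.
  have := congr1 (fun q => evz q z) hh; rewrite /evz rmorphXn /= horner_exp => ->.
  rewrite rmorphD rmorphM /= hornerD hornerM map_comp_poly horner_comp map_polyXn hornerXn.
  by rewrite rmorph_nat -(rmorph_nat polyC) hornerC.
have pM : ~~ (p%:Z %| M)%Z by rewrite dvdzE gtnNdvd ?absz_gt0//; lia.
have px : coprimez p%:Z x.
  rewrite coprimezE prime_coprime//; apply: contra pM => px.
  have : (p%:Z %| x ^+ 2)%Z by rewrite expr2 dvdz_mulr// dvdzE.
  by move=> hx2; have := rpredB hx2 hx; rewrite subKr.
(* Half of Euler's criterion: M is congruent to x ^ 2, and x ^ (p - 1) to 1, so M ^ ((p - 1) / 2) is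
   congruent to 1. *)
have [m hm] : exists m : int, M ^+ (p./2) = 1 + p%:Z * m.
  have [m1 hm1] := fermat_int x pp op.
  have d1 : (p%:Z %| x ^+ p.-1 - 1)%Z.
    rewrite -(Gauss_dvdzr _ px) mulrBr mulr1 -exprS prednK ?prime_gt0// hm1 addrAC subrr add0r; exact: dvdz_mulr.
  have ep : p.-1 = (2 * p./2)%N by rewrite -[in LHS](odd_double_half p) op mul2n.
  rewrite ep exprM in d1.
  have d2 : (p%:Z %| (x ^+ 2) ^+ p./2 - M ^+ p./2)%Z by rewrite subrXX; exact: dvdz_mulr.
  have /dvdzP[m hm] : (p%:Z %| M ^+ p./2 - 1)%Z.
    by have := rpredB d1 d2; rewrite opprB addrC addrA subrK.
  by exists m; rewrite mulrC -hm addrC subrK.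
have e2 : evz g z ^+ p = evz g z + p%:R * (m%:~R * evz g z).
  have -> : evz g z ^+ p = evz g z * (evz g z ^+ 2) ^+ p./2.
    by rewrite -exprM -exprS mul2n -[in LHS](odd_double_half p) op.
  by rewrite h1 -rmorphXn /= hm rmorphD rmorphM /= -pmulrn; ring.
have [//|] : evz g (z ^+ p) = evz g z \/ evz g (z ^+ p) = - evz g z.
  have /eqP : evz g (z ^+ p) ^+ 2 = evz g z ^+ 2 by rewrite h1 h2.
  by rewrite eqf_sqr => /orP[/eqP|/eqP]; [left|right].
(* With the sign - 1, twice the root is p times an algebraic integer w. Squaring gives 4 M = p ^ 2 w
   ^ 2, where w ^ 2 is a nonzero integer, and p is too large for that. *)
move=> hN; exfalso.
have h3 : 2 * evz g z = p%:R * (evz h z - m%:~R * evz g z).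
  by rewrite mulrBr; move: eX; rewrite e2 hN => /eqP; rewrite -subr_eq0 => /eqP e; apply/eqP; rewrite -subr_eq0 -e; apply/eqP; ring.
set w := evz h z - m%:~R * evz g z in h3.
have wA : w \in Aint.
  by rewrite rpredB ?rpredM ?evz_Aint// Aint_int// intr_int.
have h4 : (4 * M)%:~R = p%:R ^+ 2 * w ^+ 2 :> algC by rewrite -exprMn -h3 exprMn h1 rmorphM /= rmorph_nat -natrX.
have wC : w ^+ 2 \is a Num.int.
  apply: Cint_rat_Aint; last exact: rpredX.
  have p0 : (p%:R ^+ 2 : algC) != 0 by rewrite expf_neq0// pnatr_eq0 -lt0n prime_gt0.
  by rewrite -[_ ^+ 2](mulKf p0) -h4 rpredM ?rpredV ?rpredX ?rpred_nat ?rpred_int.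
have /intrP[n hn] := wC; rewrite hn in h4.
have : 4 * M = p%:Z ^+ 2 * n by apply: (@intr_inj algC); rewrite h4 rmorphM rmorphXn /= -pmulrn.
move=> /(congr1 absz); rewrite !abszM /= => e.
have n0 : (0 < `|n|)%N by rewrite lt0n; apply/eqP => n0; move: e; rewrite n0 muln0; lia.
have h5 : (p <= p * p * `|n|)%N by rewrite -mulnA leq_pmulr// muln_gt0 n0 prime_gt0.
move: h5 hp; rewrite -e; lia.
Qed.

(** * Square roots of integers in cyclotomic rings *)

Definition cyclo (a : algC) := exists (N : nat) (z : algC) (g : {poly int}), N.-primitive_root z /\ evz g z = a.

Lemma evzM g h z : evz (g * h) z = evz g z * evz h z.
Proof. by rewrite /evz rmorphM hornerM. Qed.

Lemma evz_comp g h z : evz (g \Po h) z = evz g (evz h z).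
Proof. by rewrite /evz map_comp_poly horner_comp. Qed.

Lemma evz_Xn n z : evz 'X^n z = z ^+ n.
Proof. by rewrite /evz map_polyXn hornerXn. Qed.

Lemma cyclo_lift N z g M (z' : algC) : N.-primitive_root z -> M.-primitive_root z' -> (N %| M)%N ->
  exists h, evz h z' = evz g z.
Proof.
move=> hz hz' hNM.
have z1 : z ^+ M = 1 by apply/eqP; rewrite -(prim_order_dvd hz).
have [i hi] := prim_rootP hz' z1.
by exists (g \Po 'X^i); rewrite evz_comp evz_Xn -hi.
Qed.

Lemma cycloM a b : cyclo a -> cyclo b -> cyclo (a * b).
Proof.
move=> [N [z [g [hz <-]]]] [N' [z' [g' [hz' <-]]]].
have NN : (0 < N * N')%N by rewrite muln_gt0 (prim_order_gt0 hz) (prim_order_gt0 hz').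
have [y hy] := C_prim_root_exists NN.
have [h hh] := cyclo_lift g hz hy (dvdn_mulr _ (dvdnn _)).
have [h' hh'] := cyclo_lift g' hz' hy (dvdn_mull _ (dvdnn _)).
by exists (N * N')%N, y, (h * h'); rewrite evzM hh hh'.
Qed.

Lemma cyclo_int (m : int) : cyclo m%:~R.
Proof.
have [z hz] := C_prim_root_exists (isT : (0 < 1)%N).
by exists 1%N, z, m%:P; rewrite /evz map_polyC hornerC.
Qed.

Definition has_sqrt (x : algC) := exists2 a, cyclo a & a ^+ 2 = x.

Lemma has_sqrtM x y : has_sqrt x -> has_sqrt y -> has_sqrt (x * y).
Proof.
by move=> [a ha <-] [b hb <-]; exists (a * b); [exact: cycloM|rewrite exprMn].
Qed.

Lemma has_sqrt_root n (z : algC) : n.-primitive_root z -> has_sqrt z.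
Proof.
move=> hz; have n0 := prim_order_gt0 hz.
have [y hy] := C_prim_root_exists (isT : (0 < 2)%N) .
have n2 : (0 < n * 2)%N by rewrite muln_gt0 n0.
have [x hx] := C_prim_root_exists n2.
have x2 : n.-primitive_root (x ^+ 2) by have := dvdn_prim_root hx (dvdn_mulr 2 (dvdnn n)); rewrite mulKn.
have [i hi] := prim_rootP x2 (prim_expr_order hz).
exists (x ^+ i); last by rewrite hi -!exprM mulnC.
by exists (n * 2)%N, x, 'X^i; rewrite evz_Xn.
Qed.

Lemma has_sqrtN1 : has_sqrt (-1).
Proof.
have [y hy] := C_prim_root_exists (isT : (0 < 2)%N).
have := has_sqrt_root hy; suff -> : y = -1 by [].
have := prim_expr_order hy => /eqP; rewrite sqrf_eq1 => /orP[/eqP y1|/eqP//].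
have := prim_order_dvd hy 1; rewrite y1 expr1n eqxx; by [].
Qed.

Lemma has_sqrt_sqr a : cyclo a -> has_sqrt (a ^+ 2).
Proof. by exists a. Qed.

(** For a primitive eighth root of unity z, the square of z + 1 / z is 2. *)
Lemma has_sqrt2 : has_sqrt 2.
Proof.
have [z hz] := C_prim_root_exists (isT : (0 < 8)%N).
exists (z + z ^+ 7).
  by exists 8, z, ('X + 'X^7); split=> //; rewrite /evz rmorphD /= map_polyX map_polyXn !hornerE.
have z8 := prim_expr_order hz.
have z4 : z ^+ 4 = -1.
  have : (z ^+ 4) ^+ 2 = 1 by rewrite -exprM.
  move/eqP; rewrite sqrf_eq1 => /orP[|/eqP//].
  by rewrite -(prim_order_dvd hz).
have -> : (z + z ^+ 7) ^+ 2 = z ^+ 2 + 2 * z ^+ 8 + z ^+ 8 * (z ^+ 4 * z ^+ 2) by ring.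
by rewrite z8 z4; ring.
Qed.

Lemma prod_one_sub n (z : algC) : n.+1.-primitive_root z -> \prod_(i < n) (1 - z ^+ i.+1) = n.+1%:R.
Proof.
move=> hz; have := factor_Xn_sub_1 hz; rewrite big_nat_recl// expr0 subrX1 => h.
have X1 : 'X - 1%:P != 0 :> {poly algC} by rewrite polyXsubC_eq0.
have {h} := mulfI X1 h; move/(congr1 (fun q => q.[1])).
rewrite big_mkord horner_prod horner_sum => h.
transitivity (\prod_(i < n) ('X - (z ^+ i.+1)%:P).[1]); first by apply: eq_bigr => i _; rewrite !hornerE.
rewrite h; under eq_bigr do rewrite hornerXn expr1n.
by rewrite sumr_const card_ord.
Qed.

Lemma has_sqrt_prod (I : finType) (F : I -> algC) : (forall i, has_sqrt (F i)) -> has_sqrt (\prod_i F i).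
Proof.
move=> h; elim/big_ind: _ => //; last exact: has_sqrtM.
by rewrite -(expr1n _ 2); apply: has_sqrt_sqr; exact: (cyclo_int 1).
Qed.

Lemma has_sqrtX x n : has_sqrt x -> has_sqrt (x ^+ n).
Proof.
move=> h; elim: n => [|n IH]; last by rewrite exprS; exact: has_sqrtM.
by exists 1; [exact: (cyclo_int 1)|rewrite expr1n].
Qed.

(** An odd N is the product of the 1 - z ^ i for 0 < i < N. Pairing i with N - i gives - z ^ (N - i)
    (1 - z ^ i) ^ 2, and - 1 and roots of unity have cyclotomic square roots. *)
Lemma has_sqrt_odd n : has_sqrt (n.*2.+1)%:R.
Proof.
have [z hz] := C_prim_root_exists (ltn0Sn n.*2).
rewrite -(prod_one_sub hz).
have -> : \prod_(i < n.*2) (1 - z ^+ i.+1) = \prod_(i < n) (-1 * z ^+ (n.*2 - i) * (1 - z ^+ i.+1) ^+ 2).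
  rewrite -addnn big_split_ord /= [X in _ * X](reindex_inj rev_ord_inj) /= -big_split; apply: eq_bigr => i _ /=.
  have hi := ltn_ord i.
  have -> : (n + (n - i.+1)).+1 = (n + n - i)%N by lia.
  have e : z ^+ i.+1 * z ^+ (n + n - i) = 1.
    rewrite -exprD (_ : i.+1 + _ = n.*2.+1)%N ?(prim_expr_order hz)//; lia.
  move: e; move: (z ^+ (n + n - i)) (z ^+ i.+1) => b a e.
  transitivity (1 - a - b + a * b); first by ring.
  transitivity (- b + 2 * (a * b) - a * (a * b)); last by ring.
  by rewrite e; ring.
apply: has_sqrt_prod => i; apply: has_sqrtM.
  exact: has_sqrtM has_sqrtN1 (has_sqrtX _ (has_sqrt_root hz)).
apply: has_sqrt_sqr; exists n.*2.+1, z, (1 - 'X^(i.+1)); split=> //.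
by rewrite /evz rmorphB rmorph1 /= map_polyXn hornerD hornerN hornerXn hornerC.
Qed.

Lemma has_sqrt_int (M : int) : has_sqrt M%:~R.
Proof.
have hn (n : nat) : (0 < n)%N -> has_sqrt n%:R.
  elim/ltn_ind: n => n IH n0; have [n1|n1] := leqP n 1.
    have -> : n = 1%N by lia.
    exact: (has_sqrt_odd 0).
  have hp := pdiv_prime n1; rewrite -(divnK (pdiv_dvd n)) natrM; apply: has_sqrtM.
    by apply: IH; rewrite ?ltn_Pdiv ?prime_gt1// divn_gt0 ?prime_gt0// pdiv_leq.
  have [->|hp'] := even_prime hp; first exact: has_sqrt2.
  by rewrite -(odd_double_half (pdiv n)) hp'; exact: has_sqrt_odd.
case: M => [[|n]|n].
- by exists 0; [exact: (cyclo_int 0)|rewrite expr0n].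
- by rewrite -pmulrn; exact: hn.
- by rewrite NegzE rmorphN /= -mulN1r -pmulrn; apply: has_sqrtM has_sqrtN1 (hn _ _).
Qed.

(* So that k can be reached using Frobenius maps at large primes only. *)
Lemma rough_representative (N k P : nat) : (0 < N)%N -> coprime k N ->
  exists n, [/\ (0 < n)%N, n = k %[mod N] & forall p, prime p -> (p %| n)%N -> (P < p)%N \/ (p %| N)%N].
Proof.
move=> N0 hk; pose T := (\prod_(i < P.+1 | prime i && coprime N i) i)%N.
have cT : coprime N T.
  rewrite /T; elim/big_ind: _ => [|x y hx hy|i /andP[_ //]]; first exact: coprimen1.
  by rewrite coprimeMr hx.
have T0 : (0 < T)%N by apply: prodn_cond_gt0 => i /andP[/prime_gt0].
(* Congruent to k modulo N and to 1 modulo every prime up to P that is prime to N; the summand N T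
   only ensures positivity. *)
exists (chinese N T k 1 + N * T)%N; split; first by rewrite addn_gt0 muln_gt0 N0 T0 orbT.
  by rewrite -modnDmr modnMr addn0 chinese_modl.
move=> p pp hp; have [|hP] := ltnP P p; first by left.
right; apply: contraT => pN; have cNp : coprime N p by rewrite coprime_sym prime_coprime.
have pT : (p %| T)%N.
  have hp1 : (p < P.+1)%N by [].
  by rewrite /T (bigD1 (Ordinal hp1)) /= ?pp// dvdn_mulr.
have : (p %| chinese N T k 1)%N by rewrite -(dvdn_addl _ (dvdn_mull N pT)).
rewrite /dvdn -(modn_dvdm _ pT) chinese_modr// modn_dvdm// modn_small ?prime_gt1//.
Qed.

Theorem infinitely_many_nonresidues (M : int) (P : nat) : (forall m : int, m ^+ 2 <> M) ->
  exists2 p, prime p & (P < p)%N /\ ~ (exists x : int, (x ^+ 2 = M %[mod p])%Z).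
Proof.
move=> hM; apply: contrapT => hno.
have M0 : M != 0 by apply/eqP => M0; apply: (hM 0); rewrite M0.
have hres p : prime p -> (P < p)%N -> exists x : int, (x ^+ 2 = M %[mod p])%Z.
  by move=> pp hp; apply: contrapT => h; apply: hno; exists p.
have [a [N [z [g [hz ha]]]] a2] := has_sqrt_int M; subst a.
have N0 := prim_order_gt0 hz.
pose P1 := (P + 4 * `|M| + 2 + N)%N.
have aut k : coprime k N -> evz g (z ^+ k) ^+ 2 = M%:~R.
  by move=> /Qn_aut_exists[u hu]; rewrite -(hu z (prim_expr_order hz)) -evz_aut -rmorphXn a2 rmorph_int.
have rough n : (0 < n)%N -> (forall p, prime p -> (p %| n)%N -> (P1 < p)%N) -> evz g (z ^+ n) = evz g z.
  elim/ltn_ind: n => n IH n0 hn; have [n1|n1] := leqP n 1.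
    by have -> : n = 1%N by lia; rewrite expr1.
  have hp := pdiv_prime n1; have hpn := pdiv_dvd n; set p := pdiv n in hp hpn.
  have hpP := hn p hp hpn; rewrite /P1 in hpP.
  set m := (n %/ p)%N; have nE : n = (p * m)%N by rewrite /m mulnC divnK.
  have m0 : (0 < m)%N by rewrite divn_gt0 ?prime_gt0// pdiv_leq.
  have hm q : prime q -> (q %| m)%N -> (P1 < q)%N.
    by move=> qp hq; apply: hn => //; rewrite nE dvdn_mull.
  have cm : coprime m N.
    apply: contraT => hc; have g1 : (1 < gcdn m N)%N.
      by rewrite ltn_neqAle eq_sym hc gcdn_gt0 m0.
    have qp := pdiv_prime g1; have hq := pdiv_dvd (gcdn m N).
    have h1 := hm _ qp (dvdn_trans hq (dvdn_gcdl _ _)).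
    have h2 := dvdn_leq N0 (dvdn_trans hq (dvdn_gcdr _ _)).
    by move: h1 h2; rewrite /P1; lia.
  have cp : coprime p N by rewrite prime_coprime// gtnNdvd//; lia.
  have [u hu] := Qn_aut_exists cm.
  have e1 : evz g (z ^+ p) = evz g z.
    apply: (residue_fixed hp _ M0 (Aint_prim_root hz) a2 (aut _ cp)); first by lia.
    by apply: hres => //; lia.
  (* The automorphism sending z to z ^ m carries the invariance under z to z ^ p over to z ^ m, so
     that n = p m reduces to m. *)
  have := congr1 u e1; rewrite !evz_aut rmorphXn (hu z (prim_expr_order hz)) -exprM mulnC -nE => ->.
  by apply: IH => //; rewrite /m ltn_Pdiv ?prime_gt1.
have all_k k : coprime k N -> evz g (z ^+ k) = evz g z.
  move=> hk; have [n [n0 nk hn]] := rough_representative P1 N0 hk.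
  have -> : z ^+ k = z ^+ n by apply/eqP; rewrite (eq_prim_root_expr hz) nk.
  apply: rough => // p pp hp; case: (hn p pp hp) => // hpN.
  have hpk : (p %| k)%N by rewrite /dvdn -(modn_dvdm _ hpN) -nk modn_dvdm.
  by have := dvdn_gcd p k N; rewrite hpk hpN (eqP hk) dvdn1 => /eqP p1; move: pp; rewrite p1.
(* Descent to the rationals: modulo the cyclotomic polynomial, g has degree below phi(N) and takes
   one value at all phi(N) primitive roots, so it is a constant. The root of M is then rational,
   hence an integer. *)
pose gq : {poly rat} := map_poly intr g; pose Fq : {poly rat} := map_poly intr 'Phi_N.
have toC (h : {poly int}) : map_poly ratr (map_poly intr h : {poly rat}) = map_poly intr h :> {poly algC}.
  by rewrite -map_poly_comp; apply: eq_map_poly => x /=; rewrite ratr_int.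
have FC : map_poly ratr Fq = cyclotomic z N by rewrite toC (Cintr_Cyclotomic hz).
pose h := map_poly (ratr : rat -> algC) (gq %% Fq).
have hk k : coprime k N -> h.[z ^+ k] = evz g z.
  move=> ck; rewrite -(all_k k ck) /evz -toC -/gq.
  have := congr1 (map_poly (ratr : rat -> algC)) (divp_eq gq Fq); rewrite rmorphD rmorphM /= -/h FC => ->.
  rewrite hornerD hornerM; suff -> : (cyclotomic z N).[z ^+ k] = 0 by rewrite mulr0 add0r.
  by apply/rootP; rewrite (root_cyclotomic hz) (prim_root_exp_coprime _ hz).
have sF : size Fq = (totient N).+1 by rewrite -(size_map_poly (ratr : {rmorphism rat -> algC})) FC size_cyclotomic.
have hs : (size h <= totient N)%N.
  by rewrite size_map_poly -ltnS -sF ltn_modp -size_poly_gt0 sF.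
have t0 : (0 < totient N)%N by rewrite totient_gt0.
have hc : h - (evz g z)%:P = 0.
  apply/eqP; apply: contraT => r0.
  pose rs := [seq z ^+ k | k <- iota 0 N & coprime k N].
  have h1 : all (root (h - (evz g z)%:P)) rs.
    apply/allP => x /mapP[k]; rewrite mem_filter => /andP[ck _] ->.
    by rewrite /root hornerD hornerN hornerC hk// subrr.
  have h2 : uniq rs.
    rewrite map_inj_in_uniq ?filter_uniq ?iota_uniq// => i j; rewrite !mem_filter !mem_iota /= add0n => /andP[_ hi] /andP[_ hj] /eqP.
    by rewrite (eq_prim_root_expr hz) !modn_small// => /eqP.
  have h3 : size rs = totient N.
    rewrite size_map size_filter totient_count_coprime -sum1_count /index_iota subn0 big_mkcond /=.
    by apply: eq_bigr => i _; rewrite coprime_sym; case: coprime.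
  have := max_poly_roots r0 h1 h2; rewrite h3 ltnNge (leq_trans (size_polyD _ _))// geq_max hs size_polyN size_polyC.
  by case: (_ != 0).
have aE : evz g z = ratr (gq %% Fq)`_0.
  by move/eqP: hc; rewrite subr_eq0 => /eqP hc; rewrite -coef_map -/h hc coefC.
have aC : evz g z \is a Num.int.
  apply: Cint_rat_Aint; first by rewrite aE Crat_rat.
  exact: evz_Aint (Aint_prim_root hz).
have /intrP[m hm] := aC; apply: (hM m); apply: (@intr_inj algC).
by rewrite rmorphXn /= -hm a2.
Qed.

End Nonresidues.

(** * Denominators *)

Section QuadraticIrrationals.
Variable R : realType.
Local Notation K := (C R).

Definition quadratic_form (x d : K) := exists u v : int, exists q : nat,
  [/\ (0 < q)%N, v != 0 & x = (u%:~R + v%:~R * d) / q%:R].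

Lemma degree2_irrational (x : K) (r : rat) : algebraic_degree2 x -> x <> ratr r.
Proof.
move=> [p [[_ irr] sp px]] xr; rewrite xr in px.
have pr : root p r by rewrite -(fmorph_root (ratr : {rmorphism rat -> K})).
have := irr ('X - r%:P); rewrite size_XsubC => /(_ isT).
by rewrite dvdp_XsubCl pr => /(_ isT) /eqp_size; rewrite size_XsubC sp.
Qed.

Lemma ratr_quadratic (x d : K) (a b : rat) : b != 0 -> x = ratr a + ratr b * d -> quadratic_form x d.
Proof.
move=> b0 ->; exists (numq a * denq b), (numq b * denq a), (`|denq a| * `|denq b|)%N; split.
- by rewrite muln_gt0 !absz_gt0 !denq_neq0.
- by rewrite mulf_neq0 ?numq_eq0 ?denq_neq0.
have da : ((denq a)%:~R : K) != 0 by rewrite intr_eq0 denq_neq0.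
have db : ((denq b)%:~R : K) != 0 by rewrite intr_eq0 denq_neq0.
have e (y : rat) : (`|denq y|%:R : K) = (denq y)%:~R by rewrite -[in RHS](gez0_abs (denq_ge0 y)) -pmulrn.
rewrite natrM !e !rmorphM /= -[in LHS](divq_num_den a) -[in LHS](divq_num_den b) !fmorph_div /= !ratr_int.
by cfield.
Qed.

Lemma degree2_quadratic (x : K) : algebraic_degree2 x -> exists (M : int) (d : K),
  [/\ d ^+ 2 = M%:~R, quadratic_form x d & forall m : int, m ^+ 2 <> M].
Proof.
move=> hx; have [p [_ sp /rootP px]] := hx.
have [a [b [c [a0 E]]]] : exists a b c : rat, a != 0 /\ ratr a * x ^+ 2 + ratr b * x + ratr c = 0 :> K.
  exists p`_2, p`_1, p`_0; split.
    by rewrite -[2%N]/(3.-1) -sp -lead_coefE lead_coef_eq0 -size_poly_eq0 sp.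
  rewrite -px (@horner_coef_wide _ 3) ?size_map_poly ?sp// !big_ord_recl big_ord0 /= !coef_map /= expr0 expr1.
  rewrite /bump /= !addn0 ?add1n; by move: (ratr _) (ratr _) (ratr _) => *; ring.
pose D := (b ^+ 2 - 4 * a * c) .
(* For the discriminant D, the number denq D times a square root of D is a square root of an
   integer. *)
pose M := numq D * denq D.
pose d : K := ratr (denq D)%:~R * (2 * ratr a * x + ratr b).
have a0' : (ratr a : K) != 0 by rewrite fmorph_eq0.
have d2 : d ^+ 2 = M%:~R.
  have dD : ((denq D)%:~R : K) != 0 by rewrite intr_eq0 denq_neq0.
  have h : (2 * ratr a * x + ratr b) ^+ 2 = ratr D :> K.
    rewrite /D rmorphB rmorphXn !rmorphM /= ratr_nat -[LHS]subr0 -(mulr0 (4 * ratr a)) -E; ring.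
  rewrite /d exprMn h -{2}(divq_num_den D) fmorph_div /= !ratr_int /M rmorphM /=.
  by cfield.
have xd : x = ratr (- b / (2 * a)) + ratr (2 * a * (denq D)%:~R)^-1 * d.
  have dD : (ratr (denq D)%:~R : K) != 0 by rewrite ratr_int intr_eq0 denq_neq0.
  rewrite /d !rmorphM /= !fmorphV /= !rmorphM rmorphN /= ratr_nat.
  by move: dD a0'; move: (ratr (denq D)%:~R : K) (ratr a : K) (ratr b : K) => y u v *; cfield.
have dD0 : ((denq D)%:~R : rat) != 0 by rewrite intr_eq0 denq_neq0.
exists M, d; split=> //.
  by apply: ratr_quadratic xd; rewrite invr_eq0 !mulf_neq0.
move=> m hm; have : d ^+ 2 = (m%:~R) ^+ 2 by rewrite d2 -hm rmorphXn.
move/eqP; rewrite eqf_sqr => h.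
have [e he] : exists e : rat, d = ratr e.
  case/orP: h => /eqP ->; [exists m%:~R|exists (- m%:~R)]; by rewrite ?rmorphN /= ratr_int.
apply: (@degree2_irrational x (- b / (2 * a) + (2 * a * (denq D)%:~R)^-1 * e) hx).
by rewrite rmorphD (rmorphM _ (2 * a * _)^-1) /= -he.
Qed.

Lemma in_predE (P : K -> Prop) x : (x \in [pred x : K | `[< P x >]]) = `[< P x >].
Proof. by []. Qed.

(** Inverses are obtained from the norm n. As d is irrational, n vanishes only for the zero element,
    whose inverse is 0 by convention. *)
Lemma divring_quadratic (d : K) (M : int) : d ^+ 2 = M%:~R -> (forall r : rat, d <> ratr r) ->
  divring_closed [pred x : K | `[< exists a b : rat, x = ratr a + ratr b * d >]].
Proof.
move=> d2 hd; split.
- by rewrite in_predE; apply/asboolP; exists 1, 0; rewrite rmorph1 rmorph0 mul0r addr0.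
- move=> x y; rewrite !in_predE => /asboolP[a [b ->]] /asboolP[a' [b' ->]]; apply/asboolP.
  by exists (a - a'), (b - b'); rewrite !rmorphB /=; ring.
move=> x y; rewrite !in_predE => /asboolP[a [b ->]] /asboolP[a' [b' ->]]; apply/asboolP.
pose n := a' ^+ 2 - b' ^+ 2 * M%:~R.
have nE : (ratr a' + ratr b' * d) * (ratr a' - ratr b' * d) = ratr n.
  by rewrite /n !expr2 rmorphB !rmorphM /= ratr_int -d2; ring.
have [n0|n0] := eqVneq n 0.
  have b0 : b' = 0.
    apply/eqP; apply: contraT => b0; exfalso.
    have : (d * ratr b') ^+ 2 = (ratr a') ^+ 2.
      rewrite exprMn d2 -!rmorphXn /= -(ratr_int K M) -rmorphM /= mulrC; congr ratr.
      by apply/eqP; rewrite eq_sym -subr_eq0 -/n n0.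
    have rb : (ratr b' : K) != 0 by rewrite fmorph_eq0.
    move/eqP; rewrite eqf_sqr => /orP[]/eqP h.
      by apply: (hd (a' / b')); rewrite fmorph_div /= -h mulfK.
    by apply: (hd (- a' / b')); rewrite fmorph_div rmorphN /= -h mulfK.
  have a0 : a' = 0.
    by move/eqP: n0; rewrite /n b0 expr0n mul0r subr0 sqrf_eq0 => /eqP.
  by exists 0, 0; rewrite a0 b0 rmorph0 !mul0r !addr0 invr0 mulr0.
have n0' : (ratr n : K) != 0 by rewrite fmorph_eq0.
exists ((a * a' - b * b' * M%:~R) / n), ((b * a' - a * b') / n).
have -> : (ratr a' + ratr b' * d)^-1 = (ratr a' - ratr b' * d) / ratr n.
  rewrite -nE invfM mulrCA divff ?mulr1//; apply: contra_neq n0' => h.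
  by rewrite -nE h mulr0.
rewrite !fmorph_div /=; move: n0'; move: (ratr n : K) => N N0; rewrite !rmorphB !rmorphM /= ratr_int -d2.
by move: (ratr a) (ratr b) (ratr a') (ratr b') => *; cfield.
Qed.

Lemma divring_rat : divring_closed [pred x : K | `[< exists a : rat, x = ratr a >]].
Proof.
split.
- by rewrite in_predE; apply/asboolP; exists 1; rewrite rmorph1.
- by move=> x y; rewrite !in_predE => /asboolP[a ->] /asboolP[b ->]; apply/asboolP; exists (a - b); rewrite rmorphB.
- by move=> x y; rewrite !in_predE => /asboolP[a ->] /asboolP[b ->]; apply/asboolP; exists (a / b); rewrite fmorph_div.
Qed.

(** Membership in [Qadjoin d] is tested on explicit subfields: on the rationals if d is rational,
    which contradicts the degree of x, and on the a + b d otherwise, where b = 0 is excluded for the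
    same reason. *)
Lemma Qadjoin_quadratic (x d : K) (M : int) : d ^+ 2 = M%:~R -> algebraic_degree2 x -> Qadjoin d = Qadjoin x ->
  quadratic_form x d.
Proof.
move=> d2 hx hQ; have xx : Qadjoin d x by rewrite hQ => S _.
have [[r hr]|hd] := pselect (exists r : rat, d = ratr r).
  have dS : d \in [pred x : K | `[< exists a : rat, x = ratr a >]] by rewrite in_predE; apply/asboolP; exists r.
  have := xx _ divring_rat dS; rewrite in_predE => /asboolP[a ha].
  by case: (degree2_irrational hx ha).
have hd' r : d <> ratr r by move=> h; apply: hd; exists r.
have dS : d \in [pred x : K | `[< exists a b : rat, x = ratr a + ratr b * d >]].
  by rewrite in_predE; apply/asboolP; exists 0, 1; rewrite rmorph0 rmorph1 mul1r add0r.
have := xx _ (divring_quadratic d2 hd') dS; rewrite in_predE => /asboolP[a [b hab]].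
apply: ratr_quadratic (hab); apply/eqP => b0; apply: (degree2_irrational (r := a) hx).
by rewrite hab b0 rmorph0 mul0r addr0.
Qed.

End QuadraticIrrationals.

Section Main.
Variable R : realType.
Local Notation K := (C R).
Variables (psi : 'M[int]_2 -> K) (xi1 : rat) (xi2 : K) (rho' : 'M[int]_2 -> 'M[K]_2) (k : int) (Z : K -> 'cV[K]_2)
  (mu : 'I_2 -> K) (c : 'I_2 -> nat -> K).
Hypotheses (hpsi : character_Gamma2 psi) (hN : psi (-1) = 1) (hxi1 : e2pi (ratr xi1) = psi (Tmx ^+ 2))
  (hdeg : algebraic_degree2 xi2) (hxi2 : e2pi xi2 = psi (Umx ^+ 2)) (hrho : normalization (Ind psi) rho')
  (hZ : modular_form k rho' Z) (hnz : nonzero_form Z) (hq : forall i, qexpansion 1 (fun t => Z t i 0) (mu i) (c i))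
  (halg : forall i n, algebraic_number (c i n)).

Lemma nonresidue_denominators (M : int) (d : K) i : d ^+ 2 = M%:~R -> quadratic_form xi2 d ->
  exists P0, forall p, prime p -> (P0 < p)%N -> ~ (exists x : int, (x ^+ 2 = M %[mod p])%Z) ->
    exists n N, [/\ c i n != 0, is_denominator (c i n) N & (p %| N)%N].
Proof.
move=> d2 [u [v [q [q0 v0 hx]]]].
have [E [z [uE hE hz0 hz1 hE0]]] := normalization_shape hpsi hrho.
have [l [m [Q [Q0 hQ]]]] := component_expansion hpsi uE hE hz0 hz1 hE0 hZ hN hxi1 hxi2 hnz hq.
have [s [e [s0 e0 hb]]] := hQ i.
set x0 : K := ratr xi1 - m%:R in hb; set y0 : K := - xi2 - m%:R in hb.
pose n := size Q.
pose D (j : 'I_n + 'I_n) : K := match j with inl d => e * Q`_d | inr d => e * s * Q`_d end.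
pose ex (j : 'I_n + 'I_n) : K := match j with inl d => y0 + d%:R | inr d => l%:~R - x0 - y0 - d%:R end.
have irr (r : rat) : xi2 <> ratr r by exact: degree2_irrational.
have hex j : exists u v : int, exists q : nat, [/\ (0 < q)%N, v != 0 & ex j = (u%:~R + v%:~R * d) / q%:R].
  have q0' : (q%:R : K) != 0 by rewrite pnatr_eq0 -lt0n.
  case: j => j /=.
    exists (- u + q%:Z * (j%:Z - m%:Z)), (- v), q; split=> //; first by rewrite oppr_eq0.
    rewrite /y0 hx !(rmorphD, rmorphM, rmorphN) /= -!pmulrn; cfield.
  have den0 : ((denq xi1)%:~R : K) != 0 by rewrite intr_eq0 denq_neq0.
  exists (denq xi1 * u + q%:Z * (denq xi1 * (l + 2 * m%:Z - j%:Z) - numq xi1)), (denq xi1 * v), (q * `|denq xi1|)%N.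
  split; [by rewrite muln_gt0 q0 absz_gt0 denq_neq0|by rewrite mulf_neq0 ?denq_neq0|].
  have eden : (`|denq xi1|%:R : K) = (denq xi1)%:~R by rewrite -[in RHS](gez0_abs (denq_ge0 xi1)) -pmulrn.
  rewrite natrM eden /x0 /y0 hx -[in LHS](divq_num_den xi1) fmorph_div /= !ratr_int.
  rewrite !(rmorphD, rmorphM, rmorphN) /= -!pmulrn.
  by cfield.
have inj : injective ex.
  have half (y x r t w : K) : y + r = w - x - y - t -> y = (w - x - r - t) / 2.
    by move=> h; have -> : x = w - y - t - (y + r) by [rewrite h; ring]; field.
  (* An exponent common to the two families would determine y0 rationally, and with it xi2. *)
  have mix (a b : nat) : y0 + a%:R = l%:~R - x0 - y0 - b%:R -> False.
    move=> h; apply: (irr (- (l%:~R - xi1 - a%:R - b%:R) / 2 - m%:R - m%:R / 2)).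
    rewrite !rmorphB /= !fmorph_div /= rmorphN !rmorphB /= !ratr_nat ratr_int.
    have -> : xi2 = - y0 - m%:R by rewrite /y0; ring.
    have -> : y0 = (l%:~R - x0 - a%:R - b%:R) / 2 by exact: half.
    by rewrite /x0; field.
  move=> [a|a] [b|b] /= h.
  - by congr inl; apply/val_inj/eqP; rewrite -(eqr_nat K); apply/eqP/(addrI y0).
  - by case: (mix _ _ h).
  - by case: (mix _ _ (esym h)).
  by congr inr; apply/val_inj/eqP; rewrite -(eqr_nat K); apply/eqP/oppr_inj/(addrI _ h).
have n0 : (0 < n)%N by rewrite size_poly_gt0.
(* The term to isolate belongs to the leading coefficient of Q, which is nonzero. *)
have nl : (n.-1 < n)%N by rewrite prednK.
have Dj : D (inl (Ordinal nl)) != 0 by rewrite mulf_neq0// -/(lead_coef Q) lead_coef_eq0.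
have [P0 hP] := not_fpint (xi1 - m%:R) l d2 hex inj Dj.
exists P0 => p pp hp hM; have := hP p pp hp hM.
have -> : fPsi (ratr (xi1 - m%:R)) 0 l * \sum_j fC (D j) * fexpB (ex j) =
    fPsi x0 0 l * (\sum_(d < size Q) fC (e * Q`_d) * fexp (fC (y0 + d%:R) * fB R) +
         \sum_(d < size Q) fC (e * s * Q`_d) * fexp (fC (l%:~R - x0 - y0 - d%:R) * fB R)).
  by rewrite rmorphB /= ratr_nat big_sumType.
move=> hnp; apply: contrapT => hno; apply: hnp => r; have [->|[r' ->]] := hb r; first exact: (pint_nat _ pp 0).
apply: contrapT => hnp; apply: hno; exists r'.
exact: bad_denominator.
Qed.

End Main.

Theorem theorem1p7 (R : realType) (psi : 'M[int]_2 -> C R)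
    (xi1 : rat) (xi2 : C R) (rho' : 'M[int]_2 -> 'M[C R]_2)
    (k : int) (Z : C R -> 'cV[C R]_2)
    (mu : 'I_2 -> C R) (c : 'I_2 -> nat -> C R) :
  character_Gamma2 psi ->
  psi (-1) = 1 ->
  e2pi (ratr xi1) = psi (Tmx ^+ 2) ->
  algebraic_degree2 xi2 ->
  e2pi xi2 = psi (Umx ^+ 2) ->
  normalization (Ind psi) rho' ->
  modular_form k rho' Z ->
  nonzero_form Z ->
  (forall i, qexpansion 1 (fun t => Z t i 0) (mu i) (c i)) ->
  (forall i n, algebraic_number (c i n)) ->
  (forall i, unbounded_denominators (c i)) /\
  (forall M : int, squarefreez M ->
     Qadjoin (sqrtC (M%:~R : C R)) = Qadjoin xi2 ->
     exists P0 : nat, forall p : nat, prime p -> (P0 < p)%N ->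
       ~ (exists x : int, (x ^+ 2 = M %[mod p])%Z) ->
       forall i, exists n N : nat,
         [/\ c i n != 0, is_denominator (c i n) N & (p %| N)%N]).
Proof.
move=> hpsi hN h1 hdeg h2 hrho hZ hnz hq halg.
have key M d i := nonresidue_denominators (M := M) (d := d) hpsi hN h1 hdeg h2 hrho hZ hnz hq halg i.
split.
  (* The integer M comes from the discriminant of xi2; a nonresidue prime beyond B divides some
     denominator, which therefore exceeds B. *)
  move=> i B; have [M [d [d2 hx hM]]] := degree2_quadratic hdeg.
  have [P0 hP] := key M d i d2 hx.
  have [p pp [hp hnr]] := infinitely_many_nonresidues (maxn P0 B) hM.
  have [n [N [cn hN' pN]]] := hP p pp (leq_ltn_trans (leq_maxl _ _) hp) hnr.
  exists n, N; split=> //; have [N0 _ _] := hN'.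
  exact: leq_trans (leq_ltn_trans (leq_maxr _ _) hp) (dvdn_leq N0 pN).
move=> M _ hQ; have d2 : sqrtC (M%:~R : C R) ^+ 2 = M%:~R by exact: sqrtCK.
have hx := Qadjoin_quadratic d2 hdeg hQ.
have [P0 hP0] := key M _ 0 d2 hx; have [P1 hP1] := key M _ 1 d2 hx.
exists (maxn P0 P1) => p pp hp hM i; have [->|->] := ord2 i.
  by apply: hP0 => //; apply: leq_ltn_trans hp; exact: leq_maxl.
by apply: hP1 => //; apply: leq_ltn_trans hp; exact: leq_maxr.
Qed.
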